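(* Let $A$ be a Fredholm operator on $b^2_\nu$ that belongs to $\mathfrak{T}$. Then the Fredholm index of $A$ is $\mathrm{ind}(A)=0$.
   Context: Fix an integer $n\ge 2$. $\mathbb{B}$ is the open unit ball and $\bar{\mathbb{B}}$ the closed unit ball in $\mathbb{R}^n$; $|x|$ is the Euclidean norm. $\nu$ is a regular Borel probability measure on $\mathbb{B}$ that is invariant under the orthogonal group $O(n)$ and satisfies $\nu(\{x\in\mathbb{B}:|x|\ge r\})>0$ for all $0<r<1$. $L^2_\nu=L^2(\mathbb{B},\nu)$ (complex-valued functions), and $b^2_\nu$ is the closed subspace of $L^2_\nu$ consisting of the harmonic functions on $\mathbb{B}$ that belong to $L^2_\nu$. $Q:L^2_\nu\to b^2_\nu$ is the orthogonal projection. For a bounded measurable function $f$ on $\mathbb{B}$, the Toeplitz operator $T_f:b^2_\nu\to b^2_\nu$ is $T_fu=Q(fu)$. $\mathfrak{T}$ is the $C^*$-algebra of operators on $b^2_\nu$ generated by all $T_f$ with $f\in C(\bar{\mathbb{B}})$, the continuous complex-valued functions on $\bar{\mathbb{B}}$. *)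

(* Defs.v *)
From HB Require Import structures.
From mathcomp Require Import all_boot all_order all_algebra.
From mathcomp Require Import all_classical all_reals all_analysis measurable_realfun.
From mathcomp Require Import complex ring.

Set Implicit Arguments.
Unset Strict Implicit.
Unset Printing Implicit Defensive.

Import Order.TTheory GRing.Theory Num.Theory numFieldNormedType.Exports.
Local Open Scope classical_set_scope.
Local Open Scope ring_scope.

Section Operators.
Context {R : realType} {V : lmodType R[i]} (dot : V -> V -> R[i]).
Implicit Types (A B : V -> V) (W : set V) (S G : set (V -> V)).

Definition hnorm (v : V) : R := Num.sqrt (complex.Re (dot v v)).

Definition bounded_op A : Prop :=
  linear A /\ exists M : R, forall v, hnorm (A v) <= M * hnorm v.

Definition is_adjoint A B : Prop := forall u v, dot (A u) v = dot u (B v).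

(* The last clause is closedness in the operator norm:
   the bound on [A v - B v] says that the operator norm of [A - B] is <= e. *)
Definition cstar_subalgebra S : Prop :=
  [/\ S `<=` bounded_op,
      (forall A B, S A -> S B -> S (A + B)) /\
        (forall (c : R[i]) A, S A -> S (c *: A)),
      forall A B, S A -> S B -> S (A \o B),
      forall A B, S A -> bounded_op B -> is_adjoint A B -> S B
    & forall A, bounded_op A ->
        (forall e : R, 0 < e -> exists2 B, S B &
           forall v, hnorm (A v - B v) <= e * hnorm v) -> S A].

Definition cstar_generated G : set (V -> V) :=
  [set A | forall S, cstar_subalgebra S -> G `<=` S -> S A].

Definition op_ker A : set V := [set v | A v = 0].

Definition norm_closed W : Prop :=
  forall v, (forall e : R, 0 < e -> exists2 w, W w & hnorm (v - w) < e) -> W v.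

Definition has_dim W (d : nat) : Prop :=
  exists e : 'I_d -> V,
    (forall c : 'I_d -> R[i],
       \sum_i c i *: e i = 0 -> forall i, c i = 0) /\
    W = [set v | exists c : 'I_d -> R[i], v = \sum_i c i *: e i].

(* The classes of the [e i] form a basis of the quotient [V / W]. *)
Definition has_codim W (d : nat) : Prop :=
  exists e : 'I_d -> V,
    (forall c : 'I_d -> R[i],
       W (\sum_i c i *: e i) -> forall i, c i = 0) /\
    (forall v, exists c : 'I_d -> R[i], W (v - \sum_i c i *: e i)).

Definition dimension W : nat := xget 0%N [set d | has_dim W d].
Definition codimension W : nat := xget 0%N [set d | has_codim W d].

Definition fredholm A : Prop :=
  [/\ bounded_op A,
      norm_closed (range A),
      exists d, has_dim (op_ker A) d
    & exists d, has_codim (range A) d].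

Definition fredholm_index A : int :=
  (dimension (op_ker A))%:Z - (codimension (range A))%:Z.

End Operators.

Section Ball.
Context {R : realType} {n : nat}.
Implicit Types (D : set 'rV[R]_n) (u v : 'rV[R]_n -> R).

(* The library norm on ['rV[R]_n] is the sup norm (same topology). *)
Definition enorm (x : 'rV[R]_n) : R := Num.sqrt (\sum_i x ord0 i ^+ 2).

Definition uball : set 'rV[R]_n := [set x | enorm x < 1].
Definition cuball : set 'rV[R]_n := [set x | enorm x <= 1].

Definition partial (i : 'I_n) u : 'rV[R]_n -> R :=
  fun x => 'D_(delta_mx ord0 i) u x.

Definition C2_on D u : Prop := forall x, D x ->
  {for x, continuous u} /\
  forall i, [/\ derivable u x (delta_mx ord0 i),
                {for x, continuous (partial i u)}
              & forall j, derivable (partial i u) x (delta_mx ord0 j) /\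
                          {for x, continuous (partial j (partial i u))}].

Definition laplacian u : 'rV[R]_n -> R :=
  fun x => \sum_i partial i (partial i u) x.

Definition harmonic_on D u : Prop :=
  C2_on D u /\ forall x, D x -> laplacian u x = 0.

Definition charmonic_on D (f : 'rV[R]_n -> R[i]^o) : Prop :=
  harmonic_on D (fun x => complex.Re (f x)) /\
  harmonic_on D (fun x => complex.Im (f x)).

End Ball.

Section BallTheory.
Context {R : realType} {n : nat}.
Implicit Types (D : set 'rV[R]_n) (u v : 'rV[R]_n -> R).

Lemma continuous_enorm : continuous (@enorm R n).
Proof.
move=> x; apply: (@continuous_comp _ _ _ (fun x : 'rV[R]_n => \sum_i x ord0 i ^+ 2) Num.sqrt).
  apply: (@continuous_big _ _ +%R 0 _ _ _ _ (fun i (x : 'rV[R]_n) => x ord0 i ^+ 2)).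
    exact: add_continuous.
  move=> i _ y; apply: (@continuous_comp _ _ _ (fun x : 'rV[R]_n => x ord0 i)
    (fun r : R => r ^+ 2)); [exact: coord_continuous|exact: exprn_continuous].
exact: sqrt_continuous.
Qed.
Lemma open_uball : open (@uball R n).
Proof.
have -> : @uball R n = (@enorm R n) @^-1` [set r | r < 1] by [].
by apply: open_comp => [x _|]; [exact: continuous_enorm|exact: open_lt].
Qed.

Lemma partialD i u v (a b : R) x :
  derivable u x (delta_mx ord0 i) -> derivable v x (delta_mx ord0 i) ->
  derivable (fun x => a * u x + b * v x) x (delta_mx ord0 i) /\
  partial i (fun x => a * u x + b * v x) x = a * partial i u x + b * partial i v x.
Proof.
move=> du dv.
have dau := @derivableZ R _ _ _ a _ _ du.
have dbv := @derivableZ R _ _ _ b _ _ dv.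
split; first exact: (derivableD dau dbv).
rewrite /partial.
rewrite -[LHS]/('D_(delta_mx ord0 i) ((a \*: u) + (b \*: v)) x).
by rewrite deriveD// !deriveZ.
Qed.

Lemma harmonic_onD D u v (a b : R) : open D ->
  harmonic_on D u -> harmonic_on D v ->
  harmonic_on D (fun x => a * u x + b * v x).
Proof.
move=> oD [uC uL] [vC vL]; set w := fun x => _.
have cE (f g : 'rV[R]_n -> R) (x : 'rV[R]_n) : {for x, continuous f} -> {for x, continuous g} ->
  {for x, continuous (fun x : 'rV[R]_n => a * f x + b * g x : R)}.
  move=> cf cg.
  have cfa : {for x, continuous (fun y : 'rV[R]_n => a * f y : R)}.
    by apply: (@continuousM R _ (fun=> a) f) => //; exact: cst_continuous.
  have cgb : {for x, continuous (fun y : 'rV[R]_n => b * g y : R)}.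
    by apply: (@continuousM R _ (fun=> b) g) => //; exact: cst_continuous.
  exact: (@continuousD _ _ _ _ _ _ cfa cgb).
have w1 x i : D x -> derivable w x (delta_mx ord0 i) /\
    partial i w x = a * partial i u x + b * partial i v x.
  move=> Dx; apply: partialD.
    by have [_ /(_ i)[]] := uC _ Dx.
  by have [_ /(_ i)[]] := vC _ Dx.
have nw x i : D x -> {near x, (fun y => a * partial i u y + b * partial i v y)
    =1 partial i w}.
  move=> Dx; apply: filterS (open_nbhs_nbhs (conj oD Dx)) => y Dy.
  by rewrite (w1 _ _ Dy).2.
have w2 x i j : D x -> derivable (partial i w) x (delta_mx ord0 j) /\
    partial j (partial i w) x =
    a * partial j (partial i u) x + b * partial j (partial i v) x.
  move=> Dx.
  have [_ /(_ i)[_ _ /(_ j)[du _]]] := uC _ Dx.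
  have [_ /(_ i)[_ _ /(_ j)[dv _]]] := vC _ Dx.
  have [d <-] := partialD a b du dv; split.
    exact: (@near_eq_derivable _ _ _ _ _ _ _ (nw x i Dx) d).
  exact/esym/(@near_eq_derive _ _ _ _ _ _ _ (nw x i Dx)).
have nw2 x i j : D x -> {near x,
    (fun y => a * partial j (partial i u) y + b * partial j (partial i v) y)
    =1 partial j (partial i w)}.
  move=> Dx; apply: filterS (open_nbhs_nbhs (conj oD Dx)) => y Dy.
  by rewrite (w2 _ _ _ Dy).2.
have ceq (f g : 'rV[R]_n -> R) x : D x -> {near x, f =1 g} -> f x = g x ->
    {for x, continuous f} -> {for x, continuous g}.
  move=> Dx fg fgx cf; rewrite /prop_for /continuous_at -fgx.
  exact: (cvg_trans (near_eq_cvg fg) cf).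
split=> [x Dx|x Dx].
  have [uc up] := uC _ Dx; have [vc vp] := vC _ Dx.
  split=> [|i]; first exact: cE.
  have [ud uc1 u2] := up i; have [vd vc1 v2] := vp i.
  split; first exact: (w1 _ _ Dx).1.
    apply: (ceq _ _ _ Dx (nw x i Dx)); first by rewrite (w1 _ _ Dx).2.
    exact: cE.
  move=> j; have [_ ?] := u2 j; have [_ ?] := v2 j.
  split; first exact: (w2 _ _ _ Dx).1.
  apply: (ceq _ _ _ Dx (nw2 x i j Dx)); first by rewrite (w2 _ _ _ Dx).2.
  exact: cE.
have -> : laplacian w x = a * laplacian u x + b * laplacian v x.
  rewrite /laplacian 2!mulr_sumr -big_split.
  by apply: eq_bigr => i _; rewrite (w2 _ _ _ Dx).2.
by rewrite (uL _ Dx) (vL _ Dx) 2!mulr0 addr0.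
Qed.
End BallTheory.

(* A Borel probability measure on the open ball is encoded as a Borel probability
   measure on the whole space that gives mass 1 to [uball]; the definitions
   below only look at its restriction to [uball]. *)
Definition borel_rV (R : realType) (n : nat) :=
  g_sigma_algebraType (@open 'rV[R]_n).
HB.instance Definition _ (R : realType) (n : nat) :=
  Measurable.on (borel_rV R n).

Section Measure.
Context {R : realType} {n : nat}.
Variable nu : {measure set (borel_rV R n) -> \bar R}.

Definition regular_on_ball : Prop :=
  forall E : set (borel_rV R n), measurable E -> E `<=` uball ->
    nu E = ereal_inf [set nu U | U in
             [set U : set 'rV[R]_n | [/\ open U, E `<=` U & U `<=` uball]]] /\
    nu E = ereal_sup [set nu K | K in
             [set K : set 'rV[R]_n | compact K /\ K `<=` E]].

(* Vectors are rows, so the orthogonal group acts on the right. *)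
Definition rotation_invariant : Prop :=
  forall M : 'M[R]_n, M *m M^T = 1%:M ->
  forall E : set (borel_rV R n), measurable E ->
    nu [set x : 'rV[R]_n | E (x *m M)] = nu E.

Definition charges_boundary : Prop :=
  forall r : R, 0 < r < 1 ->
    (0 < nu [set x : 'rV[R]_n | uball x /\ (r <= enorm x)%R])%E.

(* Complex-valued functions are measurable, integrable or harmonic when their
   real and imaginary parts are. *)
Definition L2 (f : 'rV[R]_n -> R[i]^o) : Prop :=
  [/\ measurable_fun (uball : set (borel_rV R n))
        (fun x => complex.Re (f x) : R),
      measurable_fun (uball : set (borel_rV R n))
        (fun x => complex.Im (f x) : R)
    & (\int[nu]_(x in uball)
         ((complex.Re (f x)) ^+ 2 + (complex.Im (f x)) ^+ 2)%:E < +oo)%E].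

Definition cintegral (f : 'rV[R]_n -> R[i]^o) : R[i] :=
  Complex (\int[nu]_(x in uball) complex.Re (f x))
          (\int[nu]_(x in uball) complex.Im (f x)).

Definition inner (f g : 'rV[R]_n -> R[i]^o) : R[i] :=
  cintegral (fun x => f x * (g x)^*%C).

(* A function on the open ball is encoded by its extension by [0] to the whole
   space, so that equality of encodings is equality on the ball.
   Two elements of [b2] that agree almost everywhere are equal (for the measures
   considered: rotation invariant and charging every neighbourhood of the
   boundary), so no quotient is needed to view [b2] as a subspace of [L^2]. *)
Definition b2_pred : {pred 'rV[R]_n -> R[i]^o} :=
  fun f => `[< [/\ charmonic_on uball f, L2 f
                 & forall x, ~ uball x -> f x = 0] >].

Let ReE (c z w : R[i]) : complex.Re (c * z + w) =
  complex.Re c * complex.Re z + - complex.Im c * complex.Im z + complex.Re w.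
Proof. by case: c z w => a b [x y] [u v] /=; rewrite mulNr. Qed.

Let ImE (c z w : R[i]) : complex.Im (c * z + w) =
  complex.Im c * complex.Re z + complex.Re c * complex.Im z + complex.Im w.
Proof. by case: c z w => a b [x y] [u v] /=; rewrite [X in X + v]addrC. Qed.

Lemma measurable_uball : measurable (uball : set (borel_rV R n)).
Proof. by apply: sub_sigma_algebra; exact: open_uball. Qed.

Lemma L2_lin (c : R[i]) (f g : 'rV[R]_n -> R[i]^o) :
  L2 f -> L2 g -> L2 (c *: f + g).
Proof.
move=> [fR fI fi] [gR gI gi].
have mR : measurable_fun (uball : set (borel_rV R n))
    (fun x => complex.Re ((c *: f + g) x) : R).
  rewrite (_ : (fun x => _) = (fun x => complex.Re c * complex.Re (f x) +
     - complex.Im c * complex.Im (f x) + complex.Re (g x))).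
    by do 2![apply: measurable_funD => //]; apply: measurable_funM.
  by apply/funext => x; rewrite -ReE.
have mI : measurable_fun (uball : set (borel_rV R n))
    (fun x => complex.Im ((c *: f + g) x) : R).
  rewrite (_ : (fun x => _) = (fun x => complex.Im c * complex.Re (f x) +
     complex.Re c * complex.Im (f x) + complex.Im (g x))).
    by do 2![apply: measurable_funD => //]; apply: measurable_funM.
  by apply/funext => x; rewrite -ImE.
split=> //.
have mS (h : 'rV[R]_n -> R[i]^o) :
    measurable_fun (uball : set (borel_rV R n)) (fun x => complex.Re (h x) : R) ->
    measurable_fun (uball : set (borel_rV R n)) (fun x => complex.Im (h x) : R) ->
    measurable_fun (uball : set (borel_rV R n)) (fun x =>
      (complex.Re (h x) ^+ 2 + complex.Im (h x) ^+ 2)%:E).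
  by move=> hR hI; apply/measurable_EFinP/measurable_funD; exact: measurable_funX.
pose k : R := 2 * (complex.Re c ^+ 2 + complex.Im c ^+ 2).
have k0 : 0 <= k by rewrite mulr_ge0// addr_ge0// sqr_ge0.
have mB := measurable_uball.
have S0 (h : 'rV[R]_n -> R[i]^o) x :
    (0 <= (complex.Re (h x) ^+ 2 + complex.Im (h x) ^+ 2)%:E)%E.
  by rewrite lee_fin addr_ge0// sqr_ge0.
apply: (@le_lt_trans _ _ (\int[nu]_(x in uball)
   (k%:E * (complex.Re (f x) ^+ 2 + complex.Im (f x) ^+ 2)%:E +
    2%:E * (complex.Re (g x) ^+ 2 + complex.Im (g x) ^+ 2)%:E))%E).
  apply: ge0_le_integral => //.
  - exact: mS.
  - by apply: emeasurable_funD; apply: emeasurable_funM => //; exact: mS.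
  move=> x _; rewrite -!EFinM -EFinD lee_fin.
  rewrite -[(c *: f + g) x]/(c * f x + g x) ReE ImE /k.
  move: (complex.Re c) (complex.Im c) (complex.Re (f x)) (complex.Im (f x))
    (complex.Re (g x)) (complex.Im (g x)) => a b u v w z.
  rewrite -subr_ge0 (_ : _ - _ = (a * u + - b * v - w) ^+ 2 +
     (b * u + a * v - z) ^+ 2); last by ring.
  by rewrite addr_ge0// sqr_ge0.
rewrite ge0_integralD//.
- rewrite !ge0_integralZl// ?lee_fin//; [|exact: mS|exact: mS].
  by rewrite lte_add_pinfty// lte_mul_pinfty// lee_fin.
- by move=> x _; rewrite mule_ge0.
- by apply: emeasurable_funM => //; exact: mS.
- by move=> x _; rewrite mule_ge0.
- by apply: emeasurable_funM => //; exact: mS.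
Qed.

Lemma charmonic_lin (c : R[i]) (f g : 'rV[R]_n -> R[i]^o) :
  charmonic_on uball f -> charmonic_on uball g ->
  charmonic_on uball (c *: f + g).
Proof.
move=> [fR fI] [gR gI]; have oB := @open_uball R n; split.
- have := harmonic_onD 1 1 oB
    (harmonic_onD (complex.Re c) (- complex.Im c) oB fR fI) gR.
  by congr harmonic_on; apply/funext => x; rewrite 2!mul1r -ReE.
- have := harmonic_onD 1 1 oB
    (harmonic_onD (complex.Im c) (complex.Re c) oB fR fI) gI.
  by congr harmonic_on; apply/funext => x; rewrite 2!mul1r -ImE.
Qed.

Lemma harmonic_on0 (D : set 'rV[R]_n) : harmonic_on D (fun=> 0).
Proof.
have p0 i : partial i (fun=> 0 : R) = (fun=> 0) :> ('rV[R]_n -> R).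
  by apply/funext => x; rewrite /partial derive_cst.
split=> [x Dx|x Dx]; last by rewrite /laplacian big1// => i _; rewrite !p0.
split=> [|i]; first exact: cst_continuous.
split=> [||j]; rewrite ?p0.
- exact: derivable_cst.
- exact: cst_continuous.
- by split; [exact: derivable_cst|exact: cst_continuous].
Qed.

Lemma b2_submod_closed : submod_closed b2_pred.
Proof.
split.
  apply/asboolP; split=> //; first by split; exact: harmonic_on0.
  split; [exact: measurable_cst|exact: measurable_cst|].
  by rewrite integral0_eq// => x _ /=; rewrite expr0n/= addr0.
move=> c f g /asboolP[fh f2 f0] /asboolP[gh g2 g0]; apply/asboolP; split.
- exact: charmonic_lin.
- exact: L2_lin.
- by move=> x xB; rewrite -[LHS]/(c * f x + g x) f0// g0// mulr0 addr0.
Qed.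

HB.instance Definition _ :=
  GRing.isSubmodClosed.Build R[i] ('rV[R]_n -> R[i]^o) b2_pred
    b2_submod_closed.

Record b2 := B2 {
  b2_fun :> 'rV[R]_n -> R[i]^o;
  _ : b2_fun \in b2_pred }.

HB.instance Definition _ := [isSub for b2_fun].
HB.instance Definition _ := [Choice of b2 by <:].
HB.instance Definition _ := [SubChoice_isSubLmodule of b2 by <:].

Definition b2_inner (u v : b2) : R[i] := inner u v.

(* Orthogonal projection of (the class of) [g], for [g] in [L2], onto [b2]: the
   element [h] of [b2] such that [g - h] is orthogonal to [b2]. *)
Definition Q (g : 'rV[R]_n -> R[i]^o) : b2 :=
  xget 0 [set h : b2 | forall v : b2,
    inner (fun x => g x - h x) v = 0].

Definition toeplitz (f : 'rV[R]_n -> R[i]^o) (u : b2) : b2 :=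
  Q (fun x => f x * u x).

Definition toeplitz_algebra : set (b2 -> b2) :=
  cstar_generated b2_inner
    [set toeplitz f | f in
       [set f : 'rV[R]_n -> R[i]^o | {within cuball, continuous f}]].

End Measure.

(* Main.v *)
Require Import Defs.
From HB Require Import structures.
From mathcomp Require Import all_boot all_order all_algebra.
From mathcomp Require Import all_classical all_reals all_analysis.
From mathcomp Require Import complex ring lra zify measurable_realfun.

(* Complex conjugation is an antilinear isometric involution C of b^2 with
   C T_f C = T_(conj f) = T_f^*.  Modulo compact operators the Toeplitz algebra
   consists of the T_f with f continuous, because T_f T_g - T_(fg) is compact; hence
   C A C - A^* is compact for every A in the algebra.  As C A C has the index of A
   and A^* the opposite one, ind A = - ind A.

   The semicommutators are compact because f u is close to b^2 as soon as u is
   orthogonal to the harmonic polynomials of low degree.  This property of f is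
   stable under sums, products and uniform limits, so it suffices to check it for
   the coordinates.  For q homogeneous harmonic of degree m, the function
   x_j q - (|x|^2 - 1) (d_j q) / (n + 2 m - 2) is harmonic, and the norm of the
   correction is small compared with that of q for large m, since the measures
   |x|^(2m) nu concentrate on the sphere when nu charges every neighbourhood of
   it. *)

Set Implicit Arguments.
Unset Strict Implicit.
Unset Printing Implicit Defensive.

Import Order.TTheory GRing.Theory Num.Theory numFieldNormedType.Exports.
Local Open Scope classical_set_scope.
Local Open Scope ring_scope.

(** * Fredholm index and finite rank perturbations *)

Section LinearIndex.
Context {R : realType} {V : lmodType R[i]}.
Implicit Types (W X : set V) (A D G : V -> V) (phi : V -> R[i]).

(** Invariance of the index under compact perturbation is proved by hand. On the orthogonal
    complement of finitely many vectors a compact operator is smaller than the lower bound of the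
    adjoint on the range of [A]; so [C A C] agrees, on a subspace of finite codimension, with a
    norm-small perturbation of the adjoint, and the rest is linear algebra. The analytic obstacle is
    that [nu] is known only through its invariance, without surface measure or polar coordinates.
    Invariance is used infinitesimally: angular derivatives integrate to zero. Passing repeatedly to
    gradients then writes the weighted integral of a product of two harmonic forms of degree [m] as
    a radial moment times a form independent of the weight. Comparing weights reduces to comparing
    moments, which gives the smallness of the correction and the interior estimates behind the
    completeness of b^2. The number [n + 2 m - 2] comes from [laplacian (x_j q) = 2 d_j q] and, for
    [p] harmonic of degree [m - 1], [laplacian (|x|^2 p) = (2 n + 4 (m - 1)) p]. *)

Definition lsubspace W : Prop :=
  W 0 /\ forall (c : R[i]) u v, W u -> W v -> W (c *: u + v).

Lemma lsubspaceD W u v : lsubspace W -> W u -> W v -> W (u + v).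
Proof. by move=> [_ sW] Wu Wv; have := sW 1 u v Wu Wv; rewrite scale1r. Qed.

Lemma lsubspaceZ W c u : lsubspace W -> W u -> W (c *: u).
Proof. by move=> [W0 sW] Wu; have := sW c u 0 Wu W0; rewrite addr0. Qed.

Lemma lsubspaceB W u v : lsubspace W -> W u -> W v -> W (u - v).
Proof.
move=> sW Wu Wv; apply: lsubspaceD => //; rewrite -scaleN1r; exact: lsubspaceZ.
Qed.

Lemma lsubspace_sum W d (c : 'I_d -> R[i]) (e : 'I_d -> V) : lsubspace W ->
  (forall i, W (e i)) -> W (\sum_i c i *: e i).
Proof.
move=> sW We; apply: (big_ind W); first by have [] := sW.
  by move=> u v; exact: lsubspaceD.
by move=> i _; exact: lsubspaceZ.
Qed.

Lemma linear0' A : linear A -> A 0 = 0.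
Proof. by move=> lA; have := lA (-1) 0 0; rewrite !scaleN1r !addNr. Qed.

Lemma linearZ' A c u : linear A -> A (c *: u) = c *: A u.
Proof. by move=> lA; have := lA c u 0; rewrite !addr0 (linear0' lA) addr0. Qed.

Lemma linearD' A u v : linear A -> A (u + v) = A u + A v.
Proof. by move=> lA; have := lA 1 u v; rewrite !scale1r. Qed.

Lemma linearB' A u v : linear A -> A (u - v) = A u - A v.
Proof. by move=> lA; rewrite linearD' // -scaleN1r linearZ' // scaleN1r. Qed.

Lemma linear_sum' A d (c : 'I_d -> R[i]) (e : 'I_d -> V) : linear A ->
  A (\sum_i c i *: e i) = \sum_i c i *: A (e i).
Proof.
move=> lA; apply: (big_ind2 (fun x y => A x = y)).
- exact: linear0'.
- by move=> x1 x2 y1 y2 <- <-; rewrite linearD'.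
- by move=> i _; rewrite linearZ'.
Qed.

(** Steinitz exchange modulo [W]: with [d' > d] the coefficient matrix has a nonzero left kernel
    vector, which is a nontrivial relation among the [e'] modulo [W]. The case [W = 0] gives
    uniqueness of the dimension, the general case that of the codimension. *)
Lemma exchange_le W d d' (e : 'I_d -> V) (e' : 'I_d' -> V) : lsubspace W ->
  (forall j, exists c : 'I_d -> R[i], W (e' j - \sum_i c i *: e i)) ->
  (forall c : 'I_d' -> R[i], W (\sum_j c j *: e' j) -> forall j, c j = 0) ->
  (d' <= d)%N.
Proof.
move=> sW /choice[m mP] ind; rewrite leqNgt; apply/negP => ltdd.
pose M := \matrix_(j < d', i < d) m j i.
have : kermx M != 0.
  rewrite -mxrank_eq0 mxrank_ker -lt0n subn_gt0.
  exact: leq_ltn_trans (rank_leq_col M) ltdd.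
case/rowV0Pn => c /sub_kermxP cM /negP; apply.
apply/eqP/rowP => j; rewrite mxE; apply: (ind (fun j => c ord0 j)).
suff -> : \sum_j c ord0 j *: e' j =
    \sum_j c ord0 j *: (e' j - \sum_i m j i *: e i).
  exact: lsubspace_sum.
under [RHS]eq_bigr do rewrite scalerBr scaler_sumr.
rewrite sumrB exchange_big /= [X in _ - X]big1 ?subr0// => i _.
under eq_bigr do rewrite scalerA.
rewrite -scaler_suml.
suff -> : \sum_i0 c ord0 i0 * m i0 i = (c *m M) ord0 i by rewrite cM mxE scale0r.
by rewrite mxE; apply: eq_bigr => k _; rewrite mxE.
Qed.

Lemma lsubspace0 : lsubspace (fun v : V => v = 0).
Proof. by split=> // c u v -> ->; rewrite scaler0 addr0. Qed.

Lemma has_dim_uniq W d d' : has_dim W d -> has_dim W d' -> d = d'.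
Proof.
have le d1 d2 : has_dim W d1 -> has_dim W d2 -> (d2 <= d1)%N.
  move=> [e [_ We]] [e' [ie' We']].
  apply: (exchange_le (e := e) (e' := e') lsubspace0) => // j.
  have : W (e' j).
    rewrite We'; exists (fun k => (k == j)%:R); rewrite (bigD1 j)//= eqxx scale1r.
    by rewrite big1 ?addr0// => i /negbTE ->; rewrite scale0r.
  by rewrite {1}We => -[c ->]; exists c; rewrite subrr.
by move=> h h'; apply/eqP; rewrite eqn_leq !le.
Qed.

Lemma has_codim_uniq W d d' : lsubspace W ->
  has_codim W d -> has_codim W d' -> d = d'.
Proof.
move=> sW.
have le d1 d2 : has_codim W d1 -> has_codim W d2 -> (d2 <= d1)%N.
  by move=> [e [_ We]] [e' [ie' We']]; exact: (exchange_le (e := e) (e' := e') sW).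
by move=> h h'; apply/eqP; rewrite eqn_leq !le.
Qed.

Lemma dimensionE W d : has_dim W d -> dimension W = d.
Proof.
by move=> h; rewrite /dimension; case: xgetP => [x _ /has_dim_uniq/(_ h)//|/(_ d)].
Qed.

Lemma codimensionE W d : lsubspace W -> has_codim W d -> codimension W = d.
Proof.
move=> sW h; rewrite /codimension; case: xgetP => [x _ hx|/(_ d)//].
exact: has_codim_uniq hx h.
Qed.

Lemma lsubspace_image A X : linear A -> lsubspace X -> lsubspace (A @` X).
Proof.
move=> lA [X0 sX]; split; first by exists 0 => //; rewrite linear0'.
by move=> c _ _ [u Xu <-] [v Xv <-]; exists (c *: u + v); [exact: sX|exact: lA].
Qed.

Lemma lsubspaceT : lsubspace setT. Proof. by []. Qed.

Lemma lsubspace_range A : linear A -> lsubspace (range A).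
Proof. by move=> lA; exact: lsubspace_image. Qed.

(** One step of elimination: a basis vector on which [phi] does not vanish serves as pivot, and a
    suitable multiple of it is subtracted from every other basis vector. *)
Lemma functional_ker_dim X phi d : has_dim X d -> scalar phi ->
  (exists2 k, X k & phi k != 0) ->
  exists2 d', has_dim (X `&` [set v | phi v = 0]) d' & d = d'.+1.
Proof.
move=> [e [ie Xe]] lphi.
have p0 : phi 0 = 0 by have := lphi (-1) 0 0; rewrite scaleN1r mulN1r !addNr.
have psum (d1 : nat) (c : 'I_d1 -> R[i]) (f : 'I_d1 -> V) :
    phi (\sum_i c i *: f i) = \sum_i c i * phi (f i).
  apply: (big_ind2 (fun x y => phi x = y)) => // [x1 x2 y1 y2 <- <-|i _].
    by have := lphi 1 x1 y1; rewrite scale1r mul1r.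
  by have := lphi (c i) (f i) 0; rewrite !addr0 p0 addr0.
move=> [k Xk phik].
have [i0 pi0] : exists i0, phi (e i0) != 0.
  apply/not_existsP => h; move/eqP: phik; apply.
  move: Xk; rewrite Xe => -[c ->]; rewrite psum big1// => i _.
  by have /negP := h i; rewrite negbK => /eqP ->; rewrite mulr0.
case: d e ie Xe i0 pi0 {k Xk phik} => [|d] e ie Xe i0 pi0; first by case: i0 pi0.
pose t j := phi (e (lift i0 j)) / phi (e i0).
pose f j := e (lift i0 j) - t j *: e i0.
have fsum (c : 'I_d -> R[i]) : \sum_j c j *: f j =
    \sum_i (if unlift i0 i is Some j then c j else - \sum_j c j * t j) *: e i.
  rewrite (bigD1_ord i0)//= unlift_none; under [X in _ + X]eq_bigr do rewrite liftK.
  rewrite scaleNr addrC; under eq_bigr do rewrite scalerBr scalerA.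
  by rewrite sumrB scaler_suml.
exists d => //; exists f; split=> [c|].
  by rewrite fsum => /ie h j; have := h (lift i0 j); rewrite liftK.
rewrite eqEsubset; split=> [v []|v [c ->]].
  rewrite Xe => -[c ->]; rewrite /= psum => pv.
  exists (fun j => c (lift i0 j)); rewrite fsum; apply: eq_bigr => i _.
  congr (_ *: _); case: unliftP => [j ->//|->].
  apply: (mulIf pi0); rewrite mulNr mulr_suml; apply/eqP; rewrite -addr_eq0; apply/eqP.
  rewrite -[RHS]pv [RHS](bigD1_ord i0)//=; congr (_ + _).
  by apply: eq_bigr => j _; rewrite /t mulrA divfK.
split; first by rewrite Xe fsum; eexists.
rewrite /= psum big1// => j _.
rewrite /f addrC -scaleNr lphi.
by rewrite mulNr /t divfK// addNr mulr0.
Qed.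

(** If [phi] is nonzero somewhere on the kernel, the kernel loses one dimension and the image is
    unchanged, since kernel vectors can correct the value of [phi]. Otherwise the kernel is
    unchanged and [G x0] becomes a new class modulo the image. *)
Lemma restrict_index X G phi a b : linear G -> lsubspace X -> scalar phi ->
  (exists2 x, X x & phi x != 0) ->
  has_dim (X `&` op_ker G) a -> has_codim (G @` X) b ->
  exists a' b', [/\ has_dim ((X `&` [set v | phi v = 0]) `&` op_ker G) a',
    has_codim (G @` (X `&` [set v | phi v = 0])) b' & (a + b' = a' + b + 1)%N].
Proof.
move=> lG sX lphi [x0 Xx0 px0] ha [e [ie Xe]].
have p0 : phi 0 = 0 by have := lphi (-1) 0 0; rewrite scaleN1r mulN1r !addNr.
have [X0 lX] := sX.
have sX' : lsubspace (X `&` [set v | phi v = 0]).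
  split=> [//|c u v [Xu pu] [Xv pv]]; split; first exact: lX.
  by rewrite /= lphi pu pv mulr0 addr0.
have [[k [Xk Gk] pk]|nk] := pselect (exists2 k, (X `&` op_ker G) k & phi k != 0).
  have [a' ha' ->] := functional_ker_dim ha lphi
    (ex_intro2 _ (fun k => phi k != 0) k (conj Xk Gk) pk).
  exists a', b; split; last by rewrite addnAC addn1.
    by rewrite -setIA [_ `&` op_ker G]setIC setIA.
  suff -> : G @` (X `&` [set v | phi v = 0]) = G @` X by exists e.
  rewrite eqEsubset; split=> [_ [x [Xx _] <-]|_ [x Xx <-]]; first by exists x.
  exists ((- (phi x / phi k)) *: k + x).
    by split; [exact: lX|rewrite /= lphi mulNr divfK// addNr].
  by rewrite lG Gk scaler0 add0r.
have k0 k : X k -> G k = 0 -> phi k = 0.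
  by move=> Xk Gk; apply/eqP/negPn/negP => pk; apply: nk; exists k.
exists a, b.+1; split; last by rewrite addn1 addnS.
- suff -> : (X `&` [set v | phi v = 0]) `&` op_ker G = X `&` op_ker G by [].
  rewrite eqEsubset; split=> [x [[]]//|x [Xx Gx]]; split=> //; split=> //.
  exact: k0.
- exists (fun i => if unlift ord0 i is Some j then e j else G x0); split=> [c|v].
    rewrite big_ord_recl unlift_none; under eq_bigr do rewrite liftK.
    move=> [x [Xx px] Gx].
    have c0 : forall j, c (lift ord0 j) = 0.
      apply: ie; exists (x - c ord0 *: x0).
        by apply: lsubspaceB => //; exact: lsubspaceZ.
      by rewrite linearB'// linearZ'// Gx addrC addKr.
    move: Gx; rewrite [X in _ = _ + X]big1 => [|j _]; last by rewrite c0 scale0r.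
    rewrite addr0 -linearZ'// => /eqP; rewrite -subr_eq0 -linearB'// => /eqP Gx.
    have := k0 _ (lsubspaceB sX Xx (lsubspaceZ _ sX Xx0)) Gx.
    rewrite addrC -scaleNr lphi => /eqP.
    rewrite px addr0 mulNr oppr_eq0 mulf_eq0 (negbTE px0) orbF => /eqP cz j.
    by case: (unliftP ord0 j) => [i ->|->].
  have [c [x Xx Gx]] := Xe v; pose t := phi x / phi x0.
  exists (fun i => if unlift ord0 i is Some j then c j else t).
  rewrite big_ord_recl !unlift_none.
  under eq_bigr do rewrite !liftK.
  exists (x - t *: x0).
    split; first by apply: lsubspaceB => //; exact: lsubspaceZ.
    by rewrite /= addrC -scaleNr lphi mulNr divfK// addNr.
  by rewrite linearB'// linearZ'// Gx opprD [RHS]addrA [RHS]addrAC.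
Qed.

(* The index of the restriction to the common kernel of [phi] only depends on
   that restriction, and drops by one with each functional that is not
   redundant, independently of the operator. *)
Lemma index_finite_perturbation (k : nat) (phi : 'I_k -> V -> R[i]) D G a b a' b' :
  linear D -> linear G -> (forall i, scalar (phi i)) ->
  (forall v, (forall i, phi i v = 0) -> D v = G v) ->
  has_dim (op_ker D) a -> has_codim (range D) b ->
  has_dim (op_ker G) a' -> has_codim (range G) b' ->
  (a + b' = a' + b)%N.
Proof.
move=> lD lG lphi DG hDa hDb hGa hGb.
(* Each functional cuts the domain down to its kernel, so the induction on [k] needs restrictions to
   an arbitrary subspace. *)
suff key X : lsubspace X -> forall a b a' b' : nat,
    (forall v, X v -> (forall i, phi i v = 0) -> D v = G v) ->
    has_dim (X `&` op_ker D) a -> has_codim (D @` X) b ->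
    has_dim (X `&` op_ker G) a' -> has_codim (G @` X) b' ->
    (a + b' = a' + b)%N.
  have := key setT lsubspaceT a b a' b' (fun v _ => DG v).
  by rewrite !setTI; apply.
move=> {DG hDa hDb hGa hGb a b a' b'}.
elim: k phi lphi X => [|k IH] phi lphi X sX a b a' b' DG hDa hDb hGa hGb.
  have DG' v : X v -> D v = G v by move=> Xv; apply: DG => // -[].
  have e1 : X `&` op_ker D = X `&` op_ker G.
    by apply/seteqP; split=> v [Xv h]; split=> //; move: h; rewrite /op_ker/= DG'.
  have e2 : D @` X = G @` X.
    by apply/seteqP; split=> _ [v Xv <-]; exists v => //; rewrite DG'.
  rewrite e1 in hDa; rewrite e2 in hDb.
  rewrite (has_dim_uniq hDa hGa).
  by rewrite (has_codim_uniq (lsubspace_image lG sX) hDb hGb).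
have [px|npx] := pselect (exists2 x, X x & phi ord0 x != 0).
  have [a1 [b1 [h1 h2 h3]]] := restrict_index lD sX (lphi ord0) px hDa hDb.
  have [a2 [b2 [h1' h2' h3']]] := restrict_index lG sX (lphi ord0) px hGa hGb.
  have [X0 lX] := sX.
  have sX' : lsubspace (X `&` [set v | phi ord0 v = 0]).
    split.
      split=> //=; have := lphi ord0 (-1) 0 0.
      by rewrite scaleN1r mulN1r !addNr.
    move=> c u v [Xu pu] [Xv pv]; split; first exact: lX.
    by rewrite /= lphi pu pv mulr0 addr0.
  have := IH (fun i => phi (lift ord0 i)) (fun i => lphi _) _ sX' a1 b1 a2 b2.
  move=> /(_ _ h1 h2 h1' h2') IH'.
  have {}IH' : (a1 + b2 = a2 + b1)%N.
    apply: IH' => v [Xv pv] pl; apply: DG => // i.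
    by case: (unliftP ord0 i) => [j ->|->//]; exact: pl.
  move: h3 h3' IH'; clear; lia.
(* Here [phi ord0] already vanishes on [X] and is simply dropped. *)
apply: (IH (fun i => phi (lift ord0 i)) (fun i => lphi _) X) => // v Xv pl.
apply: DG => // i; case: (unliftP ord0 i) => [j ->|->]; first exact: pl.
by apply/eqP/negPn/negP => pv; apply: npx; exists v.
Qed.

End LinearIndex.

(** * Hilbert spaces *)

Section ComplexParts.
Context {R : realType}.
Implicit Types z w : R[i].

Lemma ReD z w : complex.Re (z + w) = complex.Re z + complex.Re w.
Proof. by case: z w => a b []. Qed.

Lemma ImD z w : complex.Im (z + w) = complex.Im z + complex.Im w.
Proof. by case: z w => a b []. Qed.

Lemma ReN z : complex.Re (- z) = - complex.Re z.
Proof. by case: z. Qed.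

Lemma ImN z : complex.Im (- z) = - complex.Im z.
Proof. by case: z. Qed.

Lemma ReM z w : complex.Re (z * w) =
  complex.Re z * complex.Re w - complex.Im z * complex.Im w.
Proof. by case: z w => a b []. Qed.

Lemma ImM z w : complex.Im (z * w) =
  complex.Re z * complex.Im w + complex.Im z * complex.Re w.
Proof. by case: z w => a b []. Qed.

Lemma ReJ z : complex.Re z^*%C = complex.Re z.
Proof. by case: z. Qed.

Lemma ImJ z : complex.Im z^*%C = - complex.Im z.
Proof. by case: z. Qed.

Lemma complex_ext z w :
  complex.Re z = complex.Re w -> complex.Im z = complex.Im w -> z = w.
Proof. by case: z w => a b [c d] /= -> ->. Qed.

Definition complexpE := (ReD, ImD, ReN, ImN, ReM, ImM, ReJ, ImJ).

End ComplexParts.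

Section Hilbert.
Context {R : realType} {V : lmodType R[i]} (dot : V -> V -> R[i]).
Implicit Types (W X : set V) (A B D G : V -> V).

Local Notation norm := (hnorm dot).
Local Notation rdot u v := (complex.Re (dot u v)).

(** [V] is a bare module without topology, so completeness is spelled out with sequences and
    [hnorm]. Positivity concerns only real parts; the imaginary part of [dot u u] vanishes by
    [dotC]. *)
Record hilbert : Prop := Hilbert {
  dot_linear : forall (c : R[i]) u v w, dot (c *: u + v) w = c * dot u w + dot v w;
  dotC : forall u v, dot v u = (dot u v)^*%C;
  dot_ge0 : forall u, 0 <= rdot u u;
  dot_eq0 : forall u, rdot u u = 0 -> u = 0;
  hilbert_complete : forall u : nat -> V,
    (forall e : R, 0 < e -> exists N, forall k l, (N <= k)%N -> (N <= l)%N ->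
       norm (u k - u l) < e) ->
    exists v, forall e : R, 0 < e -> exists N, forall k, (N <= k)%N ->
       norm (u k - v) < e }.

Hypothesis H : hilbert.

Lemma dotDl u v w : dot (u + v) w = dot u w + dot v w.
Proof. by have := dot_linear H 1 u v w; rewrite scale1r mul1r. Qed.

Lemma dot0l w : dot 0 w = 0.
Proof. by have := dot_linear H (-1) 0 0 w; rewrite scaler0 addr0 mulN1r addNr. Qed.

Lemma dotZl c u w : dot (c *: u) w = c * dot u w.
Proof. by have := dot_linear H c u 0 w; rewrite addr0 dot0l addr0. Qed.

Lemma dotNl u w : dot (- u) w = - dot u w.
Proof. by rewrite -scaleN1r dotZl mulN1r. Qed.

Lemma dotBl u v w : dot (u - v) w = dot u w - dot v w.
Proof. by rewrite dotDl dotNl. Qed.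

Lemma dotDr u v w : dot u (v + w) = dot u v + dot u w.
Proof. by rewrite (dotC H) dotDl rmorphD /= -!(dotC H). Qed.

Lemma dotZr c u w : dot u (c *: w) = c^*%C * dot u w.
Proof. by rewrite (dotC H) dotZl rmorphM /= -(dotC H). Qed.

Lemma dot0r w : dot w 0 = 0.
Proof. by rewrite (dotC H) dot0l rmorph0. Qed.

Lemma dotNr u w : dot u (- w) = - dot u w.
Proof. by rewrite (dotC H) dotNl rmorphN /= -(dotC H). Qed.

Lemma dotBr u v w : dot u (v - w) = dot u v - dot u w.
Proof. by rewrite dotDr dotNr. Qed.

Lemma rdotC u v : rdot u v = rdot v u.
Proof. by rewrite (dotC H) ReJ. Qed.

Lemma hnorm_ge0 u : 0 <= norm u.
Proof. exact: sqrtr_ge0. Qed.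

Lemma hnormE u : norm u ^+ 2 = rdot u u.
Proof. by rewrite /hnorm sqr_sqrtr// (dot_ge0 H). Qed.

Lemma dot_hnormE u : dot u u = (norm u ^+ 2)%:C%C.
Proof.
apply: complex_ext; rewrite ?hnormE//=.
have /(congr1 (@complex.Im R)) := dotC H u u; rewrite ImJ; lra.
Qed.

Lemma hnorm0 : norm 0 = 0.
Proof. by rewrite /hnorm dot0l sqrtr0. Qed.

Lemma hnorm_eq0 u : norm u = 0 -> u = 0.
Proof. by move=> h; apply: (dot_eq0 H); rewrite -hnormE h expr0n. Qed.

Lemma hnorm_gt0 u : u <> 0 -> 0 < norm u.
Proof.
move=> u0; rewrite lt_def hnorm_ge0 andbT; apply/eqP => h; exact/u0/hnorm_eq0.
Qed.

Lemma hnormDE u v : norm (u + v) ^+ 2 = norm u ^+ 2 + 2 * rdot u v + norm v ^+ 2.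
Proof. by rewrite !hnormE dotDl !dotDr !ReD (rdotC v u); ring. Qed.

Lemma hnormN u : norm (- u) = norm u.
Proof. by rewrite /hnorm dotNl dotNr opprK. Qed.

Lemma hdistC u v : norm (u - v) = norm (v - u).
Proof. by rewrite -hnormN opprB. Qed.

Lemma hnormBE u v : norm (u - v) ^+ 2 = norm u ^+ 2 - 2 * rdot u v + norm v ^+ 2.
Proof. by rewrite hnormDE hnormN dotNr ReN; ring. Qed.

Lemma rdotZl (a : R) u v : rdot (a%:C%C *: u) v = a * rdot u v.
Proof. by rewrite dotZl ReM /= mul0r subr0. Qed.

Lemma rdotZr (a : R) u v : rdot u (a%:C%C *: v) = a * rdot u v.
Proof. by rewrite rdotC rdotZl rdotC. Qed.

Lemma hnormZr (a : R) u : norm (a%:C%C *: u) = `|a| * norm u.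
Proof.
rewrite /hnorm rdotZl rdotZr mulrA -expr2 sqrtrM ?sqr_ge0//.
by rewrite sqrtr_sqr.
Qed.

Lemma hnormZ c u : norm (c *: u) ^+ 2 =
  (complex.Re c ^+ 2 + complex.Im c ^+ 2) * norm u ^+ 2.
Proof.
by rewrite !hnormE dotZl dotZr dot_hnormE !complexpE /= hnormE; ring.
Qed.

Lemma rdot_le u v : rdot u v <= norm u * norm v.
Proof.
have [->|v0] := pselect (v = 0); first by rewrite dot0r hnorm0 mulr0.
have [->|u0] := pselect (u = 0); first by rewrite dot0l hnorm0 mul0r.
have v1 := hnorm_gt0 v0; have u1 := hnorm_gt0 u0.
have := sqr_ge0 (norm ((norm v)%:C%C *: u - (norm u)%:C%C *: v)).
rewrite hnormBE !hnormZr rdotZl rdotZr !ger0_norm ?hnorm_ge0// !exprMn => h.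
rewrite -(ler_pM2l (mulr_gt0 u1 v1)).
by move: h; set a := norm u; set b := norm v; set c := rdot u v => h; nra.
Qed.

Lemma norm_rdot_le u v : `|rdot u v| <= norm u * norm v.
Proof.
rewrite ler_norml rdot_le andbT lerNl -ReN -dotNl.
by rewrite (le_trans (rdot_le _ _))// hnormN.
Qed.

Lemma ler_hnormD u v : norm (u + v) <= norm u + norm v.
Proof.
rewrite -ler_sqr ?nnegrE ?addr_ge0 ?hnorm_ge0// hnormDE sqrrD -mulr_natl mulrC.
by have := rdot_le u v; lra.
Qed.

Lemma ler_hnormB u v : norm (u - v) <= norm u + norm v.
Proof. by rewrite (le_trans (ler_hnormD _ _))// hnormN. Qed.

Lemma ler_hdist u v w : norm (u - w) <= norm (u - v) + norm (v - w).
Proof. by rewrite -{1}(subrK v u) -addrA ler_hnormD. Qed.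

Lemma hnorm_le_sqr u (a : R) : 0 <= a -> norm u ^+ 2 <= a ^+ 2 -> norm u <= a.
Proof. by move=> a0; rewrite ler_sqr ?nnegrE ?hnorm_ge0. Qed.

Lemma dot_eq0_re u v : (forall c : R[i], rdot u (c *: v) = 0) -> dot u v = 0.
Proof.
move=> h; apply: complex_ext.
  by have := h 1; rewrite scale1r.
have := h 'i%C; rewrite dotZr !complexpE /=; lra.
Qed.

Lemma bounded_opP A : bounded_op dot A ->
  linear A /\ exists2 M : R, 0 < M & forall v, norm (A v) <= M * norm v.
Proof.
move=> [lA [M hM]]; split=> //; exists (`|M| + 1); first by rewrite ltr_wpDl.
move=> v; rewrite (le_trans (hM v))// ler_wpM2r ?hnorm_ge0//.
by rewrite (le_trans (ler_norm _))// lerDl.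
Qed.

Lemma bounded_comp A B : bounded_op dot A -> bounded_op dot B ->
  bounded_op dot (A \o B).
Proof.
move=> /bounded_opP[lA [M M0 hM]] /bounded_opP[lB [N N0 hN]]; split.
  by move=> c u v /=; rewrite lB lA.
exists (M * N) => v /=; rewrite (le_trans (hM _))// -mulrA ler_pM2l//.
Qed.

Lemma bounded_add A B : bounded_op dot A -> bounded_op dot B ->
  bounded_op dot (A + B).
Proof.
move=> /bounded_opP[lA [M M0 hM]] /bounded_opP[lB [N N0 hN]]; split.
  move=> c u v; rewrite -![(A + B) _]/(A _ + B _).
  by rewrite lB lA scalerDr addrACA.
exists (M + N) => v; rewrite -![(A + B) _]/(A _ + B _) (le_trans (ler_hnormD _ _))//.
by rewrite mulrDl lerD.
Qed.

Lemma bounded_scale c A : bounded_op dot A -> bounded_op dot (c *: A).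
Proof.
move=> /bounded_opP[lA [M M0 hM]]; split.
  move=> d u v; rewrite -![(c *: A) _]/(c *: A _).
  by rewrite lA scalerDr !scalerA mulrC.
exists (Num.sqrt (complex.Re c ^+ 2 + complex.Im c ^+ 2) * M) => v.
have c0 : 0 <= complex.Re c ^+ 2 + complex.Im c ^+ 2 by rewrite addr_ge0 ?sqr_ge0.
apply: hnorm_le_sqr; first by rewrite !mulr_ge0 ?hnorm_ge0 ?sqrtr_ge0 ?ltW.
rewrite -[(c *: A) _]/(c *: A _) hnormZ -mulrA [X in _ <= X]exprMn (sqr_sqrtr c0).
apply: ler_wpM2l => //; rewrite ler_sqr ?nnegrE ?hnorm_ge0//.
by rewrite mulr_ge0 ?hnorm_ge0// ltW.
Qed.

Lemma bounded_sub A B : bounded_op dot A -> bounded_op dot B ->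
  bounded_op dot (A - B).
Proof.
move=> bA bB; rewrite -scaleN1r; apply: bounded_add => //; exact: bounded_scale.
Qed.

(* The minimum of [|w|^2 - 2 Re (phi w)] over [W] represents [phi]. *)
Lemma riesz_re W (phi : V -> R) (M : R) : lsubspace W -> norm_closed dot W ->
  (forall u v, phi (u + v) = phi u + phi v) ->
  (forall (a : R) u, phi (a%:C%C *: u) = a * phi u) ->
  (forall w, W w -> phi w <= M * norm w) ->
  exists2 h, W h & forall w, W w -> phi w = rdot w h.
Proof.
move=> sW cW phiD phiZ phiM.
have [W0 _] := sW.
pose J v := norm v ^+ 2 - 2 * phi v.
have Jlb v : W v -> - M ^+ 2 <= J v.
  move=> /phiM h; rewrite /J; have := sqr_ge0 (norm v - M).
  rewrite sqrrB -mulr_natl; nra.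
pose S := [set J v | v in W].
have Sinf : has_inf S.
  split; first by exists (J 0), 0.
  by exists (- M ^+ 2) => _ [v Wv <-]; exact: Jlb.
set m := inf S.
have mle v : W v -> m <= J v.
  by move=> Wv; apply: ge_inf; [exact: Sinf.2|exists v].
have /choice[u uP] : forall k : nat, exists v, W v /\ J v < m + k.+1%:R^-1.
  move=> k.
  have k0 : 0 < k.+1%:R^-1 :> R by rewrite invr_gt0.
  have [_ [v Wv <-] h] := inf_adherent k0 Sinf.
  by exists v.
(* Parallelogram identity at the midpoint of [v] and [w], where [J] is at least [m]; the linear
   terms cancel. Minimising sequences are therefore Cauchy. *)
have par v w : W v -> W w -> norm (v - w) ^+ 2 <= 2 * (J v - m) + 2 * (J w - m).
  move=> Wv Ww.
  have Wh : W ((2^-1)%:C%C *: (v + w)) by apply: lsubspaceZ => //; exact: lsubspaceD.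
  have := mle _ Wh; rewrite /J hnormZr phiZ phiD exprMn ger0_norm ?invr_ge0//.
  by rewrite hnormBE hnormDE; lra.
have invS (e : R) : 0 < e -> exists N, forall k, (N <= k)%N -> k.+1%:R^-1 < e.
  move=> e0; exists (Num.truncn e^-1) => k hk.
  rewrite invf_plt ?posrE//.
  by rewrite (lt_le_trans (truncnS_gt _))// ler_nat.
have [h hP] : exists v, forall e : R, 0 < e -> exists N, forall k, (N <= k)%N ->
       norm (u k - v) < e.
  apply: (hilbert_complete H) => e e0.
  have [N NP] := invS (e ^+ 2 / 4) ltac:(by rewrite divr_gt0// exprn_gt0).
  exists N => k l hk hl.
  rewrite -ltr_sqr ?nnegrE ?hnorm_ge0 ?ltW//.
  have [Wk Jk] := uP k; have [Wl Jl] := uP l.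
  have := par _ _ Wk Wl; move: (NP _ hk) (NP _ hl) Jk Jl.
  move: (k.+1%:R^-1) (l.+1%:R^-1) (e ^+ 2) (J (u k)) (J (u l)) (norm (u k - u l)).
  clear; move=> a b c x y z; lra.
have Wh : W h.
  apply: cW => e e0; have [N NP] := hP e e0; exists (u N); first by have [] := uP N.
  by rewrite hdistC; exact: NP.
exists h => // w Ww.
(* The infimum passes to the limit [h] because [J h - J (u k)] is at most [K] times the distance
   from [u k] to [h]. *)
have Jmin v : W v -> J h <= J v.
  move=> Wv; apply: (@le_trans _ _ m); last exact: mle.
  apply/ler_addgt0Pr => e e0.
  pose K := 2 * norm h + 1 + 2 * `|M|.
  have K0 : 0 < K.
    by rewrite /K; have := hnorm_ge0 h; have := normr_ge0 M; lra.
  have [N1 NP1] := hP (Num.min 1 (e / (2 * K)))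
    ltac:(by rewrite lt_min ltr01/= divr_gt0// mulr_gt0).
  have [N2 NP2] := invS (e / 2) ltac:(by rewrite divr_gt0).
  have [Wk Jk] := uP (maxn N1 N2).
  have := NP2 _ (leq_maxr N1 N2); have := NP1 _ (leq_maxl N1 N2).
  set k := maxn N1 N2 in Wk Jk *.
  rewrite lt_min => /andP[d1 d2] kk.
  have dK : norm (u k - h) * K < e / 2.
    move: d2; rewrite -(ltr_pM2r K0).
    suff -> : e / (2 * K) * K = e / 2 by [].
    by field; rewrite gt_eqF.
  have Jd : J h - J (u k) <= norm (u k - h) * K.
    have Wd : W (u k - h) by exact: lsubspaceB.
    rewrite /J -{1 2}(subrK (u k) h) -(opprB (u k)) -[- (u k - h)]scaleN1r.
    have -> : (-1 : R[i]) = (-1 : R)%:C%C by rewrite rmorphN1.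
    rewrite phiD phiZ hnormDE hnormZr rdotZl normrN1 mul1r.
    have e1 : rdot (u k - h) (u k) = rdot (u k - h) h + norm (u k - h) ^+ 2.
      by rewrite hnormE -ReD -dotDr [h + _]addrC subrK.
    have := rdot_le (- (u k - h)) h; rewrite dotNl ReN hnormN => c1.
    have := phiM _ Wd => c2; have := hnorm_ge0 (u k - h) => n0.
    have c3 : M * norm (u k - h) <= `|M| * norm (u k - h).
      by rewrite ler_wpM2r// ler_norm.
    rewrite /K e1.
    move: c1 c2 c3 n0 d1; set a := norm (u k - h); set b := norm h.
    set x := rdot _ h; set y := phi _; set z := `|M|; clear.
    move=> c1 c2 c3 n0 d1; nra.
  move: Jd dK Jk kk; move: (k.+1%:R^-1) (norm (u k - h) * K) (J (u k)) (J h).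
  clear; move=> a b x y; lra.
suff /eqP : phi w - rdot w h = 0 by rewrite subr_eq0 => /eqP.
apply/eqP/negPn/negP => t0.
set t := phi w - rdot w h in t0.
have J1 s : 0 <= s ^+ 2 * norm w ^+ 2 - 2 * s * t.
  have := Jmin (h + s%:C%C *: w) (lsubspaceD sW Wh (lsubspaceZ _ sW Ww)).
  rewrite /J phiD phiZ hnormDE hnormZr rdotZr exprMn real_normK ?num_real//.
  rewrite (rdotC h) /t; lra.
have q0 : 0 < norm w ^+ 2 + 1 by rewrite ltr_wpDl// sqr_ge0.
(* This parameter makes the quadratic [s^2 |w|^2 - 2 s t] negative unless [t = 0]; the added 1 keeps
   the denominator positive when [w] is zero. *)
have := J1 (t / (norm w ^+ 2 + 1)).
have t2 : 0 < t ^+ 2 by rewrite lt_def sqr_ge0 sqrf_eq0 t0.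
set q := norm w ^+ 2.
have qq : 0 < q + 1 by [].
suff -> : (t / (q + 1)) ^+ 2 * q - 2 * (t / (q + 1)) * t =
   - (t ^+ 2 * (q + 2)) / (q + 1) ^+ 2.
  rewrite leNgt => /negP; apply.
  rewrite mulNr oppr_lt0 divr_gt0 ?exprn_gt0// mulr_gt0//.
  by rewrite (lt_trans qq)// ltrD2l ltr1n.
by field; rewrite gt_eqF.
Qed.

Definition orth W : set V := [set u | forall w, W w -> dot u w = 0].

Lemma lsubspace_orth W : lsubspace (orth W).
Proof.
split=> [w _|c u v hu hv w Ww]; first by rewrite dot0l.
by rewrite (dot_linear H) hu// hv// mulr0 addr0.
Qed.

Lemma closed_orth W : norm_closed dot (orth W).
Proof.
move=> v vP w Ww; apply: dot_eq0_re => c; apply/eqP/negPn/negP => t0.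
have w0 : 0 < norm (c *: w) + 1 by rewrite ltr_wpDl// hnorm_ge0.
have := vP (`|rdot v (c *: w)| / (norm (c *: w) + 1)).
case; first by rewrite divr_gt0// normr_gt0.
move=> u ou; rewrite ltr_pdivlMr//; apply/negP; rewrite -leNgt.
have := norm_rdot_le (v - u) (c *: w).
rewrite dotBl [dot u _]dotZr ou// mulr0 subr0 => h.
by rewrite (le_trans h)// ler_wpM2l ?hnorm_ge0// lerDl.
Qed.

(** The projection is the Riesz representative in [W] of [w |-> Re <w, v>]. *)
Lemma projection_exists W v : lsubspace W -> norm_closed dot W ->
  exists2 p, W p & orth W (v - p).
Proof.
move=> sW cW.
have [p Wp pP] := @riesz_re W (fun w => rdot w v) (norm v) sW cW
  (fun u w => ltac:(by rewrite /= dotDl ReD)) (fun a u => rdotZl a u v)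
  (fun w _ => ltac:(by rewrite mulrC; exact: rdot_le)).
exists p => // w Ww; apply: dot_eq0_re => c.
have Wcw : W (c *: w) by exact: lsubspaceZ.
by rewrite rdotC dotBr ReD ReN pP// subrr.
Qed.

Lemma closedT : norm_closed dot setT.
Proof. by []. Qed.

Lemma adjoint_exists A : bounded_op dot A ->
  exists2 B, bounded_op dot B & is_adjoint dot A B.
Proof.
move=> /bounded_opP[lA [M M0 hM]].
have /choice[B BP] : forall v, exists h, forall u, dot (A u) v = dot u h.
  move=> v.
  have [h _ hP] := @riesz_re setT (fun u => rdot (A u) v) (M * norm v) lsubspaceT
    closedT (fun u w => ltac:(by rewrite /= linearD' // dotDl ReD))
    (fun a u => ltac:(by rewrite /= linearZ' // rdotZl))
    (fun w _ => ltac:(by rewrite (le_trans (rdot_le _ _))// mulrAC ler_wpM2r ?hnorm_ge0)).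
  exists h => u; apply/eqP; rewrite -subr_eq0; apply/eqP.
  apply: complex_ext.
    by rewrite ReD ReN hP// subrr.
  have := hP ('i%C *: u) I; rewrite linearZ'// !dotZl !complexpE /=; lra.
have AB : is_adjoint dot A B by move=> u v; rewrite BP.
exists B => //; split.
  move=> c u v; apply/eqP; rewrite -subr_eq0; apply/eqP/(dot_eq0 H).
  set d := B _ - _.
  suff -> : dot d d = 0 by [].
  rewrite {2}/d dotBr dotDr dotZr -!AB dotDr dotZr; ring.
exists M => v.
have [->|/hnorm_gt0 B0] := pselect (B v = 0).
  by rewrite hnorm0 mulr_ge0 ?hnorm_ge0// ltW.
rewrite -(ler_pM2l B0) -expr2 hnormE -AB.
rewrite (le_trans (rdot_le _ _))// mulrA ler_wpM2r ?hnorm_ge0//.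
by rewrite mulrC hM.
Qed.

End Hilbert.

(** * Compact operators and antilinear conjugations *)

Section Fredholm.
Context {R : realType} {V : lmodType R[i]} (dot : V -> V -> R[i]).
Implicit Types (W X : set V) (A B C D G K : V -> V).

Local Notation norm := (hnorm dot).
Local Notation rdot u v := (complex.Re (dot u v)).
Hypothesis H : hilbert dot.

(* Equivalent, on a Hilbert space, to being a norm limit of finite rank
   operators; this form avoids mentioning projections. *)
Definition compact_op K : Prop := forall e : R, 0 < e ->
  exists ws : seq V, forall u, (forall w, w \in ws -> dot u w = 0) ->
    norm (K u) <= e * norm u.

Lemma compact_add K G : compact_op K -> compact_op G -> compact_op (K + G).
Proof.
move=> cK cG e e0; have e2 : 0 < e / 2 by rewrite divr_gt0.
have [ws wsP] := cK _ e2; have [xs xsP] := cG _ e2.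
exists (ws ++ xs) => u hu; rewrite -[(K + G) u]/(K u + G u).
rewrite (le_trans (ler_hnormD H _ _))//.
have h1 : norm (K u) <= e / 2 * norm u.
  by apply: wsP => w hw; apply: hu; rewrite mem_cat hw.
have h2 : norm (G u) <= e / 2 * norm u.
  by apply: xsP => w hw; apply: hu; rewrite mem_cat hw orbT.
lra.
Qed.

Lemma compact_compl A K : bounded_op dot A -> compact_op K -> compact_op (A \o K).
Proof.
move=> /bounded_opP[lA [M M0 hM]] cK e e0.
have [|ws wsP] := cK (e / M); first by rewrite divr_gt0.
exists ws => u /wsP hu /=; rewrite (le_trans (hM _))// mulrC -ler_pdivlMr//.
by rewrite mulrAC.
Qed.

(** The finitely many tests for [K] are pulled back along [A] by its adjoint. *)
Lemma compact_compr A K : bounded_op dot A -> compact_op K -> compact_op (K \o A).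
Proof.
move=> bA cK e e0.
have [B bB AB] := adjoint_exists H bA.
have [lA [M M0 hM]] := bounded_opP bA.
have [|ws wsP] := cK (e / M); first by rewrite divr_gt0.
exists (map B ws) => u hu /=; rewrite (le_trans (wsP _ _))//.
  by move=> w hw; rewrite AB; apply: hu; rewrite map_f.
have -> : e * norm u = e / M * (M * norm u) by rewrite mulrA divfK ?gt_eqF.
by rewrite ler_wpM2l// divr_ge0// ltW.
Qed.

(** The tests [K w] force [B u] to be orthogonal to every [w], and [|B u|^2 = <K (B u), u>] then
    carries the bound of [K] over to [B]. *)
Lemma compact_adjoint K B : compact_op K -> is_adjoint dot K B -> compact_op B.
Proof.
move=> cK KB e e0; have [ws wsP] := cK e e0.
exists (map K ws) => u hu.
have [->|/(hnorm_gt0 H) B0] := pselect (B u = 0).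
  by rewrite (hnorm0 H) mulr_ge0 ?hnorm_ge0// ltW.
rewrite -(ler_pM2l B0) -expr2 (hnormE H) -KB.
rewrite (le_trans (rdot_le H _ _))// mulrA [_ * e]mulrC ler_wpM2r ?hnorm_ge0//.
by apply: wsP => w hw; rewrite (dotC H) -KB -(dotC H) hu ?map_f.
Qed.

Lemma compact_lim K : (forall e : R, 0 < e ->
    exists2 G, compact_op G & forall v, norm (K v - G v) <= e * norm v) ->
  compact_op K.
Proof.
move=> h e e0; have e2 : 0 < e / 2 by rewrite divr_gt0.
have [G cG GP] := h _ e2; have [ws wsP] := cG _ e2.
exists ws => u hu; rewrite -(subrK (G u) (K u)) (le_trans (ler_hnormD H _ _))//.
have := GP u; have := wsP _ hu; lra.
Qed.

Lemma expr_dominates (a : R) : exists k : nat, a < k%:R.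
Proof. by exists (Num.truncn a).+1; exact: truncnS_gt. Qed.

Lemma inv3X_lt (e : R) : 0 < e -> exists N, forall k, (N <= k)%N -> 3^-1 ^+ k < e.
Proof.
move=> e0; have [k hk] := expr_dominates e^-1; exists k => l hkl.
have pos m : 0 < (3 : R) ^+ m by rewrite exprn_gt0.
rewrite exprVn invf_plt ?posrE//; apply: (lt_le_trans hk).
have : (k%:R : R) <= l%:R by rewrite ler_nat.
move/le_trans; apply; rewrite -natrX ler_nat.
exact/ltnW/ltn_expl.
Qed.

(* Gliding hump: [x = \sum +- 3^-k y_k / |y_k|] contradicts the pointwise bound
   when the norms [|y_k|] grow fast enough. *)
Lemma uniform_bound W (Y : set V) : lsubspace W -> norm_closed dot W -> Y `<=` W ->
  (forall w, W w -> exists M : R, forall y, Y y -> `|rdot w y| <= M) ->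
  exists M : R, forall y, Y y -> norm y <= M.
Proof.
move=> sW cW YW pb; apply/not_existsP => nb.
have [W0 _] := sW.
have large (M : R) : exists2 y, Y y & M < norm y.
  have /existsNP[y /not_implyP[Yy /negP]] := nb M.
  by rewrite -ltNge; exists y.
pose q : R := 3^-1.
have q0 : 0 < q by rewrite /q invr_gt0.
have qk k : 0 < q ^+ k by rewrite exprn_gt0.
(* One hump: [x] moves by [3^-k] along [y / |y|], with the sign chosen so that the pairings of [x]
   and of the increment with [y] do not cancel. *)
have /choice[g gP] : forall kx : nat * V, exists x', W kx.2 ->
    W x' /\ norm (x' - kx.2) <= q ^+ kx.1 /\
    exists2 y, Y y & 2 * kx.1%:R < q ^+ kx.1 * norm y /\
       q ^+ kx.1 * norm y <= `|rdot x' y|.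
  move=> [k x] /=.
  have [Wx|nWx] := pselect (W x); last by exists x.
  have [y Yy hy] := large (`|2 * k%:R / q ^+ k|).
  have y0 : 0 < norm y by exact: le_lt_trans hy.
  have hy2 : 2 * k%:R < q ^+ k * norm y.
    by rewrite -ltr_pdivrMl// mulrC (le_lt_trans (ler_norm _) hy).
  pose t := q ^+ k / norm y.
  have t0 : 0 < t by rewrite divr_gt0.
  have tn : t * norm y = q ^+ k by rewrite /t divfK// gt_eqF.
  have nt (s : R) : `|s| = t -> norm (s%:C%C *: y) = q ^+ k.
    by move=> st; rewrite (hnormZr H) st tn.
  have ty : t * rdot y y = q ^+ k * norm y.
    by rewrite -(hnormE H) expr2 mulrA tn.
  have Wt (s : R) : W (x + s%:C%C *: y).
    by apply: lsubspaceD => //; apply: lsubspaceZ => //; exact: YW.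
  have [h|h] := leP 0 (rdot x y).
    exists (x + t%:C%C *: y) => _; split; first exact: Wt.
    split; first by rewrite addrC addKr nt// gtr0_norm.
    exists y => //; split=> //; rewrite (dotDl H) ReD (rdotZl H) ty.
    by rewrite (le_trans _ (ler_norm _))// lerDr.
  exists (x + (- t)%:C%C *: y) => _; split; first exact: Wt.
  split; first by rewrite addrC addKr nt// normrN gtr0_norm.
  exists y => //; split=> //; rewrite (dotDl H) ReD (rdotZl H) mulNr ty.
  by rewrite -normrN (le_trans _ (ler_norm _))// opprD opprK lerDr oppr_ge0 ltW.
pose x := fix x k := if k is k'.+1 then g (k', x k') else 0.
have Wx k : W (x k).
  by elim: k => [//|k IH] /=; have [] := gP (k, x k) IH.
have xS k d : norm (x (k + d)%N - x k) <= 3 / 2 * (q ^+ k - q ^+ (k + d)).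
  elim: d => [|d IH]; first by rewrite addn0 !subrr (hnorm0 H) mulr0.
  rewrite addnS (le_trans (ler_hdist H _ (x (k + d)%N) _))//=.
  have [_ [/= h _]] := gP ((k + d)%N, x (k + d)%N) (Wx _).
  rewrite (le_trans (lerD h IH))// exprS /q; lra.
have xle k l : (k <= l)%N -> norm (x l - x k) <= 3 / 2 * q ^+ k.
  move=> kl; rewrite -(subnKC kl) (le_trans (xS _ _))//.
  by rewrite ler_pM2l// gerBl ltW.
have [z zP] : exists v, forall e : R, 0 < e -> exists N, forall k, (N <= k)%N ->
       norm (x k - v) < e.
  apply: (hilbert_complete H) => e e0.
  have [N NP] := inv3X_lt (e := e / 4) ltac:(by rewrite divr_gt0).
  exists N => k l hk hl; have := NP _ (leqnn N); have := xle _ _ hk.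
  have := xle _ _ hl; have := ler_hdist H (x k) (x N) (x l).
  rewrite (hdistC H (x N)) -/q; lra.
have Wz : W z.
  apply: cW => e e0; have [N NP] := zP e e0; exists (x N) => //.
  by rewrite (hdistC H); exact: NP.
have zx k : norm (z - x k) <= 3 / 2 * q ^+ k.
  apply/ler_addgt0Pr => e e0; have [N NP] := zP e e0.
  have := NP _ (leq_maxl N k); have := xle _ _ (leq_maxr N k).
  have := ler_hdist H z (x (maxn N k)) (x k); rewrite (hdistC H z (x (maxn N k))).
  lra.
have [M MP] := pb z Wz.
have [k hk] := expr_dominates M.
have [_ [_ [y Yy [y1 y2]]]] := gP (k, x k) (Wx k); rewrite /= in y1 y2.
have := MP y Yy; apply/negP; rewrite -ltNge; apply: (lt_trans hk).
have := norm_rdot_le H (x k.+1 - z) y; rewrite (dotBl H) ReD ReN /= => h1.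
have h2 := zx k.+1; rewrite (hdistC H z) /= in h2.
have := lerB_dist (rdot (g (k, x k)) y) (rdot z y) => h3.
(* All later humps together move the point by at most [3/2 * 3^-(k+1) = 3^-k / 2], which spoils half
   of the pairing reached at step [k]; the factor 2 in the choice of [y] leaves more than [k]. *)
have h4 : norm (g (k, x k) - z) * norm y <= q ^+ k * norm y / 2.
  rewrite mulrAC ler_wpM2r ?hnorm_ge0//; move: h2; rewrite exprS /q; lra.
lra.
Qed.

Lemma projector W : lsubspace W -> norm_closed dot W -> exists P : V -> V,
  [/\ linear P, forall v, W (P v), forall v, orth dot W (v - P v),
      forall w, W w -> P w = w & forall v, norm (P v) <= norm v].
Proof.
move=> sW cW; have /choice[P PP] : forall v, exists p, W p /\ orth dot W (v - p).
  by move=> v; have [p] := projection_exists H v sW cW; exists p.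
have uq v w : W v -> W w -> orth dot W (v - w) -> v = w.
  move=> Wv Ww h; apply/eqP; rewrite -subr_eq0; apply/eqP/(dot_eq0 H).
  by rewrite h//; exact: lsubspaceB.
exists P; split=> [c u v|v|v|w Ww|v].
- have [[Wu hu] [Wv hv]] := (PP u, PP v); have [Wc hc] := PP (c *: u + v).
  apply: uq => //; first by case: sW => _; apply.
  have -> : P (c *: u + v) - (c *: P u + P v) =
      (c *: (u - P u) + (v - P v)) - (c *: u + v - P (c *: u + v)).
    by rewrite scalerBr addrACA -opprD opprB [RHS]addrC addrA subrK.
  have oW := lsubspace_orth H W.
  by apply: (lsubspaceB oW) => //; apply: (lsubspaceD oW) => //; exact: (lsubspaceZ _ oW).
- by have [] := PP v.
- by have [] := PP v.
- have [h1 h2] := PP w; apply/esym/uq => //.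
- have [h1 h2] := PP v; rewrite -ler_sqr ?nnegrE ?hnorm_ge0//.
  rewrite -[X in _ <= norm X ^+ 2](subrK (P v) v) (hnormDE H) h2//= mulr0 addr0.
  by rewrite lerDr sqr_ge0.
Qed.

(** The lower bound turns a convergent sequence of images into a Cauchy sequence of preimages. *)
Lemma closed_image W G (c : R) : lsubspace W -> norm_closed dot W ->
  bounded_op dot G -> 0 < c -> (forall w, W w -> c * norm w <= norm (G w)) ->
  norm_closed dot (G @` W).
Proof.
move=> sW cW bG c0 Gc v vP.
have [lG [M M0 GM]] := bounded_opP bG.
have /choice[w wP] : forall k : nat, exists w, W w /\ norm (v - G w) < 3^-1 ^+ k.
  move=> k; have k0 : 0 < (3 : R)^-1 ^+ k by rewrite exprn_gt0// invr_gt0.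
  by have [_ [w Ww <-] h] := vP _ k0; exists w.
have [z zP] : exists v, forall e : R, 0 < e -> exists N, forall k, (N <= k)%N ->
       norm (w k - v) < e.
  apply: (hilbert_complete H) => e e0.
  have [N NP] := inv3X_lt (e := c * e / 2) ltac:(by rewrite divr_gt0// mulr_gt0).
  exists N => k l hk hl; rewrite -(ltr_pM2l c0).
  have [[Wk h1] [Wl h2]] := (wP k, wP l).
  apply: le_lt_trans (Gc _ (lsubspaceB sW Wk Wl)) _; rewrite linearB'//.
  apply: le_lt_trans (ler_hdist H _ v _) _; rewrite (hdistC H (G _)).
  have := NP _ hk; have := NP _ hl; lra.
have Wz : W z.
  apply: cW => e e0; have [N NP] := zP e e0; exists (w N); first by have [] := wP N.
  by rewrite (hdistC H); exact: NP.
exists z => //; apply/eqP; rewrite eq_sym -subr_eq0; apply/eqP/(hnorm_eq0 H).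
apply/eqP; rewrite eq_le hnorm_ge0 andbT; apply/ler_addgt0Pr => e e0; rewrite add0r; apply: ltW.
have [N1 NP1] := inv3X_lt (e := e / 2) ltac:(by rewrite divr_gt0).
have [N2 NP2] := zP (e / (2 * M)) ltac:(by rewrite divr_gt0// mulr_gt0).
have h1 := NP1 _ (leq_maxl N1 N2); have h2 := NP2 _ (leq_maxr N1 N2).
have [_ h3] := wP (maxn N1 N2).
apply: le_lt_trans (ler_hdist H _ (G (w (maxn N1 N2))) _) _.
rewrite -linearB'//; have h4 := GM (w (maxn N1 N2) - z).
have : M * norm (w (maxn N1 N2) - z) < e / 2.
  have -> : e / 2 = M * (e / (2 * M)) by field; rewrite gt_eqF.
  by rewrite ltr_pM2l.
lra.
Qed.

(** Half of the closed range theorem. The vectors [y] of the range with [|B y| <= 1] are pointwise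
    bounded as functionals on it, because [<A v, y> = <v, B y>]; uniform boundedness on the closed
    range, followed by rescaling, gives the constant. *)
Lemma adjoint_bounded_below A B : bounded_op dot A -> bounded_op dot B ->
  is_adjoint dot A B -> norm_closed dot (range A) ->
  exists2 c : R, 0 < c & forall y, range A y -> c * norm y <= norm (B y).
Proof.
move=> [lA bA] [lB bB] AB cA.
have sW := lsubspace_range lA.
have [||M MP] := @uniform_bound (range A) [set y | range A y /\ norm (B y) <= 1]
  sW cA.
- by move=> y [].
- move=> _ [v _ <-]; exists (norm v) => y [_ hy].
  rewrite AB (le_trans (norm_rdot_le H _ _))// -[X in _ <= X]mulr1.
  by rewrite ler_wpM2l ?hnorm_ge0.
pose N := `|M| + 1.
have N0 : 0 < N by rewrite ltr_wpDl.
have scal (t : R) y : 0 <= t -> range A y -> t * norm (B y) <= 1 -> t * norm y < N.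
  move=> t0 Ay h.
  have := MP (t%:C%C *: y); rewrite (hnormZr H) ger0_norm// => MP'.
  apply: le_lt_trans (MP' _) _.
    split; first exact: lsubspaceZ.
    by rewrite linearZ'// (hnormZr H) ger0_norm.
  by rewrite /N (le_lt_trans (ler_norm _))// ltrDl.
exists N^-1; first by rewrite invr_gt0.
move=> y Ay; rewrite mulrC ler_pdivrMr//.
(* If [B y = 0], every multiple of [y] obeys the constraint, and the multiple of norm [N]
   contradicts the bound. *)
have [/eqP B0|B0] := eqVneq (norm (B y)) 0.
  have [->|/(hnorm_gt0 H) y0] := pselect (y = 0).
    by rewrite (hnorm0 H) mulr_ge0 ?hnorm_ge0// ltW.
  have := scal (N / norm y) y (ltW (divr_gt0 N0 y0)) Ay.
  by rewrite (eqP B0) mulr0 ler01 divfK ?gt_eqF// ltxx => /(_ isT).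
have B1 : 0 < norm (B y) by rewrite lt_def B0 hnorm_ge0.
have := scal (norm (B y))^-1 y; rewrite invr_ge0 hnorm_ge0 mulVf// => h.
by have := h isT Ay (lexx _); rewrite mulrC ltr_pdivrMr// mulrC => /ltW.
Qed.

(** [C] maps the kernel of [A] onto that of [C A C]; antilinearity only conjugates the
    coefficients. *)
Lemma conj_has_dim C A d : (forall c u v, C (c *: u + v) = c^*%C *: C u + C v) ->
  involutive C -> has_dim (op_ker A) d -> has_dim (op_ker (C \o A \o C)) d.
Proof.
move=> lC CK [e [ie We]].
have C0 : C 0 = 0 by have := lC (-1) 0 0; rewrite rmorphN1 !scaleN1r !addNr.
have Csum (c : 'I_d -> R[i]) (f : 'I_d -> V) :
    C (\sum_i c i *: f i) = \sum_i (c i)^*%C *: C (f i).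
  apply: (big_ind2 (fun x y => C x = y)) => // [x1 x2 y1 y2 <- <-|i _].
    by have := lC 1 x1 y1; rewrite rmorph1 !scale1r.
  by have := lC (c i) (f i) 0; rewrite C0 !addr0.
exists (C \o e); split=> [c|].
  move/(congr1 C); rewrite Csum C0 => h i.
  apply: (can_inj (@conjcK R)); rewrite conjc0; move: i; apply: ie.
  by rewrite -[RHS]h; apply: eq_bigr => i _; rewrite /= CK.
apply/seteqP; split=> v.
  rewrite /op_ker/= => /(congr1 C); rewrite CK C0 => h.
  have : op_ker A (C v) by [].
  rewrite We => -[c /(congr1 C)]; rewrite CK Csum => ->.
  by exists (fun i => (c i)^*%C).
move=> [c ->]; rewrite /op_ker/= Csum.
suff -> : A (\sum_i (c i)^*%C *: C (C (e i))) = 0 by [].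
suff : op_ker A (\sum_i (c i)^*%C *: C (C (e i))) by [].
by rewrite We; exists (fun i => (c i)^*%C); apply: eq_bigr => i _; rewrite CK.
Qed.

Lemma conj_has_codim C A d : (forall c u v, C (c *: u + v) = c^*%C *: C u + C v) ->
  involutive C -> has_codim (range A) d -> has_codim (range (C \o A \o C)) d.
Proof.
move=> lC CK [e [ie We]].
have C0 : C 0 = 0 by have := lC (-1) 0 0; rewrite rmorphN1 !scaleN1r !addNr.
have Csum (c : 'I_d -> R[i]) (f : 'I_d -> V) :
    C (\sum_i c i *: f i) = \sum_i (c i)^*%C *: C (f i).
  apply: (big_ind2 (fun x y => C x = y)) => // [x1 x2 y1 y2 <- <-|i _].
    by have := lC 1 x1 y1; rewrite rmorph1 !scale1r.
  by have := lC (c i) (f i) 0; rewrite C0 !addr0.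
exists (C \o e); split=> [c [x _ /= hx] i|v].
  apply: (can_inj (@conjcK R)); rewrite conjc0; move: i; apply: ie.
  exists (C x) => //; rewrite -[LHS]CK hx Csum.
  by apply: eq_bigr => i _; rewrite /= CK.
have [c [x _ hx]] := We (C v).
exists (fun i => (c i)^*%C); exists (C x) => //=.
rewrite CK hx addrC -scaleN1r lC rmorphN1 scaleN1r CK addrC Csum; congr (_ - _).
Qed.

(** Put [D = C A C] and [K = D - B]. On a subspace [X] of finite codimension [K] is at most half the
    lower bound [c] of [B] on the range of [A]. With [Px] the projection onto [X], the operator
    [G = B + K Px] agrees with [D] on [X], while its kernel and cokernel have the dimensions of
    those of the adjoint [B], namely [d1] and [d0]. The finite perturbation lemma then reads
    [d0 + d0 = d1 + d1]. *)
Theorem index_eq0 C A B :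
  (forall c u v, C (c *: u + v) = c^*%C *: C u + C v) -> involutive C ->
  fredholm dot A -> bounded_op dot B -> is_adjoint dot A B ->
  compact_op (C \o A \o C - B) -> fredholm_index A = 0.
Proof.
move=> lC CK [bA cA [d0 hd0] [d1 hd1]] bB AB cK.
have lA := bA.1; have lB := bB.1; have sW := lsubspace_range lA.
rewrite /fredholm_index (dimensionE hd0) (codimensionE sW hd1).
suff -> : d0 = d1 by rewrite subrr.
pose D := C \o A \o C; pose K := D - B.
have lD : linear D.
  by move=> c u v; rewrite /D/= lC lA lC conjcK.
have lK : linear K.
  move=> c u v; rewrite -![K _]/(D _ - B _) lD lB scalerBr.
  by rewrite opprD addrACA.
have [c c0 Bc] := adjoint_bounded_below bA bB AB cA.
have c2 : 0 < c / 2 by rewrite divr_gt0.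
have [ws wsP] := cK _ c2.
have [P [lP WP oP PW _]] := projector sW cA.
have [e [ie We]] := hd1.
(* Representatives of the cokernel, made orthogonal to the range of [A]; they form a basis of the
   kernel of [B]. *)
pose f i := e i - P (e i).
have fsum (a : 'I_d1 -> R[i]) :
    \sum_i a i *: f i = \sum_i a i *: e i - P (\sum_i a i *: e i).
  rewrite linear_sum'// -sumrB; apply: eq_bigr => i _; exact: scalerBr.
have oW := lsubspace_orth H (range A).
have fspan v : orth dot (range A) v -> exists a, v = \sum_i a i *: f i.
  move=> ov; have [a ha] := We v; exists a.
  have Pv : P v = 0.
    apply: (dot_eq0 H); have := oP v _ (WP v).
    by rewrite (dotBl H) ov// sub0r => /eqP; rewrite oppr_eq0 => /eqP ->.
  by have := PW _ ha; rewrite fsum linearB'// Pv sub0r => ->; rewrite [RHS]addrC subrK.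
(* Adding the [f i] to the tests puts [X] inside the range of [A], so that [K Px] vanishes on the
   kernel of [B] and does not disturb it. *)
pose s := ws ++ [seq f i | i <- enum 'I_d1].
pose X := orth dot [set w | w \in s].
have sX : lsubspace X := lsubspace_orth H _.
have cX : norm_closed dot X := closed_orth H (W := _).
have XW : X `<=` range A.
  move=> u Xu; suff /eqP : u - P u = 0.
    by rewrite subr_eq0 => /eqP ->; exact: WP.
  apply: (dot_eq0 H); have [a fa] := fspan _ (oP u).
  suff h : dot u (u - P u) = 0.
    by rewrite (dotBl H) h (dotC H) (oP u _ (WP u)) conjc0 subr0.
  rewrite fa; apply: (big_ind (fun x => dot u x = 0)); first exact: dot0r.
    by move=> x y hx hy; rewrite (dotDr H) hx hy addr0.
  move=> i _; rewrite (dotZr H) Xu ?mulr0//= mem_cat; apply/orP; right.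
  by apply/mapP; exists i => //; rewrite mem_enum.
have [Px [lPx XPx oPx PxX Px1]] := projector sX cX.
pose E := K \o Px.
have lE : linear E by move=> a u v; rewrite /E/= lPx lK.
have Ec v : norm (E v) <= c / 2 * norm v.
  rewrite /E/= (le_trans (wsP _ _))//; last by rewrite ler_wpM2l// ltW.
  by move=> w hw; apply: (XPx v); rewrite /= mem_cat hw.
have E0 v : orth dot (range A) v -> E v = 0.
  move=> ov; suff -> : E v = K 0 by rewrite linear0'.
  congr K; apply: (dot_eq0 H); have := oPx v _ (XPx v).
  rewrite (dotBl H) ov; last exact/XW/XPx.
  rewrite sub0r => /eqP; rewrite oppr_eq0 => /eqP. by move=> ->.
have B0 v : orth dot (range A) v -> B v = 0.
  by move=> ov; apply: (dot_eq0 H); rewrite -AB (dotC H) ov// conjc0.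
pose G v := B v + E v.
have lG : linear G.
  move=> a u v; by rewrite /G lB (lE a u v) (scalerDr a (B u) (E u)) addrACA.
have Gle w : range A w -> c / 2 * norm w <= norm (G w).
  move=> Ww; have := Bc _ Ww; have := Ec w.
  have := ler_hnormB H (G w) (E w); rewrite /G addrK; lra.
have GP v : G (P v) = G v.
  rewrite -[in RHS](subrK (P v) v) linearD'//.
  by rewrite {2}/G (B0 _ (oP v)) (E0 _ (oP v)) addr0 add0r.
have hG0 : has_dim (op_ker G) d1.
  exists f; split=> [a|].
    rewrite fsum => /eqP; rewrite subr_eq0 => /eqP h; apply: ie.
    by rewrite h; exact: WP.
  apply/seteqP; split=> [v Gv|v [a ->]].
    apply: fspan; suff <- : v - P v = v by exact: oP.
    suff -> : P v = 0 by rewrite subr0.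
    apply: (hnorm_eq0 H); apply/eqP; rewrite eq_le hnorm_ge0 andbT.
    have := Gle _ (WP v); rewrite GP Gv (hnorm0 H).
    by rewrite pmulr_rle0.
  have ov : orth dot (range A) (\sum_i a i *: f i).
    by apply: lsubspace_sum => // i; exact: oP.
  by rewrite /op_ker/= /G B0// E0// addr0.
have bBM := bounded_opP bB.
have cY : norm_closed dot (B @` range A) := closed_image sW cA bB c0 Bc.
have sY : lsubspace (B @` range A) by exact: lsubspace_image.
(* [Q] projects onto the range of [B], which is closed with orthogonal complement the kernel of [A].
   The cokernel of [G] is found by showing that [Q G] is still onto that range. *)
have [Q [lQ YQ oQ QY Q1]] := projector sY cY.
have YB v : (B @` range A) (B v).
  exists (P v) => //; rewrite -[in RHS](subrK (P v) v) linearD'//.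
  by rewrite (B0 _ (oP v)) add0r.
have kerA v : orth dot (B @` range A) v <-> A v = 0.
  split=> [ov|Av _ [w _ <-]]; last by rewrite -AB Av dot0l.
  by apply: (dot_eq0 H); rewrite AB ov.
have Q0 v : orth dot (B @` range A) v <-> Q v = 0.
  split=> [ov|Qv]; last by have := oQ v; rewrite Qv subr0.
  apply: (dot_eq0 H); have := oQ v _ (YQ v).
  by rewrite (dotBl H) ov// sub0r => /eqP; rewrite oppr_eq0 => /eqP ->.
have QGle w : range A w -> c / 2 * norm w <= norm ((Q \o G) w).
  move=> Ww; have := Bc _ Ww; have := Ec w; have := Q1 (E w).
  have := ler_hnormB H (Q (G w)) (Q (E w)).
  rewrite /= {2}/G linearD'// addrK (QY _ (YB w)); lra.
have bK : bounded_op dot E.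
  by split=> //; exists (c / 2).
have bG : bounded_op dot G.
  by have := bounded_add H bB bK.
have bQ : bounded_op dot Q.
  by split=> //; exists 1 => v; rewrite mul1r.
have cZ : norm_closed dot ((Q \o G) @` range A).
  exact: closed_image sW cA (bounded_comp bQ bG) c2 QGle.
have sZ : lsubspace ((Q \o G) @` range A).
  by apply: lsubspace_image => // a u v /=; rewrite lG lQ.
(* A residual [B w] orthogonal to the image of [Q G] is tested against [Q (G w)]: this gives
   [<B w, B w + E w> = 0], hence [|B w| <= |E w| <= |B w| / 2] unless [B w = 0]. *)
have QGsurj v : exists2 w, range A w & Q (G w) = Q v.
  suff [w Ww <-] : ((Q \o G) @` range A) (Q v) by exists w.
  have [p Zp op] := projection_exists H (Q v) sZ cZ.
  suff -> : Q v = p by [].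
  have Yp : (B @` range A) p by have [w _ <-] := Zp; exact: YQ.
  apply/eqP; rewrite -subr_eq0.
  have [w Ww hw] := lsubspaceB sY (YQ v) Yp.
  rewrite -hw; rewrite -hw in op.
  have := op (Q (G w)) (ex_intro2 _ _ w Ww erefl).
  have oQG : dot (B w) (G w - Q (G w)) = 0.
    by rewrite (dotC H) oQ ?conjc0//; exists w.
  have w0 : dot (B w) (G w) = 0.
    by rewrite -(subrK (Q (G w)) (G w)) (dotDr H) oQG add0r; apply: op; exists w.
  have : norm (B w) ^+ 2 <= norm (B w) * norm (E w).
    move: (w0); rewrite /G (dotDr H) => /(congr1 (@complex.Re R)).
    rewrite ReD -(hnormE H)/=.
    have := norm_rdot_le H (B w) (E w); rewrite ler_norml => /andP[]; lra.
  have := Bc _ Ww; have := Ec w; have := hnorm_ge0 dot w; have := hnorm_ge0 dot (B w).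
  move=> h1 h2 h3 h4 h5.
  suff h : norm (B w) = 0 by rewrite (hnorm_eq0 H h).
  have h6 : norm (B w) * norm (E w) <= norm (B w) * (norm (B w) / 2).
    by rewrite ler_wpM2l//; lra.
  apply/eqP; rewrite -sqrf_eq0 eq_le sqr_ge0 andbT; lra.
have hGc : has_codim (range G) d0.
  have [e0 [ie0 We0]] := hd0.
  have ke0 (a : 'I_d0 -> R[i]) : A (\sum_i a i *: e0 i) = 0.
    suff : op_ker A (\sum_i a i *: e0 i) by [].
    by rewrite We0; exists a.
  exists e0; split=> [a [v _ hv]|v].
    apply: ie0; rewrite -hv -GP.
    have : Q (G (P v)) = 0 by apply/Q0/kerA; rewrite GP hv.
    move=> QG; have := QGle _ (WP v); rewrite /= QG (hnorm0 H) pmulr_rle0// => h.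
    have /(hnorm_eq0 H) -> : norm (P v) = 0.
      by apply/eqP; rewrite eq_le h hnorm_ge0.
    exact: linear0'.
  have [w Ww hw] := QGsurj v.
  have : op_ker A (v - G w).
    by apply/kerA/Q0; rewrite linearB'// hw subrr.
  rewrite We0 => -[a ha]; exists a; exists w => //.
  by rewrite -ha opprB addrC subrK.
have DG v : (forall i : 'I_(size s), dot v (nth 0 s i) = 0) -> D v = G v.
  move=> hv; have Xv : X v.
    move=> w ws'; have lt := index_mem w s; rewrite ws' in lt.
    by have := hv (Ordinal lt); rewrite /= nth_index.
  rewrite /G /E /= PxX// -[K v]/(D v - B v).
  by rewrite addrC subrK.
have := index_finite_perturbation (phi := fun i v => dot v (nth 0 s (nat_of_ord i)))
  lD lG (fun i c u v => dot_linear H c u v _) DG (conj_has_dim lC CK hd0)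
  (conj_has_codim lC CK hd1) hG0 hGc.
lia.
Qed.

End Fredholm.

(** * Homogeneous harmonic polynomials *)

Section HomogeneousPolynomials.
Context {R : realType} {n : nat}.
Local Notation E := 'rV[R]_n.
Local Notation basis i := (delta_mx ord0 i : 'rV[R]_n).
Implicit Types (f g : E -> R).

Definition nsq (x : E) : R := \sum_i x ord0 i ^+ 2.

(** Homogeneous polynomials of degree [m], as functions. The decomposition [sum x_i g_i] is not
    unique, but every property needed is proved by induction on it, without multi-indices. *)
Fixpoint homp (m : nat) (f : E -> R) : Prop :=
  if m is m'.+1 then
    exists2 g : 'I_n -> E -> R, (forall i, homp m' (g i)) &
      f = (fun x : E => \sum_i x ord0 i * g i x)
  else exists c : R, f = (fun=> c).

Lemma homSP m f : homp m.+1 f -> exists2 g : 'I_n -> E -> R,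
  (forall i, homp m (g i)) & f = (fun x : E => \sum_i x ord0 i * g i x).
Proof. by []. Qed.

Lemma hom_lin m (a b : R) f g : homp m f -> homp m g ->
  homp m (fun x : E => a * f x + b * g x).
Proof.
elim: m f g => [|m IH] f g /=.
  by move=> [c ->] [d ->]; exists (a * c + b * d).
move=> [f' hf ->] [g' hg ->]; exists (fun i (x : E) => a * f' i x + b * g' i x).
  by move=> i; exact: IH.
apply/funext => x; rewrite !mulr_sumr -big_split; apply: eq_bigr => i _ /=; ring.
Qed.

Lemma hom_eq m f g : f =1 g -> homp m f -> homp m g.
Proof. by move=> /funext ->. Qed.

Lemma hom0 m : homp m (fun=> 0).
Proof.
elim: m => [|m IH] /=; first by exists 0.
by exists (fun=> fun=> 0) => //; apply/funext => x; rewrite big1// => i _; rewrite mulr0.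
Qed.

Lemma homD m f g : homp m f -> homp m g -> homp m (fun x : E => f x + g x).
Proof.
by move=> hf hg; apply: hom_eq (hom_lin 1 1 hf hg) => x; rewrite !mul1r.
Qed.

Lemma homZ m (a : R) f : homp m f -> homp m (fun x : E => a * f x).
Proof.
by move=> hf; apply: hom_eq (hom_lin a 0 hf hf) => x; rewrite mul0r addr0.
Qed.

Lemma homB m f g : homp m f -> homp m g -> homp m (fun x : E => f x - g x).
Proof.
by move=> hf hg; apply: hom_eq (hom_lin 1 (-1) hf hg) => x; rewrite mul1r mulN1r.
Qed.

Lemma hom_sum m (I : Type) (r : seq I) (P : pred I) (F : I -> E -> R) :
  (forall i, P i -> homp m (F i)) -> homp m (fun x : E => \sum_(i <- r | P i) F i x).
Proof.
move=> hF; elim: r => [|a r IH].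
  by apply: hom_eq (hom0 m) => x; rewrite big_nil.
have [Pa|nPa] := boolP (P a).
  by apply: hom_eq (homD (hF _ Pa) IH) => x; rewrite big_cons Pa.
by apply: hom_eq IH => x; rewrite big_cons (negbTE nPa).
Qed.

Lemma hom_mulX m i f : homp m f -> homp m.+1 (fun x : E => x ord0 i * f x).
Proof.
move=> hf; exists (fun j => if j == i then f else fun=> 0).
  by move=> j; case: eqP => _ //; exact: hom0.
apply/funext => x; rewrite (bigD1 i)//= eqxx big1 ?addr0// => j /negbTE ->.
by rewrite mulr0.
Qed.

Lemma homX i : homp 1 (fun x : E => x ord0 i).
Proof.
by apply: hom_eq (hom_mulX i (_ : homp 0 (fun=> 1))) => [x|]; [rewrite mulr1|exists 1].
Qed.

Lemma hom_mul m l f g : homp m f -> homp l g -> homp (m + l) (fun x : E => f x * g x).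
Proof.
elim: m f => [|m IH] f /=; first by move=> [c ->] hg; exact: homZ.
move=> [f' hf ->] hg; exists (fun i (x : E) => f' i x * g x).
  by move=> i; exact: IH.
by apply/funext => x; rewrite mulr_suml; apply: eq_bigr => i _; rewrite mulrA.
Qed.

Lemma is_derive_coord (x v : E) i : is_derive x v (fun y : E => y ord0 i : R) (v ord0 i).
Proof.
have : (fun h : R => h^-1 *: ((h *: v + x) ord0 i - x ord0 i) : R) @ 0^'
    --> (v ord0 i : R).
  apply: cvg_near_cst; near=> h; rewrite !mxE addrK /GRing.scale/= mulrA mulVf ?mul1r//.
  by near: h; exact: nbhs_dnbhs_neq.
move=> h; apply: DeriveDef; first by apply/cvg_ex; exists (v ord0 i).
exact/cvg_lim.
Unshelve. all: by end_near. Qed.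

Lemma is_derive_bigsum (I : Type) (r : seq I) (F : I -> E -> R) (dF : I -> R) (x v : E) :
  (forall i, is_derive x v (F i) (dF i)) ->
  is_derive x v (fun y => \sum_(i <- r) F i y) (\sum_(i <- r) dF i).
Proof.
move=> h; elim: r => [|a r IH].
  rewrite big_nil (_ : (fun y => _) = cst 0); first exact: is_derive_cst.
  by apply/funext => y; rewrite big_nil.
rewrite big_cons (_ : (fun y => _) = F a + (fun y => \sum_(i <- r) F i y)).
  exact: is_deriveD.
by apply/funext => y; rewrite big_cons.
Qed.

Lemma is_derive_mul f g (x v : E) df dg :
  is_derive x v f df -> is_derive x v g dg ->
  is_derive x v (fun y => f y * g y) (df * g x + f x * dg).
Proof.
move=> hf hg; have := is_deriveM hf hg; rewrite /GRing.scale/= => h.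
by apply: is_derive_eq h _; rewrite addrC; congr (_ + _); rewrite mulrC.
Qed.

Lemma is_derive_partial f i x df : is_derive x (basis i) f df -> partial i f x = df.
Proof. by move=> h; rewrite /partial derive_val. Qed.

Lemma partial_cst (c : R) i : partial i (fun=> c : R) = (fun=> 0) :> (E -> R).
Proof. by apply/funext => x; rewrite /partial derive_cst. Qed.

(* Unification would otherwise unfold derivatives down to limits. *)
Local Opaque partial.

Lemma hom_is_derive m f : homp m f ->
  forall i x, is_derive x (basis i) f (partial i f x).
Proof.
elim: m f => [|m IH] f /=.
  by move=> [c ->] i x; apply: is_derive_eq; rewrite partial_cst.
move=> /homSP[g hg ->] i x.
have hd : is_derive x (basis i) (fun x : E => \sum_i x ord0 i * g i x)
    (\sum_k ((basis i) ord0 k * g k x + x ord0 k * partial i (g k) x)).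
  apply: is_derive_bigsum => k; apply: is_derive_mul; last exact: IH.
  exact: is_derive_coord.
by rewrite (is_derive_partial hd).
Qed.

Lemma hom_derivable m f i x : homp m f -> derivable f x (basis i).
Proof. by move=> /hom_is_derive/(_ i x)[]. Qed.

Lemma partial_step m (g : 'I_n -> E -> R) i : (forall k, homp m (g k)) ->
  partial i (fun x : E => \sum_k x ord0 k * g k x) =
  (fun x : E => g i x + \sum_k x ord0 k * partial i (g k) x).
Proof.
move=> hg; apply/funext => x.
have hd : is_derive x (basis i) (fun x : E => \sum_i x ord0 i * g i x)
    (\sum_k ((basis i) ord0 k * g k x + x ord0 k * partial i (g k) x)).
  apply: is_derive_bigsum => k; apply: is_derive_mul; last exact: hom_is_derive.
  exact: is_derive_coord.
rewrite (is_derive_partial hd) big_split; congr (_ + _).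
rewrite (bigD1 i)//= mxE !eqxx mul1r big1 ?addr0// => k ki.
by rewrite mxE eqxx (negbTE ki) mul0r.
Qed.

Lemma partial_mul m l f g i : homp m f -> homp l g ->
  partial i (fun x : E => f x * g x) = (fun x : E => partial i f x * g x + f x * partial i g x).
Proof.
move=> hf hg; apply/funext => x; apply: is_derive_partial.
by apply: is_derive_mul; [exact: hom_is_derive hf _ _|exact: hom_is_derive hg _ _].
Qed.

Lemma partial_lin m l (a b : R) f g i : homp m f -> homp l g ->
  partial i (fun x : E => a * f x + b * g x) =
  (fun x : E => a * partial i f x + b * partial i g x).
Proof.
move=> hf hg; apply/funext => x.
by have [_ ->] := partialD a b (hom_derivable (i:=i) (x:=x) hf) (hom_derivable (i:=i) (x:=x) hg).
Qed.

Lemma partial_add m l f g i x : homp m f -> homp l g ->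
  partial i (fun x : E => f x + g x) x = partial i f x + partial i g x.
Proof.
move=> hf hg; apply: is_derive_partial.
exact: is_deriveD (hom_is_derive hf _ _) (hom_is_derive hg _ _).
Qed.

Lemma partialZ m (a : R) f i : homp m f ->
  partial i (fun x : E => a * f x) = (fun x : E => a * partial i f x).
Proof.
move=> hf; have := partial_lin a 0 i hf hf.
by under eq_fun do rewrite mul0r addr0; move=> ->; apply/funext => x; rewrite mul0r addr0.
Qed.

Lemma partialX i k : partial i (fun x : E => x ord0 k) = (fun=> (k == i)%:R) :> (E -> R).
Proof.
apply/funext => x; rewrite (is_derive_partial (is_derive_coord _ _ k)) mxE eqxx.
by [].
Qed.

Lemma partial_sum m (I : Type) (r : seq I) (F : I -> E -> R) i :
  (forall k, homp m (F k)) ->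
  partial i (fun x : E => \sum_(k <- r) F k x) = (fun x : E => \sum_(k <- r) partial i (F k) x).
Proof.
move=> hF; apply/funext => x; apply: is_derive_partial.
by apply: is_derive_bigsum => k; exact: hom_is_derive (hF k) _ _.
Qed.

(** The truncated predecessor is harmless: in degree 0 the derivative is zero, which is homogeneous
    of degree 0 as well. *)
Lemma hom_partial m f i : homp m f -> homp m.-1 (partial i f).
Proof.
elim: m f => [|m IH] f /=; first by move=> [c ->]; exists 0; rewrite partial_cst.
move=> /homSP[g hg ->]; rewrite (partial_step _ hg); apply: homD => //.
case: m IH hg => [|m] IH hg.
  apply: hom_eq (hom0 0) => x; rewrite big1// => k _.
  by have [c ->] := hg k; rewrite partial_cst mulr0.
by apply: hom_sum => k _; apply: hom_mulX; exact: IH.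
Qed.

Lemma partialC m f i j : homp m f -> partial i (partial j f) = partial j (partial i f).
Proof.
elim: m f => [|m IH] f; first by move=> [c ->]; rewrite !partial_cst.
move=> /homSP[g hg ->]; rewrite !(partial_step _ hg).
have step i' j' : partial i' (fun x : E => g j' x + \sum_k x ord0 k * partial j' (g k) x) =
  (fun x : E => partial i' (g j') x + (partial j' (g i') x +
     \sum_k x ord0 k * partial i' (partial j' (g k)) x)).
  pose G (x : E) := \sum_k x ord0 k * partial j' (g k) x.
  have h1 : homp m.-1.+1 G.
    by exists (fun k => partial j' (g k)) => // k; exact: hom_partial.
  have e1 := partial_lin 1 1 i' (hg j') h1.
  have e2 := partial_step i' (fun k => hom_partial j' (hg k)).
  transitivity (partial i' (fun x : E => 1 * g j' x + 1 * G x)).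
    by congr partial; apply/funext => x; rewrite !mul1r.
  by rewrite e1 /G e2; apply/funext => x; rewrite !mul1r.
transitivity (fun x : E => partial i (g j) x + (partial j (g i) x +
     \sum_k x ord0 k * partial i (partial j (g k)) x)); first exact: step.
apply/esym; transitivity (fun x : E => partial j (g i) x + (partial i (g j) x +
     \sum_k x ord0 k * partial j (partial i (g k)) x)); first exact: step.
apply/funext => x.
have e : \sum_k x ord0 k * partial j (partial i (g k)) x =
    \sum_k x ord0 k * partial i (partial j (g k)) x.
  apply: eq_bigr => k _.
  by have /(congr1 (fun h : E -> R => x ord0 k * h x)) h := IH _ (hg k); exact: esym h.
have e' := congr1 (fun s => partial i (g j) x + (partial j (g i) x + s)) e.
have e'' := etrans (addrCA (partial j (g i) x) (partial i (g j) x) _) e'.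

exact: e''.
Qed.

Lemma euler m f (x : E) : homp m f -> \sum_i x ord0 i * partial i f x = m%:R * f x.
Proof.
elim: m f => [|m IH] f.
  move=> [c ->]; rewrite mul0r big1// => i _.
  by rewrite partial_cst mulr0.
move=> /homSP[g hg ->]; rewrite -[m.+1]addn1 natrD mulrDl mul1r addrC.
under eq_bigr do rewrite (partial_step _ hg) mulrDr mulr_sumr.
rewrite big_split exchange_big mulr_sumr /=; congr (_ + _).
apply: eq_bigr => k _; rewrite mulrCA -IH// mulr_sumr.
by apply: eq_bigr => i _; rewrite mulrCA.
Qed.

Lemma hom_scale m f (t : R) (x : E) : homp m f -> f (t *: x) = t ^+ m * f x.
Proof.
elim: m f => [|m IH] f; first by move=> [c ->]; rewrite expr0 mul1r.
move=> /homSP[g hg ->]; rewrite mulr_sumr; apply: eq_bigr => i _.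
by rewrite (IH (g i))// mxE exprS; ring.
Qed.

Lemma hom_continuous m f : homp m f -> continuous f.
Proof.
elim: m f => [|m IH] f; first by move=> [c ->]; exact: cst_continuous.
move=> /homSP[g hg ->] x.
apply: (@continuous_big _ _ +%R 0 _ _ _ _ (fun i (x : E) => x ord0 i * g i x)).
  exact: add_continuous.
move=> i _ y; apply: (@continuousM _ _ (fun x : E => x ord0 i) (g i)).
  exact: coord_continuous.
exact: IH.
Qed.

Lemma hom_rotate m f (M : 'M[R]_n) : homp m f -> homp m (fun x : E => f (x *m M)).
Proof.
elim: m f => [|m IH] f; first by move=> [c ->]; exists c.
move=> /homSP[g hg ->]; apply: hom_sum => i _.
rewrite (_ : (fun x : E => _) = (fun x : E => \sum_k x ord0 k * (M k i * g i (x *m M)))).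
  by exists (fun k (x : E) => M k i * g i (x *m M)) => // k; apply/homZ/IH.
apply/funext => x; rewrite mxE mulr_suml; apply: eq_bigr => k _.
by rewrite mulrA.
Qed.

Lemma partial_rotate m f (M : 'M[R]_n) i : homp m f ->
  partial i (fun x : E => f (x *m M)) = (fun x : E => \sum_j M i j * partial j f (x *m M)).
Proof.
elim: m f => [|m IH] f.
  move=> [c ->]; rewrite partial_cst; apply/funext => x.
  by rewrite big1// => j _; rewrite partial_cst mulr0.
move=> /homSP[g hg ->].
have e1 : (fun x : E => \sum_i (x *m M) ord0 i * g i (x *m M)) =
    (fun x : E => \sum_l x ord0 l * \sum_k M l k * g k (x *m M)).
  apply/funext => x; under [RHS]eq_bigr do rewrite mulr_sumr.
  rewrite exchange_big; apply: eq_bigr => k _; rewrite mxE mulr_suml.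
  by apply: eq_bigr => l _; rewrite mulrA.
have hgM k : homp m (fun x : E => g k (x *m M)) by exact: hom_rotate.
have h1 l : partial i (fun x : E => \sum_k M l k * g k (x *m M)) =
    (fun x : E => \sum_k M l k * \sum_j M i j * partial j (g k) (x *m M)).
  rewrite (partial_sum _ _ (fun k => homZ (M l k) (hgM k))); apply/funext => x.
  by apply: eq_bigr => k _; rewrite (partialZ _ _ (hgM k)) (IH _ (hg k)).
rewrite e1 (@partial_step m (fun l (x : E) => \sum_k M l k * g k (x *m M))); last first.
  by move=> l; apply: hom_sum => k _; exact: homZ.
apply/funext => x; under [RHS]eq_bigr do rewrite (partial_step _ hg) mulrDr.
rewrite big_split; congr (_ + _).
transitivity (\sum_l x ord0 l * \sum_k M l k * \sum_j M i j * partial j (g k) (x *m M)).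
  by apply: eq_bigr => l _; rewrite h1.
under [RHS]eq_bigr do rewrite mulr_sumr.
rewrite [RHS]exchange_big /=.
transitivity (\sum_k (x *m M) ord0 k * \sum_j M i j * partial j (g k) (x *m M)).
  under eq_bigr do rewrite mulr_sumr.
  rewrite exchange_big; apply: eq_bigr => k _; rewrite mxE mulr_suml.
  by apply: eq_bigr => l _; rewrite mulrA.
apply: eq_bigr => k _; rewrite mulr_sumr; apply: eq_bigr => j _.
by rewrite mulrCA.
Qed.

Lemma hom_laplacian m f : homp m f -> homp m.-2 (laplacian f).
Proof. by move=> hf; apply: hom_sum => i _; do 2![apply: hom_partial]. Qed.

Lemma laplacian_lin m l (a b : R) f g : homp m f -> homp l g ->
  laplacian (fun x : E => a * f x + b * g x) =
  (fun x : E => a * laplacian f x + b * laplacian g x).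
Proof.
move=> hf hg; apply/funext => x; rewrite /laplacian 2!mulr_sumr -big_split.
apply: eq_bigr => i _; rewrite (partial_lin _ _ _ hf hg).
by rewrite (partial_lin _ _ _ (hom_partial i hf) (hom_partial i hg)).
Qed.

Lemma laplacian_rotate m f (M : 'M[R]_n) x : M *m M^T = 1%:M -> homp m f ->
  laplacian (fun x : E => f (x *m M)) x = laplacian f (x *m M).
Proof.
move=> oM hf; have oM' := mulmx1C oM; rewrite /laplacian.
transitivity (\sum_i \sum_j \sum_k M i j * M i k * partial k (partial j f) (x *m M)).
  apply: eq_bigr => i _; rewrite (partial_rotate _ _ hf).
  rewrite (@partial_sum m.-1); last first.
    by move=> j; apply/homZ/hom_rotate/hom_partial.
  apply: eq_bigr => j _; rewrite (@partialZ m.-1); last exact/hom_rotate/hom_partial.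
  rewrite (partial_rotate _ _ (hom_partial j hf)) mulr_sumr.
  by apply: eq_bigr => k _; rewrite mulrA.
rewrite exchange_big; apply: eq_bigr => j _; rewrite exchange_big /=.
rewrite (bigD1 j)//= [X in _ + X]big1 => [|k kj].
  rewrite addr0 -mulr_suml; suff -> : \sum_i M i j * M i j = 1 by rewrite mul1r.
  have /matrixP/(_ j j) := oM'; rewrite !mxE eqxx => h; apply: etrans h.
  by apply: eq_bigr => i _; rewrite mxE.
rewrite -mulr_suml; suff -> : \sum_i M i j * M i k = 0 by rewrite mul0r.
have /matrixP/(_ j k) := oM'; rewrite !mxE eq_sym (negbTE kj) => h; apply: etrans h.
by apply: eq_bigr => i _; rewrite mxE.
Qed.

Lemma laplacian_mul m l f g x : homp m f -> homp l g ->
  laplacian (fun x : E => f x * g x) x = laplacian f x * g x +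
    2 * \sum_i partial i f x * partial i g x + f x * laplacian g x.
Proof.
move=> hf hg; rewrite /laplacian mulr_suml mulr_sumr !mulr_sumr -!big_split.
apply: eq_bigr => i _ /=; have hf' := hom_partial i hf; have hg' := hom_partial i hg.
rewrite (partial_mul _ hf hg).
have e := partial_add i x (hom_mul hf' hg) (hom_mul hf hg').
have /(congr1 (fun h : E -> R => h x)) e1 := partial_mul i hf' hg.
have /(congr1 (fun h : E -> R => h x)) e2 := partial_mul i hf hg'.
have aux (a b c : R) : (a + b) + (b + c) = a + 2 * b + c by ring.
exact: etrans (etrans e (congr2 +%R e1 e2)) (aux _ _ _).
Qed.

Lemma hom_nsq : homp 2 nsq.
Proof.
rewrite /nsq; apply: hom_sum => i _; have := hom_mul (homX i) (homX i).
by apply: hom_eq => x; rewrite expr2.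
Qed.

Lemma partial_nsq i : partial i nsq = (fun x : E => 2 * x ord0 i).
Proof.
rewrite /nsq; under eq_fun do under eq_bigr do rewrite expr2.
rewrite (@partial_step 1); last exact: homX.
apply/funext => x; rewrite (bigD1 i)//= partialX eqxx mulr1 big1 => [|k /negbTE ki].
  by rewrite addr0; ring.
by rewrite partialX ki mulr0.
Qed.

Lemma laplacian_nsq x : laplacian nsq x = 2 * n%:R.
Proof.
rewrite /laplacian; under eq_bigr do rewrite partial_nsq (partialZ _ _ (homX _)) partialX eqxx mulr1.
by rewrite sumr_const card_ord mulr_natr.
Qed.

Lemma laplacian_nsq_mul m f x : homp m f -> laplacian (fun x : E => nsq x * f x) x =
  (2 * n%:R + 4 * m%:R) * f x + nsq x * laplacian f x.
Proof.
move=> hf; rewrite (laplacian_mul x hom_nsq hf) laplacian_nsq; congr (_ + _).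
under eq_bigr do rewrite partial_nsq -mulrA; rewrite -mulr_sumr (euler _ hf); ring.
Qed.

Lemma hom_nsqX j : homp j.*2 (fun x : E => nsq x ^+ j).
Proof.
elim: j => [|j IH]; first by exists 1; apply/funext => x; rewrite expr0.
rewrite doubleS -[j.*2.+2]/(2 + j.*2)%N; apply: hom_eq (hom_mul hom_nsq IH) => x.
by rewrite exprS.
Qed.

Lemma laplacian_nsqX_mul j m f x : homp m f ->
  laplacian (fun x : E => nsq x ^+ j.+1 * f x) x =
  2 * j.+1%:R * (2 * j%:R + 2 * m%:R + n%:R) * (nsq x ^+ j * f x) +
  nsq x ^+ j.+1 * laplacian f x.
Proof.
move=> hf; elim: j x => [|j IH] x.
  under eq_fun do rewrite expr1; rewrite (laplacian_nsq_mul _ hf) expr0 expr1; ring.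
have h := hom_mul (hom_nsqX j.+1) hf.
have -> : (fun x : E => nsq x ^+ j.+2 * f x) = (fun x : E => nsq x * (nsq x ^+ j.+1 * f x)).
  by apply/funext => y; rewrite exprS mulrA.
rewrite (laplacian_nsq_mul _ h) IH natrD -muln2 natrM !exprS.
rewrite -[j.+2]addn1 -[j.+1]addn1 !natrD; ring.
Qed.

Lemma predn2_lt m : (2 <= m)%N -> (m.-2 < m)%N.
Proof. by case: m => [|[|m]]. Qed.

Lemma predn2K m : (2 <= m)%N -> (2 + m.-2)%N = m.
Proof. by case: m => [|[|m]]. Qed.

(* Solves [laplacian (|x|^(2j+2) s) = |x|^(2j) g] by descending on the degree of
   [g]: the defect of the choice [s = g / c] has its degree lowered by two. *)
Lemma laplacian_nsqX_surj (n_ge1 : (1 <= n)%N) m : forall j g, homp m g ->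
  exists2 s, homp m s & forall x,
    nsq x ^+ j * g x = laplacian (fun x : E => nsq x ^+ j.+1 * s x) x.
Proof.
elim/ltn_ind: m => m IH j g hg.
pose c : R := 2 * j.+1%:R * (2 * j%:R + 2 * m%:R + n%:R).
have c0 : c != 0.
  rewrite gt_eqF//; apply: mulr_gt0; first by rewrite mulr_gt0 ?ltr0n.
  by rewrite ltr_wpDl ?ltr0n// addr_ge0 ?mulr_ge0.
have [m1|m1] := ltnP m 2.
  exists (fun x : E => c^-1 * g x) => [|x]; first exact: homZ.
  rewrite (laplacian_nsqX_mul _ _ (homZ _ hg)).
  have -> : laplacian (fun x : E => c^-1 * g x) x = 0.
    rewrite /laplacian big1// => i _; rewrite (partialZ _ _ hg).
    rewrite (partialZ _ _ (hom_partial i hg)).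
    have : homp 0 (partial i g) by case: m m1 hg {IH c c0} => [|[]]// _ /(hom_partial i).
    by move=> [d ->]; rewrite partial_cst mulr0.
  by rewrite mulr0 addr0 -/c (mulrCA _ c^-1) mulVKf.
(* For [s = g / c] the error is [|x|^(2j+2) (laplacian g) / c]; the induction hypothesis writes
   [|x|^(2j+2) (laplacian g)] as the Laplacian of [|x|^(2j+4) s'], whence the correction by
   [|x|^2 s' / c]. *)
have [s' hs' s'P] := IH _ (predn2_lt m1) j.+1 _ (hom_laplacian hg).
have hns : homp m (fun x : E => nsq x * s' x).
  by have h := hom_mul hom_nsq hs'; rewrite (predn2K m1) in h.
exists (fun x : E => c^-1 * g x + (- c^-1) * (nsq x * s' x)); first exact: hom_lin.
move=> x.
have e1 : (fun x : E => nsq x ^+ j.+1 * (c^-1 * g x + - c^-1 * (nsq x * s' x))) =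
   (fun x : E => c^-1 * (nsq x ^+ j.+1 * g x) + (- c^-1) * (nsq x ^+ j.+2 * s' x)).
  by apply/funext => y; rewrite [nsq y ^+ j.+2]exprSr; ring.
rewrite e1 (laplacian_lin _ _ (hom_mul (hom_nsqX _) hg) (hom_mul (hom_nsqX _) hs')).
rewrite -s'P (laplacian_nsqX_mul _ _ hg) -/c mulrDr mulKf//.
ring.
Qed.

Definition Harm (m : nat) (f : E -> R) : Prop := homp m f /\ forall x, laplacian f x = 0.

Lemma Harm_lin m (a b : R) f g : Harm m f -> Harm m g ->
  Harm m (fun x : E => a * f x + b * g x).
Proof.
move=> [hf lf] [hg lg]; split; first exact: hom_lin.
by move=> x; rewrite (laplacian_lin _ _ hf hg) lf lg !mulr0 addr0.
Qed.

Lemma Harm0 m : Harm m (fun=> 0).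
Proof.
split; first exact: hom0.
by move=> x; rewrite /laplacian big1// => i _; rewrite !partial_cst.
Qed.

Lemma HarmD m f g : Harm m f -> Harm m g -> Harm m (fun x : E => f x + g x).
Proof.
move=> hf hg; have := Harm_lin 1 1 hf hg.
by under eq_fun do rewrite !mul1r.
Qed.

Lemma HarmZ m (a : R) f : Harm m f -> Harm m (fun x : E => a * f x).
Proof.
move=> hf; have := Harm_lin a 0 hf hf.
by under eq_fun do rewrite mul0r addr0.
Qed.

Lemma Harm_sum m (I : Type) (r : seq I) (F : I -> E -> R) :
  (forall i, Harm m (F i)) -> Harm m (fun x : E => \sum_(i <- r) F i x).
Proof.
move=> hF; elim: r => [|a r IH].
  by rewrite (_ : (fun x : E => _) = fun=> 0); [exact: Harm0|apply/funext => x; rewrite big_nil].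
rewrite (_ : (fun x : E => _) = (fun x : E => F a x + \sum_(i <- r) F i x)).
  exact: HarmD (hF a) IH.
by apply/funext => x; rewrite big_cons.
Qed.

Lemma Harm_partial m f i : Harm m f -> Harm m.-1 (partial i f).
Proof.
move=> [hf lf]; split; first exact: hom_partial.
move=> x.
transitivity (partial i (laplacian f) x).
  rewrite (@partial_sum m.-2); last by move=> k; do 2![apply: hom_partial].
  apply: eq_bigr => k _; rewrite (partialC _ _ hf).
  by rewrite (partialC _ _ (hom_partial k hf)).
have -> : laplacian f = (fun=> 0) by apply/funext => y; rewrite lf.
by rewrite partial_cst.
Qed.

Lemma Harm_rotate m f (M : 'M[R]_n) : M *m M^T = 1%:M -> Harm m f ->
  Harm m (fun x : E => f (x *m M)).
Proof.
move=> oM [hf lf]; split; first exact: hom_rotate.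
by move=> x; rewrite (laplacian_rotate _ oM hf).
Qed.

Definition hpoly (f : E -> R) : Prop := exists N (h : nat -> E -> R),
  (forall m, Harm m (h m)) /\ f = (fun x : E => \sum_(m < N) h m x).

Lemma hpoly_lin (a b : R) f g : hpoly f -> hpoly g ->
  hpoly (fun x : E => a * f x + b * g x).
Proof.
move=> [N [h [hh ->]]] [N' [h' [hh' ->]]].
pose k m := (fun x : E => a * (if (m < N)%N then h m x else 0) +
                      b * (if (m < N')%N then h' m x else 0)).
exists (N + N')%N, k; split=> [m|].
  by apply: Harm_lin; [case: (m < N)%N|case: (m < N')%N] => //; exact: Harm0.
apply/funext => x.
have w (N0 N1 : nat) (h0 : nat -> E -> R) : (N0 <= N1)%N ->
    \sum_(m < N0) h0 m x = \sum_(m < N1) (if (m < N0)%N then h0 m x else 0).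
  by move=> le; rewrite (big_ord_widen N1 (fun m => h0 m x))// big_mkcond.
rewrite (w _ _ h (leq_addr N' N)) (w _ _ h' (leq_addl N N')) !mulr_sumr -big_split.
by apply: eq_bigr.
Qed.

Lemma Harm_hpoly m f : Harm m f -> hpoly f.
Proof.
move=> hf; exists m.+1, (fun k (x : E) => if k == m then f x else 0); split=> [k|].
  by case: eqP => [->//|_]; exact: Harm0.
apply/funext => x; rewrite (bigD1 ord_max)//= eqxx big1 ?addr0// => i.
by rewrite -val_eqE => /negbTE ->.
Qed.

Lemma hpoly0 : hpoly (fun=> 0).
Proof. exact: Harm_hpoly (Harm0 0). Qed.

Lemma hpolyD f g : hpoly f -> hpoly g -> hpoly (fun x : E => f x + g x).
Proof. by move=> hf hg; have := hpoly_lin 1 1 hf hg; under eq_fun do rewrite !mul1r. Qed.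

Lemma hpolyZ (a : R) f : hpoly f -> hpoly (fun x : E => a * f x).
Proof.
by move=> hf; have := hpoly_lin a 0 hf hf; under eq_fun do rewrite mul0r addr0.
Qed.

Lemma hpolyB f g : hpoly f -> hpoly g -> hpoly (fun x : E => f x - g x).
Proof.
by move=> hf hg; have := hpoly_lin 1 (-1) hf hg; under eq_fun do rewrite mul1r mulN1r.
Qed.

Lemma hpoly_sum (I : Type) (r : seq I) (F : I -> E -> R) :
  (forall i, hpoly (F i)) -> hpoly (fun x : E => \sum_(i <- r) F i x).
Proof.
move=> hF; elim: r => [|a r IH].
  by rewrite (_ : (fun x : E => _) = fun=> 0); [exact: hpoly0|apply/funext => x; rewrite big_nil].
rewrite (_ : (fun x : E => _) = (fun x : E => F a x + \sum_(i <- r) F i x)).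
  exact: hpolyD (hF a) IH.
by apply/funext => x; rewrite big_cons.
Qed.

Lemma hpoly_partial f i : hpoly f -> hpoly (partial i f).
Proof.
move=> [N [h [hh ->]]].
have -> : partial i (fun x : E => \sum_(m < N) h m x) =
    (fun x : E => \sum_(m < N) partial i (h m) x).
  apply/funext => x; apply: is_derive_partial; apply: is_derive_bigsum => m.
  exact: hom_is_derive (hh m).1 _ _.
by apply: hpoly_sum => m; apply: Harm_hpoly (Harm_partial i (hh m)).
Qed.

(** Choosing [s] with [laplacian (|x|^2 s) = laplacian f], the difference [f - |x|^2 s] is harmonic;
    on the sphere [|x|^2 s] equals [r s], and [s] has degree lower by two. *)
Lemma hom_sphere_hpoly (n_ge1 : (1 <= n)%N) (r : R) m f : homp m f ->
  exists2 h, hpoly h & forall x, nsq x = r -> f x = h x.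
Proof.
elim/ltn_ind: m f => m IH f hf.
have [m1|m1] := ltnP m 2.
  exists f => //; apply: (Harm_hpoly (m := m)); split=> // x.
  rewrite /laplacian big1// => i _.
  have : homp 0 (partial i f) by case: m m1 hf {IH} => [|[]]// _ /(hom_partial i).
  by move=> [d ->]; rewrite partial_cst.
have [s hs sP] := laplacian_nsqX_surj n_ge1 0 (hom_laplacian hf).
have [h' hh' h'P] := IH _ (predn2_lt m1) s hs.
have hns : homp m (fun x : E => nsq x * s x).
  by have h := hom_mul hom_nsq hs; rewrite (predn2K m1) in h.
exists (fun x : E => (f x - nsq x * s x) + r * h' x).
  apply: hpolyD; last exact: hpolyZ.
  apply: (Harm_hpoly (m := m)); split=> [|x]; first exact: homB.
  have := laplacian_lin 1 (-1) hf hns.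
  under eq_fun do rewrite mul1r mulN1r; move=> ->.
  rewrite mul1r mulN1r; have := sP x; rewrite expr0 mul1r => ->.
  exact: subrr.
by move=> x xr; rewrite -h'P// xr subrK.
Qed.

End HomogeneousPolynomials.

(** * Rotation invariant integration over the ball *)

Section BallIntegral.
Context {R : realType} {n : nat} (nu : probability (borel_rV R n) R).
Local Notation E := 'rV[R]_n.
Local Notation ball := (uball : set (borel_rV R n)).
Implicit Types (f g w : E -> R).

Lemma uball_nsq (x : E) : uball x <-> nsq x < 1.
Proof.
rewrite /uball/= /enorm -/(nsq x).
have n0 : 0 <= nsq x by apply: sumr_ge0 => i _; exact: sqr_ge0.
by rewrite -{1}[1]sqrtr1 ltr_sqrt.
Qed.

Lemma continuous_measurable f :
  (forall x, uball x -> {for x, continuous f}) -> measurable_fun ball f.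
Proof.
move=> cf; apply: (measurability _ (RGenOInfty.measurableE R)).
move=> _ [_ [a ->] <-]; apply: sub_sigma_algebra; rewrite preimage_itvoy.
suff : open (uball `&` [set x | a < f x] : set E) by [].
rewrite openE => x [Bx fx].
apply: filterI; first exact: open_nbhs_nbhs (conj (@open_uball R n) Bx).
have oa : open_nbhs (f x) [set r | a < r] by split=> //; exact: open_gt.
exact: (cf x Bx _ (open_nbhs_nbhs oa)).
Qed.

(** Boundedness makes integrability automatic for a probability measure and keeps the class closed
    under products. *)
Definition bmeas f : Prop :=
  measurable_fun ball f /\ exists M : R, forall x, uball x -> `|f x| <= M.

Lemma bmeas_integrable f : bmeas f -> nu.-integrable ball (EFin \o f).
Proof.
move=> [mf [M hM]]; apply: measurable_bounded_integrable => //.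
- exact: measurable_uball.
- by rewrite (le_lt_trans (probability_le1 _ _)) ?ltry//; exact: measurable_uball.
- exists M; split; first exact: num_real.
  by move=> y My x Bx; exact: le_trans (hM x Bx) (ltW My).
Qed.

Lemma bmeas_cst (c : R) : bmeas (fun=> c).
Proof. by split; [exact: measurable_cst|exists `|c|]. Qed.

Lemma bmeasD f g : bmeas f -> bmeas g -> bmeas (fun x => f x + g x).
Proof.
move=> [mf [M hM]] [mg [N hN]]; split; first exact: measurable_funD.
exists (M + N) => x Bx; rewrite (le_trans (ler_normD _ _))// lerD//; [exact: hM|exact: hN].
Qed.

Lemma bmeasM f g : bmeas f -> bmeas g -> bmeas (fun x => f x * g x).
Proof.
move=> [mf [M hM]] [mg [N hN]]; split; first exact: measurable_funM.
by exists (M * N) => x Bx; rewrite normrM ler_pM//; [exact: hM|exact: hN].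
Qed.

Lemma bmeasZ (a : R) f : bmeas f -> bmeas (fun x => a * f x).
Proof. by apply: bmeasM; exact: bmeas_cst. Qed.

Lemma bmeasB f g : bmeas f -> bmeas g -> bmeas (fun x => f x - g x).
Proof.
move=> bf bg; rewrite (_ : (fun x => _) = (fun x => f x + (-1) * g x)).
  by apply: bmeasD => //; exact: bmeasZ.
by apply/funext => x; rewrite mulN1r.
Qed.

Lemma bmeas_sum (I : Type) (r : seq I) (F : I -> E -> R) :
  (forall i, bmeas (F i)) -> bmeas (fun x => \sum_(i <- r) F i x).
Proof.
move=> hF; elim: r => [|a r IH].
  by rewrite (_ : (fun x => _) = fun=> 0); [exact: bmeas_cst|apply/funext => x; rewrite big_nil].
rewrite (_ : (fun x => _) = (fun x : E => F a x + \sum_(i <- r) F i x)).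
  exact: bmeasD (hF a) IH.
by apply/funext => x; rewrite big_cons.
Qed.

Definition bint f : R := \int[nu]_(x in ball) f x.

Lemma eq_bint f g : (forall x, uball x -> f x = g x) -> bint f = bint g.
Proof. by move=> h; apply: eq_Rintegral => x /set_mem /h. Qed.

Lemma bint_lin (a b : R) f g : bmeas f -> bmeas g ->
  bint (fun x => a * f x + b * g x) = a * bint f + b * bint g.
Proof.
move=> bf bg; have mB := @measurable_uball R n.
rewrite /bint RintegralD//; last 2 first.
- exact: bmeas_integrable (bmeasZ a bf).
- exact: bmeas_integrable (bmeasZ b bg).
by rewrite !RintegralZl//; exact: bmeas_integrable.
Qed.

Lemma bintZ (a : R) f : bmeas f -> bint (fun x => a * f x) = a * bint f.
Proof.
by move=> bf; rewrite /bint RintegralZl//; [exact: measurable_uball|exact: bmeas_integrable].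
Qed.

Lemma bintD f g : bmeas f -> bmeas g ->
  bint (fun x => f x + g x) = bint f + bint g.
Proof.
by move=> bf bg; rewrite /bint RintegralD//; [exact: measurable_uball|exact: bmeas_integrable..].
Qed.

Lemma bintB f g : bmeas f -> bmeas g ->
  bint (fun x => f x - g x) = bint f - bint g.
Proof.
by move=> bf bg; rewrite /bint RintegralB//; [exact: measurable_uball|exact: bmeas_integrable..].
Qed.

Lemma bint_sum (I : Type) (r : seq I) (F : I -> E -> R) : (forall i, bmeas (F i)) ->
  bint (fun x => \sum_(i <- r) F i x) = \sum_(i <- r) bint (F i).
Proof.
move=> hF; elim: r => [|a r IH].
  rewrite big_nil (_ : (fun x => _) = fun=> 0 * 0).
    by rewrite bintZ ?mul0r//; exact: bmeas_cst.
  by apply/funext => x; rewrite big_nil mul0r.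
rewrite big_cons -IH -bintD//; last exact: bmeas_sum.
by congr bint; apply/funext => x; rewrite big_cons.
Qed.

Lemma le_bint f g : bmeas f -> bmeas g -> (forall x, uball x -> f x <= g x) ->
  bint f <= bint g.
Proof.
by move=> bf bg h; apply: le_Rintegral => //; [exact: measurable_uball|exact: bmeas_integrable..].
Qed.

Lemma bint_ge0 f : (forall x, uball x -> 0 <= f x) -> 0 <= bint f.
Proof. by move=> h; apply: Rintegral_ge0. Qed.

Lemma bint_norm f : bmeas f -> `|bint f| <= bint (fun x => `|f x|).
Proof.
by move=> bf; apply: le_normr_Rintegral; [exact: measurable_uball|exact: bmeas_integrable].
Qed.

Lemma bmeas_norm f : bmeas f -> bmeas (fun x => `|f x|).
Proof.
move=> [mf [M hM]]; split; first exact: measurableT_comp.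
by exists M => x Bx; rewrite normr_id hM.
Qed.

Hypothesis nu_ball : nu uball = 1%E.

Lemma bint_cst (c : R) : bint (fun=> c) = c.
Proof.
rewrite /bint Rintegral_cst; last exact: measurable_uball.
by transitivity (c * fine (1%E : \bar R)); [congr (_ * fine _)|rewrite mulr1].
Qed.

Lemma bint_norm_le f (M : R) : bmeas f -> (forall x, uball x -> `|f x| <= M) ->
  `|bint f| <= M.
Proof.
move=> bf hM; rewrite (le_trans (bint_norm bf))// -[X in _ <= X]bint_cst.
by apply: le_bint => //; [exact: bmeas_norm|exact: bmeas_cst].
Qed.

Hypothesis nu_invariant : rotation_invariant nu.

Lemma nsq_rotate (M : 'M[R]_n) (x : E) : M *m M^T = 1%:M -> nsq (x *m M) = nsq x.
Proof.
move=> oM.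
have e (y : E) : nsq y = (y *m y^T) ord0 ord0.
  by rewrite mxE; apply: eq_bigr => i _; rewrite mxE expr2.
by rewrite !e trmx_mul -mulmxA (mulmxA M) oM mul1mx.
Qed.

Lemma uball_rotate (M : 'M[R]_n) (x : E) : M *m M^T = 1%:M -> uball (x *m M) <-> uball x.
Proof. by move=> oM; rewrite !uball_nsq nsq_rotate. Qed.

Lemma mulmx_continuous (M : 'M[R]_n) : continuous (fun x : E => x *m M).
Proof.
move=> x; apply/(@cvgrPdist_le _ _ _ (nbhs x) (nbhs_filter x)) => e e0.
have F : nbhs x (fun y : E => forall ij : 'I_1 * 'I_n,
    `|(x *m M) ij.1 ij.2 - (y *m M) ij.1 ij.2| <= e).
  apply: (@filter_forall _ _ _ (nbhs x) (nbhs_filter x)) => -[i j] /=.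
  rewrite (ord1 i).
  have c : continuous (fun y : E => (y *m M) ord0 j).
    exact: hom_continuous (hom_rotate M (homX j)).
  exact: (cvgrPdist_le _ _).1 (c x) e e0.
apply: (@filterS _ (nbhs x) (nbhs_filter x) _ _ _ F) => y hy.
rewrite /Num.Def.normr/= mx_normrE (bigmax_le _ (ltW e0))//= => i _.
by have := hy i; rewrite !mxE.
Qed.

Lemma mulmx_measurable (M : 'M[R]_n) :
  measurable_fun setT ((fun x : E => x *m M) : borel_rV R n -> borel_rV R n).
Proof.
move=> _ A; rewrite setTI; move: A.
apply: smallest_sub; last first.
  move=> A oA; apply: sub_sigma_algebra.
  by apply: open_comp => // x _; exact: mulmx_continuous.
split=> [|A mA|F mF].
- by rewrite /= preimage_set0; exact: measurable0.
- by rewrite /= setTD preimage_setC; exact: measurableC.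
- by rewrite /= preimage_bigcup; exact: bigcup_measurable.
Qed.

(** Change of variables: the push-forward of [nu] under the rotation is [nu], and the ball is its
    own preimage. *)
Lemma bint_rotate (M : 'M[R]_n) f : M *m M^T = 1%:M -> bmeas f ->
  bint (fun x => f (x *m M)) = bint f.
Proof.
move=> oM bf; rewrite /bint /Rintegral; congr fine.
pose rot := (fun x : E => x *m M) : borel_rV R n -> borel_rV R n.
pose g := EFin \o (f \_ (uball : set E)) : borel_rV R n -> \bar R.
have mB := @measurable_uball R n.
have mg : measurable_fun setT g.
  apply/measurable_EFinP; apply/(measurable_restrictT _ mB).
  by have [] := bf.
have preB : rot @^-1` ball = ball.
  by apply/seteqP; split=> x /=; rewrite /rot uball_rotate.
have e1 : (\int[nu]_(x in ball) (f (x *m M))%:E = \int[nu]_(x in ball) (g \o rot) x)%E.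
  apply: eq_integral => x /set_mem Bx; rewrite /g/= patchE mem_set//.
  by rewrite /rot uball_rotate.
have e2 : (\int[nu]_(x in ball) (f x)%:E = \int[nu]_(x in ball) g x)%E.
  by apply: eq_integral => x /set_mem Bx; rewrite /g/= patchE mem_set.
have ig : nu.-integrable (rot @^-1` ball) (g \o rot).
  rewrite preB; have [mf [K hK]] := bf.
  apply: (@measurable_bounded_integrable _ _ _ nu ((f \_ (uball : set E)) \o rot)) => //.
  - by rewrite (le_lt_trans (probability_le1 _ _)) ?ltry.
  - apply: measurable_funTS; apply: measurableT_comp; last exact: mulmx_measurable.
    exact/(measurable_restrictT _ mB).
  - exists K; split; first exact: num_real.
    move=> y Ky x Bx; rewrite /= patchE mem_set; last by rewrite /rot uball_rotate.
    by rewrite (le_trans (hK _ _))// ?ltW//; rewrite /rot uball_rotate.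
rewrite e1 e2 -[in LHS]preB -(integral_pushforward (mulmx_measurable M) mg ig mB).
apply: eq_measure_integral; first exact: mulmx_measurable.
by move=> mrot A mA _; exact: (nu_invariant oM mA).
Qed.

(** Rotation invariant densities, possibly signed. They are carried along because passing to
    gradients multiplies the density by [|x|^2], and because interior estimates use indicators of
    annuli. *)
Definition weight w : Prop :=
  bmeas w /\ forall (M : 'M[R]_n) x, M *m M^T = 1%:M -> w (x *m M) = w x.

Lemma weightM w w' : weight w -> weight w' -> weight (fun x => w x * w' x).
Proof.
move=> [bw iw] [bw' iw']; split; first exact: bmeasM.
by move=> M x oM; rewrite iw// iw'.
Qed.

Lemma weight_lin (a b : R) w w' : weight w -> weight w' ->
  weight (fun x => a * w x + b * w' x).
Proof.
move=> [bw iw] [bw' iw']; split; first by apply: bmeasD; exact: bmeasZ.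
by move=> M x oM; rewrite iw// iw'.
Qed.

Lemma coord_le (x : E) i : nsq x <= 1 -> `|x ord0 i| <= 1.
Proof.
move=> x1; rewrite -(@ler_pXn2r _ 2)// ?nnegrE// expr1n real_normK ?num_real//.
apply: le_trans x1; rewrite /nsq (bigD1 i)//= lerDl.
by apply: sumr_ge0 => j _; exact: sqr_ge0.
Qed.

Lemma hom_bounded m f : homp m f -> exists2 C : R, 0 < C &
  forall x, nsq x <= 1 -> `|f x| <= C.
Proof.
elim: m f => [|m IH] f.
  by move=> [c ->]; exists (`|c| + 1) => [|x _]; rewrite ?ltr_wpDl// lerDl.
move=> /homSP[g hg ->].
have /choice[C CP] : forall i, exists C : R, forall x, nsq x <= 1 -> `|g i x| <= C.
  by move=> i; have [C _ hC] := IH _ (hg i); exists C.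
exists (\sum_i `|C i| + 1) => [|x x1].
  by rewrite ltr_wpDl// sumr_ge0.
rewrite (le_trans (ler_norm_sum _ _ _))// (@le_trans _ _ (\sum_i `|C i|))//.
  apply: ler_sum => i _; rewrite normrM -[X in _ <= X]mul1r ler_pM//.
    exact: coord_le.
  by rewrite (le_trans (CP i x x1))// ler_norm.
by rewrite lerDl.
Qed.

Lemma hom_bmeas m f : homp m f -> bmeas f.
Proof.
move=> hf; split.
  by apply: continuous_measurable => x _; exact: hom_continuous hf x.
have [C _ hC] := hom_bounded hf; exists C => x /uball_nsq/ltW; exact: hC.
Qed.

Lemma weight_cst (c : R) : weight (fun=> c).
Proof. by split=> //; exact: bmeas_cst. Qed.

Lemma weight_nsq : weight nsq.
Proof.
split; first exact: hom_bmeas hom_nsq.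
by move=> M x oM; exact: nsq_rotate.
Qed.

Lemma weight_nsqX m : weight (fun x => nsq x ^+ m).
Proof.
split; first exact: hom_bmeas (hom_nsqX m).
by move=> M x oM; rewrite nsq_rotate.
Qed.

End BallIntegral.

(** * Reflections, rational plane rotations and angular derivatives *)

Section Moments.
Context {R : realType} {n : nat}.
Local Notation E := 'rV[R]_n.
Implicit Types (f g w : E -> R).

Lemma nsq_ge0 (x : E) : 0 <= nsq x.
Proof. by apply: sumr_ge0 => i _; exact: sqr_ge0. Qed.

Lemma nsq_mx (x : E) : x *m x^T = (nsq x)%:M.
Proof.
rewrite [LHS]mx11_scalar; congr (_%:M); rewrite mxE; apply: eq_bigr => i _.
by rewrite mxE expr2.
Qed.

Lemma nsq_eq0 (x : E) : nsq x = 0 -> x = 0.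
Proof.
move=> x0; apply/rowP => i; rewrite mxE; apply/eqP; rewrite -sqrf_eq0.
have /psumr_eq0P : \sum_i x ord0 i ^+ 2 = 0 by [].
by move=> ->// j _; exact: sqr_ge0.
Qed.

Definition reflection (v : E) : 'M[R]_n := 1%:M - (2 / nsq v) *: (v^T *m v).

Lemma reflection_orthogonal v : v != 0 -> reflection v *m (reflection v)^T = 1%:M.
Proof.
move=> v0; have q0 : nsq v != 0 by apply: contra v0 => /eqP/nsq_eq0 ->.
have -> : (reflection v)^T = reflection v.
  by rewrite /reflection linearB linearZ /= trmx1 trmx_mul trmxK.
rewrite /reflection; set V := v^T *m v; set c := 2 / nsq v.
have VV : V *m V = nsq v *: V.
  by rewrite /V mulmxA -(mulmxA v^T) nsq_mx mul_mx_scalar scalemxAl.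
have cc : c * (c * nsq v) = c + c by rewrite /c; field.
rewrite mulmxBl mul1mx mulmxBr mulmx1 -scalemxAl -scalemxAr VV !scalerA -mulrA cc.
rewrite scalerDl; set a := c *: V.
have -> : a - (a + a) = - a by rewrite opprD addrA subrr add0r.
by rewrite opprK subrK.
Qed.

Lemma reflectionE (v x : E) : x *m reflection v =
  x - ((2 / nsq v) * \sum_k x ord0 k * v ord0 k) *: v.
Proof.
rewrite /reflection mulmxBr mulmx1 -scalemxAr mulmxA.
have -> : x *m v^T = (\sum_k x ord0 k * v ord0 k)%:M.
  by rewrite [LHS]mx11_scalar; congr (_%:M); rewrite mxE; apply: eq_bigr => i _; rewrite mxE.
by rewrite mul_scalar_mx scalerA.
Qed.

(* By the reflection in the hyperplane bisecting [x] and [y]. *)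
Lemma rotation_transitive (x y : E) : nsq x = nsq y ->
  exists2 M : 'M[R]_n, M *m M^T = 1%:M & x *m M = y.
Proof.
move=> xy; have [->|xny] := eqVneq x y.
  by exists 1%:M; rewrite ?mulmx1// trmx1 mulmx1.
have v0 : x - y != 0 by rewrite subr_eq0.
exists (reflection (x - y)); first exact: reflection_orthogonal.
rewrite reflectionE; set s := \sum_k _.
have -> : nsq (x - y) = 2 * s.
  have -> : nsq (x - y) = nsq x + nsq y - 2 * \sum_k x ord0 k * y ord0 k.
    rewrite /nsq mulr_sumr -big_split -sumrB; apply: eq_bigr => k _ /=.
    by rewrite !mxE; ring.
  have -> : s = nsq x - \sum_k x ord0 k * y ord0 k.
    by rewrite /s /nsq -sumrB; apply: eq_bigr => k _; rewrite !mxE; ring.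
  by rewrite -xy; ring.
have s0 : s != 0.
  apply: contra v0 => /eqP s0; apply/eqP/nsq_eq0.
  have -> : nsq (x - y) = 2 * s.
    have -> : nsq (x - y) = nsq x + nsq y - 2 * \sum_k x ord0 k * y ord0 k.
      rewrite /nsq mulr_sumr -big_split -sumrB; apply: eq_bigr => k _ /=.
      by rewrite !mxE; ring.
    have -> : s = nsq x - \sum_k x ord0 k * y ord0 k.
      by rewrite /s /nsq -sumrB; apply: eq_bigr => k _; rewrite !mxE; ring.
    by rewrite -xy; ring.
  by rewrite s0 mulr0.
suff -> : 2 / (2 * s) * s = 1 by rewrite scale1r opprB addrC subrK.
by field.
Qed.

Section Plane.
Variables i j : 'I_n.
Hypothesis ij : i != j.

(** A product of two reflections is a rotation by twice the angle between their axes, here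
    [2 arctan t] in the plane of coordinates [i] and [j]. The parametrisation is rational in [t],
    and the doubled angle is the source of the factor 2 in [rotation_approx]. *)
Definition plane_rotation (t : R) : 'M[R]_n :=
  reflection (delta_mx ord0 i) *m reflection (delta_mx ord0 i + t *: delta_mx ord0 j).

Let pv t : E := delta_mx ord0 i + t *: delta_mx ord0 j.

Lemma pvE t k : pv t ord0 k = (k == i)%:R + t * (k == j)%:R.
Proof. by rewrite !mxE !eqxx. Qed.

Lemma sum_pv t (x : E) : \sum_k x ord0 k * pv t ord0 k = x ord0 i + t * x ord0 j.
Proof.
under eq_bigr do rewrite pvE mulrDr mulrCA.
rewrite big_split -mulr_sumr /= (bigD1 i)//= eqxx mulr1 big1 ?addr0; last first.
  by move=> k /negbTE ->; rewrite mulr0.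
rewrite (bigD1 j)//= eqxx mulr1 big1 ?addr0// => k /negbTE ->.
by rewrite mulr0.
Qed.

Lemma nsq_pv t : nsq (pv t) = 1 + t ^+ 2.
Proof.
rewrite /nsq; under eq_bigr do rewrite expr2.
rewrite sum_pv !pvE !eqxx [j == i]eq_sym (negbTE ij) /=; ring.
Qed.

Lemma pv_neq0 t : pv t != 0.
Proof.
apply/eqP => /(congr1 nsq); rewrite nsq_pv /nsq big1 => [|k _].
  by have := sqr_ge0 t; lra.
by rewrite mxE expr0n.
Qed.

Lemma plane_rotation_orthogonal t : plane_rotation t *m (plane_rotation t)^T = 1%:M.
Proof.
rewrite /plane_rotation trmx_mul mulmxA -(mulmxA (reflection (delta_mx ord0 i))).
rewrite (reflection_orthogonal (pv_neq0 t)) mulmx1 reflection_orthogonal//.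
by have := pv_neq0 0; rewrite /pv scale0r addr0.
Qed.

Lemma plane_rotationE t (x : E) k : (x *m plane_rotation t) ord0 k =
  x ord0 k - 2 * x ord0 i * (k == i)%:R -
  2 / (1 + t ^+ 2) * (t * x ord0 j - x ord0 i) * ((k == i)%:R + t * (k == j)%:R).
Proof.
have r1 k' : (x *m reflection (delta_mx ord0 i)) ord0 k' =
    x ord0 k' - 2 * x ord0 i * (k' == i)%:R.
  have -> : delta_mx ord0 i = pv 0 by rewrite /pv scale0r addr0.
  rewrite reflectionE nsq_pv sum_pv [LHS]mxE [X in _ + X]mxE [X in _ - X]mxE pvE.
  by rewrite !mul0r !addr0 expr0n addr0 divr1.
rewrite /plane_rotation mulmxA reflectionE -/(pv t) nsq_pv.
rewrite [LHS]mxE [X in _ + X]mxE [X in _ - X]mxE pvE r1; congr (_ - _ * _).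
congr (_ * _); under eq_bigr do rewrite r1 mulrBl.
rewrite sumrB sum_pv (bigD1 i)//= big1 => [|l /negbTE ->]; last first.
  by rewrite mulr0 mul0r.
by rewrite eqxx pvE eqxx (negbTE ij) /=; ring.
Qed.

Definition angular f (x : E) : R := x ord0 i * partial j f x - x ord0 j * partial i f x.

(** [Df] is the derivative of [f] along the rotation, with a remainder quadratic in [t] uniformly on
    the closed ball. In this form it is stable under sums and products and can be integrated
    directly. *)
Definition rotation_approx f Df : Prop := exists2 C : R, 0 <= C &
  forall t x, `|t| <= 1 -> nsq x <= 1 ->
    `|f (x *m plane_rotation t) - f x - 2 * t * Df x| <= C * t ^+ 2.

Definition ball_bounded f : Prop := exists2 C : R, 0 < C & forall x, nsq x <= 1 -> `|f x| <= C.

Lemma rotation_approxM f g Df Dg : ball_bounded f -> ball_bounded g ->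
  ball_bounded Df -> ball_bounded Dg ->
  rotation_approx f Df -> rotation_approx g Dg ->
  rotation_approx (fun x => f x * g x) (fun x => Df x * g x + f x * Dg x).
Proof.
move=> [A A0 hA] [B B0 hB] [A' A'0 hA'] [B' B'0 hB'] [C C0 hC] [D D0 hD].
exists (C * B + (A + 2 * A') * D + 4 * A' * B').
  by rewrite !addr_ge0// ?mulr_ge0// ?addr_ge0 ?mulr_ge0// ltW.
move=> t x t1 x1; set y := x *m _.
have y1 : nsq y <= 1 by rewrite nsq_rotate//; exact: plane_rotation_orthogonal.
have := hC t x t1 x1; have := hD t x t1 x1; rewrite -/y => h1 h2.
have -> : f y * g y - f x * g x - 2 * t * (Df x * g x + f x * Dg x) =
  (f y - f x - 2 * t * Df x) * g y + (f x + 2 * t * Df x) * (g y - g x - 2 * t * Dg x)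
  + 4 * t ^+ 2 * (Df x * Dg x) by ring.
have t2 : 0 <= t ^+ 2 by exact: sqr_ge0.
have -> : (C * B + (A + 2 * A') * D + 4 * A' * B') * t ^+ 2 =
  (C * t ^+ 2) * B + (A + 2 * A') * (D * t ^+ 2) + (4 * t ^+ 2) * (A' * B') by ring.
apply: le_trans (ler_normD _ _) _; apply: lerD; last first.
  have t4 : 0 <= 4 * t ^+ 2 by apply: mulr_ge0.
  rewrite normrM (ger0_norm t4); apply: ler_wpM2l => //.
  by rewrite normrM ler_pM ?hA' ?hB'.
apply: le_trans (ler_normD _ _) _; apply: lerD; rewrite normrM.
  by apply: ler_pM => //; exact: hB.
apply: ler_pM => //.
apply: le_trans (ler_normD _ _) _; apply: lerD; first exact: hA.
rewrite -mulrA normrM ger0_norm// ler_pM2l// normrM -[X in _ <= X]mul1r.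
by rewrite ler_pM ?hA'.
Qed.

Lemma rotation_approxD f g Df Dg :
  rotation_approx f Df -> rotation_approx g Dg ->
  rotation_approx (fun x => f x + g x) (fun x => Df x + Dg x).
Proof.
move=> [C C0 hC] [D D0 hD]; exists (C + D); first exact: addr_ge0.
move=> t x t1 x1; set y := x *m _.
have -> : f y + g y - (f x + g x) - 2 * t * (Df x + Dg x) =
  (f y - f x - 2 * t * Df x) + (g y - g x - 2 * t * Dg x) by ring.
by rewrite (le_trans (ler_normD _ _))// (mulrDl C) lerD ?hC ?hD.
Qed.

Lemma rotation_approx_cst (c : R) : rotation_approx (fun=> c) (fun=> 0).
Proof.
exists 0 => // t x _ _.
by rewrite mulr0 subr0 subrr normr0 mul0r.
Qed.

Lemma rotation_approx_sum (I : Type) (r : seq I) (F DF : I -> E -> R) :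
  (forall i, rotation_approx (F i) (DF i)) ->
  rotation_approx (fun x => \sum_(i <- r) F i x) (fun x => \sum_(i <- r) DF i x).
Proof.
move=> hF; elim: r => [|a r IH].
  rewrite (_ : (fun x => _) = fun=> 0); last by apply/funext => x; rewrite big_nil.
  rewrite [X in rotation_approx _ X](_ : _ = fun=> 0).
    exact: rotation_approx_cst.
  by apply/funext => x; rewrite big_nil.
have -> : (fun x => \sum_(i <- a :: r) F i x) =
    (fun x => F a x + \sum_(i <- r) F i x).
  by apply/funext => x; rewrite big_cons.
have -> : (fun x => \sum_(i <- a :: r) DF i x) =
    (fun x => DF a x + \sum_(i <- r) DF i x).
  by apply/funext => x; rewrite big_cons.
exact: rotation_approxD (hF a) IH.
Qed.

Lemma rotation_approx_coord k : rotation_approx (fun x => x ord0 k)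
  (fun x => x ord0 i * (k == j)%:R - x ord0 j * (k == i)%:R).
Proof.
exists 4 => // t x t1 x1; rewrite plane_rotationE.
have xi := coord_le i x1; have xj := coord_le j x1.
have t2 : 0 <= t ^+ 2 by exact: sqr_ge0.
have p0 : 0 < 1 + t ^+ 2 by lra.
have pn : 1 + t ^+ 2 != 0 by rewrite gt_eqF.
have key (a b : R) : `|a| <= 1 -> `|b| <= 1 ->
    `|2 * t ^+ 2 / (1 + t ^+ 2) * (a + t * b)| <= 4 * t ^+ 2.
  move=> a1 b1.
  have -> : 4 * t ^+ 2 = (2 * t ^+ 2) * 2 by ring.
  have t4 : 0 <= 2 * t ^+ 2 by apply: mulr_ge0.
  rewrite normrM; apply: ler_pM => //.
    rewrite (ger0_norm (divr_ge0 t4 (ltW p0))) ler_pdivrMr//.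
    by apply: ler_peMr => //; rewrite lerDl.
  apply: le_trans (ler_normD _ _) _; rewrite -[2]/(1 + 1) lerD// normrM.
  by rewrite -[X in _ <= X]mul1r; apply: ler_pM.
have [->|ki] := eqVneq k i.
  rewrite (negbTE ij) /=.
  have -> : x ord0 i - 2 * x ord0 i * 1 - 2 / (1 + t ^+ 2) * (t * x ord0 j - x ord0 i) *
    (1 + t * 0) - x ord0 i - 2 * t * (x ord0 i * 0 - x ord0 j * 1) =
    2 * t ^+ 2 / (1 + t ^+ 2) * (- x ord0 i + t * x ord0 j) by field.
  by apply: key; rewrite ?normrN.
have [->|kj] := eqVneq k j.
  have -> : x ord0 j - 2 * x ord0 i * 0 - 2 / (1 + t ^+ 2) * (t * x ord0 j - x ord0 i) *
    (0 + t * 1) - x ord0 j - 2 * t * (x ord0 i * 1 - x ord0 j * 0) =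
    2 * t ^+ 2 / (1 + t ^+ 2) * (- x ord0 j + t * (- x ord0 i)) by field.
  by apply: key; rewrite normrN.
have -> : x ord0 k - 2 * x ord0 i * 0 - 2 / (1 + t ^+ 2) * (t * x ord0 j - x ord0 i) *
  (0 + t * 0) - x ord0 k - 2 * t * (x ord0 i * 0 - x ord0 j * 0) = 0 by ring.
by rewrite normr0; apply: mulr_ge0.
Qed.

Lemma homp_angular m f : homp m f -> homp m (angular f).
Proof.
case: m => [[c ->]|m hf].
  exists 0; apply/funext => x.
  by rewrite /angular !partial_cst !mulr0 subrr.
by apply: homB; apply: hom_mulX; exact: (hom_partial _ hf).
Qed.

Lemma homp_ball_bounded m f : homp m f -> ball_bounded f.
Proof. by move=> /hom_bounded[C C0 hC]; exists C. Qed.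

Lemma homp_rotation_approx m f : homp m f -> rotation_approx f (angular f).
Proof.
elim: m f => [|m IH] f.
  move=> [c ->]; rewrite (_ : angular _ = fun=> 0); first exact: rotation_approx_cst.
  by apply/funext => x; rewrite /angular !partial_cst !mulr0 subrr.
move=> /homSP[g hg ->].
have := @rotation_approx_sum _ (index_enum 'I_n) (fun k (x : E) => x ord0 k * g k x)
  (fun k (x : E) => (x ord0 i * (k == j)%:R - x ord0 j * (k == i)%:R) * g k x +
     x ord0 k * angular (g k) x).
rewrite (_ : (fun x => \sum_(k <- _) (_ + _)) =
    angular (fun x : E => \sum_k x ord0 k * g k x)).
  apply => k; apply: rotation_approxM.
  - exact: homp_ball_bounded (homX k).
  - exact: homp_ball_bounded (hg k).
  - have [A A0 hA] := homp_ball_bounded (homX i); have [B B0 hB] := homp_ball_bounded (homX j).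
    exists (A + B) => [|x x1]; first exact: addr_gt0.
    rewrite (le_trans (ler_normB _ _))// lerD// normrM -[X in _ <= X]mulr1.
      by rewrite ler_pM ?hA//; case: eqP; rewrite ?normr1 ?normr0.
    by rewrite ler_pM ?hB//; case: eqP; rewrite ?normr1 ?normr0.
  - exact: homp_ball_bounded (homp_angular (hg k)).
  - exact: rotation_approx_coord.
  - exact: IH (hg k).
apply/funext => x; rewrite /angular !(partial_step _ hg).
have dl (i' : 'I_n) : g i' x = \sum_k (k == i')%:R * g k x.
  rewrite (bigD1 i')//= eqxx mul1r big1 ?addr0// => k /negbTE ->.
  by rewrite mul0r.
rewrite (dl i) (dl j) !mulrDr !mulr_sumr -!big_split -sumrB.
by apply: eq_bigr => k _ /=; ring.
Qed.

End Plane.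
End Moments.

(** * Orthogonality of harmonic polynomials *)

Section Orthogonality.
Context {R : realType} {n : nat} (nu : probability (borel_rV R n) R).
Hypothesis n_ge2 : (2 <= n)%N.
Hypothesis nu_ball : nu uball = 1%E.
Hypothesis nu_invariant : rotation_invariant nu.
Local Notation E := 'rV[R]_n.
Implicit Types (f g w : E -> R).

Definition wint w f : R := bint nu (fun x => w x * f x).

Lemma wint_lin w (a b : R) f g : bmeas w -> bmeas f -> bmeas g ->
  wint w (fun x => a * f x + b * g x) = a * wint w f + b * wint w g.
Proof.
move=> bw bf bg; rewrite /wint -bint_lin; [|exact: bmeasM..].
by congr bint; apply/funext => x; ring.
Qed.

Lemma wint_sum w (I : Type) (r : seq I) (F : I -> E -> R) : bmeas w ->
  (forall i, bmeas (F i)) ->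
  wint w (fun x => \sum_(i <- r) F i x) = \sum_(i <- r) wint w (F i).
Proof.
move=> bw bF; rewrite /wint -bint_sum; last by move=> i; exact: bmeasM.
by congr bint; apply/funext => x; rewrite mulr_sumr.
Qed.

Lemma wintZ w (a : R) f : bmeas w -> bmeas f ->
  wint w (fun x => a * f x) = a * wint w f.
Proof.
move=> bw bf; rewrite /wint -bintZ; last exact: bmeasM.
by congr bint; apply/funext => x; rewrite mulrCA.
Qed.

(** By invariance [f] and its rotated copy have the same weighted integral, so [2 t] times the
    integral of the angular derivative is only the quadratic remainder; dividing by [t] and letting
    it tend to zero concludes. *)
Lemma wint_angular i j w m f : i != j -> weight w -> homp m f ->
  wint w (angular i j f) = 0.
Proof.
move=> ij [bw iw] hf; have [C C0 hC] := homp_rotation_approx ij hf.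
have [_ [M hM]] := bw.
have bf := hom_bmeas hf; have bD := hom_bmeas (homp_angular i j hf).
pose K := `|M| * C.
have K0 : 0 <= K by rewrite mulr_ge0.
have key t : 0 < t -> t <= 1 -> 2 * t * `|wint w (angular i j f)| <= K * t ^+ 2.
  move=> t0 t1; have oR := plane_rotation_orthogonal ij t.
  have e1 := bint_rotate nu_invariant oR (bmeasM bw bf).
  have bfR : bmeas (fun x => f (x *m plane_rotation i j t)).
    exact: hom_bmeas (hom_rotate _ hf).
  pose r x := f (x *m plane_rotation i j t) - f x - 2 * t * angular i j f x.
  have br : bmeas r.
    by apply: bmeasB; [exact: bmeasB|exact: bmeasZ].
  have -> : 2 * t * `|wint w (angular i j f)| = `|bint nu (fun x => w x * r x)|.
    rewrite -{1}(ger0_norm (ltW t0)) -{1}(ger0_norm (ler0n R 2)) -!normrM -normrN.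
    congr (`|_|).
    have -> : (fun x => w x * r x) = (fun x =>
        (w (x *m plane_rotation i j t) * f (x *m plane_rotation i j t) - w x * f x)
        - 2 * t * (w x * angular i j f x)).
      by apply/funext => x; rewrite iw// /r; ring.
    rewrite bintB; last 2 first.
    - apply: bmeasB; last exact: bmeasM.
      have -> : (fun x => w (x *m plane_rotation i j t) * f (x *m plane_rotation i j t)) =
          (fun x => w x * f (x *m plane_rotation i j t)).
        by apply/funext => x; rewrite iw.
      exact: bmeasM.
    - by apply: bmeasZ; exact: bmeasM.
    rewrite bintB; last 2 first.
    - have -> : (fun x => w (x *m plane_rotation i j t) * f (x *m plane_rotation i j t)) =
          (fun x => w x * f (x *m plane_rotation i j t)).
        by apply/funext => x; rewrite iw.
      exact: bmeasM.
    - exact: bmeasM.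
    by rewrite e1 subrr sub0r bintZ//; exact: bmeasM.
  apply: bint_norm_le => //; first exact: bmeasM.
  move=> x Bx; rewrite normrM /K -mulrA ler_pM//.
    by rewrite (le_trans (hM x Bx))// ler_norm.
  by apply: hC; [rewrite ger0_norm// ltW|move/uball_nsq/ltW: Bx].
apply/eqP; rewrite -normr_eq0 eq_le normr_ge0 andbT; apply/ler_addgt0Pr => e e0.
rewrite add0r; pose t := Num.min 1 (e / (K + 1)).
have t0 : 0 < t by rewrite lt_min ltr01 divr_gt0// ltr_wpDl.
have t1 : t <= 1 by rewrite ge_min lexx.
have te : t * (K + 1) <= e by rewrite -ler_pdivlMr ?ltr_wpDl// ge_min lexx orbT.
have := key t t0 t1; rewrite expr2 mulrA (mulrC (2 * t)) mulrA ler_pM2r//.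
move: (normr_ge0 (wint w (angular i j f))) => h1 h2.
have : K * t <= t * (K + 1) by lra.
lra.
Qed.

Lemma partial_coord_mul m k l f (x : E) : homp m f ->
  partial l (fun y : E => y ord0 k * f y) x =
  (k == l)%:R * f x + x ord0 k * partial l f x.
Proof.
move=> hf; apply: is_derive_partial.
have := is_derive_mul (is_derive_coord x (delta_mx ord0 l) k) (hom_is_derive hf l x).
by rewrite mxE eqxx.
Qed.

(** The angular part of the Laplacian. With [L_ij] the angular derivative, antisymmetry gives
    [sum L_ij (x_i d_j) = 1/2 sum L_ij^2], and Euler's identity evaluates the radial part as
    [m (m + n - 2)]. The left side is written as a sum of angular derivatives because these
    integrate to zero. *)
Lemma sum_angular m f x : homp m f ->
  \sum_i \sum_j angular i j (fun y => y ord0 i * partial j f y) x =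
  nsq x * laplacian f x - m%:R * (m%:R + n%:R - 2) * f x.
Proof.
case: m => [[c ->]|m hf].
  have p0 i : partial i (fun=> c) = (fun=> 0) :> (E -> R) by exact: partial_cst.
  rewrite /laplacian big1 => [|i _]; last first.
    rewrite big1// => j _; rewrite /angular p0.
    by rewrite (_ : (fun y : E => _) = fun=> 0) ?partial_cst ?mulr0 ?subrr//; apply/funext => y; rewrite mulr0.
  by rewrite big1 ?mulr0 ?mul0r ?subrr// => i _; rewrite p0 partial_cst.
have e i j : angular i j (fun y => y ord0 i * partial j f y) x =
    x ord0 i * ((i == j)%:R * partial j f x) + x ord0 i ^+ 2 * partial j (partial j f) x
    - x ord0 j * partial j f x - x ord0 j * (x ord0 i * partial i (partial j f) x).
  have e1 := partial_coord_mul i j x (hom_partial j hf).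
  have e2 := partial_coord_mul i i x (hom_partial j hf).
  have aux (a b c d s u : R) : a * (s * c + a * d) - b * ((i == i)%:R * c + a * u) =
    a * (s * c) + a ^+ 2 * d - b * c - b * (a * u) by rewrite eqxx /=; ring.
  exact: etrans (congr2 (fun s t => x ord0 i * s - x ord0 j * t) e1 e2)
    (aux (x ord0 i) (x ord0 j) (partial j f x) (partial j (partial j f) x)
      (i == j)%:R (partial i (partial j f) x)).
transitivity (\sum_i ((\sum_j x ord0 i * ((i == j)%:R * partial j f x) +
    \sum_j x ord0 i ^+ 2 * partial j (partial j f) x)
    - \sum_j x ord0 j * partial j f x
    - \sum_j x ord0 j * (x ord0 i * partial i (partial j f) x))).
  apply: eq_bigr => i _; rewrite -big_split -sumrB -sumrB.
  by apply: eq_bigr => j _; exact: e.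
rewrite sumrB sumrB big_split.
have -> : \sum_i \sum_j x ord0 i * ((i == j)%:R * partial j f x) = m.+1%:R * f x.
  rewrite -(euler x hf); apply: eq_bigr => i _; rewrite (bigD1 i)//= eqxx mul1r.
  by rewrite big1 ?addr0// => j /negbTE; rewrite eq_sym => ->; rewrite mul0r mulr0.
have -> : \sum_i \sum_j x ord0 i ^+ 2 * partial j (partial j f) x =
    nsq x * laplacian f x.
  by rewrite /nsq mulr_suml; apply: eq_bigr => i _; rewrite /laplacian mulr_sumr.
have -> : \sum_(i < n) \sum_j x ord0 j * partial j f x = n%:R * (m.+1%:R * f x).
  by rewrite (euler x hf) sumr_const card_ord [RHS]mulr_natl.
have -> : \sum_i \sum_j x ord0 j * (x ord0 i * partial i (partial j f) x) =
    m%:R * (m.+1%:R * f x).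
  rewrite exchange_big -(euler x hf) mulr_sumr; apply: eq_bigr => j _ /=.
  by rewrite -mulr_sumr (euler x (hom_partial j hf)) mulrCA.
have -> : (m.+1%:R : R) = m%:R + 1 by rewrite -addn1 natrD.
rewrite /=; ring.
Qed.

Lemma wint_laplacian w m f : weight w -> homp m f ->
  wint w (fun x => nsq x * laplacian f x) = m%:R * (m%:R + n%:R - 2) * wint w f.
Proof.
move=> ww hf; have [bw _] := ww; have bf := hom_bmeas hf.
have bl : bmeas (fun x => nsq x * laplacian f x).
  by apply: bmeasM; [exact: hom_bmeas hom_nsq|exact: hom_bmeas (hom_laplacian hf)].
have hg i j : homp m.-1.+1 (fun y : E => y ord0 i * partial j f y).
  by apply: hom_mulX; exact: hom_partial.
have e : wint w (fun x => \sum_i \sum_j angular i j (fun y => y ord0 i * partial j f y) x) = 0.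
  rewrite wint_sum//; last first.
    by move=> i; apply: bmeas_sum => j; exact: hom_bmeas (homp_angular i j (hg i j)).
  rewrite big1// => i _; rewrite wint_sum//; last first.
    by move=> j; exact: hom_bmeas (homp_angular i j (hg i j)).
  rewrite big1// => j _; have [->|ij] := eqVneq i j; last first.
    exact: wint_angular ij ww (hg i j).
  rewrite (_ : angular _ _ _ = fun=> 0 * 0); last first.
    by apply/funext => x; rewrite /angular subrr mul0r.
  by rewrite wintZ ?mul0r//; exact: bmeas_cst.
apply/eqP; rewrite -subr_eq0 -[X in _ == X]e; apply/eqP.
rewrite (_ : (fun x => \sum_i _) = (fun x => 1 * (nsq x * laplacian f x) +
    (- (m%:R * (m%:R + n%:R - 2))) * f x)); last first.
  by apply/funext => x; rewrite (sum_angular x hf) mul1r mulNr.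
by rewrite wint_lin// mul1r mulNr.
Qed.

(* For harmonic [f] and [g], [laplacian (f g) = 2 grad f . grad g]. *)
Lemma wint_Harm_mul w m k f g : weight w -> Harm m f -> Harm k g ->
  (m + k)%:R * ((m + k)%:R + n%:R - 2) * wint w (fun x => f x * g x) =
  2 * \sum_i wint (fun x => w x * nsq x) (fun x => partial i f x * partial i g x).
Proof.
move=> ww [hf lf] [hg lg]; rewrite -wint_laplacian//; last exact: hom_mul.
have bw := ww.1; have wn := weightM ww (weight_nsq (n:=n) (R:=R)).
have bp i : bmeas (fun x => partial i f x * partial i g x).
  by apply: bmeasM; [exact: hom_bmeas (hom_partial i hf)|exact: hom_bmeas (hom_partial i hg)].
rewrite -(wint_sum _ wn.1)// -wintZ; last 2 first.
- exact: wn.1.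
- exact: bmeas_sum.
rewrite /wint; congr bint; apply/funext => x.
by rewrite (laplacian_mul x hf hg) lf lg mul0r mulr0 addr0 add0r mulrA.
Qed.

Lemma eigen_gt0 d : (0 < d)%N -> 0 < d%:R * (d%:R + n%:R - 2) :> R.
Proof.
move=> d0; have : (1 : R) <= d%:R by rewrite ler1n.
have : (2 : R) <= n%:R by rewrite ler_nat.
by move=> h1 h2; apply: mulr_gt0; lra.
Qed.

(** Passing to gradients lowers both degrees by one and multiplies the weight by [|x|^2]. When one
    degree reaches 0 its gradient vanishes, while the factor on the left is positive because the
    other degree is not 0. *)
Lemma wint_Harm_orthogonal m k w f g : m <> k -> weight w ->
  Harm m f -> Harm k g -> wint w (fun x => f x * g x) = 0.
Proof.
elim: m k w f g => [|m IH] [|k] w f g // mk ww hf hg.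
- have := wint_Harm_mul ww hf hg; rewrite big1 ?mulr0 => [/eqP|i _].
    by rewrite mulf_eq0 (gt_eqF (eigen_gt0 _)) ?addn_gt0 ?orbT//= => /eqP.
  have [[c ->] _] := hf; rewrite /wint.
  rewrite (_ : (fun x => _) = fun=> 0 * 0) ?bintZ ?mul0r//; first exact: bmeas_cst.
  by apply/funext => x; rewrite partial_cst !mul0r mulr0.
- have := wint_Harm_mul ww hf hg; rewrite big1 ?mulr0 => [/eqP|i _].
    by rewrite mulf_eq0 (gt_eqF (eigen_gt0 _)) ?addn_gt0 ?orbT//= => /eqP.
  have [[c ->] _] := hg; rewrite /wint.
  rewrite (_ : (fun x => _) = fun=> 0 * 0) ?bintZ ?mul0r//; first exact: bmeas_cst.
  by apply/funext => x; rewrite partial_cst !mulr0.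
- have := wint_Harm_mul ww hf hg; rewrite big1 ?mulr0 => [/eqP|i _].
    by rewrite mulf_eq0 (gt_eqF (eigen_gt0 _)) ?addn_gt0 ?orbT//= => /eqP.
  apply: (IH k); [by move=> e; apply: mk; rewrite e|exact: weightM ww (weight_nsq (n:=n) (R:=R))|..].
    exact: Harm_partial hf.
  exact: Harm_partial hg.
Qed.

(** On forms of degree [m] this is the Fischer inner product multiplied by [m!]: the sum, over all
    sequences of [m] indices, of the products of the corresponding iterated derivatives at 0. *)
Fixpoint fischer (m : nat) f g : R :=
  if m is m'.+1 then \sum_i fischer m' (partial i f) (partial i g) else f 0 * g 0.

(** Equals [1 / (m! n (n + 2) ... (n + 2 m - 2))]. *)
Fixpoint moment_coef (m : nat) : R :=
  if m is m'.+1 then moment_coef m' / (m'.+1%:R * (2 * m'%:R + n%:R)) else 1.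

Lemma moment_coef_gt0 m : 0 < moment_coef m.
Proof.
elim: m => //= m IH; rewrite divr_gt0// mulr_gt0//.
by rewrite ltr_wpDl ?mulr_ge0// ltr0n (leq_trans _ n_ge2).
Qed.

Lemma fischer_ge0 m f : 0 <= fischer m f f.
Proof.
elim: m f => [|m IH] f /=; first by rewrite -expr2 sqr_ge0.
by apply: sumr_ge0 => i _.
Qed.

Lemma fischer_eq0 m f : homp m f -> fischer m f f = 0 -> f = fun=> 0.
Proof.
elim: m f => [|m IH] f.
  by move=> [c ->] /= /eqP; rewrite mulf_eq0 orbb => /eqP ->.
move=> hf /= /psumr_eq0P h.
have p0 i : partial i f = fun=> 0.
  by apply: IH; [exact: (hom_partial i hf)|apply: h => // k _; exact: fischer_ge0].
apply/funext => x; apply/eqP; have := euler x hf.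
rewrite big1 => [/esym/eqP|i _]; last by rewrite p0 mulr0.
by rewrite mulf_eq0 pnatr_eq0.
Qed.

(** Each passage to gradients contributes [2 / ((2m + 2) (2m + n)) = 1 / ((m + 1) (2m + n))]. The
    weight survives only through one radial moment, so norms for different weights are compared by
    comparing moments. *)
Lemma wint_Harm_fischer m w f g : weight w -> Harm m f -> Harm m g ->
  wint w (fun x => f x * g x) =
  moment_coef m * fischer m f g * wint w (fun x => nsq x ^+ m).
Proof.
elim: m w f g => [|m IH] w f g ww hf hg.
  have [[c ->] _] := hf; have [[d ->] _] := hg; rewrite /= mul1r.
  have b1 : bmeas (fun x : E => nsq x ^+ 0) by exact: (weight_nsqX 0).1.
  rewrite -wintZ//; last exact: ww.1.
  by rewrite /wint; congr bint; apply/funext => x; rewrite expr0 mulr1.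
have wn := weightM ww (weight_nsq (n:=n) (R:=R)).
apply: (mulfI (lt0r_neq0 (eigen_gt0 (isT : (0 < m.+1 + m.+1)%N)))).
apply: etrans (wint_Harm_mul ww hf hg) _.
under eq_bigr => i _ do rewrite (IH _ _ _ wn (Harm_partial i hf) (Harm_partial i hg)).
rewrite -mulr_suml -mulr_sumr /=.
have -> : wint (fun x => w x * nsq x) (fun x => nsq x ^+ m) =
    wint w (fun x => nsq x ^+ m.+1).
  by rewrite /wint; congr bint; apply/funext => x; rewrite exprS mulrA.
set F := \sum_i _; set L := wint _ _.
have n0 : (0 : R) < n%:R by rewrite ltr0n (leq_trans _ n_ge2).
have m0 : (0 : R) <= m%:R by [].
have m1 : (m.+1%:R : R) = m%:R + 1 by rewrite -addn1 natrD.
rewrite natrD m1.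
by field; lra.
Qed.

End Orthogonality.

(** * Reproducing kernels and pointwise bounds for harmonic forms *)

Section PointwiseBound.
Context {R : realType} {n : nat} (nu : probability (borel_rV R n) R).
Hypothesis n_ge2 : (2 <= n)%N.
Hypothesis nu_ball : nu uball = 1%E.
Hypothesis nu_invariant : rotation_invariant nu.
Local Notation E := 'rV[R]_n.
Implicit Types (f g w : E -> R).

Lemma sum_cauchy_schwarz (I : finType) (a b : I -> R) :
  (\sum_i a i * b i) ^+ 2 <= (\sum_i a i ^+ 2) * (\sum_i b i ^+ 2).
Proof.
set A := \sum_i a i ^+ 2; set B := \sum_i b i ^+ 2; set C := \sum_i _.
have B0 : 0 <= B by apply: sumr_ge0 => i _; exact: sqr_ge0.
have h : 0 <= B * (A * B - C ^+ 2).
  have -> : B * (A * B - C ^+ 2) = \sum_i (B * a i - C * b i) ^+ 2.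
    transitivity (\sum_i (B ^+ 2 * a i ^+ 2 + (- (2 * B * C)) * (a i * b i) + C ^+ 2 * b i ^+ 2)).
      by rewrite !big_split -!mulr_sumr /= -/A -/B -/C; ring.
    by apply: eq_bigr => i _; ring.
  by apply: sumr_ge0 => i _; exact: sqr_ge0.
have [B1|B1] := eqVneq B 0.
  have /psumr_eq0P bz : \sum_i b i ^+ 2 = 0 by rewrite -/B.
  rewrite /C B1 mulr0 big1 ?expr0n// => i _.
  have /eqP := bz (fun j _ => sqr_ge0 (b j)) i isT.
  by rewrite sqrf_eq0 => /eqP ->; rewrite mulr0.
by rewrite -subr_ge0 -(pmulr_rge0 _ (_ : 0 < B))// lt_def B1.
Qed.

Section Monomials.
Variable M : nat.

(** Exponents are bounded by [M] so that the index type is finite; its cardinal [M ^ n], taken with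
    [M = m + 1], bounds the dimension of the forms of degree [m]. *)
Definition monomial (a : {ffun 'I_n -> 'I_M}) (x : E) : R := \prod_i x ord0 i ^+ a i.

Definition monomial_span (m : nat) f : Prop := exists c : {ffun 'I_n -> 'I_M} -> R,
  f = fun x : E => \sum_(a : {ffun 'I_n -> 'I_M} | (\sum_i (a i : nat) == m)%N) c a * monomial a x.

Lemma monomial_span_lin m (s t : R) f g : monomial_span m f -> monomial_span m g ->
  monomial_span m (fun x : E => s * f x + t * g x).
Proof.
move=> [c ->] [d ->]; exists (fun a => s * c a + t * d a); apply/funext => x.
by rewrite !mulr_sumr -big_split; apply: eq_bigr => a _ /=; ring.
Qed.

Lemma monomial_span0 m : monomial_span m (fun=> 0).
Proof.
by exists (fun=> 0); apply/funext => x; rewrite big1// => a _; rewrite mul0r.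
Qed.

Lemma monomial_span_sum m (I : Type) (r : seq I) (P : pred I) (F : I -> E -> R) :
  (forall i, P i -> monomial_span m (F i)) ->
  monomial_span m (fun x : E => \sum_(i <- r | P i) F i x).
Proof.
move=> hF; elim: r => [|a r IH].
  by rewrite (_ : (fun x : E => _) = fun=> 0); [exact: monomial_span0|apply/funext => x; rewrite big_nil].
have [Pa|nPa] := boolP (P a).
  rewrite (_ : (fun x : E => _) = (fun x : E => 1 * F a x + 1 * \sum_(i <- r | P i) F i x)).
    by apply: monomial_span_lin IH; exact: hF.
  by apply/funext => x; rewrite big_cons Pa !mul1r.
rewrite (_ : (fun x : E => _) = (fun x : E => \sum_(i <- r | P i) F i x))//.
by apply/funext => x; rewrite big_cons (negbTE nPa).
Qed.

Lemma monomial_spanX m (a : {ffun 'I_n -> 'I_M}) : (\sum_i (a i : nat))%N = m -> monomial_span m (monomial a).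
Proof.
move=> am; exists (fun b => (b == a)%:R); apply/funext => x.
rewrite (bigD1 a) ?am//= eqxx mul1r big1 ?addr0// => b /andP[_ /negbTE ->].
by rewrite mul0r.
Qed.

Lemma homp_monomial_span m f : (m < M)%N -> homp m f -> monomial_span m f.
Proof.
elim: m f => [|m IH] f mM.
  move=> [c ->].
  have := monomial_spanX (a := [ffun _ => Ordinal mM]) (m := 0).
  rewrite big1 => [/(_ erefl) h|i _]; last by rewrite ffunE.
  have := monomial_span_lin c 0 h h; congr monomial_span; apply/funext => x.
  by rewrite /monomial big1 ?mulr1 ?mul0r ?addr0// => i _; rewrite ffunE expr0.
move=> /homSP[g hg ->]; apply: monomial_span_sum => i _.
have [c ->] := IH _ (ltnW mM) (hg i).
have -> : (fun x : E => x ord0 i *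
      \sum_(a : {ffun 'I_n -> 'I_M} | (\sum_i (a i : nat) == m)%N) c a * monomial a x) =
    (fun x : E => \sum_(a : {ffun 'I_n -> 'I_M} | (\sum_i (a i : nat) == m)%N) c a * (x ord0 i * monomial a x)).
  by apply/funext => x; rewrite mulr_sumr; apply: eq_bigr => a _; rewrite mulrCA.
apply: monomial_span_sum => a /eqP am.
have lt j : (a j + (j == i) < M)%N.
  apply: leq_ltn_trans mM; rewrite -am -addn1 leq_add//; last by case: eqP.
  by rewrite (bigD1 j)//= leq_addr.
pose b := [ffun j => Ordinal (lt j)].
have hb : monomial_span m.+1 (monomial b).
  apply: monomial_spanX; rewrite (eq_bigr (fun j => a j + (j == i))%N); last first.
    by move=> j _; rewrite ffunE.
  rewrite big_split /= am -addn1; congr (_ + _)%N.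
  by rewrite (bigD1 i)//= eqxx big1 ?addn0// => j /negbTE ->.
have := monomial_span_lin (c a) 0 hb hb; congr monomial_span; apply/funext => x.
rewrite mul0r addr0; congr (_ * _); rewrite /monomial.
rewrite (eq_bigr (fun j => x ord0 j ^+ (j == i) * x ord0 j ^+ a j)); last first.
  by move=> j _; rewrite ffunE /= exprD mulrC.
rewrite big_split (bigD1 i)//= eqxx expr1 [X in _ * X * _]big1 ?mulr1//.
by move=> j /negbTE ->.
Qed.

Lemma monomial_bmeas (a : {ffun 'I_n -> 'I_M}) : bmeas (monomial a).
Proof.
rewrite /monomial; elim: (index_enum _) => [|i r IH].
  by rewrite (_ : (fun x : E => _) = fun=> 1); [exact: bmeas_cst|apply/funext => x; rewrite big_nil].
rewrite (_ : (fun x : E => _) = (fun x : E => x ord0 i ^+ a i * \prod_(j <- r) x ord0 j ^+ a j)).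
  apply: bmeasM => //; elim: (nat_of_ord (a i)) => [|k IHk].
    by under eq_fun do rewrite expr0; exact: bmeas_cst.
  by under eq_fun do rewrite exprS; apply: bmeasM => //; exact: hom_bmeas (homX i).
by apply/funext => x; rewrite big_cons.
Qed.

End Monomials.

Section OrthonormalFamily.
Variables (w : E -> R) (m : nat).
Hypothesis ww : weight w.
Hypothesis w_pos : 0 < wint nu w (fun x : E => nsq x ^+ m).

Local Notation form f g := (wint nu w (fun x : E => f x * g x)).

Definition orthonormal_Harm (k : nat) (e : 'I_k -> E -> R) : Prop :=
  (forall i, Harm m (e i)) /\ forall i j, form (e i) (e j) = (i == j)%:R.

Lemma Harm_bmeas f : Harm m f -> bmeas f.
Proof. by move=> [hf _]; exact: hom_bmeas hf. Qed.

(** Orthonormality writes the identity matrix as [C G C^T], with [G] the Gram matrix of the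
    monomials, so its rank is at most their number. *)
Lemma orthonormal_Harm_size k e : @orthonormal_Harm k e -> (k <= m.+1 ^ n)%N.
Proof.
move=> [he oe].
have /choice[c cP] : forall i, exists c : {ffun 'I_n -> 'I_m.+1} -> R,
    e i = fun x : E => \sum_(a : {ffun 'I_n -> 'I_m.+1} | (\sum_i (a i : nat) == m)%N) c a * monomial a x.
  by move=> i; have [c cE] := homp_monomial_span (ltnSn m) (he i).1; exists c.
pose N := #|{ffun 'I_n -> 'I_m.+1}|.
pose val (p : 'I_N) : {ffun 'I_n -> 'I_m.+1} := enum_val p.
pose d i (a : {ffun 'I_n -> 'I_m.+1}) := if (\sum_i (a i : nat) == m)%N then c i a else 0.
have eE i : e i = fun x : E => \sum_p d i (val p) * monomial (val p) x.
  apply/funext => x; rewrite cP big_mkcond (reindex val) /=; last first.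
    by exists enum_rank => p _; [exact: enum_valK|exact: enum_rankK].
  by apply: eq_bigr => p _; rewrite /d; case: ifP => // _; rewrite mul0r.
pose C := \matrix_(i < k, p < N) d i (val p).
pose G := \matrix_(p < N, q < N) form (monomial (val p)) (monomial (val q)).
have CGC : C *m G *m C^T = 1%:M.
  apply/matrixP => i j; rewrite !mxE -oe (eE i) (eE j).
  have -> : (fun x : E => (\sum_p d i (val p) * monomial (val p) x) *
       \sum_p d j (val p) * monomial (val p) x) =
     (fun x : E => \sum_q \sum_p (d i (val p) * d j (val q)) * (monomial (val p) x * monomial (val q) x)).
    apply/funext => x; rewrite mulr_sumr; apply: eq_bigr => q _.
    by rewrite mulr_suml; apply: eq_bigr => p _; ring.
  have bm p q : bmeas (fun x : E => monomial (val p) x * monomial (val q) x).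
    by apply: bmeasM; exact: monomial_bmeas.
  rewrite (wint_sum nu _ ww.1); last first.
    by move=> q; apply: bmeas_sum => p; exact: bmeasZ.
  apply: eq_bigr => q _; rewrite (wint_sum nu _ ww.1); last by move=> p; exact: bmeasZ.
  rewrite !mxE mulr_suml; apply: eq_bigr => p _.
  by rewrite (wintZ nu _ ww.1)// !mxE; ring.
have : (\rank (1%:M : 'M[R]_k) <= N)%N.
  by rewrite -CGC -mulmxA (leq_trans (mxrankM_maxl _ _))// rank_leq_col.
by rewrite mxrank1 /N card_ffun !card_ord.
Qed.

Lemma form_ge0 f : Harm m f -> 0 <= form f f.
Proof.
move=> hf; rewrite (wint_Harm_fischer n_ge2 nu_ball nu_invariant ww hf hf).
by rewrite !mulr_ge0 ?fischer_ge0 ?ltW// moment_coef_gt0.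
Qed.

Lemma form_eq0 f : Harm m f -> form f f = 0 -> f = fun=> 0.
Proof.
move=> hf; rewrite (wint_Harm_fischer n_ge2 nu_ball nu_invariant ww hf hf) => /eqP.
rewrite !mulf_eq0 (gt_eqF w_pos) orbF (gt_eqF (moment_coef_gt0 n_ge2 m)) /=.
by move=> /eqP; exact: fischer_eq0 hf.1.
Qed.

(** The size bound yields a family of maximal size; a form with nonzero residual would, once
    normalised, enlarge it. *)
Lemma orthonormal_Harm_basis : exists k, exists2 e : 'I_k -> E -> R, orthonormal_Harm e &
  forall f, Harm m f -> f = fun x : E => \sum_i form f (e i) * e i x.
Proof.
pose P k := `[< exists e : 'I_k -> E -> R, orthonormal_Harm e >].
have P0 : exists k, P k.
  by exists 0%N; apply/asboolP; exists (fun i _ => 0); split=> -[].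
have Pb k : P k -> (k <= m.+1 ^ n)%N by move=> /asboolP[e]; exact: orthonormal_Harm_size.
case: (ex_maxnP P0 Pb) => k /asboolP[e [he oe]] kmax.
exists k, e => // f hf.
have be i := Harm_bmeas (he i); have bf := Harm_bmeas hf; have bw := ww.1.
pose p x := \sum_i form f (e i) * e i x.
have hp : Harm m p := Harm_sum _ (fun i => HarmZ (form f (e i)) (he i)).
pose g x := 1 * f x + (-1) * p x.
have hg : Harm m g by exact: Harm_lin.
have bp := Harm_bmeas hp; have bg := Harm_bmeas hg.
have ge j : form g (e j) = 0.
  have -> : (fun x : E => g x * e j x) = (fun x : E => 1 * (f x * e j x) +
      (-1) * \sum_i form f (e i) * (e i x * e j x)).
    apply/funext => x; rewrite /g mulrDl -!mulrA; congr (_ + _ * _).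
    by rewrite mulr_suml; apply: eq_bigr => i _; rewrite mulrA.
  rewrite (wint_lin nu _ _ bw); last 2 first.
  - exact: bmeasM.
  - by apply: bmeas_sum => i; apply: bmeasZ; exact: bmeasM.
  rewrite (wint_sum nu _ bw); last by move=> i; apply: bmeasZ; exact: bmeasM.
  rewrite (bigD1 j)//= (wintZ nu _ bw) ?oe ?eqxx ?mulr1; last exact: bmeasM.
  rewrite big1 ?addr0 => [|i /negbTE ij]; first by rewrite mul1r mulN1r subrr.
  by rewrite (wintZ nu _ bw) ?oe ?ij ?mulr0//; exact: bmeasM.
suff g0 : form g g = 0.
  have /(congr1 (fun h : E -> R => h)) gz := form_eq0 hg g0.
  apply/funext => x; have /(congr1 (fun h : E -> R => h x)) := gz.
  by rewrite /g mul1r mulN1r => /eqP; rewrite subr_eq0 => /eqP.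
apply/eqP/negPn/negP => gn0.
have gp : 0 < form g g by rewrite lt_def gn0 form_ge0.
pose s := Num.sqrt (form g g); have s0 : 0 < s by rewrite sqrtr_gt0.
pose u x := s^-1 * g x.
have bu : bmeas u by exact: bmeasZ.
pose e' (i : 'I_k.+1) := if unlift ord0 i is Some j then e j else u.
have he' i : Harm m (e' i).
  by rewrite /e'; case: unliftP => [j _|_]; [exact: he|exact: (HarmZ s^-1 hg)].
have ue j : form u (e j) = 0.
  rewrite (_ : (fun x : E => u x * e j x) = (fun x : E => s^-1 * (g x * e j x))).
    by rewrite (wintZ nu _ bw) ?ge ?mulr0//; exact: bmeasM.
  by apply/funext => x; rewrite mulrA.
have uu : form u u = 1.
  rewrite (_ : (fun x : E => u x * u x) = (fun x : E => (s^-1 ^+ 2) * (g x * g x))).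
    rewrite (wintZ nu _ bw); last exact: bmeasM.
    rewrite exprVn sqr_sqrtr ?mulVf//; exact: ltW.
  by apply/funext => x; rewrite /u; ring.
have : P k.+1.
  apply/asboolP; exists e'; split=> // i j; rewrite /e'.
  case: (unliftP ord0 i) => [i' ->|->]; case: (unliftP ord0 j) => [j' ->|->].
  - by rewrite oe (inj_eq lift_inj).
  - under eq_fun do rewrite mulrC.
    by rewrite ue eq_sym -(inj_eq val_inj).
  - by rewrite ue -(inj_eq val_inj).
  - by rewrite uu eqxx.
by move/kmax; rewrite ltnn.
Qed.

(* [K x = \sum_i (e i x)^2] is the squared norm of the evaluation at [x], hence
   rotation invariant, and its integral is the dimension of [Harm m]. *)
Lemma Harm_pointwise f x : Harm m f ->
  f x ^+ 2 * wint nu w (fun x : E => nsq x ^+ m) <=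
  (m.+1 ^ n)%:R * nsq x ^+ m * form f f.
Proof.
move=> hf; have [k [e [he oe] ePs]] := orthonormal_Harm_basis.
have be i := Harm_bmeas (he i); have bw := ww.1.
have pars g : Harm m g -> form g g = \sum_i form g (e i) ^+ 2.
  move=> hg; have bg := Harm_bmeas hg.
  rewrite {1}(_ : (fun x : E => g x * g x) = (fun x : E => \sum_i form g (e i) * (g x * e i x))).
    rewrite (wint_sum nu _ bw); last by move=> i; apply: bmeasZ; exact: bmeasM.
    by apply: eq_bigr => i _; rewrite (wintZ nu _ bw) ?expr2//; exact: bmeasM.
  apply/funext => y; have /(congr1 (fun h : E -> R => h y)) e1 := ePs g hg.
  rewrite {2}e1 mulr_sumr; apply: eq_bigr => i _; ring.
pose K y := \sum_i e i y ^+ 2.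
have K0 y : 0 <= K y by apply: sumr_ge0 => i _; exact: sqr_ge0.
have point g y : Harm m g -> g y ^+ 2 <= form g g * K y.
  move=> hg; rewrite (pars g hg); apply: le_trans (sum_cauchy_schwarz _ _).
  by have /(congr1 (fun h : E -> R => h y)) <- := ePs g hg.
(* [p] is the reproducing kernel at [y M]. Its rotated copy keeps the norm and takes at [y] the
   value [K (y M)], so the evaluation bound gives [K (y M)^2 <= K (y M) K y]. *)
have Kle (M : 'M[R]_n) y : M *m M^T = 1%:M -> K (y *m M) <= K y.
  move=> oM; pose p z := \sum_i e i (y *m M) * e i z.
  have hp : Harm m p := Harm_sum _ (fun i => HarmZ (e i (y *m M)) (he i)).
  have pe j : form p (e j) = e j (y *m M).
    rewrite (_ : (fun x : E => p x * e j x) = (fun x : E => \sum_i e i (y *m M) * (e i x * e j x))).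
      rewrite (wint_sum nu _ bw); last by move=> i; apply: bmeasZ; exact: bmeasM.
      rewrite (bigD1 j)//= (wintZ nu _ bw) ?oe ?eqxx ?mulr1; last exact: bmeasM.
      rewrite big1 ?addr0// => i /negbTE ij.
      by rewrite (wintZ nu _ bw) ?oe ?ij ?mulr0//; exact: bmeasM.
    by apply/funext => z; rewrite mulr_suml; apply: eq_bigr => i _; rewrite mulrA.
  have pK : form p p = K (y *m M).
    by rewrite (pars p hp); apply: eq_bigr => j _; rewrite pe.
  have hpM := Harm_rotate oM hp.
  have e1 : form (fun x : E => p (x *m M)) (fun x : E => p (x *m M)) = form p p.
    have bp := Harm_bmeas hp.
    rewrite -[RHS](bint_rotate nu_invariant oM (bmeasM bw (bmeasM bp bp))).
    by congr bint; apply/funext => z; rewrite ww.2.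
  have := point _ y hpM; rewrite e1 pK.
  have -> : p (y *m M) = K (y *m M) by apply: eq_bigr => i _; rewrite expr2.
  have := K0 (y *m M); rewrite le_eqVlt => /orP[/eqP <- _|Kp]; first exact: K0.
  by rewrite expr2 ler_pM2l.
have Keq y z : nsq y = nsq z -> K y = K z.
  move=> yz; apply/eqP; rewrite eq_le.
  have [M oM <-] := rotation_transitive yz.
  have [M' oM' e1] := rotation_transitive (esym yz).
  rewrite Kle// andbT; have [M1 oM1 e2] := rotation_transitive yz.
  by rewrite -{1}(_ : y *m M *m M^T = y) ?Kle// ?trmxK ?(mulmx1C oM)// -mulmxA oM mulmx1.
have i0 : 'I_n by exact: Ordinal (ltnW n_ge2).
pose u : E := delta_mx ord0 i0.
have u1 : nsq u = 1.
  rewrite /nsq (bigD1 i0)//= mxE !eqxx expr1n big1 ?addr0// => j /negbTE ji.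
  by rewrite mxE eqxx ji /= expr0n.
(* [K] is constant on spheres and homogeneous of degree [2 m]; integrating this formula then
   expresses [K u] through [k] and one moment. *)
have Ku y : K y = nsq y ^+ m * K u.
  rewrite (@Keq y (Num.sqrt (nsq y) *: u)); last first.
    rewrite (hom_scale _ _ hom_nsq) u1 mulr1 sqr_sqrtr//; exact: nsq_ge0.
  rewrite /K mulr_sumr; apply: eq_bigr => i _.
  by rewrite (hom_scale _ _ (he i).1) exprMn -exprM mulnC exprM sqr_sqrtr// nsq_ge0.
have Kint : K u * wint nu w (fun x : E => nsq x ^+ m) = k%:R.
  have bK : bmeas (fun x : E => nsq x ^+ m) by exact: hom_bmeas (hom_nsqX m).
  rewrite -(wintZ nu _ bw)//.
  rewrite (_ : (fun x : E => _) = (fun x : E => \sum_i e i x * e i x)); last first.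
    by apply/funext => y; rewrite mulrC -Ku; apply: eq_bigr => i _; rewrite expr2.
  rewrite (wint_sum nu _ bw); last by move=> i; exact: bmeasM.
  under eq_bigr do rewrite oe eqxx.
  by rewrite sumr_const card_ord.
have := point f x hf; rewrite Ku => h.
have h2 := ler_wpM2r (ltW w_pos) h.
apply: (le_trans h2).
have -> : form f f * (nsq x ^+ m * K u) * wint nu w (fun x0 => nsq x0 ^+ m) =
   (K u * wint nu w (fun x0 => nsq x0 ^+ m)) * nsq x ^+ m * form f f by ring.
rewrite Kint ler_wpM2r ?form_ge0// ler_wpM2r ?exprn_ge0 ?nsq_ge0//.
by rewrite ler_nat; apply: orthonormal_Harm_size; split; [exact: he|exact: oe].
Qed.

End OrthonormalFamily.
End PointwiseBound.

(** * Approximation by polynomials and by harmonic polynomials *)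

Section PolynomialApproximation.
Context {R : realType} {n : nat}.
Local Notation E := 'rV[R]_n.
Implicit Types (f g : E -> R).

Definition polyf f : Prop := exists N (p : nat -> E -> R),
  (forall m, homp m (p m)) /\ f = (fun x => \sum_(m < N) p m x).

Lemma homp_polyf m f : homp m f -> polyf f.
Proof.
move=> hf; exists m.+1, (fun k x => if k == m then f x else 0); split=> [k|].
  by case: eqP => [->//|_]; exact: hom0.
apply/funext => x; rewrite (bigD1 ord_max)//= eqxx big1 ?addr0// => i.
by rewrite -val_eqE => /negbTE ->.
Qed.

Lemma polyf_lin (a b : R) f g : polyf f -> polyf g ->
  polyf (fun x => a * f x + b * g x).
Proof.
move=> [N [h [hh ->]]] [N' [h' [hh' ->]]].
pose k m := (fun x : E => a * (if (m < N)%N then h m x else 0) +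
                      b * (if (m < N')%N then h' m x else 0)).
exists (N + N')%N, k; split=> [m|].
  by apply: hom_lin; [case: (m < N)%N|case: (m < N')%N] => //; exact: hom0.
apply/funext => x.
have w (N0 N1 : nat) (h0 : nat -> E -> R) : (N0 <= N1)%N ->
    \sum_(m < N0) h0 m x = \sum_(m < N1) (if (m < N0)%N then h0 m x else 0).
  by move=> le; rewrite (big_ord_widen N1 (fun m => h0 m x))// big_mkcond.
rewrite (w _ _ h (leq_addr N' N)) (w _ _ h' (leq_addl N N')) !mulr_sumr -big_split.
by apply: eq_bigr.
Qed.

Lemma polyf_cst (c : R) : polyf (fun=> c).
Proof. by apply: (homp_polyf (m := 0)); exists c. Qed.

Lemma polyf_coord i : polyf (fun x => x ord0 i).
Proof. exact: homp_polyf (homX i). Qed.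

Lemma polyfD f g : polyf f -> polyf g -> polyf (fun x => f x + g x).
Proof.
move=> hf hg; rewrite (_ : (fun x => _) = (fun x => 1 * f x + 1 * g x)).
  exact: polyf_lin.
by apply/funext => x; rewrite !mul1r.
Qed.

Lemma polyfB f g : polyf f -> polyf g -> polyf (fun x => f x - g x).
Proof.
move=> hf hg; rewrite (_ : (fun x => _) = (fun x => 1 * f x + (-1) * g x)).
  exact: polyf_lin.
by apply/funext => x; rewrite mul1r mulN1r.
Qed.

Lemma polyfZ (a : R) f : polyf f -> polyf (fun x => a * f x).
Proof.
move=> hf; rewrite (_ : (fun x => _) = (fun x => a * f x + 0 * f x)).
  exact: polyf_lin.
by apply/funext => x; rewrite mul0r addr0.
Qed.

Lemma polyf_sum (I : Type) (r : seq I) (F : I -> E -> R) :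
  (forall i, polyf (F i)) -> polyf (fun x => \sum_(i <- r) F i x).
Proof.
move=> hF; elim: r => [|a r IH].
  by rewrite (_ : (fun x => _) = fun=> 0); [exact: polyf_cst|apply/funext => x; rewrite big_nil].
rewrite (_ : (fun x => _) = (fun x : E => F a x + \sum_(i <- r) F i x)).
  exact: polyfD (hF a) IH.
by apply/funext => x; rewrite big_cons.
Qed.

Lemma polyfM f g : polyf f -> polyf g -> polyf (fun x => f x * g x).
Proof.
move=> [N [p [hp ->]]] [M [q [hq ->]]].
rewrite (_ : (fun x => _) = (fun x => \sum_(i < N) \sum_(j < M) p i x * q j x)).
  apply: polyf_sum => i; apply: polyf_sum => j.
  exact: homp_polyf (hom_mul (hp i) (hq j)).
by apply/funext => x; rewrite mulr_suml; apply: eq_bigr => i _; rewrite mulr_sumr.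
Qed.

Lemma polyf_nsq_sub (y : E) : polyf (fun x => nsq (x - y)).
Proof.
rewrite /nsq; apply: polyf_sum => i.
rewrite (_ : (fun x => _) = (fun x : E => (x ord0 i - y ord0 i) * (x ord0 i - y ord0 i))).
  by apply: polyfM; apply: polyfB; rewrite //; [exact: polyf_coord|exact: polyf_cst..|exact: polyf_coord|exact: polyf_cst].
by apply/funext => x; rewrite !mxE expr2.
Qed.

Lemma polyf_continuous f : polyf f -> continuous f.
Proof.
move=> [N [p [hp ->]]] x.
apply: (@continuous_big _ _ +%R 0 _ _ _ _ (fun (i : 'I_N) (x : E) => p i x)).
  exact: add_continuous.
by move=> i _ y; exact: hom_continuous (hp i) y.
Qed.

Lemma polyf_bounded f : polyf f -> exists2 C : R, 0 < C &
  forall x, nsq x <= 1 -> `|f x| <= C.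
Proof.
move=> [N [p [hp ->]]].
have /choice[C CP] : forall i, exists C : R, forall x, nsq x <= 1 -> `|p i x| <= C.
  by move=> i; have [C _ hC] := hom_bounded (hp i); exists C.
exists (\sum_(i < N) `|C i| + 1) => [|x x1]; first by rewrite ltr_wpDl// sumr_ge0.
rewrite (le_trans (ler_norm_sum _ _ _))// (@le_trans _ _ (\sum_(i < N) `|C i|))//.
  by apply: ler_sum => i _; rewrite (le_trans (CP i x x1))// ler_norm.
by rewrite lerDl.
Qed.

(** Neighbourhoods come from the sup norm; squared Euclidean balls are used from here on because
    [nsq] is a polynomial invariant under rotations. *)
Lemma nsq_sub_nbhs (y : E) (P : set E) : nbhs y P ->
  exists2 d : R, 0 < d & forall x, nsq (x - y) < d -> P x.
Proof.
move=> /nbhs_ballP[e /= e0 eP]; exists (e ^+ 2) => [|x xe]; first exact: exprn_gt0.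
apply: eP; split=> // i j; rewrite (ord1 i) /ball/= -ltr_sqr ?nnegrE ?(ltW e0) ?normr_ge0//.
apply: le_lt_trans xe; rewrite real_normK ?num_real// /nsq (bigD1 j)//= !mxE.
rewrite -[X in X <= _]sqrrN opprB lerDl; apply: sumr_ge0 => k _; exact: sqr_ge0.

Qed.

Lemma open_nsq_sub (y : E) (d : R) : open [set x : E | nsq (x - y) < d].
Proof.
apply: (@open_comp _ _ (fun x : E => nsq (x - y)) [set r | r < d]); last exact: open_lt.
by move=> x _; exact: polyf_continuous (polyf_nsq_sub y) x.
Qed.

Lemma nsq_continuous : continuous (@nsq R n).
Proof. exact: hom_continuous hom_nsq. Qed.

Definition cball (r : R) : set E := [set x | nsq x <= r].

Lemma cball_compact (r : R) : r <= 1 -> compact (cball r).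
Proof.
move=> r1; apply: bounded_closed_compact.
  exists 1; split; first exact: num_real.
  move=> M M1 x xr; rewrite /Num.Def.normr/= mx_normrE.
  rewrite (bigmax_le _ (ltW (lt_trans ltr01 M1)))// => -[i j] _ /=.
  by rewrite (ord1 i) (le_trans _ (ltW M1))// coord_le// (le_trans xr).
apply: (@closed_comp _ _ (@nsq R n) [set t | t <= r]); last exact: closed_le.
by move=> x _; exact: nsq_continuous.
Qed.

Lemma cball_subcover (r : R) (d : E -> R) : r <= 1 -> (forall y, 0 < d y) ->
  exists s : seq E, forall x, cball r x ->
    exists2 y, y \in s & cball r y /\ nsq (x - y) < d y.
Proof.
move=> r1 d0; have := @cball_compact r r1; rewrite compact_cover => cc.
have [|x xr|D Dr cD] := cc E (cball r) (fun y => [set x | nsq (x - y) < d y]).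
- by move=> y _; exact: open_nsq_sub.
- exists x => //=; rewrite subrr (_ : nsq 0 = 0)//.
  by rewrite /nsq big1// => i _; rewrite mxE expr0n.
exists (finmap.enum_fset D) => x xr; have [y Dy xy] := cD x xr.
by exists y => //; split=> //; have := Dr y Dy; rewrite inE.
Qed.

(** Continuity relative to the closed ball, since symbols are controlled only there when [r = 1];
    [d] bounds a squared distance. *)
Definition cball_continuous (r : R) f : Prop := forall y, cball r y ->
  forall e : R, 0 < e -> exists2 d : R, 0 < d &
    forall x, cball r x -> nsq (x - y) < d -> `|f x - f y| < e.

Definition poly_approx (r : R) f : Prop := forall e : R, 0 < e ->
  exists2 p, polyf p & forall x, cball r x -> `|f x - p x| <= e.

Lemma cball_continuous_bounded r f : r <= 1 -> cball_continuous r f ->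
  exists2 C : R, 0 < C & forall x, cball r x -> `|f x| <= C.
Proof.
move=> r1 cf.
have /choice[d dP] : forall y, exists d : R, 0 < d /\
    (cball r y -> forall x, cball r x -> nsq (x - y) < d -> `|f x - f y| < 1).
  move=> y; have [ry|ry] := pselect (cball r y); last by exists 1.
  by have [d d0 hd] := cf y ry 1 ltr01; exists d.
have [s sP] := cball_subcover r1 (fun y => (dP y).1).
exists (\sum_(y <- s) `|f y| + 1) => [|x xr].
  by rewrite ltr_wpDl// sumr_ge0.
have [y ys [yr xy]] := sP x xr.
have := ltW ((dP y).2 yr x xr xy) => h.
rewrite -(subrK (f y) (f x)) (le_trans (ler_normD _ _))// addrC lerD//.
rewrite (big_rem y)//= lerDl sumr_ge0//.
Qed.

(* [q (k+1) = q k + (t^2 - (q k)^2) / 2] increases to [|t|] on [-1, 1]. *)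
Fixpoint abs_approx (k : nat) (t : R) : R :=
  if k is k'.+1 then abs_approx k' t + (t ^+ 2 - abs_approx k' t ^+ 2) / 2 else 0.

(** Each step multiplies the error by [1 - (|t| + q) / 2], which is at most [1 - |t| / 2]. The third
    clause is the resulting bound in a form that survives induction without division; it yields the
    uniform error [2 / (k + 1)]. *)
Lemma abs_approxP k (t : R) : `|t| <= 1 ->
  [/\ 0 <= abs_approx k t, abs_approx k t <= `|t| &
      (`|t| - abs_approx k t) * (2 + k%:R * `|t|) <= 2 * `|t|].
Proof.
move=> t1; have t0 := normr_ge0 t.
have tt : t ^+ 2 = `|t| ^+ 2 by rewrite real_normK ?num_real.
elim: k => [|k [h1 h2 h3]] /=; first by split=> //; rewrite mul0r addr0 subr0 mulrC.
rewrite tt; move: h1 h2 h3; set q := abs_approx k t; set a := `|t| in t0 t1 *.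
move=> h1 h2 h3; split; [by nra|by nra|].
have k0 : (0 : R) <= k%:R by [].
have e : a - (q + (a ^+ 2 - q ^+ 2) / 2) = (a - q) * (1 - (a + q) / 2) by field.
have e2 : 2 + k.+1%:R * a = 2 + (k%:R * a + a) by rewrite -[k.+1]addn1 natrD mulrDl mul1r.
rewrite e e2.
have h4 : (1 - (a + q) / 2) <= 1 - a / 2 by lra.
have h5 : 0 <= 1 - (a + q) / 2 by lra.
have h6 : 0 <= a - q by lra.
have h7 : (1 - a / 2) * (2 + (k%:R * a + a)) <= 2 + k%:R * a.
  have : 0 <= k%:R * a * a by rewrite !mulr_ge0.
  have : 0 <= a * a by rewrite mulr_ge0.
  by move: (k%:R : R) => s; nra.
apply: le_trans h3; rewrite -mulrA ler_wpM2l//.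
by apply: le_trans h7; rewrite ler_wpM2r// !addr_ge0// mulr_ge0.
Qed.

Lemma abs_approx_le k (t : R) : `|t| <= 1 -> `| `|t| - abs_approx k t| <= 2 / k.+1%:R.
Proof.
move=> t1; have [h1 h2 h3] := abs_approxP k t1; rewrite ger0_norm ?subr_ge0//.
rewrite ler_pdivlMr// -[k.+1]addn1 natrD; move: h3 h1 h2 t1 (normr_ge0 t).
set a := `|t|; set q := abs_approx k t; have k0 : (0 : R) <= k%:R by [].
move: k0; move: (k%:R : R) => s k0 h3 h1 h2 t1 a0.
have [az|az] := eqVneq a 0.
  move: h1 h2; rewrite az => h1 h2; have -> : q = 0 by lra.
  by rewrite subrr mul0r.
have ap : 0 < a by rewrite lt_def az.
rewrite -(ler_pM2l ap).
have h5 : 0 <= a - q by lra.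
have h6 : 0 <= 2 - a by lra.
have := mulr_ge0 h5 h6; nra.
Qed.

Lemma polyf_abs_approx k f : polyf f -> polyf (fun x => abs_approx k (f x)).
Proof.
move=> hf; elim: k => [|k IH] /=; first exact: polyf_cst.
rewrite (_ : (fun x => _) = (fun x => abs_approx k (f x) +
   2^-1 * (f x * f x - abs_approx k (f x) * abs_approx k (f x)))).
  by apply: polyfD => //; apply: polyfZ; apply: polyfB; exact: polyfM.
by apply/funext => x; rewrite !expr2 [_ / 2]mulrC.
Qed.

Lemma poly_approx_polyf r f : polyf f -> poly_approx r f.
Proof. by move=> hf e e0; exists f => // x _; rewrite subrr normr0 ltW. Qed.

Lemma poly_approx_lim r f : (forall e : R, 0 < e ->
  exists2 g, poly_approx r g & forall x, cball r x -> `|f x - g x| <= e) ->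
  poly_approx r f.
Proof.
move=> h e e0; have e2 : 0 < e / 2 by rewrite divr_gt0.
have [g ag fg] := h _ e2; have [p hp gp] := ag _ e2; exists p => // x xr.
rewrite -(subrK (g x) (f x)) -addrA (le_trans (ler_normD _ _))//.
by have := fg x xr; have := gp x xr; lra.
Qed.

Lemma poly_approx_lin r (a b : R) f g : poly_approx r f -> poly_approx r g ->
  poly_approx r (fun x => a * f x + b * g x).
Proof.
move=> af ag e e0; pose K := `|a| + `|b| + 1.
have K0 : 0 < K by rewrite ltr_wpDl// addr_ge0.
have eK : 0 < e / K by rewrite divr_gt0.
have [p hp fp] := af _ eK; have [q hq gq] := ag _ eK.
exists (fun x => a * p x + b * q x) => [|x xr]; first exact: polyf_lin.
have -> : a * f x + b * g x - (a * p x + b * q x) = a * (f x - p x) + b * (g x - q x) by ring.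
rewrite (le_trans (ler_normD _ _))// !normrM.
apply: (@le_trans _ _ (`|a| * (e / K) + `|b| * (e / K))).
  by rewrite lerD// ler_wpM2l//; [exact: fp|exact: gq].
rewrite -mulrDl mulrA ler_pdivrMr// mulrC ler_pM2l// /K; lra.
Qed.

Lemma poly_approx_abs r f : r <= 1 -> poly_approx r f -> poly_approx r (fun x => `|f x|).
Proof.
move=> r1 af; apply: poly_approx_lim => e e0.
have [p hp fp] := af e e0; exists (fun x => `|p x|) => [|x xr]; last first.
  by rewrite (le_trans (ler_dist_dist _ _))// fp.
move=> d d0; have [C C0 hC] := polyf_bounded hp.
have [k hk] : exists k : nat, 2 * C / d < k.+1%:R.
  by exists (Num.truncn (2 * C / d)); rewrite truncnS_gt.
have hs : polyf (fun x => C^-1 * p x) by exact: polyfZ.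
exists (fun x => C * abs_approx k (C^-1 * p x)) => [|x xr].
  by apply: polyfZ; exact: polyf_abs_approx.
have t1 : `|C^-1 * p x| <= 1.
  rewrite normrM gtr0_norm ?invr_gt0// mulrC ler_pdivrMr// mul1r.
  by apply: hC; exact: le_trans xr r1.
have -> : `|p x| = C * `|C^-1 * p x|.
  by rewrite normrM gtr0_norm ?invr_gt0// mulVKf// gt_eqF.
rewrite -mulrBr normrM gtr0_norm//.
apply: (@le_trans _ _ (C * (2 / k.+1%:R))).
  by rewrite ler_pM2l// abs_approx_le.
rewrite mulrA ler_pdivrMr// [d * _]mulrC -ler_pdivrMr//.
by rewrite [C * 2]mulrC ltW.
Qed.

Lemma poly_approx_min r f g : r <= 1 -> poly_approx r f -> poly_approx r g ->
  poly_approx r (fun x => Num.min (f x) (g x)).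
Proof.
move=> r1 af ag.
have afg := poly_approx_abs r1 (poly_approx_lin 1 (-1) af ag).
have := poly_approx_lin (2^-1) (- 2^-1) (poly_approx_lin 1 1 af ag) afg.
congr poly_approx; apply/funext => x.
rewrite !mul1r mulN1r; have [fg|fg] := leP (f x) (g x).
  by rewrite ler0_norm ?subr_le0//; field.
by rewrite gtr0_norm ?subr_gt0//; field.
Qed.

(** [f] is approximated by the minimum of finitely many paraboloids [f y + e/3 + L |x - y|^2], each
    lying above [f] on the whole ball and within [e] of it near its vertex. Minima reduce to
    absolute values, which are limits of polynomials. *)
Theorem stone_weierstrass_cball r f : r <= 1 -> cball_continuous r f -> poly_approx r f.
Proof.
move=> r1 cf; have [F F0 FP] := cball_continuous_bounded r1 cf.
apply: poly_approx_lim => e e0.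
have e3 : 0 < e / 3 by rewrite divr_gt0.
have /choice[dL dLP] : forall y, exists dL : R * R, 0 < dL.1 /\ (cball r y ->
    (forall x, cball r x -> f x <= f y + e / 3 + dL.2 * nsq (x - y)) /\
    (forall x, cball r x -> nsq (x - y) < dL.1 ->
       f y + e / 3 + dL.2 * nsq (x - y) <= f x + e)).
  move=> y; have [ry|ry] := pselect (cball r y); last by exists (1, 0).
  have [d d0 hd] := cf y ry _ e3.
  (* At squared distance at least [d] the quadratic term exceeds [2 F], the largest possible
     oscillation of [f]. *)
  pose L := 2 * F / d; have L0 : 0 < L by rewrite divr_gt0// mulr_gt0.
  exists (Num.min d (e / 3 / L), L); split=> [|_].
    by rewrite /= lt_min d0 divr_gt0.
  split=> x xr /=.
    have [xd|xd] := ltP (nsq (x - y)) d.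
      have := hd x xr xd; rewrite ltr_norml => /andP[_ h].
      have := mulr_ge0 (ltW L0) (nsq_ge0 (x - y)); lra.
    have : 2 * F <= L * nsq (x - y).
      have <- : L * d = 2 * F by rewrite /L divfK ?gt_eqF.
      by rewrite ler_pM2l.
    have := FP x xr; have := FP y ry; rewrite !ler_norml => /andP[? ?] /andP[? ?].
    lra.
  rewrite lt_min => /andP[x1 x2].
  have := hd x xr x1; rewrite ltr_norml => /andP[h _].
  have : L * nsq (x - y) < e / 3 by rewrite -ltr_pdivlMl// mulrC.
  lra.
have [s sP] := cball_subcover r1 (fun y => (dLP y).1).
pose g y x := f y + e / 3 + (dL y).2 * nsq (x - y).
have ag y : poly_approx r (g y).
  apply: poly_approx_polyf; apply: polyfD; first exact: polyf_cst.
  by apply: polyfZ; exact: polyf_nsq_sub.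
pose s' := [seq y <- s | `[< cball r y >]].
(* The starting value [F + e] lies above [f]; only vertices inside the ball are kept, as only they
   are controlled. *)
pose G x := foldr (fun y m => Num.min (g y x) m) (F + e) s'.
have aG : poly_approx r G.
  rewrite /G; elim: (s') => [|y s1 IH] /=; first exact: poly_approx_polyf (polyf_cst _).
  exact: poly_approx_min.
have Gle x y : y \in s' -> G x <= g y x.
  rewrite /G; elim: (s') => // z s1 IH; rewrite inE => /orP[/eqP ->|/IH h] /=.
    by rewrite ge_min lexx.
  by rewrite ge_min h orbT.
have leG x : cball r x -> f x <= G x.
  move=> xr; rewrite /G.
  have : all (fun y => `[< cball r y >]) s' by exact: filter_all.
  elim: (s') => [_|y s1 IH /= /andP[/asboolP ry h]].
    by rewrite /= (le_trans (le_trans (ler_norm _) (FP x xr)))// lerDl ltW.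
  by rewrite le_min IH// andbT; have [_ /(_ ry)[+ _]] := dLP y; exact.
exists G => // x xr; rewrite ler_norml lerBrDl lerBlDl.
have [y ys [yr xy]] := sP x xr.
have ys' : y \in s' by rewrite mem_filter ys andbT; exact/asboolP.
have h1 := Gle x y ys'; have h2 := leG x xr.
have [_ /(_ yr)[_ /(_ x xr xy) h3]] := dLP y.
rewrite /g in h1; apply/andP; split; lra.
Qed.

End PolynomialApproximation.

(** * Maximum principle and uniform approximation by harmonic polynomials *)

Section MaximumPrinciple.
Context {R : realType} {n : nat}.
Local Notation E := 'rV[R]_n.
Local Notation basis i := (delta_mx ord0 i : 'rV[R]_n).
Implicit Types (f g u v : E -> R).

Lemma is_derive_line f (e x : E) (t d : R) : is_derive (t *: e + x) e f d ->
  is_derive t 1 (fun s => f (s *: e + x)) d.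
Proof.
move=> [df <-].
have E1 : (fun h : R => h^-1 *: (f ((h *: (1 : R) + t) *: e + x) - f (t *: e + x))) =
    (fun h : R => h^-1 *: (f (h *: e + (t *: e + x)) - f (t *: e + x))).
  by apply/funext => h; rewrite scalerDl addrA /GRing.scale/= mulr1.
apply: DeriveDef; first by rewrite /derivable; move: df; rewrite /derivable -E1.
by rewrite /derive -E1.
Qed.

(** At the maximum [psi 0 = 0]; if [L > 0] then [psi] is positive just to the right of 0, and the
    mean value theorem makes [phi] exceed its maximum. *)
Lemma second_derivative_max (phi psi : R -> R) (r L : R) : 0 < r ->
  (forall t : R, `|t| < r -> is_derive t 1 phi (psi t)) ->
  (forall t, `|t| < r -> phi t <= phi 0) ->
  is_derive (0 : R) 1 psi L -> L <= 0.
Proof.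
move=> r0 dphi phimax dpsi.
have in_r t : t \in `]-r, r[%R -> `|t| < r.
  by rewrite in_itv /= => /andP[h1 h2]; rewrite ltr_norml h1.
have psi0 : psi 0 = 0.
  have [||||_ h2] := @derive1_at_max R phi (-r) r 0.
  - by rewrite ge0_cp// ltW.
  - by move=> t /in_r /dphi [].
  - by rewrite in_itv /= r0 oppr_lt0 r0.
  - by move=> t /in_r; exact: phimax.
  have [_ h1] := dphi 0 ltac:(by rewrite normr0).
  by rewrite -h1 h2.
rewrite leNgt; apply/negP => L0.
have [d1 d2] := dpsi.
have : (fun h : R => h^-1 *: (psi (h *: (1 : R) + 0) - psi 0)) @ 0^' --> L.
  by rewrite -d2; exact: d1.
move/cvgrPdist_lt => /(_ L L0) /nbhs_ballP[s /= s0 sP].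
pose t := Num.min (r / 2) (s / 2).
have t0 : 0 < t by rewrite lt_min !divr_gt0.
have tr : t < r by rewrite gt_min; apply/orP; left; lra.
have ts : t < s by rewrite gt_min; apply/orP; right; lra.
have psi_gt0 c : 0 < c -> c <= t -> 0 < psi c.
  move=> c0 ct.
  have : ball 0 s c by rewrite /ball/= sub0r normrN gtr0_norm// (le_lt_trans ct).
  move/sP => /(_ (lt0r_neq0 c0)); rewrite psi0 subr0 /GRing.scale/= mulr1 addr0.
  rewrite ltr_norml => /andP[_]; rewrite ltrBlDl -ltrBlDr subrr => h.
  by move: h; rewrite pmulr_rgt0// invr_gt0.
have [||c ctz e] := @MVT R phi psi 0 t t0.
- move=> z; rewrite in_itv /= => /andP[z0 zt]; apply: dphi.
  by rewrite gtr0_norm// (lt_trans zt).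
- apply: derivable_within_continuous => z; rewrite in_itv /= => /andP[z0 zt].
  by have [] := dphi z ltac:(by rewrite ger0_norm// (le_lt_trans zt)).
move: ctz; rewrite in_itv /= => /andP[c0 ct].
have := phimax t ltac:(by rewrite gtr0_norm).
by rewrite -subr_le0 e subr0 leNgt mulr_gt0// psi_gt0// ltW.
Qed.

Lemma cball_continuous_on r f : (forall x, cball r x -> {for x, continuous f}) ->
  cball_continuous r f.
Proof.
move=> cf y ry e e0.
have h : nbhs y (fun x : E => `|f y - f x| < e).
  exact: (@cvgrPdist_lt _ _ _ (nbhs y) (nbhs_filter y) f (f y)).1 (cf y ry) e e0.
have [d d0 dP] := nsq_sub_nbhs h; exists d => // x xr xy.
by rewrite distrC; exact: dP.
Qed.

Lemma cball_uball r (x : E) : r < 1 -> cball r x -> uball x.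
Proof. by move=> r1 xr; apply/uball_nsq; exact: le_lt_trans r1. Qed.

Lemma line_nsq_sub i (x : E) (t : R) : nsq (t *: basis i + x - x) = t ^+ 2.
Proof.
rewrite addrK (hom_scale _ _ hom_nsq) /nsq (bigD1 i)//= mxE !eqxx expr1n.
rewrite big1 ?addr0 ?mulr1// => j /negbTE ji.
by rewrite mxE eqxx ji expr0n.
Qed.

(** Adding [eta |x|^2] makes the Laplacian equal to the positive number [2 eta n], which is
    incompatible with an interior maximum, where all pure second derivatives are at most zero. *)
Lemma maximum_principle (n_ge1 : (1 <= n)%N) v (r c : R) : 0 <= r -> r < 1 ->
  harmonic_on uball v -> (forall x, nsq x = r -> v x <= c) ->
  forall x, nsq x <= r -> v x <= c.
Proof.
move=> r0 r1 [vC vL] vc x0 x0r; rewrite leNgt; apply/negP => vx0.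
(* Small enough that [eta r < v x0 - c], so the perturbed function cannot attain its maximum on the
   bounding sphere. *)
pose eta := (v x0 - c) / (2 * (r + 1)).
have eta0 : 0 < eta by rewrite divr_gt0 ?subr_gt0// mulr_gt0// ltr_wpDl.
have eta1 : eta * r < v x0 - c.
  have -> : v x0 - c = eta * (2 * (r + 1)) by rewrite /eta divfK// gt_eqF// mulr_gt0// ltr_wpDl.
  by rewrite ltr_pM2l//; lra.
pose w x := v x + eta * nsq x.
have cw : {within cball r, continuous w}.
  apply/continuous_in_subspaceT => x /set_mem xr.
  have [vx _] := vC x (cball_uball r1 xr).
  apply: (@continuousD _ _ _ v (fun x => eta * nsq x)) => //.
  apply: (@continuousM _ _ (fun=> eta) (@nsq R n)); first exact: cst_continuous.
  exact: nsq_continuous.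
have [|x1 x1r x1max] := @compact_EVT_max _ R w (cball r) _ (cball_compact (ltW r1)) cw.
  by exists x0.
have {}x1r : nsq x1 <= r by exact/set_mem.
have wx : v x0 <= w x1.
  apply: le_trans (x1max x0 _); last exact/mem_set.
  by rewrite lerDl mulr_ge0 ?nsq_ge0// ltW.
move: (x1r); rewrite le_eqVlt => /orP[/eqP x1e|x1lt].
  by have := vc _ x1e; move: wx; rewrite /w x1e; lra.
have opn : nbhs x1 [set y : E | nsq y < r].
  apply: open_nbhs_nbhs; split=> //.
  by apply: (@open_comp _ _ (@nsq R n) [set t | t < r]); [move=> y _; exact: nsq_continuous|exact: open_lt].
have [d d0 dP] := nsq_sub_nbhs opn.
have U1 : uball x1 by exact: cball_uball r1 _.
have neg i : partial i (partial i v) x1 + 2 * eta <= 0.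
  pose phi t := v (t *: basis i + x1) + eta * nsq (t *: basis i + x1).
  pose psi t := partial i v (t *: basis i + x1) + eta * (2 * (t *: basis i + x1) ord0 i).
  have sd : 0 < Num.sqrt d by rewrite sqrtr_gt0.
  have near t : `|t| < Num.sqrt d -> nsq (t *: basis i + x1) < r.
    move=> td; apply: dP; rewrite line_nsq_sub -real_normK ?num_real//.
    by rewrite -(sqr_sqrtr (ltW d0)) ltr_sqr ?nnegrE ?sqrtr_ge0.
  apply: (second_derivative_max (phi := phi) (psi := psi) sd).
  - move=> t /near tr.
    have U : uball (t *: basis i + x1) by apply: (cball_uball r1); exact: ltW.
    have [_ /(_ i) [dv _ _]] := vC _ U.
    apply: is_deriveD; first by apply: is_derive_line; exact: derivableP.
    have := is_deriveZ eta (is_derive_line (hom_is_derive hom_nsq i (t *: basis i + x1))).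
    by rewrite partial_nsq.
  - move=> t /near tr.
    have := x1max (t *: basis i + x1) (mem_set (ltW tr)).
    by rewrite /phi scale0r add0r.
  - have [_ /(_ i) [_ _ /(_ i) [dv _]]] := vC _ U1.
    apply: is_deriveD.
      apply: is_derive_line; rewrite scale0r add0r; exact: derivableP.
    have := is_deriveZ (eta * 2) (is_derive_line (is_derive_coord (0 *: basis i + x1) (basis i) i)).
    rewrite mxE !eqxx /GRing.scale/= mulr1 [eta * 2]mulrC.
    congr is_derive; apply/funext => t /=.
    by rewrite /GRing.scale/=; ring.
have : laplacian v x1 + (2 * eta) *+ n <= 0.
  rewrite /laplacian -[X in _ *+ X]card_ord -sumr_const -big_split.
  by apply: sumr_le0 => i _; exact: neg.
rewrite vL// add0r => h.
have : 0 < (2 * eta) *+ n by rewrite pmulrn_lgt0// mulr_gt0.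
lra.
Qed.

Lemma hpoly_polyf f : hpoly f -> polyf f.
Proof. by move=> [N [h [hh ->]]]; exists N, h; split=> // m; have [] := hh m. Qed.

Lemma hpoly_is_derive f i x : hpoly f -> is_derive x (basis i) f (partial i f x).
Proof.
move=> [N [h [hh ->]]].
have hd := is_derive_bigsum (index_enum 'I_N) (F := fun m : 'I_N => h m)
  (fun m => hom_is_derive (hh m).1 i x).
by rewrite (is_derive_partial hd).
Qed.

Lemma hpoly_laplacian f x : hpoly f -> laplacian f x = 0.
Proof.
move=> [N [h [hh ->]]].
have p1 i : partial i (fun x => \sum_(m < N) h m x) = (fun x => \sum_(m < N) partial i (h m) x).
  apply/funext => y; apply: is_derive_partial; apply: is_derive_bigsum => m.
  exact: hom_is_derive (hh m).1 _ _.
have p2 i y : partial i (fun x => \sum_(m < N) partial i (h m) x) y =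
    \sum_(m < N) partial i (partial i (h m)) y.
  apply: is_derive_partial; apply: is_derive_bigsum => m.
  exact: hom_is_derive (hom_partial i (hh m).1) _ _.
rewrite /laplacian (eq_bigr (fun i => \sum_(m < N) partial i (partial i (h m)) x)).
  by rewrite exchange_big big1// => m _; have [_] := hh m; exact.
by move=> i _; rewrite p1 p2.
Qed.

Lemma hpoly_harmonic D f : hpoly f -> harmonic_on D f.
Proof.
move=> hf; split=> [x _|x _]; last exact: hpoly_laplacian.
have cont g : hpoly g -> continuous g by move=> hg; exact: polyf_continuous (hpoly_polyf hg).
split; first exact: cont.
move=> i; have hi := hpoly_partial i hf; split.
- by have [] := hpoly_is_derive i x hf.
- exact: cont.
- move=> j; split; first by have [] := hpoly_is_derive j x hi.
  exact: cont (hpoly_partial j hi) x.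
Qed.

(** A polynomial close to [u] is replaced by the harmonic polynomial with the same values on the
    bounding sphere; the maximum principle, applied to the difference and to its opposite, extends
    the estimate inside. *)
Theorem harmonic_approx (n_ge1 : (1 <= n)%N) u (r e : R) : 0 <= r -> r < 1 -> 0 < e ->
  harmonic_on uball u -> exists2 h, hpoly h & forall x, cball r x -> `|u x - h x| <= e.
Proof.
move=> r0 r1 e0 hu.
have cu : cball_continuous r u.
  by apply: cball_continuous_on => x /(cball_uball r1) /hu.1 [].
have [p [N [q [hq pE]]] up] := stone_weierstrass_cball (ltW r1) cu e0.
have /choice[H HP] : forall m, exists h, hpoly h /\ forall x, nsq x = r -> q m x = h x.
  by move=> m; have [h hh hE] := hom_sphere_hpoly n_ge1 r (hq m); exists h.
pose h x := \sum_(m < N) H m x.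
have hh : hpoly h by apply: hpoly_sum => m; have [] := HP m.
have hp x : nsq x = r -> p x = h x.
  by move=> xr; rewrite pE; apply: eq_bigr => m _; have [_ ->] := HP m.
exists h => // x xr.
have har a : harmonic_on uball (fun x => a * u x + (- a) * h x).
  exact: (harmonic_onD a (- a) (@open_uball R n) hu (hpoly_harmonic _ hh)).
have bnd y : nsq y = r -> `|u y - h y| <= e.
  by move=> yr; rewrite -hp//; apply: up; rewrite /cball/= yr.
have h1 := maximum_principle n_ge1 (c := e) r0 r1 (har 1) _ xr.
have h2 := maximum_principle n_ge1 (c := e) r0 r1 (har (-1)) _ xr.
rewrite ler_norml; apply/andP; split.
  have : -1 * u x + - -1 * h x <= e.
    by apply: h2 => y /bnd; rewrite ler_norml => /andP[]; lra.
  lra.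
have : 1 * u x + - 1 * h x <= e.
  by apply: h1 => y /bnd; rewrite ler_norml => /andP[]; lra.
lra.
Qed.

End MaximumPrinciple.

(** * Interior estimates and limits of harmonic functions *)

Section Annulus.
Context {R : realType} {n : nat} (nu : probability (borel_rV R n) R).
Hypothesis nu_boundary : charges_boundary nu.
Local Notation E := 'rV[R]_n.

Definition annulus (r s : R) : set E := [set x | r <= nsq x <= s].

Lemma annulus_measurable r s : measurable (annulus r s : set (borel_rV R n)).
Proof.
have -> : annulus r s = ~` [set x | nsq x < r] `&` ~` [set x | s < nsq x].
  apply/seteqP; split=> x /=; rewrite /annulus/=.
    by move=> /andP[h1 h2]; split; apply/negP; rewrite -leNgt.
  by move=> [/negP h1 /negP h2]; rewrite -leNgt in h1; rewrite -leNgt in h2; rewrite h1.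
apply: measurableI; apply: measurableC; apply: sub_sigma_algebra.
  by apply: (@open_comp _ _ (@nsq R n) [set t | t < r]); [move=> y _; exact: nsq_continuous|exact: open_lt].
by apply: (@open_comp _ _ (@nsq R n) [set t | s < t]); [move=> y _; exact: nsq_continuous|exact: open_gt].
Qed.

(** Countably many annuli with outer radius below 1 cover a neighbourhood of the boundary, so not
    all are null. The bound [s < 1] matters: the annulus then stays where harmonic functions are
    bounded and uniformly approximable. *)
Lemma annulus_charged r : 0 < r -> r < 1 ->
  exists s, [/\ r <= s, s < 1 & (0 < nu (annulus r s : set (borel_rV R n)))%E].
Proof.
move=> r0 r1.
pose s k : R := 1 - k.+1%:R^-1.
have s1 k : s k < 1 by rewrite ltrBlDr ltrDl invr_gt0.
suff [k hk] : exists k, (0 < nu (annulus r (s k) : set (borel_rV R n)))%E.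
  exists (s k); split=> //; rewrite leNgt; apply/negP => sr.
  move: hk; rewrite (_ : annulus r (s k) = set0) ?measure0 ?ltxx//.
  apply/seteqP; split=> x //=; rewrite /annulus/= => /andP[h1 h2].
  by have := le_lt_trans (le_trans h1 h2) sr; rewrite ltxx.
apply/not_existsP => h.
have n0 k : nu (annulus r (s k) : set (borel_rV R n)) = 0%E.
  apply/eqP; rewrite eq_le measure_ge0 andbT leNgt; apply/negP; exact: h.
(* Annuli are cut by [nsq], whereas the hypothesis on [nu] uses the Euclidean norm. *)
pose q := Num.sqrt r.
have q0 : 0 < q by rewrite sqrtr_gt0.
have q1 : q < 1 by rewrite -sqrtr1 ltr_sqrt.
have := nu_boundary (introT andP (conj q0 q1)); apply/negP; rewrite -leNgt.
pose F := [set x : E | uball x /\ (q <= enorm x)%R].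
have FU : F `<=` \bigcup_k annulus r (s k).
  move=> x [/uball_nsq Bx qx].
  have rx : r <= nsq x.
    by move: qx; rewrite /q /enorm -/(nsq x) ler_sqrt// nsq_ge0.
  have d0 : 0 < 1 - nsq x by rewrite subr_gt0.
  exists (Num.truncn (1 - nsq x)^-1) => //; rewrite /annulus/= rx /= /s.
  rewrite lerBrDl -lerBrDr invf_ple ?posrE//.
  exact: ltW (truncnS_gt _).
have mU : measurable (\bigcup_k annulus r (s k) : set (borel_rV R n)).
  by apply: bigcup_measurable => k _; exact: annulus_measurable.
have mF : measurable (F : set (borel_rV R n)).
  rewrite (_ : F = uball `&` annulus r 1).
    by apply: measurableI; [exact: measurable_uball|exact: annulus_measurable].
  apply/seteqP; split=> x [Bx hx]; split=> //.
    move/uball_nsq : (Bx) => /ltW B1; rewrite /annulus/= B1 andbT.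
    by move: hx; rewrite /q /enorm -/(nsq x) ler_sqrt// nsq_ge0.
  by move: hx => /andP[hx _]; rewrite /q /enorm -/(nsq x) ler_sqrt// nsq_ge0.
apply: (@le_trans _ _ (\sum_(k <oo) nu (annulus r (s k) : set (borel_rV R n)))%E).
  by apply: measure_sigma_subadditive => // k; exact: annulus_measurable.
by rewrite eseries0.
Qed.

Definition annulus_weight (r s : R) (x : E) : R := \1_(annulus r s) x.

Lemma annulus_weightE r s x : annulus_weight r s x = (r <= nsq x <= s)%R%:R.
Proof.
rewrite /annulus_weight indicE; congr (_%:R); congr nat_of_bool.
by apply/idP/idP => [/set_mem|h] //; exact/mem_set.
Qed.

Lemma weight_annulus r s : weight (annulus_weight r s).
Proof.
split; last by move=> M x oM; rewrite !annulus_weightE nsq_rotate.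
split; first by apply: measurable_indic; exact: annulus_measurable.
by exists 1 => x _; rewrite annulus_weightE; case: (_ <= _ <= _)%R; rewrite ?normr1 ?normr0.
Qed.

Hypothesis nu_ball : nu uball = 1%E.

Lemma bint_annulus_gt0 r s : s < 1 -> (0 < nu (annulus r s : set (borel_rV R n)))%E ->
  0 < bint nu (annulus_weight r s).
Proof.
move=> s1 h; rewrite /bint /Rintegral.
have -> : (\int[nu]_(x in uball) (annulus_weight r s x)%:E)%E =
    nu (annulus r s : set (borel_rV R n)).
  rewrite (integral_indic nu (@measurable_uball R n) (annulus_measurable r s)).
  congr (nu _); apply/seteqP; split=> x; first by case.
  move=> hx; split=> //; apply: (cball_uball s1).
  by move: hx => /andP[].
rewrite fine_gt0// h /=.
by rewrite (le_lt_trans (probability_le1 _ (annulus_measurable r s))) ?ltry.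
Qed.

End Annulus.

(** * Summability of polynomial growth against geometric decay *)

Section PolynomialGrowth.
Context {R : realType}.

Lemma expn_succ_le (k N : nat) : (N.+1 ^ k.+1 <= k.+1 * N.+1 ^ k + N ^ k.+1)%N.
Proof.
elim: k => [|k IH]; first by rewrite !expn1 expn0 mul1n.
rewrite expnS (leq_trans (leq_mul (leqnn N.+1) IH))//.
rewrite mulnDr mulnCA -expnS [(N.+1 * N ^ _)%N]mulSn -expnS addnA leq_add2r.
by rewrite [(k.+2 * _)%N]mulSn addnC leq_add2r leq_exp2r.
Qed.

(** Summation by parts: multiplying by [1 - t] replaces [(m + 1)^(k+1)] by its increments, which are
    at most [(k + 1) (m + 1)^k]. *)
Lemma poly_growth_sum (k : nat) (t : R) : 0 <= t -> t < 1 ->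
  exists2 C : R, 0 < C & forall N, \sum_(m < N) (m.+1 ^ k)%:R * t ^+ m <= C.
Proof.
move=> t0 t1; have d0 : 0 < 1 - t by rewrite subr_gt0.
elim: k => [|k [C C0 hC]].
  exists (1 - t)^-1 => [|N]; first by rewrite invr_gt0.
  rewrite -[X in _ <= X]mul1r ler_pdivlMr// mulrC.
  suff -> : (1 - t) * \sum_(m < N) (m.+1 ^ 0)%:R * t ^+ m = 1 - t ^+ N.
    by rewrite gerBl exprn_ge0.
  elim: N => [|N IH]; first by rewrite big_ord0 mulr0 expr0 subrr.
  by rewrite big_ord_recr mulrDr IH /= expn0 mul1r exprS; ring.
exists (k.+1%:R * C / (1 - t)) => [|N]; first by rewrite divr_gt0// mulr_gt0.
rewrite ler_pdivlMr// mulrC.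
suff h : (1 - t) * \sum_(m < N) (m.+1 ^ k.+1)%:R * t ^+ m <=
    k.+1%:R * (\sum_(m < N) (m.+1 ^ k)%:R * t ^+ m) - (N ^ k.+1)%:R * t ^+ N.
  apply: le_trans h _; rewrite lerBlDr (@le_trans _ _ (k.+1%:R * C))//.
    by rewrite ler_pM2l// hC.
  by rewrite lerDl mulr_ge0// exprn_ge0.
elim: N => [|N IH]; first by rewrite !big_ord0 !mulr0 exp0n// mul0r subrr.
rewrite !big_ord_recr /= !mulrDr.
have tN : 0 <= t ^+ N by rewrite exprn_ge0.
have := expn_succ_le k N; rewrite -(ler_nat R) natrD natrM => /(ler_wpM2r tN).
rewrite mulrDl; move: IH.
rewrite [t ^+ N.+1]exprS.
move: (\sum_(m < N) _) (\sum_(m < N) _) (N.+1 ^ k.+1)%:R (N.+1 ^ k)%:R (N ^ k.+1)%:R (k.+1%:R : R) (t ^+ N) tN.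
clear; move=> a b c d e f g g0 h1 h2.
have -> : (1 - t) * (c * g) = c * g - c * (t * g) by ring.
rewrite -mulrA in h2; lra.
Qed.

End PolynomialGrowth.

(** * Interior bounds for harmonic polynomials and their derivatives *)

Section HarmonicBounds.
Context {R : realType} {n : nat} (nu : probability (borel_rV R n) R).
Hypothesis n_ge2 : (2 <= n)%N.
Hypothesis nu_ball : nu uball = 1%E.
Hypothesis nu_invariant : rotation_invariant nu.
Hypothesis nu_boundary : charges_boundary nu.
Local Notation E := 'rV[R]_n.
Implicit Types (f g h u : E -> R).

Lemma hpoly_bmeas h : hpoly h -> bmeas h.
Proof.
move=> [N [p [hp ->]]]; apply: bmeas_sum => i; exact: hom_bmeas (hp i).1.
Qed.

Lemma annulus_weight_ge0 r s (x : E) : 0 <= annulus_weight r s x.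
Proof. by rewrite annulus_weightE. Qed.

Section FixedAnnulus.
Variables r s : R.
Hypothesis r0 : 0 < r.
Let w : E -> R := annulus_weight r s.
Let mass : R := bint nu w.
Hypothesis mass_gt0 : 0 < mass.
Let ww : weight w := weight_annulus r s.

Lemma moment_step m : r * wint nu w (fun x => nsq x ^+ m) <=
  wint nu w (fun x => nsq x ^+ m.+1).
Proof.
have bX k : bmeas (fun x : E => nsq x ^+ k) by exact: hom_bmeas (hom_nsqX k).
rewrite -(wintZ nu _ ww.1)// /wint; apply: le_bint.
- by apply: bmeasM; [exact: ww.1|exact: bmeasZ].
- by apply: bmeasM; [exact: ww.1|exact: bX].
move=> x _; rewrite /w annulus_weightE; case: (boolP (r <= nsq x <= s)) => [/andP[h1 h2]|_] /=.
  by rewrite !mul1r exprS ler_wpM2r// exprn_ge0// nsq_ge0.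
by rewrite !mul0r.
Qed.

Lemma moment_ge m : r ^+ m * mass <= wint nu w (fun x => nsq x ^+ m).
Proof.
elim: m => [|m IH].
  rewrite expr0 mul1r /mass /wint (_ : (fun x => w x * _) = w)//.
  by apply/funext => x; rewrite expr0 mulr1.
by rewrite exprS -mulrA; apply: le_trans (moment_step m); rewrite ler_pM2l.
Qed.

Lemma moment_gt0 m : 0 < wint nu w (fun x => nsq x ^+ m).
Proof. by apply: lt_le_trans (moment_ge m); rewrite mulr_gt0// exprn_gt0. Qed.

(** The annulus lies outside the squared radius [r], so its moment is at least [r^m mass], while
    [|x|^(2m) <= (t^2 r)^m]. The quotient [t^(2m)] is the decay that lets the degrees be summed. *)
Lemma Harm_degree_bound m f (t : R) x : 0 <= t -> nsq x <= t ^+ 2 * r -> Harm m f ->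
  f x ^+ 2 <= (m.+1 ^ n)%:R * (t ^+ m) ^+ 2 / mass * wint nu w (fun x => f x * f x).
Proof.
move=> t0 xt hf.
have F0 := form_ge0 n_ge2 nu_ball nu_invariant ww (moment_gt0 m) hf.
have := Harm_pointwise n_ge2 nu_ball nu_invariant ww (moment_gt0 m) x hf.
rewrite -ler_pdivlMr ?moment_gt0// => h; apply: le_trans h _.
set F := wint nu w _; set W := wint nu w _.
have W0 : 0 < W := moment_gt0 m.
rewrite ler_pdivrMr//.
have e : (m.+1 ^ n)%:R * (t ^+ m) ^+ 2 / mass * F * W =
    ((m.+1 ^ n)%:R * F) * ((t ^+ m) ^+ 2 * (W / mass)).
  by field; rewrite gt_eqF.
rewrite e mulrAC ler_wpM2l ?mulr_ge0//.
apply: (@le_trans _ _ ((t ^+ 2 * r) ^+ m)).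
  by rewrite lerXn2r// ?nnegrE ?nsq_ge0 ?mulr_ge0 ?sqr_ge0// ltW.
rewrite exprMn -!exprM mulnC ler_wpM2l ?exprn_ge0// ler_pdivlMr//.
exact: moment_ge.
Qed.

(** Both sides are evaluated by the Fischer form, in which the derivative in direction [j] is one of
    the summands. The ratio of coefficients is [(m + 1) (2 m + n)], at most [n (m + 1)^2] since
    [n >= 2]; the factor [1 / r] compares consecutive moments. *)
Lemma form_partial_le m f j : Harm m.+1 f ->
  wint nu w (fun x => partial j f x * partial j f x) <=
  n%:R * (m.+1 ^ 2)%:R / r * wint nu w (fun x => f x * f x).
Proof.
move=> hf.
rewrite (wint_Harm_fischer n_ge2 nu_ball nu_invariant ww hf hf).
rewrite (wint_Harm_fischer n_ge2 nu_ball nu_invariant ww (Harm_partial j hf) (Harm_partial j hf)).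
set W := wint nu w _; set W' := wint nu w _.
have WW : r * W <= W' := moment_step m.
have fis : fischer m (partial j f) (partial j f) <= fischer m.+1 f f.
  rewrite /= (bigD1 j)//= lerDl; apply: sumr_ge0 => i _; exact: fischer_ge0.
have f0 := fischer_ge0 m (partial j f); have f1 := fischer_ge0 m.+1 f.
have W0 : 0 < W := moment_gt0 m.
have c0 := moment_coef_gt0 (R := R) n_ge2 m.
have n0 : (0 : R) < n%:R by rewrite ltr0n (leq_trans _ n_ge2).
have p0 : (0 : R) < m.+1%:R * (2 * m%:R + n%:R).
  by rewrite mulr_gt0// ltr_wpDl// mulr_ge0.
apply: (@le_trans _ _ (moment_coef (R := R) (n := n) m * fischer m.+1 f f * (W' / r))).
  apply: ler_pM; rewrite ?mulr_ge0 ?(ltW c0)// ?(ltW W0)//; first by rewrite ler_pM2l.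
  by rewrite ler_pdivlMr// mulrC.
have -> : n%:R * (m.+1 ^ 2)%:R / r * (moment_coef (R := R) (n := n) m.+1 * fischer m.+1 f f * W') =
   (moment_coef (R := R) (n := n) m * fischer m.+1 f f * (W' / r)) *
   (n%:R * (m.+1 ^ 2)%:R / (m.+1%:R * (2 * m%:R + n%:R))).
  have m0 : (0 : R) <= m%:R by [].
  by rewrite [moment_coef m.+1]/=; field; apply/and3P; split; apply: lt0r_neq0;
    [rewrite ltr_wpDl ?mulr_ge0|rewrite ltr_wpDr|exact: r0].
have W'0 : 0 < W' := moment_gt0 m.+1.
apply: ler_peMr; first exact: mulr_ge0 (mulr_ge0 (ltW c0) f1) (divr_ge0 (ltW W'0) (ltW r0)).
rewrite ler_pdivlMr// mul1r -!natrM -natrD -natrM ler_nat.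
move: n_ge2; clear; nia.
Qed.

(** Different degrees are orthogonal, so the integral of the squared sum splits into nonnegative
    terms. *)
Lemma form_component_le N (p : nat -> E -> R) (m : 'I_N) : (forall m, Harm m (p m)) ->
  wint nu w (fun x => p m x * p m x) <=
  wint nu w (fun x => (\sum_(m < N) p m x) * (\sum_(m < N) p m x)).
Proof.
move=> hp; have bw := ww.1.
have bp k : bmeas (p k) by exact: hom_bmeas (hp k).1.
have -> : (fun x : E => (\sum_(m < N) p m x) * (\sum_(m < N) p m x)) =
    (fun x => \sum_(i < N) \sum_(j < N) p i x * p j x).
  by apply/funext => x; rewrite mulr_suml; apply: eq_bigr => i _; rewrite mulr_sumr.
rewrite (wint_sum nu _ bw); last first.
  by move=> i; apply: bmeas_sum => j; exact: bmeasM.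
have e (i : 'I_N) : wint nu w (fun x => \sum_(j < N) p i x * p j x) =
    wint nu w (fun x => p i x * p i x).
  rewrite (wint_sum nu _ bw); last by move=> j; exact: bmeasM.
  rewrite (bigD1 i)//= big1 ?addr0// => j ji.
  apply: (wint_Harm_orthogonal n_ge2 nu_ball nu_invariant _ ww (hp i) (hp j)).
  by move=> /val_inj h; rewrite h eqxx in ji.
under eq_bigr do rewrite e.
rewrite (bigD1 m)//= lerDl; apply: sumr_ge0 => i _.
by have := form_ge0 n_ge2 nu_ball nu_invariant ww (moment_gt0 i) (hp i).
Qed.

(** Each component is controlled by the norm of the whole polynomial, with a constant polynomial in
    the degree times [t^m]; the sum over degrees is bounded independently of their number. A
    derivative costs one more power of the degree, hence the exponent [n + 1]. *)
Lemma hpoly_annulus_bounds (t : R) : 0 <= t -> t < 1 -> exists2 C : R, 0 < C &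
  forall h x, hpoly h -> nsq x <= t ^+ 2 * r ->
    h x ^+ 2 <= C * wint nu w (fun x => h x * h x) /\
    forall j, partial j h x ^+ 2 <= C * wint nu w (fun x => h x * h x).
Proof.
move=> t0 t1.
have [C1 C10 h1] := poly_growth_sum n t0 t1.
have [C2 C20 h2] := poly_growth_sum n.+1 t0 t1.
have n0 : (0 : R) < n%:R by rewrite ltr0n (leq_trans _ n_ge2).
exists (C1 ^+ 2 / mass + C2 ^+ 2 * n%:R / (r * mass)).
  by rewrite addr_gt0// divr_gt0// ?mulr_gt0 ?exprn_gt0.
move=> h x [N [p [hp hE]]] xt.
have F0 : 0 <= wint nu w (fun x => h x * h x).
  apply: bint_ge0 => y _; rewrite mulr_ge0 ?annulus_weight_ge0//.
  by rewrite -expr2 sqr_ge0.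
have Fle (m : 'I_N) : wint nu w (fun x => p m x * p m x) <= wint nu w (fun x => h x * h x).
  by rewrite hE; exact: form_component_le.
set F := wint nu w (fun x => h x * h x) in F0 Fle *.
have ptw (m : 'I_N) : `|p m x| <= (m.+1 ^ n)%:R * t ^+ m * Num.sqrt (F / mass).
  rewrite -ler_sqr ?nnegrE ?mulr_ge0 ?exprn_ge0 ?sqrtr_ge0// real_normK ?num_real//.
  have := Harm_degree_bound t0 xt (hp m) => h3; apply: le_trans h3 _.
  rewrite !exprMn sqr_sqrtr; last by rewrite divr_ge0// ltW.
  have -> : (m.+1 ^ n)%:R * (t ^+ m) ^+ 2 / mass * wint nu w (fun x0 => p m x0 * p m x0) =
      (m.+1 ^ n)%:R * ((t ^+ m) ^+ 2 * (wint nu w (fun x0 => p m x0 * p m x0) / mass)).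
    by field; rewrite gt_eqF.
  have Fm : 0 <= wint nu w (fun x0 => p m x0 * p m x0).
    by have := form_ge0 n_ge2 nu_ball nu_invariant ww (moment_gt0 m) (hp m).
  rewrite -mulrA; apply: ler_pM => //.
  - by apply: mulr_ge0; [exact: sqr_ge0|exact: divr_ge0 Fm (ltW mass_gt0)].
  - by rewrite -natrX ler_nat -[X in (X <= _)%N]expn1 leq_pexp2l// expn_gt0.
  - apply: ler_wpM2l; first exact: sqr_ge0.
    by apply: ler_wpM2r; [rewrite invr_ge0 ltW|exact: Fle].
have ptw' j (m : nat) : (m.+1 < N)%N -> `|partial j (p m.+1) x| <=
    (m.+1 ^ n.+1)%:R * t ^+ m * Num.sqrt (n%:R * F / (r * mass)).
  move=> mN.
  rewrite -ler_sqr ?nnegrE ?mulr_ge0 ?exprn_ge0 ?sqrtr_ge0// real_normK ?num_real//.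
  have := Harm_degree_bound t0 xt (Harm_partial j (hp m.+1)) => h3; apply: le_trans h3 _.
  rewrite !exprMn sqr_sqrtr; last by rewrite divr_ge0 ?mulr_ge0// ltW.
  have h4 := form_partial_le j (hp m.+1).
  have h5 := Fle (Ordinal mN); rewrite /= in h5.
  apply: (@le_trans _ _ ((m.+1 ^ n)%:R * (t ^+ m) ^+ 2 / mass * (n%:R * (m.+1 ^ 2)%:R / r * F))).
    apply: ler_wpM2l.
      by apply: divr_ge0 (ltW mass_gt0); apply: mulr_ge0 => //; exact: sqr_ge0.
    apply: le_trans h4 _; apply: ler_wpM2l => //.
    by apply: divr_ge0 (ltW r0); exact: mulr_ge0.
  have -> : (m.+1 ^ n)%:R * (t ^+ m) ^+ 2 / mass * (n%:R * (m.+1 ^ 2)%:R / r * F) =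
     (m.+1 ^ n * m.+1 ^ 2)%:R * ((t ^+ m) ^+ 2 * (n%:R * F / (r * mass))).
    by rewrite natrM; field; rewrite !gt_eqF.
  rewrite -[X in _ <= X]mulrA; apply: ler_wpM2r.
    apply: mulr_ge0; first exact: sqr_ge0.
    by apply: divr_ge0; [exact: mulr_ge0|exact/ltW/mulr_gt0].
  rewrite -natrX ler_nat -expnD -expnM leq_pexp2l//; clear; lia.
have hx : `|h x| <= C1 * Num.sqrt (F / mass).
  rewrite hE (le_trans (ler_norm_sum _ _ _))//.
  apply: (@le_trans _ _ (\sum_(m < N) (m.+1 ^ n)%:R * t ^+ m * Num.sqrt (F / mass))).
    by apply: ler_sum => m _; exact: ptw.
  by rewrite -mulr_suml ler_wpM2r ?sqrtr_ge0.
have dx j : `|partial j h x| <= C2 * Num.sqrt (n%:R * F / (r * mass)).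
  have -> : partial j h x = \sum_(m < N) partial j (p m) x.
    rewrite hE; apply: is_derive_partial; apply: is_derive_bigsum => m.
    exact: hom_is_derive (hp m).1 _ _.
  rewrite (le_trans (ler_norm_sum _ _ _))//.
  case: N p hp hE Fle ptw ptw' => [|N] p hp hE Fle ptw ptw'.
    by rewrite big_ord0 mulr_ge0 ?sqrtr_ge0// ltW.
  rewrite big_ord_recl.
  have -> : partial j (p (ord0 : 'I_N.+1)) x = 0.
    by have [[c ->] _] := hp 0%N; rewrite partial_cst.
  rewrite normr0 add0r.
  apply: (@le_trans _ _ (\sum_(m < N) (m.+1 ^ n.+1)%:R * t ^+ m * Num.sqrt (n%:R * F / (r * mass)))).
    by apply: ler_sum => m _; apply: ptw'; rewrite ltnS.
  by rewrite -mulr_suml ler_wpM2r ?sqrtr_ge0.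
have sq (a b : R) : `|a| <= b -> a ^+ 2 <= b ^+ 2.
  move=> ab; rewrite -[a ^+ 2]real_normK ?num_real// ler_sqr ?nnegrE//.
  exact: le_trans ab.
split=> [|j].
  apply: le_trans (sq _ _ hx) _; rewrite exprMn sqr_sqrtr; last by rewrite divr_ge0// ltW.
  rewrite mulrDl -[X in X <= _]addr0 lerD//; first by rewrite mulrA mulrAC.
  exact: mulr_ge0 (divr_ge0 (mulr_ge0 (sqr_ge0 C2) (ltW n0)) (ltW (mulr_gt0 r0 mass_gt0))) F0.
apply: le_trans (sq _ _ (dx j)) _; rewrite exprMn sqr_sqrtr; last first.
  by rewrite divr_ge0 ?mulr_ge0// ltW.
rewrite mulrDl -[X in X <= _]add0r lerD//.
  exact: mulr_ge0 (divr_ge0 (sqr_ge0 C1) (ltW mass_gt0)) F0.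
by rewrite -!mulrA; rewrite [(r * _)^-1 * F]mulrC.
Qed.

End FixedAnnulus.

Lemma hpoly_bounds (q : R) : 0 <= q -> q < 1 -> exists s, [/\ q <= s, s < 1 &
  exists2 C : R, 0 < C & forall h x, hpoly h -> nsq x <= q ->
    h x ^+ 2 <= C * wint nu (annulus_weight 0 s) (fun x => h x * h x) /\
    forall j, partial j h x ^+ 2 <= C * wint nu (annulus_weight 0 s) (fun x => h x * h x)].
Proof.
move=> q0 q1; pose r := (1 + q) / 2.
have r0 : 0 < r by rewrite /r; lra.
have r1 : r < 1 by rewrite /r; lra.
have qr : q < r by rewrite /r; lra.
have [s [rs s1 mu]] := annulus_charged nu_boundary r0 r1.
have mass0 := bint_annulus_gt0 s1 mu.
pose t := Num.sqrt (q / r).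
have t0 : 0 <= t by exact: sqrtr_ge0.
have t1 : t < 1 by rewrite -sqrtr1 ltr_sqrt// ltr_pdivrMr// mul1r.
have tq : t ^+ 2 * r = q.
  by rewrite sqr_sqrtr ?divfK ?gt_eqF// divr_ge0// ltW.
have [C C0 hC] := hpoly_annulus_bounds r0 mass0 t0 t1.
exists s; split=> //; first by rewrite (le_trans (ltW qr)).
exists C => // h x hh xq; have := hC h x hh; rewrite tq => /(_ xq) [h1 h2].
have bh := hpoly_bmeas hh.
have W : wint nu (annulus_weight r s) (fun x => h x * h x) <=
         wint nu (annulus_weight 0 s) (fun x => h x * h x).
  apply: le_bint; [by apply: bmeasM; [exact: (weight_annulus _ _).1|exact: bmeasM]..|].
  move=> y _; rewrite ler_wpM2r -?expr2 ?sqr_ge0// !annulus_weightE nsq_ge0 /=.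
  by rewrite ler_nat; case: (r <= nsq y) => //; case: (nsq y <= s).
split=> [|j]; first by rewrite (le_trans h1)// ler_pM2l.
by rewrite (le_trans (h2 j))// ler_pM2l.
Qed.

End HarmonicBounds.

Section Rate.
Context (R : realType).

Definition rate (k : nat) : R := k.+1%:R^-1.

Lemma rate_gt0 k : 0 < rate k.
Proof. by rewrite /rate invr_gt0. Qed.

Lemma rate_le1 k : rate k <= 1.
Proof. by rewrite /rate invf_le1 ?ler1n. Qed.

Lemma rate_small (c e : R) : 0 <= c -> 0 < e ->
  exists k, forall l, (k <= l)%N -> c * rate l <= e.
Proof.
move=> c0 e0; exists (Num.truncn (c / e)) => l kl.
rewrite /rate ler_pdivrMr// mulrC -ler_pdivrMr//.
by rewrite ltW// (lt_le_trans (truncnS_gt _))// ler_nat.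
Qed.

End Rate.

(** * Interior estimates for harmonic functions and locally uniform limits *)

Section HarmonicLimits.
Context {R : realType} {n : nat} (nu : probability (borel_rV R n) R).
Hypothesis n_ge2 : (2 <= n)%N.
Hypothesis nu_ball : nu uball = 1%E.
Hypothesis nu_invariant : rotation_invariant nu.
Hypothesis nu_boundary : charges_boundary nu.
Local Notation E := 'rV[R]_n.
Local Notation basis i := (delta_mx ord0 i : 'rV[R]_n).
Implicit Types (f g h u : E -> R).

Lemma annulus0E s (x : E) : annulus_weight 0 s x = (nsq x <= s)%R%:R.
Proof. by rewrite annulus_weightE nsq_ge0. Qed.

Lemma cutoff_bmeas s u : s < 1 -> (forall x, uball x -> {for x, continuous u}) ->
  bmeas (fun x => annulus_weight 0 s x * u x).
Proof.
move=> s1 cu; split.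
  apply: measurable_funM; first exact: (weight_annulus _ _).1.1.
  exact: continuous_measurable.
have [|C C0 hC] := cball_continuous_bounded (r := s) (f := u) (ltW s1).
  by apply: cball_continuous_on => x /(cball_uball s1); exact: cu.
exists C => x _; rewrite annulus0E; have [xs|xs] := boolP (nsq x <= s).
  by rewrite mul1r hC.
by rewrite mul0r normr0 ltW.
Qed.

Lemma cutoff_sqr_bmeas s u : s < 1 -> (forall x, uball x -> {for x, continuous u}) ->
  bmeas (fun x => annulus_weight 0 s x * (u x * u x)).
Proof.
move=> s1 cu; rewrite (_ : (fun x => _) = (fun x =>
   (annulus_weight 0 s x * u x) * (annulus_weight 0 s x * u x))).
  by apply: bmeasM; exact: cutoff_bmeas.
by apply/funext => x; rewrite annulus0E; case: (_ <= _); rewrite ?mul1r ?mul0r.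
Qed.

Lemma harmonic_continuous u : harmonic_on uball u ->
  forall x, uball x -> {for x, continuous u}.
Proof. by move=> [hu _] x /hu[]. Qed.

Lemma harmonic_bound (q : R) : 0 <= q -> q < 1 -> exists s, [/\ q <= s, s < 1 &
  exists2 C : R, 0 < C & forall u x, harmonic_on uball u -> nsq x <= q ->
    u x ^+ 2 <= C * wint nu (annulus_weight 0 s) (fun x => u x * u x)].
Proof.
move=> q0 q1.
have [s [qs s1 [C C0 hC]]] := hpoly_bounds n_ge2 nu_ball nu_invariant nu_boundary q0 q1.
exists s; split=> //; exists (4 * C) => [|u x hu xq]; first by rewrite mulr_gt0.
apply/ler_addgt0Pr => e e0.
pose d := Num.min 1 (e / (4 * C + 2)).
have K0 : 0 < 4 * C + 2 by lra.
have d0 : 0 < d by rewrite lt_min ltr01 divr_gt0.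
have d1 : d <= 1 by rewrite ge_min lexx.
have de : d * (4 * C + 2) <= e by rewrite -ler_pdivlMr// ge_min lexx orbT.
have dd : d ^+ 2 <= d by rewrite expr2 ler_piMr// ltW.
have [h hh uh] := harmonic_approx (ltnW n_ge2) (le_trans q0 qs) s1 d0 hu.
have [hx _] := hC h x hh xq.
have cu := harmonic_continuous hu.
set W := wint nu _ _.
have : wint nu (annulus_weight 0 s) (fun x => h x * h x) <= 2 * W + 2 * d ^+ 2.
  have bu := cutoff_sqr_bmeas s1 cu.
  rewrite /W /wint -[X in _ <= _ + X](bint_cst nu_ball) -bintZ// -bintD; last 2 first.
  - exact: bmeasZ.
  - exact: bmeas_cst.
  apply: le_bint.
  - by apply: bmeasM; [exact: (weight_annulus _ _).1|apply: bmeasM; exact: hpoly_bmeas].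
  - by apply: bmeasD; [exact: bmeasZ|exact: bmeas_cst].
  move=> y _; rewrite annulus0E; have [ys|ys] := boolP (nsq y <= s); last first.
    by rewrite !mul0r mulr0 add0r mulr_ge0// sqr_ge0.
  rewrite !mul1r; have := uh y ys; rewrite ler_norml => /andP[h1 h2].
  have := sqr_ge0 (2 * u y - h y).
  have : (u y - h y) ^+ 2 <= d ^+ 2.
    by rewrite -[(u y - h y) ^+ 2]real_normK ?num_real// ler_sqr ?nnegrE ?(ltW d0)// uh.
  by rewrite !expr2; nra.
have := uh x (le_trans xq qs) => h1 h2.
have h3 : (u x - h x) ^+ 2 <= d ^+ 2.
  by rewrite -[(u x - h x) ^+ 2]real_normK ?num_real// ler_sqr ?nnegrE ?(ltW d0).
have h4 : u x ^+ 2 <= 2 * h x ^+ 2 + 2 * d ^+ 2.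
  by have := sqr_ge0 (u x - 2 * h x); move: h3; rewrite !expr2; nra.
have h5 := ler_wpM2l (ltW C0) h2.
have : C * (2 * W + 2 * d ^+ 2) = 2 * C * W + 2 * C * d ^+ 2 by ring.
have : C * d ^+ 2 <= C * d by rewrite ler_pM2l.
lra.
Qed.

Lemma mean_value_signed (phi psi : R -> R) (tau t : R) :
  (forall s : R, `|s| <= tau -> is_derive s 1 phi (psi s)) -> `|t| <= tau ->
  exists2 c, `|c| <= `|t| & phi t - phi 0 = psi c * t.
Proof.
move=> d tt.
have cont a b : (forall z, z \in `[a, b]%R -> `|z| <= tau) -> {within `[a, b], continuous phi}.
  by move=> h; apply: derivable_within_continuous => z /h /d [].
have [t0|t0|->] := ltgtP t 0; last first.
- by exists 0 => //; rewrite subrr mulr0.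
- have [z|| c] := @MVT R phi psi 0 t t0.
  + rewrite in_itv /= => /andP[z0 zt]; apply: d; rewrite gtr0_norm// (le_trans (ltW zt))//.
    by rewrite (le_trans (ler_norm _)).
  + apply: cont => z; rewrite in_itv /= => /andP[z0 zt]; rewrite ger0_norm//.
    by rewrite (le_trans zt)// (le_trans (ler_norm _)).
  rewrite in_itv /= => /andP[c0 ct] e; exists c; last by rewrite e subr0.
  by rewrite !gtr0_norm// ltW.
- have [z|| c] := @MVT R phi psi t 0 t0.
  + rewrite in_itv /= => /andP[z0 zt]; apply: d; rewrite ltr0_norm//.
    by rewrite (le_trans _ tt)// ltr0_norm// lerN2 ltW.
  + apply: cont => z; rewrite in_itv /= => /andP[z0 zt]; rewrite ler0_norm//.
    by rewrite (le_trans _ tt)// ltr0_norm// lerN2.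
  rewrite in_itv /= => /andP[c0 ct] e; exists c.
    by rewrite !ltr0_norm// lerN2 ltW.
  by rewrite -opprB e sub0r mulrN opprK.
Qed.

(** Two applications of the mean value theorem; the factor 1/2 of the sharp remainder is given
    up. *)
Lemma taylor2 (phi psi chi : R -> R) (tau M t : R) :
  (forall s : R, `|s| <= tau -> is_derive s 1 phi (psi s)) ->
  (forall s : R, `|s| <= tau -> is_derive s 1 psi (chi s)) ->
  (forall s : R, `|s| <= tau -> `|chi s| <= M) -> `|t| <= tau ->
  `|phi t - phi 0 - t * psi 0| <= M * t ^+ 2.
Proof.
move=> d1 d2 hM tt; have [c ct e] := mean_value_signed d1 tt.
have ctau := le_trans ct tt.
have [b bc e'] := mean_value_signed d2 ctau.
have -> : phi t - phi 0 - t * psi 0 = chi b * (c * t) by rewrite e mulrA -e'; ring.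
rewrite normrM ler_pM//; first by apply: hM; exact: le_trans ctau.
by rewrite normrM -real_normK ?num_real// expr2 ler_wpM2r.
Qed.

Lemma hpoly_partial_le (q : R) : 0 <= q -> q < 1 -> exists s, [/\ q <= s, s < 1 &
  exists2 C : R, 0 < C & forall h B x j, hpoly h -> 0 <= B ->
    (forall y, nsq y <= s -> `|h y| <= B) -> nsq x <= q -> `|partial j h x| <= C * B].
Proof.
move=> q0 q1.
have [s [qs s1 [C C0 hC]]] := hpoly_bounds n_ge2 nu_ball nu_invariant nu_boundary q0 q1.
exists s; split=> //; exists (Num.sqrt C) => [|h B x j hh B0 hB xq]; first by rewrite sqrtr_gt0.
rewrite -ler_sqr ?nnegrE ?mulr_ge0 ?sqrtr_ge0// real_normK ?num_real//.
have [_ /(_ j) h1] := hC h x hh xq; apply: le_trans h1 _.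
rewrite exprMn sqr_sqrtr ?(ltW C0)// ler_pM2l// -[X in _ <= X](bint_cst nu_ball).
apply: le_bint.
- by apply: bmeasM; [exact: (weight_annulus _ _).1|apply: bmeasM; exact: hpoly_bmeas].
- exact: bmeas_cst.
move=> y _; rewrite annulus0E; have [ys|ys] := boolP (nsq y <= s); last first.
  by rewrite mul0r sqr_ge0.
by rewrite mul1r -expr2 -real_normK ?num_real// ler_sqr ?nnegrE// hB.
Qed.

(** Turns out to be equivalent to harmonicity on the ball. It involves only values, not derivatives,
    and is visibly closed under locally uniform limits, which is how such limits are shown to be
    harmonic. *)
Definition locally_hpoly u : Prop := forall r e : R, 0 <= r -> r < 1 -> 0 < e ->
  exists2 h, hpoly h & forall x, nsq x <= r -> `|u x - h x| <= e.

Lemma harmonic_locally_hpoly u : harmonic_on uball u -> locally_hpoly u.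
Proof. by move=> hu r e r0 r1 e0; exact: (harmonic_approx (ltnW n_ge2) r0 r1 e0 hu). Qed.

Lemma uball_nbhs r (x : E) : nsq x < r -> nbhs x [set y : E | nsq y < r].
Proof.
move=> xr; apply: open_nbhs_nbhs; split=> //.
by apply: (@open_comp _ _ (@nsq R n) [set t | t < r]); [move=> y _; exact: nsq_continuous|exact: open_lt].
Qed.

Lemma locally_hpoly_continuous u x : locally_hpoly u -> uball x -> {for x, continuous u}.
Proof.
move=> lu /uball_nsq x1; pose r := (1 + nsq x) / 2.
have xr : nsq x < r by rewrite /r; lra.
have r1 : r < 1 by rewrite /r; lra.
apply/(@cvgrPdist_le _ _ _ (nbhs x) (nbhs_filter x)) => e e0.
have e3 : 0 < e / 3 by rewrite divr_gt0.
have [h hh uh] := lu r (e / 3) (ltW (le_lt_trans (nsq_ge0 x) xr)) r1 e3.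
have ch : nbhs x (fun y : E => `|h x - h y| <= e / 3).
  exact: (@cvgrPdist_le _ _ _ (nbhs x) (nbhs_filter x) h (h x)).1 (polyf_continuous (hpoly_polyf hh) (x := x)) _ e3.
apply: (@filterS _ (nbhs x) (nbhs_filter x) _ _ _ (@filterI _ (nbhs x) (nbhs_filter x) _ _ ch (uball_nbhs xr))).
move=> y [hxy yr].
have := uh y (ltW yr); have := uh x (ltW xr); move: hxy.
rewrite !ler_norml => /andP[? ?] /andP[? ?] /andP[? ?]; apply/andP; split; lra.
Qed.

(** The limit is the supremum of the lower bounds [a k - c rate k], each of which lies below every
    upper bound [a l + c rate l]. *)
Lemma cauchy_rate (a : nat -> R) (c : R) :
  (forall k l, `|a k - a l| <= c * rate R k + c * rate R l) ->
  exists A, forall k, `|a k - A| <= c * rate R k.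
Proof.
move=> h; pose S := [set a k - c * rate R k | k in setT].
have ub l : ubound S (a l + c * rate R l).
  move=> _ [k _ <-]; have := h k l; rewrite ler_norml => /andP[_]; lra.
have hS : has_sup S by split; [exists (a 0 - c * rate R 0), 0%N|exists (a 0 + c * rate R 0); exact: ub].
exists (sup S) => k; rewrite ler_norml; apply/andP; split.
  have : sup S <= a k + c * rate R k by apply: ge_sup; [exact: hS.1|exact: ub].
  lra.
have : a k - c * rate R k <= sup S by apply: ub_le_sup; [exact: hS.2|exists k].
lra.
Qed.

(* The remainder estimate passes to the limit of the approximating polynomials,
   which gives the derivative without any interchange of limits. *)
Lemma locally_hpoly_partial (q : R) : 0 <= q -> q < 1 -> exists s, [/\ q <= s, s < 1 &
  exists2 C : R, 0 < C & forall u, locally_hpoly u ->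
    (forall x i, nsq x <= q -> derivable u x (basis i)) /\
    forall h e, hpoly h -> 0 <= e -> (forall y, nsq y <= s -> `|u y - h y| <= e) ->
      forall x i, nsq x <= q -> `|partial i u x - partial i h x| <= C * e].
Proof.
move=> q0 q1; pose q' := (1 + q) / 2.
have qq' : q < q' by rewrite /q'; lra.
have q'1 : q' < 1 by rewrite /q'; lra.
have q'0 : 0 <= q' by rewrite /q'; lra.
(* The radii are nested: from [q] to [q'] leaves room for short segments, and the enlargements to
   [s1] and then [s2] pay for one derivative each. *)
have [s1 [qs1 s11 [C1 C10 hC1]]] := hpoly_partial_le q'0 q'1.
have [s2 [ss s21 [C2 C20 hC2]]] := hpoly_partial_le (le_trans q'0 qs1) s11.
have s20 := le_trans (le_trans q'0 qs1) ss.
exists s2; split=> //; first exact: le_trans (ltW qq') (le_trans qs1 ss).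
exists C1 => // u lu.
have /choice[h hP] : forall k : nat, exists h, hpoly h /\
    forall x, nsq x <= s2 -> `|u x - h x| <= rate R k.
  by move=> k; have [|h hh uh] := lu s2 (rate R k) s20 s21; [exact: rate_gt0|exists h].
have kpos k := @rate_gt0 R k.
have d1 f g e x i : hpoly f -> hpoly g -> 0 <= e ->
    (forall y, nsq y <= s2 -> `|f y - g y| <= e) -> nsq x <= q' ->
    `|partial i f x - partial i g x| <= C1 * e.
  move=> hf hg e0 fg xq.
  have -> : partial i f x - partial i g x = partial i (fun y => f y - g y) x.
    apply/esym/is_derive_partial.
    exact: is_deriveB (hpoly_is_derive i x hf) (hpoly_is_derive i x hg).
  by apply: hC1 => //; [exact: hpolyB|move=> y ys; apply: fg; exact: le_trans ss].
have /choice[d dP] : forall xi : E * 'I_n, exists d, nsq xi.1 <= q' ->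
    forall k, `|partial xi.2 (h k) xi.1 - d| <= C1 * rate R k.
  move=> [x i] /=; have [xq|xq] := pselect (nsq x <= q'); last by exists 0.
  have [|d hd] := cauchy_rate (a := fun k => partial i (h k) x) (c := C1); last by exists d.
  move=> k l; rewrite -mulrDr; apply: d1 => //; [exact: (hP k).1|exact: (hP l).1|..].
    by rewrite addr_ge0// ltW.
  move=> y ys; have := (hP k).2 y ys; have := (hP l).2 y ys.
  rewrite !ler_norml => /andP[? ?] /andP[? ?]; apply/andP; split; lra.
have [B B0 hB] : exists2 B : R, 0 < B & forall k y, nsq y <= s2 -> `|h k y| <= B.
  have [|B B0 hB] := cball_continuous_bounded (r := s2) (f := u) (ltW s21).
    by apply: cball_continuous_on => x /(cball_uball s21); exact: locally_hpoly_continuous.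
  exists (B + 1) => [|k y ys]; first by rewrite addr_gt0.
  have k1 := @rate_le1 R k.
  have := (hP k).2 y ys; have := hB y ys.
  rewrite !ler_norml => /andP[? ?] /andP[? ?]; apply/andP; split; lra.
(* Bound on the second derivatives of all the approximants, hence on the Taylor remainder uniformly
   in [k]. *)
pose M := C1 * (C2 * B).
have M0 : 0 < M by rewrite !mulr_gt0.
have line x i : nsq x <= q -> exists2 tau : R, 0 < tau &
    forall s, `|s| <= tau -> nsq (s *: basis i + x) <= q'.
  move=> xq; have [d' d'0 d'P] := nsq_sub_nbhs (uball_nbhs (le_lt_trans xq qq')).
  exists (Num.min 1 (d' / 2)) => [|s hs]; first by rewrite lt_min ltr01 divr_gt0.
  apply: ltW; apply: d'P; rewrite line_nsq_sub.
  move: hs; rewrite le_min => /andP[h1 h2].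
  rewrite -real_normK ?num_real//; have := normr_ge0 s; nra.
have tay x i : nsq x <= q -> exists2 tau : R, 0 < tau & forall t, `|t| <= tau ->
    `|u (t *: basis i + x) - u x - t * d (x, i)| <= M * t ^+ 2.
  move=> xq; have [tau tau0 tauP] := line x i xq; exists tau => // t tt.
  have xq' := le_trans xq (ltW qq').
  have xs2 := le_trans xq' (le_trans qs1 ss).
  have ts2 := le_trans (tauP t tt) (le_trans qs1 ss).
  apply/ler_addgt0Pr => e e0.
  pose K := 2 + `|t| * C1; have K0 : 0 < K by rewrite ltr_pwDl ?mulr_ge0// ltW.
  have [k /(_ k (leqnn k)) ke] := rate_small (ltW K0) e0.
  have hk1 := (hP k).1; have hk2 := hpoly_partial i hk1.
  have T : `|h k (t *: basis i + x) - h k x - t * partial i (h k) x| <= M * t ^+ 2.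
    have D1 (s : R) : is_derive s 1 (fun s : R => h k (s *: basis i + x))
        (partial i (h k) (s *: basis i + x)).
      exact: is_derive_line (hpoly_is_derive i (s *: basis i + x) hk1).
    have D2 (s : R) : is_derive s 1 (fun s : R => partial i (h k) (s *: basis i + x))
        (partial i (partial i (h k)) (s *: basis i + x)).
      exact: is_derive_line (hpoly_is_derive i (s *: basis i + x) hk2).
    have CB : 0 <= C2 * B by rewrite mulr_ge0// ltW.
    have b2 y : nsq y <= s1 -> `|partial i (h k) y| <= C2 * B.
      by move=> ys; exact: (hC2 (h k) B y i hk1 (ltW B0) (hB k) ys).
    have b3 (s : R) : `|s| <= tau -> `|partial i (partial i (h k)) (s *: basis i + x)| <= M.
      move=> hs; exact: (hC1 (partial i (h k)) (C2 * B) (s *: basis i + x) i hk2 CB b2 (tauP s hs)).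
    have := taylor2 (fun s _ => D1 s) (fun s _ => D2 s) b3 tt.
    by rewrite scale0r add0r.
  have h1 := (hP k).2 _ ts2; have h2 := (hP k).2 _ xs2.
  have h3 := ler_wpM2l (normr_ge0 t) (dP (x, i) xq' k); rewrite /= -normrM mulrA in h3.
  have -> : u (t *: basis i + x) - u x - t * d (x, i) =
    (h k (t *: basis i + x) - h k x - t * partial i (h k) x) +
    ((u (t *: basis i + x) - h k (t *: basis i + x)) - (u x - h k x) +
     t * (partial i (h k) x - d (x, i))) by ring.
  apply: le_trans (ler_normD _ _) _; apply: lerD => //.
  apply: le_trans (ler_normD _ _) _.
  apply: le_trans (lerD (ler_normB _ _) h3) _.
  apply: le_trans ke; rewrite /K mulrDl; lra.
have der x i : nsq x <= q -> is_derive x (basis i) u (d (x, i)).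
  move=> xq; have [tau tau0 tauP] := tay x i xq.
  have c : (fun t : R => t^-1 *: (u (t *: basis i + x) - u x)) @ 0^' --> d (x, i).
    apply/cvgrPdist_le => e e0; apply/nbhs_ballP.
    exists (Num.min tau (e / M)) => [|t /=]; first by rewrite /= lt_min tau0 divr_gt0.
    rewrite /ball/= sub0r normrN lt_min => /andP[t1 t2] t0.
    have := tauP t (ltW t1); rewrite /GRing.scale/= => h1.
    have -> : d (x, i) - t^-1 * (u (t *: basis i + x) - u x) =
       - (t^-1 * (u (t *: basis i + x) - u x - t * d (x, i))) by field.
    rewrite normrN normrM normfV ler_pdivrMl ?normr_gt0//.
    apply: le_trans h1 _; rewrite -real_normK ?num_real// expr2 mulrA [M * _]mulrC -mulrA.
    by rewrite ler_wpM2l// mulrC -ler_pdivlMr// ltW.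
  by apply: DeriveDef; [apply/cvg_ex; exists (d (x, i))|exact/cvg_lim].
split=> [x i xq|g e hg e0 ug x i xq]; first by have [] := der x i xq.
rewrite (is_derive_partial (der x i xq)).
apply/ler_addgt0Pr => e' e'0.
have [|k /(_ k (leqnn k)) ke] := rate_small (c := 2 * C1) _ e'0.
  by rewrite mulr_ge0// ltW.
have xq' := le_trans xq (ltW qq').
have h1 := dP (x, i) xq' k; rewrite /= in h1.
have h2 : `|partial i (h k) x - partial i g x| <= C1 * (rate R k + e).
  apply: d1 => //; [exact: (hP k).1|by rewrite addr_ge0// ltW|move=> y ys].
  have := (hP k).2 y ys; have := ug y ys.
  rewrite !ler_norml => /andP[? ?] /andP[? ?]; apply/andP; split; lra.
have h3 : C1 * (rate R k + e) = C1 * rate R k + C1 * e by ring.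
have h4 : 2 * C1 * rate R k = C1 * rate R k + C1 * rate R k by ring.
move: h1 h2; rewrite h3 !ler_norml => /andP[? ?] /andP[? ?]; apply/andP; split; lra.
Qed.

Lemma locally_hpoly_partialP u i : locally_hpoly u -> locally_hpoly (partial i u).
Proof.
move=> lu q e q0 q1 e0.
have [s [qs s1 [C C0 hC]]] := locally_hpoly_partial q0 q1.
have [_ hd] := hC u lu.
have [|h hh uh] := lu s (e / C) (le_trans q0 qs) s1; first by rewrite divr_gt0.
exists (partial i h) => [|x xq]; first exact: hpoly_partial.
have := hd h (e / C) hh (ltW (divr_gt0 e0 C0)) uh x i xq.
by rewrite mulrC divfK// gt_eqF.
Qed.

Lemma locally_hpoly_derivable u i x : locally_hpoly u -> uball x ->
  derivable u x (basis i).
Proof.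
move=> lu /uball_nsq x1.
have [s [qs s1 [C C0 hC]]] := locally_hpoly_partial (nsq_ge0 x) x1.
by have [h _] := hC u lu; exact: h.
Qed.

(** The property is inherited by partial derivatives, which provides the regularity; the Laplacian
    is then within any [e] of that of a harmonic polynomial, which is zero. *)
Theorem locally_hpoly_harmonic u : locally_hpoly u -> harmonic_on uball u.
Proof.
move=> lu; split=> x Bx.
  split; first exact: locally_hpoly_continuous.
  move=> i; have li := locally_hpoly_partialP i lu; split.
  - exact: locally_hpoly_derivable.
  - exact: locally_hpoly_continuous.
  - move=> j; split; first exact: locally_hpoly_derivable.
    exact: locally_hpoly_continuous (locally_hpoly_partialP j li) Bx.
have x1 := (uball_nsq x).1 Bx.
have [s [qs s1 [C C0 hC]]] := locally_hpoly_partial (nsq_ge0 x) x1.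
have s0 := le_trans (nsq_ge0 x) qs.
have [s' [ss s'1 [C' C'0 hC']]] := locally_hpoly_partial s0 s1.
apply/eqP; rewrite -normr_eq0 eq_le normr_ge0 andbT; apply/ler_addgt0Pr => e e0.
rewrite add0r; pose K := C * C' * n%:R.
have n0 : (0 : R) < n%:R by rewrite ltr0n (leq_trans _ n_ge2).
have K0 : 0 < K by rewrite !mulr_gt0.
have eK : 0 < e / K by rewrite divr_gt0.
have [h hh uh] := lu s' (e / K) (le_trans s0 ss) s'1 eK.
have -> : laplacian u x = \sum_i (partial i (partial i u) x - partial i (partial i h) x).
  by rewrite sumrB -[X in _ - X]/(laplacian h x) (hpoly_laplacian x hh) subr0.
apply: le_trans (ler_norm_sum _ _ _) _.
apply: (@le_trans _ _ (\sum_(i < n) C * (C' * (e / K)))); last first.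
  rewrite sumr_const card_ord -mulr_natr.
  suff -> : C * (C' * (e / K)) * n%:R = e by [].
  by rewrite /K; field; rewrite !gt_eqF.
apply: ler_sum => i _.
have li := locally_hpoly_partialP i lu.
have [_ hd] := hC _ li; apply: hd => //; first exact: hpoly_partial.
  by rewrite mulr_ge0// ltW.
move=> y ys; have [_ hd'] := hC' _ lu.
by apply: hd' => //; exact: ltW.
Qed.

Lemma harmonic_limit (v : nat -> E -> R) u : (forall k, harmonic_on uball (v k)) ->
  (forall r e : R, 0 <= r -> r < 1 -> 0 < e ->
     exists k, forall x, nsq x <= r -> `|u x - v k x| <= e) ->
  harmonic_on uball u.
Proof.
move=> hv uv; apply: locally_hpoly_harmonic => r e r0 r1 e0.
have e2 : 0 < e / 2 by rewrite divr_gt0.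
have [k hk] := uv r _ r0 r1 e2.
have [h hh vh] := harmonic_locally_hpoly (hv k) r0 r1 e2.
exists h => // x xr; have := hk x xr; have := vh x xr.
rewrite !ler_norml => /andP[? ?] /andP[? ?]; apply/andP; split; lra.
Qed.

End HarmonicLimits.

(** * Square integrable functions and the harmonic Hilbert space *)

Section SquareIntegrable.
Context {R : realType} {n : nat} (nu : probability (borel_rV R n) R).
Local Notation E := 'rV[R]_n.
Local Notation ball := (uball : set (borel_rV R n)).
Implicit Types (f g h u w : E -> R).

Definition integ f : Prop := nu.-integrable ball (EFin \o f).

Lemma integ_measurable f : integ f -> measurable_fun ball f.
Proof. by move=> /measurable_int/measurable_EFinP. Qed.

Lemma le_integ f g : measurable_fun ball f -> integ g ->
  (forall x, uball x -> `|f x| <= g x) -> integ f.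
Proof.
move=> mf ig fg; apply: (le_integrable (measurable_uball) _ _ ig).
  exact/measurable_EFinP.
by move=> x Bx /=; rewrite lee_fin (le_trans (fg x Bx))// ler_norm.
Qed.

Lemma eq_integ f g : (forall x, uball x -> f x = g x) -> integ f -> integ g.
Proof.
move=> fg; apply: eq_integrable; first exact: measurable_uball.
by move=> x /set_mem Bx /=; rewrite fg.
Qed.

Lemma integD f g : integ f -> integ g -> integ (fun x => f x + g x).
Proof. by move=> hf hg; have := integrableD measurable_uball hf hg. Qed.

Lemma integZ (a : R) f : integ f -> integ (fun x => a * f x).
Proof. by move=> hf; have := integrableZl measurable_uball a hf. Qed.

Lemma integ_lin (a b : R) f g : integ f -> integ g -> integ (fun x => a * f x + b * g x).
Proof. by move=> hf hg; apply: integD; exact: integZ. Qed.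

Lemma integ_norm f : integ f -> integ (fun x => `|f x|).
Proof. by move=> /integrable_norm. Qed.

Lemma integ_bmeasM w f : bmeas w -> integ f -> integ (fun x => w x * f x).
Proof.
move=> [mw [M hM]] hf; apply: (@le_integ _ (fun x => M * `|f x|)).
- exact: measurable_funM mw (integ_measurable hf).
- exact/integZ/integ_norm.
by move=> x Bx; rewrite normrM ler_wpM2r// hM.
Qed.

Lemma bmeas_integ f : bmeas f -> integ f.
Proof. exact: bmeas_integrable. Qed.

Lemma ibint_lin (a b : R) f g : integ f -> integ g ->
  bint nu (fun x => a * f x + b * g x) = a * bint nu f + b * bint nu g.
Proof.
move=> hf hg; have mB := @measurable_uball R n.
by rewrite /bint RintegralD//; [rewrite !RintegralZl|exact: integZ..].
Qed.

Lemma ibintD f g : integ f -> integ g ->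
  bint nu (fun x => f x + g x) = bint nu f + bint nu g.
Proof. by move=> hf hg; rewrite /bint RintegralD//; exact: measurable_uball. Qed.

Lemma ibintB f g : integ f -> integ g ->
  bint nu (fun x => f x - g x) = bint nu f - bint nu g.
Proof. by move=> hf hg; rewrite /bint RintegralB//; exact: measurable_uball. Qed.

Lemma ibintZ (a : R) f : integ f -> bint nu (fun x => a * f x) = a * bint nu f.
Proof. by move=> hf; rewrite /bint RintegralZl//; exact: measurable_uball. Qed.

Lemma le_ibint f g : integ f -> integ g -> (forall x, uball x -> f x <= g x) ->
  bint nu f <= bint nu g.
Proof. by move=> hf hg fg; apply: le_Rintegral => //; exact: measurable_uball. Qed.

Lemma EFin_bint f : integ f -> (bint nu f)%:E = (\int[nu]_(x in uball) (f x)%:E)%E.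
Proof.
by move=> hf; rewrite /bint /Rintegral fineK// integrable_fin_num//; exact: measurable_uball.
Qed.

Lemma bint_fatou (F : nat -> E -> R) f (M : R) :
  (forall k, integ (F k)) -> (forall k x, uball x -> 0 <= F k x) ->
  (forall x, uball x -> (fun k => F k x) @ \oo --> f x) -> measurable_fun ball f ->
  (forall k, bint nu (F k) <= M) -> integ f /\ bint nu f <= M.
Proof.
move=> hF F0 Ff mf FM; have mB := @measurable_uball R n.
have f0 x : uball x -> 0 <= f x.
  move=> Bx; rewrite -(cvg_lim _ (Ff x Bx))//; apply: limr_ge; first by apply/cvg_ex; exists (f x); exact: Ff.
  by apply: nearW => k; exact: F0.
have le : (\int[nu]_(x in uball) (f x)%:E <= M%:E)%E.
  have -> : (\int[nu]_(x in uball) (f x)%:E =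
      \int[nu]_(x in uball) limn_einf (fun k => (F k x)%:E))%E.
    apply: eq_integral => x /set_mem Bx.
    rewrite (cvg_limn_einf_sup (l := (f x)%:E))//.
    by apply: cvg_EFin; [exact: nearW|exact: Ff].
  apply: le_trans (fatou nu mB _ _) _.
  - by move=> k; exact: measurable_int (hF k).
  - by move=> k x Bx; rewrite lee_fin F0.
  rewrite limn_einf_lim; apply: lime_le; first exact: is_cvg_einfs.
  apply: nearW => k; apply: (@le_trans _ _ (\int[nu]_(x in uball) (F k x)%:E)%E).
    apply: ereal_inf_lbound; exists k => //=.
  by rewrite -EFin_bint// lee_fin.
have hf : integ f.
  apply/integrableP; split; first exact/measurable_EFinP.
  apply: (@le_lt_trans _ _ M%:E); last exact: ltry.
  apply: le_trans le; apply: ge0_le_integral => //.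
  - by apply: measurableT_comp => //; exact/measurable_EFinP.
  - exact/measurable_EFinP.
  by move=> x Bx /=; rewrite lee_fin ger0_norm// f0.
by split=> //; rewrite -lee_fin EFin_bint.
Qed.

Definition sqint f : Prop := measurable_fun ball f /\ integ (fun x => f x * f x).

Lemma sqint_integM f g : sqint f -> sqint g -> integ (fun x => f x * g x).
Proof.
move=> [mf hf] [mg hg]; apply: (le_integ _ (integD hf hg)).
  exact: measurable_funM.
move=> x _; rewrite ler_norml; have := sqr_ge0 (f x + g x); have := sqr_ge0 (f x - g x).
rewrite !expr2 => h1 h2; apply/andP; split; nra.
Qed.

Lemma sqint_lin (a b : R) f g : sqint f -> sqint g -> sqint (fun x => a * f x + b * g x).
Proof.
move=> hf hg; have [mf if2] := hf; have [mg ig2] := hg; split.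
  by apply: measurable_funD; apply: measurable_funM.
apply: (@eq_integ (fun x => 1 * (a ^+ 2 * (f x * f x) + (2 * a * b) * (f x * g x)) + b ^+ 2 * (g x * g x))).
  by move=> x _; ring.
by apply: integ_lin => //; apply: integ_lin => //; exact: sqint_integM.
Qed.

Lemma sqint_bmeasM w f : bmeas w -> sqint f -> sqint (fun x => w x * f x).
Proof.
move=> bw [mf if2]; split; first exact: measurable_funM bw.1 mf.
apply: eq_integ (integ_bmeasM (bmeasM bw bw) if2) => x _; ring.
Qed.

Lemma bmeas_sqint f : bmeas f -> sqint f.
Proof. by move=> bf; split; [exact: bf.1|exact/bmeas_integ/bmeasM]. Qed.

Lemma sqintP f : measurable_fun ball f ->
  (\int[nu]_(x in uball) (f x * f x)%:E < +oo)%E -> sqint f.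
Proof.
move=> mf hf; split=> //; have mB := @measurable_uball R n.
have mff : measurable_fun ball (fun x => (f x * f x)%:E).
  by apply/measurable_EFinP; exact: measurable_funM.
have ff0 x : (0 <= (f x * f x)%:E)%E by rewrite lee_fin -expr2 sqr_ge0.
apply/integrableP; split=> //.
apply: le_lt_trans hf; apply: ge0_le_integral => //; first exact: measurableT_comp.
by move=> x _ /=; rewrite lee_fin ger0_norm// -lee_fin.
Qed.

End SquareIntegrable.

(** * Uniqueness: orthogonality to all harmonic forms *)

Section HarmonicOrthogonality.
Context {R : realType} {n : nat} (nu : probability (borel_rV R n) R).
Hypothesis n_ge2 : (2 <= n)%N.
Hypothesis nu_ball : nu uball = 1%E.
Hypothesis nu_invariant : rotation_invariant nu.
Hypothesis nu_boundary : charges_boundary nu.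
Local Notation E := 'rV[R]_n.
Local Notation ball := (uball : set (borel_rV R n)).
Implicit Types (f g h u : E -> R).

Lemma annulus_weight_bmeas r s : bmeas (@annulus_weight R n r s).
Proof. exact: (weight_annulus r s).1. Qed.

Lemma bint_cutoff g (e : R) : integ nu g -> 0 < e -> exists k, forall l, (k <= l)%N ->
  `|wint nu (annulus_weight 0 (1 - rate R l)) g - bint nu g| <= e.
Proof.
move=> ig e0; have mB := @measurable_uball R n.
pose F l : E -> \bar R := fun x => (annulus_weight 0 (1 - rate R l) x * g x)%:E.
have iF l : integ nu (fun x => annulus_weight 0 (1 - rate R l) x * g x).
  by apply: integ_bmeasM ig; exact: annulus_weight_bmeas.
have [_ _ cv] : [/\ nu.-integrable ball (EFin \o g),
    [sequence \int[nu]_(x in ball) (`|F l x - (g x)%:E|)%E]_l @ \oo --> 0%E &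
    [sequence \int[nu]_(x in ball) F l x]_l @ \oo --> \int[nu]_(x in ball) (g x)%:E]%E.
  apply: (@dominated_convergence _ _ _ nu ball mB F (EFin \o g) (EFin \o (fun x => `|g x|))).
  - by move=> l; exact: measurable_int (iF l).
  - exact: measurable_int ig.
  - apply: aeW => x /uball_nsq x1; apply: cvg_near_cst.
    have [k hk] := rate_small (c := 1) (e := 1 - nsq x) ler01 (ltac:(by rewrite subr_gt0)).
    exists k => // l /= kl; rewrite /F annulus0E.
    have -> : nsq x <= 1 - rate R l by have := hk l kl; lra.
    by rewrite mul1r.
  - exact: integ_norm.
  - apply: aeW => x l Bx; rewrite /F annulus0E /= lee_fin.
    by case: (nsq x <= _)%R; rewrite ?mul1r ?mul0r ?normr0.
have cv' : (fun l => wint nu (annulus_weight 0 (1 - rate R l)) g) @ \oo --> bint nu g.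
  by apply: fine_cvg; rewrite -/(bint nu g) EFin_bint.
have [k _ hk] := (cvgrPdist_le _ _).1 cv' e e0.
by exists k => l kl; rewrite distrC; exact: hk.
Qed.

Lemma moment_pos m : exists s, [/\ 0 < s, s < 1 &
  0 < wint nu (annulus_weight 0 s) (fun x => nsq x ^+ m)].
Proof.
have h0 : (0 : R) < 2^-1 by rewrite invr_gt0.
have h1 : 2^-1 < (1 : R) by rewrite invf_lt1// ltr1n.
have [s [rs s1 mu]] := annulus_charged nu_boundary h0 h1.
exists s; split=> //; first exact: lt_le_trans h0 rs.
apply: lt_le_trans (moment_gt0 h0 (bint_annulus_gt0 s1 mu) m) _.
have bX : bmeas (fun x : E => nsq x ^+ m) by exact: hom_bmeas (hom_nsqX m).
apply: le_bint; [by apply: bmeasM => //; exact: annulus_weight_bmeas..|].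
move=> y _; rewrite ler_wpM2r ?exprn_ge0 ?nsq_ge0// !annulus_weightE nsq_ge0 /=.
by rewrite ler_nat; case: (2^-1 <= nsq y) => //; case: (nsq y <= s).
Qed.

Lemma le_moment m s s' : s <= s' -> wint nu (annulus_weight 0 s) (fun x => nsq x ^+ m) <=
  wint nu (annulus_weight 0 s') (fun x => nsq x ^+ m).
Proof.
move=> ss; have bX : bmeas (fun x : E => nsq x ^+ m) by exact: hom_bmeas (hom_nsqX m).
apply: le_bint; [by apply: bmeasM => //; exact: annulus_weight_bmeas..|].
move=> y _; rewrite ler_wpM2r ?exprn_ge0 ?nsq_ge0// !annulus0E ler_nat.
by have [h|//] := boolP (nsq y <= s); rewrite (le_trans h).
Qed.

(** Intended for signed weights: orthogonality leaves only the degree [m] component of [p], and the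
    Fischer formula gives it the vanishing moment as a factor. *)
Lemma wint_hpoly_Harm w m h p : weight w -> wint nu w (fun x => nsq x ^+ m) = 0 ->
  Harm m h -> hpoly p -> wint nu w (fun x => p x * h x) = 0.
Proof.
move=> ww w0 hh [N [q [hq ->]]]; have bw := ww.1.
have bq k : bmeas (q k) by exact: hom_bmeas (hq k).1.
have bh := hom_bmeas hh.1.
rewrite (_ : (fun x => _) = (fun x : E => \sum_(k < N) q k x * h x)); last first.
  by apply/funext => x; rewrite mulr_suml.
rewrite (wint_sum nu _ bw); last by move=> k; exact: bmeasM.
apply: big1 => k _; have [km|/eqP km] := eqVneq (k : nat) m.
  rewrite km in hq *.
  have hqm : Harm m (q k) by have := hq k; rewrite km.
  by rewrite -[X in q X]km (wint_Harm_fischer n_ge2 nu_ball nu_invariant ww hqm hh) w0 mulr0.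
exact: (wint_Harm_orthogonal n_ge2 nu_ball nu_invariant km ww (hq k) hh).
Qed.

(* The weight [M' w_s - M w_s'] has vanishing [2m]-th moment, so it annihilates
   the products of [h] with harmonic polynomials. *)
Lemma wint_harmonic_Harm s s' m u h : s < 1 -> s' < 1 -> harmonic_on uball u -> Harm m h ->
  wint nu (annulus_weight 0 s') (fun x => nsq x ^+ m) *
    wint nu (annulus_weight 0 s) (fun x => u x * h x) =
  wint nu (annulus_weight 0 s) (fun x => nsq x ^+ m) *
    wint nu (annulus_weight 0 s') (fun x => u x * h x).
Proof.
move=> s1 s'1 hu hh.
set M' := wint nu _ _; set M := wint nu (annulus_weight 0 s) (fun x => nsq x ^+ m).
pose w := fun x : E => M' * annulus_weight 0 s x + (- M) * annulus_weight 0 s' x.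
have ww : weight w by apply: weight_lin; exact: weight_annulus.
have bX : bmeas (fun x : E => nsq x ^+ m) by exact: hom_bmeas (hom_nsqX m).
have bh := hom_bmeas hh.1.
have cu := harmonic_continuous hu.
have b1 t f : bmeas f -> bmeas (fun x : E => annulus_weight 0 t x * f x).
  by move=> bf; apply: bmeasM => //; exact: annulus_weight_bmeas.
have bc t : t < 1 -> bmeas (fun x : E => annulus_weight 0 t x * (u x * h x)).
  move=> t1; rewrite (_ : (fun x => _) = (fun x : E => (annulus_weight 0 t x * u x) * h x)).
    by apply: bmeasM => //; exact: cutoff_bmeas.
  by apply/funext => x; rewrite mulrA.
have wE f : bmeas (fun x => annulus_weight 0 s x * f x) -> bmeas (fun x => annulus_weight 0 s' x * f x) ->
    wint nu w f = M' * wint nu (annulus_weight 0 s) f - M * wint nu (annulus_weight 0 s') f.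
  move=> c1 c2; rewrite /wint -mulNr -bint_lin//; congr (bint nu); apply/funext => x.
  by rewrite /w; ring.
have w0 : wint nu w (fun x => nsq x ^+ m) = 0.
  by rewrite wE; [rewrite -/M -/M' mulrC subrr|exact: b1..].
apply/eqP; rewrite -subr_eq0 -wE; [|exact: bc..]; rewrite -normr_eq0 eq_le normr_ge0 andbT.
apply/ler_addgt0Pr => e e0; rewrite add0r.
have [_ [K hK]] := bmeasM ww.1 bh.
pose K' := `|K| + 1; have K'0 : 0 < K' by rewrite ltr_wpDl.
(* The weight vanishes beyond [S], so it suffices to approximate [u] on that smaller ball. *)
pose S := Num.max 0 (Num.max s s').
have S0 : 0 <= S by rewrite le_max lexx.
have S1 : S < 1 by rewrite !gt_max ltr01 s1 s'1.
have [p hp up] := harmonic_approx (ltnW n_ge2) S0 S1 (divr_gt0 e0 K'0) hu.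
have bp := hpoly_bmeas hp.
have bwu : bmeas (fun x => w x * (u x * h x)).
  rewrite (_ : (fun x => _) = (fun x : E => M' * (annulus_weight 0 s x * (u x * h x)) +
     (- M) * (annulus_weight 0 s' x * (u x * h x)))).
    by apply: bmeasD; apply: bmeasZ; exact: bc.
  by apply/funext => x; rewrite /w; ring.
have bwp : bmeas (fun x => w x * (p x * h x)).
  exact: bmeasM ww.1 (bmeasM bp bh).
have <- : wint nu w (fun x => u x * h x) - wint nu w (fun x => p x * h x) =
    wint nu w (fun x => u x * h x).
  by rewrite (wint_hpoly_Harm ww w0 hh hp) subr0.
rewrite /wint -bintB//; apply: (bint_norm_le nu_ball); first exact: bmeasB.
move=> x Bx; have [xS|xS] := boolP (nsq x <= S).
  have -> : w x * (u x * h x) - w x * (p x * h x) = (w x * h x) * (u x - p x) by ring.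
  rewrite normrM.
  have -> : e = K' * (e / K') by rewrite mulrC divfK// gt_eqF.
  apply: ler_pM => //; last exact: up.
  by apply: le_trans (hK x Bx) _; rewrite /K' (le_trans (ler_norm _))// lerDl.
have w0x : w x = 0.
  rewrite /w !annulus0E.
  have -> : (nsq x <= s) = false.
    by apply/negbTE; move: xS; apply: contra => h1; rewrite (le_trans h1)// !le_max lexx orbT.
  have -> : (nsq x <= s') = false.
    by apply/negbTE; move: xS; apply: contra => h1; rewrite (le_trans h1)// !le_max lexx !orbT.
  by rewrite !mulr0 addr0.
by rewrite w0x !mul0r subr0 normr0 ltW.
Qed.

(** By the preceding proportionality the truncated pairings are multiples of the truncated moments.
    As the cutoff tends to 1 the pairing tends to the vanishing full integral while the moment stays
    bounded below, so the common ratio is zero. *)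
Lemma wint_harmonic_Harm_eq0 s m u h : s < 1 -> harmonic_on uball u -> sqint nu u ->
  Harm m h -> bint nu (fun x => u x * h x) = 0 ->
  wint nu (annulus_weight 0 s) (fun x => u x * h x) = 0.
Proof.
move=> s1 hu u2 hh uh0; have [s0 [s00 s01 M0]] := moment_pos m.
have bh := hom_bmeas hh.1.
set M := wint nu _ _ in M0.
have iuh : integ nu (fun x => u x * h x) by apply: sqint_integM => //; exact: bmeas_sqint.
have A0 : wint nu (annulus_weight 0 s0) (fun x => u x * h x) = 0.
  apply/eqP; rewrite -normr_eq0 eq_le normr_ge0 andbT; apply/ler_addgt0Pr => e e0; rewrite add0r.
  have [k1 hk1] := bint_cutoff iuh e0.
  have [k2 hk2] := rate_small (c := 1) (e := 1 - s0) ler01 (ltac:(by rewrite subr_gt0)).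
  pose l := maxn k1 k2; pose t := 1 - rate R l.
  have t1 : t < 1 by rewrite /t gtrDl oppr_lt0 rate_gt0.
  have st : s0 <= t by have := hk2 l (leq_maxr _ _); rewrite /t; lra.
  have := hk1 l (leq_maxl _ _); rewrite uh0 subr0 -/t => h1.
  rewrite -(ler_pM2l M0); apply: le_trans (ler_wpM2l (ltW M0) h1).
  rewrite -[M in X in _ <= X](ger0_norm (ltW M0)) -normrM /M -wint_harmonic_Harm// normrM.
  rewrite ler_wpM2r// ger0_norm; first exact: le_moment.
  exact: le_trans (ltW M0) (le_moment m st).
apply/eqP; rewrite -(mulrI_eq0 _ (mulfI (lt0r_neq0 M0))) /M wint_harmonic_Harm//.
by rewrite A0 mulr0.
Qed.

(** Orthogonality survives truncation to a smaller ball, where [u] is a uniform limit of harmonic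
    polynomials; hence the truncated integral of [u^2] vanishes, and it bounds [u x]. *)
Theorem harmonic_orthogonal_eq0 u : harmonic_on uball u -> sqint nu u ->
  (forall m h, Harm m h -> bint nu (fun x => u x * h x) = 0) ->
  forall x, uball x -> u x = 0.
Proof.
move=> hu u2 uh x /uball_nsq x1.
have [s [qs s1 [C C0 hC]]] := harmonic_bound n_ge2 nu_ball nu_invariant nu_boundary (nsq_ge0 x) x1.
have := hC u x hu (lexx _).
suff -> : wint nu (annulus_weight 0 s) (fun x => u x * u x) = 0.
  by rewrite mulr0 => h; apply/eqP; rewrite -sqrf_eq0 eq_le h sqr_ge0.
have cu := harmonic_continuous hu.
have wp p : hpoly p -> wint nu (annulus_weight 0 s) (fun x => u x * p x) = 0.
  move=> [N [q [hq ->]]].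
  have bc k : bmeas (fun y : E => annulus_weight 0 s y * (u y * q k y)).
    rewrite (_ : (fun x => _) = (fun x : E => (annulus_weight 0 s x * u x) * q k x)).
      by apply: bmeasM; [exact: cutoff_bmeas|exact: hom_bmeas (hq k).1].
    by apply/funext => y; rewrite mulrA.
  rewrite /wint (_ : (fun x => _) = (fun x : E => \sum_(k < N) annulus_weight 0 s x * (u x * q k x))).
    rewrite bint_sum//; apply: big1 => k _.
    exact: (wint_harmonic_Harm_eq0 s1 hu u2 (hq k) (uh _ _ (hq k))).
  by apply/funext => y; rewrite !mulr_sumr.
apply/eqP; rewrite -normr_eq0 eq_le normr_ge0 andbT; apply/ler_addgt0Pr => e e0; rewrite add0r.
have [_ [K hK]] := cutoff_bmeas s1 cu.
pose K' := `|K| + 1; have K'0 : 0 < K' by rewrite ltr_wpDl.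
have [p hp up] := harmonic_approx (ltnW n_ge2) (le_trans (nsq_ge0 x) qs) s1 (divr_gt0 e0 K'0) hu.
have bp := hpoly_bmeas hp; have bcu := cutoff_bmeas s1 cu.
have bup : bmeas (fun y => annulus_weight 0 s y * (u y * p y)).
  rewrite (_ : (fun x => _) = (fun x : E => (annulus_weight 0 s x * u x) * p x)).
    exact: bmeasM.
  by apply/funext => y; rewrite mulrA.
have -> : wint nu (annulus_weight 0 s) (fun x => u x * u x) =
   wint nu (annulus_weight 0 s) (fun x => u x * u x) - wint nu (annulus_weight 0 s) (fun x => u x * p x).
  by rewrite (wp p hp) subr0.
rewrite /wint -bintB//; last exact: cutoff_sqr_bmeas.
apply: (bint_norm_le nu_ball); first by apply: bmeasB => //; exact: cutoff_sqr_bmeas.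
move=> y By; have := hK y By; rewrite annulus0E; have [ys|ys] := boolP (nsq y <= s).
  rewrite !mul1r -mulrBr normrM => h1.
  have -> : e = K' * (e / K') by rewrite mulrC divfK// gt_eqF.
  apply: ler_pM => //; last exact: up.
  by apply: le_trans h1 _; rewrite /K' (le_trans (ler_norm _))// lerDl.
by rewrite !mul0r subr0 normr0 => _; exact: ltW.
Qed.

End HarmonicOrthogonality.

(** * Complex square integrable functions through real and imaginary parts *)

Section ComplexL2.
Context {R : realType} {n : nat} (nu : probability (borel_rV R n) R).
Local Notation E := 'rV[R]_n.
Local Notation CF := ('rV[R]_n -> R[i]^o).
Local Notation ball := (uball : set (borel_rV R n)).
Implicit Types (F G H : CF).

Definition pairing (f g : E -> R) : R := bint nu (fun x => f x * g x).

Lemma pairingC (f g : E -> R) : pairing f g = pairing g f.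
Proof. by congr bint; apply/funext => x; rewrite mulrC. Qed.

Lemma pairing_lin (a b : R) (f g h : E -> R) : sqint nu f -> sqint nu g -> sqint nu h ->
  pairing (fun x => a * f x + b * g x) h = a * pairing f h + b * pairing g h.
Proof.
move=> hf hg hh; rewrite /pairing -ibint_lin; [|exact: sqint_integM..].
by congr bint; apply/funext => x; ring.
Qed.

Definition reF F : E -> R := fun x => complex.Re (F x).
Definition imF F : E -> R := fun x => complex.Im (F x).

Lemma L2P F : L2 nu F <-> sqint nu (reF F) /\ sqint nu (imF F).
Proof.
split=> [[mR mI i]|[[mR iR] [mI iI]]]; last first.
  split=> //.
  rewrite (eq_integral (fun x : borel_rV R n => (reF F x * reF F x + imF F x * imF F x)%:E)); last first.
    by move=> x _; rewrite !expr2.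
  rewrite -EFin_bint ?ltry//; exact: integD.
have le (g : E -> R) : measurable_fun ball g ->
    (forall x, g x * g x <= complex.Re (F x) ^+ 2 + complex.Im (F x) ^+ 2) -> sqint nu g.
  move=> mg hg; apply: sqintP => //; apply: le_lt_trans i.
  apply: ge0_le_integral => //.
  - exact: measurable_uball.
  - by move=> x _; rewrite lee_fin -expr2 sqr_ge0.
  - by apply/measurable_EFinP; exact: measurable_funM.
  - by apply/measurable_EFinP; apply: measurable_funD; exact: measurable_funX.
  - by move=> x _; rewrite lee_fin.
by split; apply: le => // x; rewrite -expr2; [rewrite lerDl|rewrite lerDr]; exact: sqr_ge0.
Qed.

Lemma re_inner F G : L2 nu F -> L2 nu G -> complex.Re (inner nu F G) =
  pairing (reF F) (reF G) + pairing (imF F) (imF G).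
Proof.
move=> /L2P[fR fI] /L2P[gR gI]; rewrite /pairing -ibintD; [|exact: sqint_integM..].
by apply: eq_bint => x _; rewrite -[LHS]/(complex.Re ((F x : R[i]) * (G x)^*%C)) ReM ReJ ImJ mulrN opprK.
Qed.

Lemma im_inner F G : L2 nu F -> L2 nu G -> complex.Im (inner nu F G) =
  pairing (imF F) (reF G) - pairing (reF F) (imF G).
Proof.
move=> /L2P[fR fI] /L2P[gR gI]; rewrite /pairing -ibintB; [|exact: sqint_integM..].
by apply: eq_bint => x _; rewrite -[LHS]/(complex.Im ((F x : R[i]) * (G x)^*%C)) ImM ReJ ImJ mulrN addrC.
Qed.

Lemma inner_lin (c : R[i]) F G H : L2 nu F -> L2 nu G -> L2 nu H ->
  inner nu (c *: F + G) H = c * inner nu F H + inner nu G H.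
Proof.
move=> hF hG hH; have hL := L2_lin c hF hG.
have [fR fI] := (L2P F).1 hF; have [gR gI] := (L2P G).1 hG; have [tR tI] := (L2P H).1 hH.
have eR : reF (c *: F + G) = (fun x => 1 * (complex.Re c * reF F x + (- complex.Im c) * imF F x) + 1 * reF G x).
  by apply/funext => x; rewrite /reF /imF -[(c *: F + G) x]/(c * F x + G x) ReD ReM; ring.
have eI : imF (c *: F + G) = (fun x => 1 * (complex.Re c * imF F x + complex.Im c * reF F x) + 1 * imF G x).
  by apply/funext => x; rewrite /reF /imF -[(c *: F + G) x]/(c * F x + G x) ImD ImM; ring.
have s1 := sqint_lin (complex.Re c) (- complex.Im c) fR fI.
have s2 := sqint_lin (complex.Re c) (complex.Im c) fI fR.
by apply: complex_ext; rewrite ?ReD ?ImD ?ReM ?ImM !(re_inner, im_inner)// eR eI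
  !(pairing_lin _ _ s1)// !(pairing_lin _ _ s2)// !(pairing_lin _ _ fR)// !(pairing_lin _ _ fI)//; ring.
Qed.

Lemma innerC F G : L2 nu F -> L2 nu G -> inner nu G F = (inner nu F G)^*%C.
Proof.
move=> hF hG; apply: complex_ext; rewrite ?ReJ ?ImJ ?re_inner ?im_inner//.
  by rewrite (pairingC (reF G)) (pairingC (imF G)).
by rewrite (pairingC (reF G)) (pairingC (imF G)) opprB.
Qed.

Definition nrm2 F : R := bint nu (fun x => reF F x * reF F x + imF F x * imF F x).

Lemma nrm2_integ F : L2 nu F -> integ nu (fun x => reF F x * reF F x + imF F x * imF F x).
Proof. by move=> /L2P[[_ fR] [_ fI]]; exact: integD. Qed.

Lemma nrm2_ge0 F : 0 <= nrm2 F.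
Proof. by apply: bint_ge0 => x _; rewrite addr_ge0// -expr2 sqr_ge0. Qed.

Lemma nrm2E F : L2 nu F -> nrm2 F = complex.Re (inner nu F F).
Proof.
move=> hF; rewrite re_inner// /nrm2 ibintD//; by have /L2P[[_ ?] [_ ?]] := hF.
Qed.

Lemma nrm2D F G : L2 nu F -> L2 nu G -> nrm2 (fun x => F x + G x) <= 2 * nrm2 F + 2 * nrm2 G.
Proof.
move=> hF hG; have hS : L2 nu (fun x => F x + G x).
  by have := L2_lin 1 hF hG; rewrite scale1r.
rewrite /nrm2 -ibint_lin; [|exact: nrm2_integ..].
apply: le_ibint; [exact: nrm2_integ|by apply: integ_lin; exact: nrm2_integ|move=> x _].
rewrite /reF /imF ReD ImD.
have := sqr_ge0 (complex.Re (F x) - complex.Re (G x)); have := sqr_ge0 (complex.Im (F x) - complex.Im (G x)).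
rewrite !expr2; nra.
Qed.

Definition cbmeas (f : CF) : Prop := bmeas (reF f) /\ bmeas (imF f).

Lemma L2M (f : CF) F : cbmeas f -> L2 nu F -> L2 nu (fun x => f x * F x).
Proof.
move=> [fR fI] /L2P[hR hI]; apply/L2P; split.
  have := sqint_lin 1 (-1) (sqint_bmeasM fR hR) (sqint_bmeasM fI hI).
  by congr sqint; apply/funext => x; rewrite /reF ReM; ring.
have := sqint_lin 1 1 (sqint_bmeasM fR hI) (sqint_bmeasM fI hR).
by congr sqint; apply/funext => x; rewrite /imF ImM; ring.
Qed.

Lemma cbmeas_bound (f : CF) : cbmeas f -> exists2 M : R, 0 < M &
  forall x, uball x -> reF f x * reF f x + imF f x * imF f x <= M.
Proof.
move=> [[_ [M hM]] [_ [N hN]]]; exists (M ^+ 2 + N ^+ 2 + 1) => [|x Bx].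
  by rewrite ltr_wpDl// addr_ge0// sqr_ge0.
apply: (@le_trans _ _ (M ^+ 2 + N ^+ 2)); last by rewrite lerDl.
rewrite -!expr2 -[reF f x ^+ 2]real_normK ?num_real// -[imF f x ^+ 2]real_normK ?num_real//.
have h1 := hM x Bx; have h2 := hN x Bx.
have M0 := le_trans (normr_ge0 _) h1; have N0 := le_trans (normr_ge0 _) h2.
by apply: lerD; rewrite ler_sqr.
Qed.

Lemma nrm2M (f : CF) F (M : R) : cbmeas f -> L2 nu F ->
  (forall x, uball x -> reF f x * reF f x + imF f x * imF f x <= M) ->
  nrm2 (fun x => f x * F x) <= M * nrm2 F.
Proof.
move=> bf hF hM; rewrite /nrm2 -ibintZ; last exact: nrm2_integ.
apply: le_ibint; [exact/nrm2_integ/L2M|exact/integZ/nrm2_integ|move=> x Bx].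
have -> : reF (fun x => f x * F x) x * reF (fun x => f x * F x) x +
   imF (fun x => f x * F x) x * imF (fun x => f x * F x) x =
   (reF f x * reF f x + imF f x * imF f x) * (reF F x * reF F x + imF F x * imF F x).
  by rewrite /reF /imF ReM ImM; ring.
by rewrite ler_wpM2r ?hM// addr_ge0// -expr2 sqr_ge0.
Qed.

(** A pointwise substitute for Cauchy-Schwarz; applied to normalised vectors it already bounds the
    functional [w |-> Re <w, g>]. *)
Lemma re_inner_le F G : L2 nu F -> L2 nu G ->
  2 * complex.Re (inner nu F G) <= nrm2 F + nrm2 G.
Proof.
move=> hF hG; have /L2P[fR fI] := hF; have /L2P[gR gI] := hG.
rewrite re_inner// /pairing -ibintD; [|exact: sqint_integM..].
rewrite -ibintZ; last by apply: integD; exact: sqint_integM.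
rewrite /nrm2 -ibintD; [|exact: nrm2_integ..].
apply: le_ibint => [||x _].
- by apply/integZ/integD; exact: sqint_integM.
- by apply: integD; exact: nrm2_integ.
have := sqr_ge0 (reF F x - reF G x); have := sqr_ge0 (imF F x - imF G x).
rewrite !expr2; nra.
Qed.

Lemma nrm2_fatou (F_ : nat -> CF) F (M : R) : (forall k, L2 nu (F_ k)) ->
  (forall x, uball x -> (fun k => reF (F_ k) x) @ \oo --> reF F x) ->
  (forall x, uball x -> (fun k => imF (F_ k) x) @ \oo --> imF F x) ->
  measurable_fun ball (reF F) -> measurable_fun ball (imF F) ->
  (forall k, nrm2 (F_ k) <= M) -> L2 nu F /\ nrm2 F <= M.
Proof.
move=> hF cR cI mR mI hM.
have [i le] : integ nu (fun x => reF F x * reF F x + imF F x * imF F x) /\ nrm2 F <= M.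
  apply: (@bint_fatou R n nu
    (fun k x => reF (F_ k) x * reF (F_ k) x + imF (F_ k) x * imF (F_ k) x)) => //.
  - by move=> k; exact: nrm2_integ.
  - by move=> k x _; rewrite addr_ge0// -expr2 sqr_ge0.
  - by move=> x Bx; apply: cvgD; [exact: cvgM (cR x Bx) (cR x Bx)|exact: cvgM (cI x Bx) (cI x Bx)].
  - by apply: measurable_funD; exact: measurable_funM.
split=> //; apply/L2P; split; split=> //; apply: (le_integ _ i).
- exact: measurable_funM.
- by move=> x _; rewrite ger0_norm -expr2 ?sqr_ge0// lerDl -expr2 sqr_ge0.
- exact: measurable_funM.
- by move=> x _; rewrite ger0_norm -expr2 ?sqr_ge0// lerDr -expr2 sqr_ge0.
Qed.

End ComplexL2.

(** * The harmonic Hilbert space is complete *)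

Section HarmonicHilbert.
Context {R : realType} {n : nat} (nu : probability (borel_rV R n) R).
Hypothesis n_ge2 : (2 <= n)%N.
Hypothesis nu_ball : nu uball = 1%E.
Hypothesis nu_invariant : rotation_invariant nu.
Hypothesis nu_boundary : charges_boundary nu.
Local Notation E := 'rV[R]_n.
Local Notation CF := ('rV[R]_n -> R[i]^o).
Local Notation ball := (uball : set (borel_rV R n)).
Local Notation B := (b2 nu).
Local Notation norm := (hnorm (@b2_inner R n nu)).
Implicit Types (F G : CF) (u v h : B).

Lemma b2P u : [/\ harmonic_on uball (reF u), harmonic_on uball (imF u), L2 nu u
  & forall x, ~ uball x -> u x = 0].
Proof. have /asboolP[[hR hI] l z] := valP u; exact: And4 hR hI l z. Qed.

Lemma b2_L2 u : L2 nu u.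
Proof. by have [] := b2P u. Qed.

(** Derivatives involve points nearby, so equality on the ball is transported through
    [locally_hpoly], which only looks at values. *)
Lemma harmonic_on_eq (f g : E -> R) : (forall x, uball x -> f x = g x) ->
  harmonic_on uball f -> harmonic_on uball g.
Proof.
move=> fg hf; apply: (locally_hpoly_harmonic n_ge2 nu_ball nu_invariant nu_boundary) => r e r0 r1 e0.
have [h hh fh] := harmonic_locally_hpoly n_ge2 hf r0 r1 e0.
by exists h => // x xr; rewrite -fg ?fh//; exact: (cball_uball r1 xr).
Qed.

Lemma b2_exists F : harmonic_on uball (reF F) -> harmonic_on uball (imF F) -> L2 nu F ->
  exists u : B, forall x, uball x -> u x = F x.
Proof.
move=> hR hI lF; pose G : CF := fun x => if `[< uball x >] then F x else 0.
have GF x : uball x -> G x = F x by rewrite /G => /asboolP ->.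
have hG : G \in b2_pred nu.
  apply/asboolP; split.
  - by split; [apply: harmonic_on_eq hR|apply: harmonic_on_eq hI] => x Bx; rewrite GF.
  - have [m1 m2 i] := lF; split.
    + by apply: eq_measurable_fun m1 => x /set_mem Bx; rewrite GF.
    + by apply: eq_measurable_fun m2 => x /set_mem Bx; rewrite GF.
    + rewrite (eq_integral (fun x : borel_rV R n =>
        (complex.Re (F x) ^+ 2 + complex.Im (F x) ^+ 2)%:E))//.
      by move=> x /set_mem Bx; rewrite GF.
  - by move=> x nB; rewrite /G; case: asboolP.
by exists (B2 hG) => x; exact: GF.
Qed.

Lemma b2_ext u v : (forall x, uball x -> u x = v x) -> u = v.
Proof.
move=> uv; apply: val_inj; apply/funext => x.
have [Bx|nB] := pselect (uball x); first exact: uv.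
have [_ _ _ /(_ x nB) hu] := b2P u; have [_ _ _ /(_ x nB) hv] := b2P v.
exact: etrans hu (esym hv).
Qed.

Lemma hnorm_nrm2 u : norm u ^+ 2 = nrm2 nu u.
Proof.
rewrite nrm2E; last exact: b2_L2.
by rewrite /hnorm sqr_sqrtr// -nrm2E; [exact: nrm2_ge0|exact: b2_L2].
Qed.

Lemma b2_pointwise (q : R) : 0 <= q -> q < 1 -> exists2 C : R, 0 < C &
  forall u x, nsq x <= q -> reF u x ^+ 2 + imF u x ^+ 2 <= C * nrm2 nu u.
Proof.
move=> q0 q1.
have [s [qs s1 [C C0 hC]]] := harmonic_bound n_ge2 nu_ball nu_invariant nu_boundary q0 q1.
exists C => // u x xq; have [hR hI lu _] := b2P u.
have le f : harmonic_on uball f -> sqint nu f -> f x ^+ 2 <= C * bint nu (fun x => f x * f x).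
  move=> hf [mf sf]; apply: le_trans (hC f x hf xq) _; rewrite ler_pM2l//.
  apply: le_ibint => //.
    by apply: bmeas_integ; apply: cutoff_sqr_bmeas => //; exact: harmonic_continuous.
  move=> y _; rewrite annulus0E; case: (nsq y <= s); rewrite ?mul1r ?mul0r//.
  by rewrite -expr2 sqr_ge0.
have /L2P[sR sI] := lu.
have := le _ hR sR; have := le _ hI sI.
have -> : nrm2 nu u = bint nu (fun x => reF u x * reF u x) + bint nu (fun x => imF u x * imF u x).
  by rewrite /nrm2 ibintD//; [exact: sR.2|exact: sI.2].
by rewrite mulrDr => h1 h2; exact: lerD.
Qed.

Lemma nrm2_eq0 u : nrm2 nu u = 0 -> u = 0.
Proof.
move=> u0; apply: b2_ext => x /uball_nsq x1.
have [C C0 hC] := b2_pointwise (nsq_ge0 x) x1.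
have := hC u x (lexx _); rewrite u0 mulr0 => h.
have h1 := sqr_ge0 (reF u x); have h2 := sqr_ge0 (imF u x).
have rR : reF u x = 0 by apply/eqP; rewrite -sqrf_eq0; apply/eqP; lra.
have rI : imF u x = 0 by apply/eqP; rewrite -sqrf_eq0; apply/eqP; lra.
exact: complex_ext.
Qed.

Lemma real_cauchy (a : nat -> R) :
  (forall e : R, 0 < e -> exists N, forall k l, (N <= k)%N -> (N <= l)%N -> `|a k - a l| <= e) ->
  exists A : R, a @ \oo --> A.
Proof.
move=> h; suff : cvg (a @ \oo) by move=> /cvg_ex.
apply/cauchy_cvgP/cauchy_exP => e e0.
have e2 : 0 < e / 2 by rewrite divr_gt0.
have [N hN] := h _ e2; exists (a N), N => // k /= Nk.
apply: (le_lt_trans (hN N k (leqnn N) Nk)); rewrite ltr_pdivrMr//.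
by rewrite ltr_pMr// ltr1n.
Qed.

(** Bounded point evaluations turn a Cauchy sequence in norm into a locally uniform one, whose limit
    is harmonic; Fatou's lemma then gives both the square integrability of the limit and the
    convergence in norm. *)
Lemma b2_hilbert_complete (u : nat -> B) :
  (forall e : R, 0 < e -> exists N, forall k l, (N <= k)%N -> (N <= l)%N -> norm (u k - u l) < e) ->
  exists v, forall e : R, 0 < e -> exists N, forall k, (N <= k)%N -> norm (u k - v) < e.
Proof.
move=> cu.
have cu2 (e : R) : 0 < e -> exists N, forall k l, (N <= k)%N -> (N <= l)%N -> nrm2 nu (u k - u l) <= e.
  move=> e0; have [|N hN] := cu (Num.sqrt e); first by rewrite sqrtr_gt0.
  exists N => k l Nk Nl; rewrite -[X in nrm2 nu X]/(b2_fun (u k - u l)) -hnorm_nrm2.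
  rewrite -[X in _ <= X](sqr_sqrtr (ltW e0)) ler_sqr ?nnegrE ?sqrtr_ge0// ltW//.
  exact: hN.
have uni (q e : R) : 0 <= q -> q < 1 -> 0 < e -> exists N, forall k l x, (N <= k)%N -> (N <= l)%N ->
    nsq x <= q -> `|reF (u k) x - reF (u l) x| <= e /\ `|imF (u k) x - imF (u l) x| <= e.
  move=> q0 q1 e0; have [C C0 hC] := b2_pointwise q0 q1.
  have [|N hN] := cu2 (e ^+ 2 / C); first by rewrite divr_gt0// exprn_gt0.
  exists N => k l x Nk Nl xq; have := hC (u k - u l) x xq.
  have := hN k l Nk Nl; rewrite ler_pdivlMr// mulrC => h1 h2.
  have h3 := le_trans h2 h1.
  have -> : reF (u k) x - reF (u l) x = reF (u k - u l) x.
    by rewrite /reF -ReN -ReD.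
  have -> : imF (u k) x - imF (u l) x = imF (u k - u l) x.
    by rewrite /imF -ImN -ImD.
  have h4 := sqr_ge0 (reF (u k - u l) x); have h5 := sqr_ge0 (imF (u k - u l) x).
  by split; rewrite -ler_sqr ?nnegrE ?normr_ge0 ?(ltW e0)// real_normK ?num_real//; lra.
have lim (pr : CF -> E -> R) : (forall q e : R, 0 <= q -> q < 1 -> 0 < e -> exists N, forall k l x,
      (N <= k)%N -> (N <= l)%N -> nsq x <= q -> `|pr (u k) x - pr (u l) x| <= e) ->
    exists f : E -> R, (forall x, uball x -> (fun k => pr (u k) x) @ \oo --> f x) /\
      forall q e : R, 0 <= q -> q < 1 -> 0 < e ->
        exists N, forall k x, (N <= k)%N -> nsq x <= q -> `|f x - pr (u k) x| <= e.
  move=> hpr.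
  have /choice[f fP] : forall x, exists A : R, uball x -> (fun k => pr (u k) x) @ \oo --> A.
    move=> x; have [Bx|nB] := pselect (uball x); last by exists 0.
    have [e e0|A hA] := @real_cauchy (fun k => pr (u k) x); last by exists A.
    have [N hN] := hpr (nsq x) e (nsq_ge0 x) ((uball_nsq x).1 Bx) e0.
    by exists N => k l Nk Nl; exact: hN.
  exists f; split=> // q e q0 q1 e0; have [N hN] := hpr q e q0 q1 e0.
  exists N => k x Nk xq; have Bx := cball_uball q1 xq.
  have c : (fun l => `|pr (u l) x - pr (u k) x|) @ \oo --> `|f x - pr (u k) x|.
    by apply: cvg_norm; apply: cvgB; [exact: fP|exact: cvg_cst].
  rewrite -(cvg_lim _ c)//; apply: limr_le; first by apply/cvg_ex; exists `|f x - pr (u k) x|.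
  by exists N => // l /= Nl; exact: hN.
have [|fR [fRc fRu]] := lim reF.
  by move=> q e q0 q1 e0; have [N hN] := uni q e q0 q1 e0; exists N => k l x Nk Nl xq; have [] := hN k l x Nk Nl xq.
have [|fI [fIc fIu]] := lim imF.
  by move=> q e q0 q1 e0; have [N hN] := uni q e q0 q1 e0; exists N => k l x Nk Nl xq; have [] := hN k l x Nk Nl xq.
pose F : CF := fun x => Complex (fR x) (fI x).
have hR : harmonic_on uball (reF F).
  apply: (harmonic_limit n_ge2 nu_ball nu_invariant nu_boundary (v := fun k => reF (u k))).
    by move=> k; have [hh _ _ _] := b2P (u k); exact: hh.
  by move=> r e r0 r1 e0; have [N hN] := fRu r e r0 r1 e0; exists N => x; exact: hN.
have hI : harmonic_on uball (imF F).
  apply: (harmonic_limit n_ge2 nu_ball nu_invariant nu_boundary (v := fun k => imF (u k))).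
    by move=> k; have [_ hh _ _] := b2P (u k); exact: hh.
  by move=> r e r0 r1 e0; have [N hN] := fIu r e r0 r1 e0; exists N => x; exact: hN.
have mR : measurable_fun ball (reF F) by apply: continuous_measurable; exact: harmonic_continuous.
have mI : measurable_fun ball (imF F) by apply: continuous_measurable; exact: harmonic_continuous.
have sub (G : CF) x : reF (fun x => F x - G x) x = reF F x - reF G x /\
    imF (fun x => F x - G x) x = imF F x - imF G x.
  by rewrite /reF /imF ReD ReN ImD ImN.
have fat k (e : R) N : (N <= k)%N ->
    (forall k l, (N <= k)%N -> (N <= l)%N -> nrm2 nu (u k - u l) <= e) ->
    L2 nu (fun x => F x - u k x) /\ nrm2 nu (fun x => F x - u k x) <= e.
  move=> Nk hN; have [uR uI lu _] := b2P (u k).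
  apply: (@nrm2_fatou R n nu (fun l => u (N + l)%N - u k)).
  - by move=> l; exact: b2_L2 (u (N + l)%N - u k).
  - move=> x Bx; rewrite (sub (u k) x).1.
    rewrite (_ : (fun l => _) = (fun l => reF (u (N + l)%N) x - reF (u k) x)); last first.
      by apply/funext => l; rewrite /reF -ReN -ReD.
    apply: cvgB; last exact: cvg_cst.
    exact: (cvg_comp (addn N) (fun k => reF (u k) x) (cvg_addnl N) (fRc x Bx)).
  - move=> x Bx; rewrite (sub (u k) x).2.
    rewrite (_ : (fun l => _) = (fun l => imF (u (N + l)%N) x - imF (u k) x)); last first.
      by apply/funext => l; rewrite /imF -ImN -ImD.
    apply: cvgB; last exact: cvg_cst.
    exact: (cvg_comp (addn N) (fun k => imF (u k) x) (cvg_addnl N) (fIc x Bx)).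
  - rewrite (_ : reF _ = (fun x => reF F x - reF (u k) x)).
      apply: measurable_funB; [exact: mR|apply: continuous_measurable; exact: harmonic_continuous uR].
    by apply/funext => x; rewrite (sub (u k) x).1.
  - rewrite (_ : imF _ = (fun x => imF F x - imF (u k) x)).
      apply: measurable_funB; [exact: mI|apply: continuous_measurable; exact: harmonic_continuous uI].
    by apply/funext => x; rewrite (sub (u k) x).2.
  - by move=> l; apply: hN => //; exact: leq_addr.
have lF : L2 nu F.
  have [N hN] := cu2 1 ltr01; have [l _] := fat N 1 N (leqnn N) hN.
  have := L2_lin 1 l (b2_L2 (u N)); congr L2; apply/funext => x.
  by rewrite -[LHS]/(1 * (F x - u N x) + u N x) mul1r subrK.
have [v hv] := b2_exists hR hI lF.
exists v => e e0; have e2 : 0 < e / 2 by rewrite divr_gt0.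
have [N hN] := cu2 ((e / 2) ^+ 2) (ltac:(by rewrite exprn_gt0)).
exists N => k Nk; have [_ le] := fat k _ N Nk hN.
apply: (@le_lt_trans _ _ (e / 2)); last by rewrite ltr_pdivrMr// ltr_pMr// ltr1n.
rewrite -ler_sqr ?nnegrE ?sqrtr_ge0 ?(ltW e2)// hnorm_nrm2.
apply: le_trans le; rewrite le_eqVlt; apply/orP; left; apply/eqP.
apply: eq_bint => x Bx; rewrite (sub (u k) x).1 (sub (u k) x).2.
have -> : reF (u k - v) x = - (reF F x - reF (u k) x).
  by rewrite opprB /reF -[X in X = _]/(complex.Re (u k x - v x)) hv// ReD ReN.
have -> : imF (u k - v) x = - (imF F x - imF (u k) x).
  by rewrite opprB /imF -[X in X = _]/(complex.Im (u k x - v x)) hv// ImD ImN.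
by rewrite !mulrNN.
Qed.

Theorem b2_hilbert : hilbert (@b2_inner R n nu).
Proof.
split.
- by move=> c u v w; exact: inner_lin (b2_L2 u) (b2_L2 v) (b2_L2 w).
- by move=> u v; exact: innerC (b2_L2 u) (b2_L2 v).
- by move=> u; rewrite -(nrm2E (b2_L2 u)); exact: nrm2_ge0.
- by move=> u; rewrite -(nrm2E (b2_L2 u)); exact: nrm2_eq0.
- exact: b2_hilbert_complete.
Qed.

End HarmonicHilbert.

(** * Toeplitz operators *)

Section Toeplitz.
Context {R : realType} {n : nat} (nu : probability (borel_rV R n) R).
Hypothesis n_ge2 : (2 <= n)%N.
Hypothesis nu_ball : nu uball = 1%E.
Hypothesis nu_invariant : rotation_invariant nu.
Hypothesis nu_boundary : charges_boundary nu.
Local Notation E := 'rV[R]_n.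
Local Notation CF := ('rV[R]_n -> R[i]^o).
Local Notation B := (b2 nu).
Local Notation dot := (@b2_inner R n nu).
Local Notation norm := (hnorm dot).
Implicit Types (F G H f g : CF) (u v h : B).

Let hilb : hilbert dot := b2_hilbert n_ge2 nu_ball nu_invariant nu_boundary.

Lemma L2B F G : L2 nu F -> L2 nu G -> L2 nu (fun x => F x - G x).
Proof.
move=> hF hG; have := L2_lin (-1) hG hF; congr L2; apply/funext => x.
by rewrite -[LHS]/(-1 * G x + F x) mulN1r addrC.
Qed.

Lemma inner_eq F G H : (forall x, F x = G x) -> inner nu F H = inner nu G H.
Proof. by move=> /funext ->. Qed.

Lemma inner0l G : L2 nu G -> inner nu (fun=> 0) G = 0.
Proof.
move=> hG; have := inner_lin (-1) hG hG hG; rewrite mulN1r addNr => h; rewrite -[RHS]h.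
by apply: inner_eq => x; rewrite -[RHS]/(-1 * G x + G x) mulN1r addNr.
Qed.

Lemma innerZl (c : R[i]) F G : L2 nu F -> L2 nu G ->
  inner nu (fun x => c * F x) G = c * inner nu F G.
Proof.
move=> hF hG; have h0 : L2 nu (fun=> 0).
  by have := L2B hF hF; congr L2; apply/funext => x; rewrite subrr.
have := inner_lin c hF h0 hG; rewrite inner0l// [in RHS]addr0 => <-.
by apply: inner_eq => x; rewrite -[RHS]/(c * F x + 0) addr0.
Qed.

Lemma innerBl F G H : L2 nu F -> L2 nu G -> L2 nu H ->
  inner nu (fun x => F x - G x) H = inner nu F H - inner nu G H.
Proof.
move=> hF hG hH; rewrite addrC -mulN1r -inner_lin//.
by apply: inner_eq => x; rewrite -[RHS]/(-1 * G x + F x) mulN1r addrC.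
Qed.

Lemma nrm2_add F G : L2 nu F -> L2 nu G ->
  nrm2 nu (fun x => F x + G x) = nrm2 nu F + 2 * complex.Re (inner nu F G) + nrm2 nu G.
Proof.
move=> hF hG; have hS : L2 nu (fun x => F x + G x).
  by have := L2_lin 1 hF hG; rewrite scale1r.
have e1 H : L2 nu H -> inner nu (fun x => F x + G x) H = inner nu F H + inner nu G H.
  move=> hH; have := inner_lin 1 hF hG hH; rewrite mul1r => <-.
  by apply: inner_eq => x; rewrite -[RHS]/(1 * F x + G x) mul1r.
rewrite !nrm2E// e1// (innerC hS hF) (innerC hS hG) !e1// (innerC hF hG) ReD !ReJ !ReD ReJ.
ring.
Qed.

(** Since [g] lies outside [b2], the projection is obtained as the Riesz representative, inside
    [b2], of [w |-> Re <w, g>]; imaginary parts follow by testing on multiples by [i]. *)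
Lemma projection_spec_exists g : L2 nu g ->
  exists h, forall v, inner nu (fun x => g x - h x) v = 0.
Proof.
move=> hg; pose phi (w : B) := complex.Re (inner nu w g).
have phiD u v : phi (u + v) = phi u + phi v.
  have := inner_lin 1 (b2_L2 u) (b2_L2 v) hg; rewrite mul1r /phi -ReD => <-.
  by congr complex.Re; apply: inner_eq => x; rewrite -[RHS]/(1 * u x + v x) mul1r.
have phiZ (a : R) u : phi (a%:C%C *: u) = a * phi u.
  rewrite /phi -[inner nu (_ *: u) g]/(inner nu (fun x => a%:C%C * u x) g) (innerZl _ (b2_L2 u) hg).
  by rewrite ReM /= mul0r subr0.
have phiM w : setT w -> phi w <= (1 + nrm2 nu g) / 2 * norm w.
  move=> _; have [->|/(hnorm_gt0 hilb) w0] := pselect (w = 0).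
    rewrite (hnorm0 hilb) mulr0 /phi -[inner nu 0 g]/(inner nu (fun=> 0) g) (inner0l hg).
    exact: lexx.
  (* On the unit vector [w / |w|] the elementary inequality gives the constant [(1 + |g|^2) / 2]. *)
  have := re_inner_le (b2_L2 ((norm w)^-1%:C%C *: w)) hg.
  rewrite -/(phi _) phiZ -(hnorm_nrm2 ((norm w)^-1%:C%C *: w)) (hnormZr hilb).
  rewrite normfV ger0_norm ?(ltW w0)// mulVf ?gt_eqF// expr1n => h1.
  rewrite -ler_pdivrMr// [X in X <= _]mulrC; move: h1; set a := _ * phi w; set b := nrm2 nu g.
  by clear; lra.
have [h _ hP] := riesz_re hilb (@lsubspaceT R B) (@closedT R B dot) phiD phiZ phiM.
exists h => v; rewrite (innerBl hg (b2_L2 h) (b2_L2 v)).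
rewrite (innerC (b2_L2 v) hg) (innerC (b2_L2 v) (b2_L2 h)).
suff -> : inner nu v g = inner nu v h by rewrite subrr.
apply: complex_ext; first exact: hP v I.
have := hP ('i *: v) I.
rewrite /phi -[inner nu ('i *: v) g]/(inner nu (fun x => 'i * v x) g) (innerZl _ (b2_L2 v) hg).
rewrite (dotZl hilb) !ReM /= !mul0r !sub0r !mul1r => /eqP; rewrite eqr_opp => /eqP.
by [].
Qed.

Lemma Q_spec g v : L2 nu g -> inner nu (fun x => g x - Q nu g x) v = 0.
Proof.
by move=> hg; move: v; have [h hP] := projection_spec_exists hg; rewrite /Q; case: xgetP => [k _ //|/(_ h)].
Qed.

Lemma inner_Q g v : L2 nu g -> dot (Q nu g) v = inner nu g v.
Proof.
move=> hg; have := Q_spec v hg; rewrite (innerBl hg (b2_L2 _) (b2_L2 v)).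
by move=> /eqP; rewrite subr_eq0 => /eqP ->.
Qed.

Lemma dot_ext u v : (forall w, dot u w = dot v w) -> u = v.
Proof.
move=> uv; apply/eqP; rewrite -subr_eq0; apply/eqP; apply: (dot_eq0 hilb).
by rewrite (dotBl hilb) uv subrr.
Qed.

Lemma Q_unique g h : L2 nu g -> (forall v, inner nu g v = dot h v) -> Q nu g = h.
Proof. by move=> hg hh; apply: dot_ext => v; rewrite inner_Q// hh. Qed.

Lemma Q_b2 u : Q nu u = u.
Proof. by apply: Q_unique => //; exact: b2_L2. Qed.

Lemma Q_lin (c : R[i]) F G : L2 nu F -> L2 nu G -> Q nu (c *: F + G) = c *: Q nu F + Q nu G.
Proof.
move=> hF hG; apply: Q_unique; first exact: L2_lin.
move=> v; rewrite (inner_lin _ hF hG (b2_L2 v)) (dotDl hilb) (dotZl hilb).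
by rewrite !inner_Q.
Qed.

Lemma Q_pythagoras g h : L2 nu g -> nrm2 nu (fun x => g x - h x) =
  nrm2 nu (fun x => g x - Q nu g x) + nrm2 nu (Q nu g - h).
Proof.
move=> hg; have := nrm2_add (L2B hg (b2_L2 (Q nu g))) (b2_L2 (Q nu g - h)).
rewrite (Q_spec _ hg) mulr0 addr0 => <-; congr nrm2; apply/funext => x.
by rewrite -[b2_fun (_ - h) x]/(Q nu g x - h x) addrA subrK.
Qed.

Lemma Q_dist g h : L2 nu g ->
  nrm2 nu (fun x => g x - Q nu g x) <= nrm2 nu (fun x => g x - h x).
Proof. by move=> hg; rewrite (Q_pythagoras h hg) lerDl nrm2_ge0. Qed.

Lemma nrm2_Q g : L2 nu g -> nrm2 nu (Q nu g) <= nrm2 nu g.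
Proof.
move=> hg; have := Q_pythagoras 0 hg.
have -> : (fun x => g x - b2_fun (0 : B) x) = g by apply/funext => x; exact: subr0.
by rewrite subr0 => ->; rewrite lerDr nrm2_ge0.
Qed.

Lemma hnorm_le u v (c : R) : 0 <= c -> nrm2 nu u <= c * nrm2 nu v ->
  norm u <= Num.sqrt c * norm v.
Proof.
move=> c0 h; rewrite -ler_sqr ?nnegrE ?mulr_ge0 ?sqrtr_ge0// exprMn.
by rewrite (sqr_sqrtr c0) !hnorm_nrm2.
Qed.

Lemma toeplitz_linear f : cbmeas f -> linear (@toeplitz R n nu f).
Proof.
move=> bf c u v; rewrite /toeplitz -Q_lin; [|exact: L2M (b2_L2 _)..].
congr Q; apply/funext => x.
by rewrite -[b2_fun (_ + v) x]/(c * u x + v x) -[RHS]/(c * (f x * u x) + f x * v x) mulrDr mulrCA.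
Qed.

Lemma nrm2_toeplitz f (M : R) u : cbmeas f ->
  (forall x, uball x -> reF f x * reF f x + imF f x * imF f x <= M) ->
  nrm2 nu (toeplitz f u) <= M * nrm2 nu u.
Proof.
move=> bf hM; apply: le_trans (nrm2_Q (L2M bf (b2_L2 u))) _.
exact: nrm2M (b2_L2 u) hM.
Qed.

Lemma toeplitz_bounded f : cbmeas f -> bounded_op dot (@toeplitz R n nu f).
Proof.
move=> bf; split; first exact: toeplitz_linear.
have [M M0 hM] := cbmeas_bound bf; exists (Num.sqrt M) => u.
by apply: hnorm_le; [exact: ltW|exact: nrm2_toeplitz].
Qed.

Definition cconj F : CF := fun x => (F x)^*%C.

Lemma cconjK F : cconj (cconj F) = F.
Proof. by apply/funext => x; apply: complex_ext; rewrite !(ReJ, ImJ) ?opprK. Qed.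

Lemma reF_cconj F : reF (cconj F) = reF F.
Proof. by apply/funext => x; rewrite /reF ReJ. Qed.

Lemma imF_cconj F : imF (cconj F) = (fun x => -1 * imF F x).
Proof. by apply/funext => x; rewrite /imF ImJ mulN1r. Qed.

Lemma cbmeas_conj f : cbmeas f -> cbmeas (cconj f).
Proof. by move=> [bR bI]; split; rewrite ?reF_cconj// imF_cconj; exact: bmeasZ. Qed.

Lemma L2_conj F : L2 nu F -> L2 nu (cconj F).
Proof.
move=> /L2P[fR fI]; apply/L2P; rewrite reF_cconj imF_cconj; split=> //.
by apply: sqint_bmeasM fI; exact: bmeas_cst.
Qed.

Lemma inner_conj F G : L2 nu F -> L2 nu G -> inner nu (cconj F) (cconj G) = (inner nu F G)^*%C.
Proof.
move=> hF hG; rewrite -innerC//; congr cintegral; apply/funext => x.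
by apply: complex_ext; rewrite ?ReM ?ImM ?ReJ ?ImJ; ring.
Qed.

Lemma toeplitz_adjoint f : cbmeas f ->
  is_adjoint dot (@toeplitz R n nu f) (@toeplitz R n nu (cconj f)).
Proof.
move=> bf u v; have l1 := L2M bf (b2_L2 u); have l2 := L2M (cbmeas_conj bf) (b2_L2 v).
rewrite /toeplitz inner_Q// (dotC hilb) inner_Q// -(innerC l2 (b2_L2 u)).
congr cintegral; apply/funext => x.
by apply: complex_ext; rewrite ?complexpE; ring.
Qed.

Lemma conj_exists u : exists v : B, forall x, v x = (u x)^*%C.
Proof.
have [hR hI lu u0] := b2P u.
have [|||v vP] := @b2_exists R n nu n_ge2 nu_ball nu_invariant nu_boundary (cconj u).
- rewrite reF_cconj; exact: hR.
- rewrite imF_cconj; have := harmonic_onD (-1) 0 (@open_uball R n) hI hI.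
  by congr harmonic_on; apply/funext => x; rewrite mul0r addr0.
- exact: L2_conj.
exists v => x; have [Bx|nB] := pselect (uball x); first exact: vP.
have [_ _ _ v0] := b2P v.
by rewrite v0// u0// rmorph0.
Qed.

Definition conj_op u : B := sval (cid (conj_exists u)).

Lemma conj_opE u x : conj_op u x = (u x)^*%C.
Proof. by rewrite /conj_op; case: cid. Qed.

Lemma conj_op_lin (c : R[i]) u v : conj_op (c *: u + v) = c^*%C *: conj_op u + conj_op v.
Proof.
apply: b2_ext => x Bx; rewrite conj_opE -[b2_fun (c *: u + v) x]/(c * u x + v x).
rewrite -[RHS]/(c^*%C * conj_op u x + conj_op v x) !conj_opE.
by apply: complex_ext; rewrite ?complexpE; ring.
Qed.

Lemma conj_opK : involutive conj_op.
Proof.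
by move=> u; apply: b2_ext => x Bx; rewrite !conj_opE; apply: complex_ext; rewrite !complexpE ?opprK.
Qed.

Lemma conj_op_Q g : L2 nu g -> conj_op (Q nu g) = Q nu (cconj g).
Proof.
move=> hg; apply/esym/Q_unique; first exact: L2_conj.
have conjE w : b2_fun (conj_op w) = cconj w by apply/funext => x; exact: conj_opE.
move=> v; rewrite -[in LHS](conj_opK v) [X in inner _ _ X]conjE (inner_conj hg (b2_L2 _)).
rewrite -(inner_Q _ hg) -(inner_conj (b2_L2 _) (b2_L2 _)) -!conjE.
by rewrite conj_opK.
Qed.

Lemma conj_op_toeplitz f u : cbmeas f ->
  conj_op (toeplitz f (conj_op u)) = toeplitz (cconj f) u.
Proof.
move=> bf; rewrite /toeplitz conj_op_Q; last exact: L2M bf (b2_L2 _).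
congr Q; apply/funext => x; rewrite /cconj conj_opE.
by apply: complex_ext; rewrite ?complexpE; ring.
Qed.

Lemma hnorm_conj_op u : norm (conj_op u) = norm u.
Proof.
have h : norm (conj_op u) ^+ 2 = norm u ^+ 2.
  rewrite !hnorm_nrm2; apply: eq_bint => x _.
  by rewrite /reF /imF conj_opE !(ReJ, ImJ) mulrNN.
by apply/eqP; rewrite -(@eqrXn2 _ 2) ?sqrtr_ge0 ?h.
Qed.

End Toeplitz.

(** * Compactness of semicommutators *)

Section CoordinateDefect.
Context {R : realType} {n : nat} (nu : probability (borel_rV R n) R).
Hypothesis n_ge2 : (2 <= n)%N.
Hypothesis nu_ball : nu uball = 1%E.
Hypothesis nu_invariant : rotation_invariant nu.
Hypothesis nu_boundary : charges_boundary nu.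
Local Notation E := 'rV[R]_n.
Implicit Types (f g h q : E -> R).

(** The square of the factor in the correction [(|x|^2 - 1) p], so that the squared norm of the
    correction is an integral of [p^2] against a weight. *)
Let depth : E -> R := fun x => (1 - nsq x) ^+ 2.

Lemma weight_depth : weight depth.
Proof.
have w1 := weight_lin 1 (-1) (weight_cst (R := R) (n := n) 1) (weight_nsq (R := R) (n := n)).
have := weightM w1 w1; congr weight; apply/funext => x; rewrite /depth; ring.
Qed.

Lemma bmeas_nsqX k : bmeas (fun x : E => nsq x ^+ k).
Proof. exact: hom_bmeas (hom_nsqX k). Qed.

Lemma geometric_small (t c e : R) : 0 <= t -> t < 1 -> 0 <= c -> 0 < e ->
  exists M, forall k, (M <= k)%N -> c * t ^+ k <= e.
Proof.
(* With exponent 1 a single term of the bounded sum gives [(k + 1) t^k <= C]. *)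
move=> t0 t1 c0 e0; have [C C0 hC] := poly_growth_sum 1 t0 t1.
have [M hM] := rate_small (mulr_ge0 c0 (ltW C0)) e0.
exists M => k /hM; apply: le_trans; rewrite -mulrA ler_wpM2l//.
rewrite /rate ler_pdivlMr// mulrC; apply: le_trans (hC k.+1).
rewrite big_ord_recr /= expn1 lerDr; apply: sumr_ge0 => i _.
by rewrite mulr_ge0// exprn_ge0.
Qed.

(* Near the sphere [depth] is small; far from it the moments are negligible. *)
Lemma depth_moment_small (e : R) : 0 < e -> exists M, forall k, (M <= k)%N ->
  wint nu depth (fun x => nsq x ^+ k) <= e * wint nu (fun=> 1) (fun x => nsq x ^+ k.+1).
Proof.
move=> e0; pose d := Num.min (2^-1) (e / 4).
have d0 : 0 < d by rewrite lt_min invr_gt0 ltr0n /= divr_gt0.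
have dh : d <= 2^-1 by rewrite ge_min lexx.
have de : d <= e / 4 by rewrite ge_min lexx orbT.
have h2 : (2^-1 : R) + 2^-1 = 1 by rewrite [RHS]splitr div1r.
pose t := 1 - d; have t0 : 0 < t by rewrite /t; lra.
have t1 : t < 1 by rewrite /t; lra.
pose r := 1 - d / 2; have r0 : 0 < r by rewrite /r; lra.
have r1 : r < 1 by rewrite /r; lra.
have tr : t < r by rewrite /t /r; lra.
have [s [rs s1 mu]] := annulus_charged nu_boundary r0 r1.
have mass0 := bint_annulus_gt0 s1 mu; set mass := bint nu _ in mass0.
have tr1 : t / r < 1 by rewrite ltr_pdivrMr// mul1r.
have [M hM] := geometric_small (divr_ge0 (ltW t0) (ltW r0)) tr1 (ltW (divr_gt0 ltr01 (mulr_gt0 r0 mass0))) (divr_gt0 e0 (ltr0n R 2)).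
exists M => k Mk.
have Mge : r ^+ k.+1 * mass <= wint nu (fun=> 1) (fun x => nsq x ^+ k.+1).
  apply: le_trans (moment_ge nu s r0 k.+1) _.
  apply: le_bint.
  - by apply: bmeasM; [exact: (weight_annulus r s).1|exact: bmeas_nsqX].
  - by apply: bmeasM; [exact: bmeas_cst|exact: bmeas_nsqX].
  move=> x _; rewrite annulus_weightE ler_wpM2r ?exprn_ge0 ?nsq_ge0//.
  by case: (r <= nsq x <= s)%R.
have tk : t ^+ k <= e / 2 * wint nu (fun=> 1) (fun x => nsq x ^+ k.+1).
  have : t ^+ k <= e / 2 * (r ^+ k.+1 * mass).
    have := hM k Mk; rewrite expr_div_n => h.
    rewrite -ler_pdivrMr; last by rewrite mulr_gt0// exprn_gt0.
    apply: le_trans h; rewrite le_eqVlt; apply/orP; left; apply/eqP.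
    by rewrite exprS; field; rewrite !gt_eqF// exprn_gt0.
  by move=> h; apply: le_trans h _; apply: ler_wpM2l => //; rewrite divr_ge0// ltW.
apply: (@le_trans _ _ (t ^+ k + e / 2 * wint nu (fun=> 1) (fun x => nsq x ^+ k.+1))); last first.
  by move: tk; set w := wint _ _ _; clear; lra.
rewrite -[X in X + _](bint_cst nu_ball) /wint -bintZ; last first.
  by apply: bmeasM; [exact: bmeas_cst|exact: bmeas_nsqX].
rewrite -bintD; last 2 first.
- exact: bmeas_cst.
- by apply/bmeasZ/bmeasM; [exact: bmeas_cst|exact: bmeas_nsqX].
apply: le_bint.
- by apply: bmeasM; [exact: weight_depth.1|exact: bmeas_nsqX].
- by apply: bmeasD; [exact: bmeas_cst|apply/bmeasZ/bmeasM; [exact: bmeas_cst|exact: bmeas_nsqX]].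
move=> x /uball_nsq x1; rewrite mul1r /depth; have x0 := nsq_ge0 x.
have X0 : 0 <= nsq x ^+ k by rewrite exprn_ge0.
have [xt|xt] := leP (nsq x) t.
  apply: (@le_trans _ _ (t ^+ k)).
    apply: (@le_trans _ _ (nsq x ^+ k)).
      by rewrite ler_piMl// expr_le1 ?subr_ge0 ?(ltW x1)// gerBl.
    by rewrite lerXn2r// nnegrE ltW.
  by rewrite lerDl mulr_ge0 ?divr_ge0 ?(ltW e0)// exprn_ge0.
apply: (@le_trans _ _ (e / 2 * nsq x ^+ k.+1)); last by rewrite lerDr exprn_ge0// ltW.
rewrite [nsq x ^+ k.+1]exprS mulrA ler_wpM2r//.
have xh : 2^-1 <= nsq x by move: xt; rewrite /t; lra.
have h3 : (1 - nsq x) ^+ 2 <= d ^+ 2.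
  by rewrite ler_sqr ?nnegrE ?subr_ge0 ?(ltW x1) ?(ltW d0)//; move: xt; rewrite /t; lra.
apply: le_trans h3 _; rewrite expr2; move: dh de xh d0 e0 h2; clear; set a := (2^-1 : R).
move: (nsq x) => y; nra.
Qed.

(** Both integrals are moments times Fischer forms. The factor [(n + 2 k)^2] cancels the square of
    the normalisation of [p], and what remains of the coefficients is [(n + 2 k) / (k + 1) >= 1]. *)
Lemma form_depth_le (e : R) : 0 < e -> exists M, forall k q j, (M <= k)%N -> Harm k.+1 q ->
  wint nu depth (fun x => partial j q x * partial j q x) <=
  e * (n%:R + 2 * k%:R) ^+ 2 * wint nu (fun=> 1) (fun x => q x * q x).
Proof.
move=> e0; have [M hM] := depth_moment_small e0; exists M => k q j Mk hq.
have w1 := weight_cst (R := R) (n := n) 1.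
rewrite (wint_Harm_fischer n_ge2 nu_ball nu_invariant w1 hq hq).
rewrite (wint_Harm_fischer n_ge2 nu_ball nu_invariant weight_depth (Harm_partial j hq) (Harm_partial j hq)).
have := hM k Mk; set W := wint nu depth _; set W' := wint nu _ _ => WW.
have fis : fischer k (partial j q) (partial j q) <= fischer k.+1 q q.
  rewrite /= (bigD1 j)//= lerDl; apply: sumr_ge0 => i _; exact: fischer_ge0.
have f0 := fischer_ge0 k (partial j q); have f1 := fischer_ge0 k.+1 q.
have c0 := moment_coef_gt0 (R := R) n_ge2 k.
have W0 : 0 <= W.
  apply: bint_ge0 => x _; apply: mulr_ge0; first exact: sqr_ge0.
  by rewrite exprn_ge0// nsq_ge0.
have W'0 : 0 <= W'.
  by apply: bint_ge0 => x _; rewrite mul1r exprn_ge0// nsq_ge0.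
have n2 : (2 : R) <= n%:R by rewrite ler_nat.
have k0 : (0 : R) <= k%:R by [].
apply: (@le_trans _ _ (moment_coef (R := R) (n := n) k * fischer k.+1 q q * (e * W'))).
  apply: ler_pM => //; first by rewrite mulr_ge0// ltW.
  by rewrite ler_pM2l.
have p0 : 0 < n%:R + 2 * k%:R :> R by rewrite ltr_pwDl ?mulr_ge0// (lt_le_trans _ n2).
have -> : e * (n%:R + 2 * k%:R) ^+ 2 * (moment_coef (R := R) (n := n) k.+1 * fischer k.+1 q q * W') =
   (moment_coef (R := R) (n := n) k * fischer k.+1 q q * (e * W')) * ((n%:R + 2 * k%:R) / k.+1%:R).
  rewrite [moment_coef k.+1]/=; field; apply/andP; split; apply: lt0r_neq0 => //.
  by rewrite addrC.
apply: ler_peMr; first by rewrite !mulr_ge0// ltW.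
rewrite ler_pdivlMr// mul1r -[k.+1]addn1 natrD; lra.
Qed.

Lemma laplacian_coord_mul m q j x : homp m q ->
  laplacian (fun y : E => y ord0 j * q y) x = 2 * partial j q x + x ord0 j * laplacian q x.
Proof.
move=> hq; rewrite (laplacian_mul x (homX j) hq).
have -> : laplacian (fun y : E => y ord0 j) x = 0.
  by rewrite /laplacian big1// => i _; rewrite !partialX partial_cst.
rewrite mul0r add0r; congr (_ * _ + _).
by rewrite (bigD1 j)//= big1 ?addr0 => [|i /negbTE ij]; rewrite partialX ?eqxx ?mul1r// eq_sym ij mul0r.
Qed.

(* [x_j q - (|x|^2 - 1) p] is the harmonic function agreeing with [x_j q] on the
   unit sphere; its components of degree [k + 2] and [k] are [x_j q - |x|^2 p]
   and [p]. *)
Lemma Harm_coord_mul k q j : Harm k.+1 q -> let p := fun x : E => (n%:R + 2 * k%:R)^-1 * partial j q x in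
  Harm k.+2 (fun x : E => x ord0 j * q x + (-1) * (nsq x * p x)).
Proof.
move=> hq p; have hp : Harm k p by apply: HarmZ; exact: Harm_partial j hq.
have h1 : homp k.+2 (fun x : E => x ord0 j * q x) by exact: hom_mulX hq.1.
have h2 : homp k.+2 (fun x : E => nsq x * p x) by exact: hom_mul hom_nsq hp.1.
split; first by have := hom_lin 1 (-1) h1 h2; under eq_fun do rewrite mul1r.
move=> x; have := laplacian_lin 1 (-1) h1 h2.
under eq_fun do rewrite mul1r; move=> ->.
rewrite (laplacian_coord_mul _ _ hq.1) (laplacian_nsq_mul _ hp.1) hq.2 hp.2.
have n2 : (2 : R) <= n%:R by rewrite ler_nat.
have k0 : (0 : R) <= k%:R by [].
by rewrite /p; field; apply: lt0r_neq0; lra.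
Qed.

(** The defect of the whole sum is [(|x|^2 - 1)] times the sum of the [p m], which have different
    degrees; orthogonality for the weights [depth] and 1 reduces the claim to one degree at a
    time. *)
Theorem coordinate_defect (e : R) : 0 < e -> exists2 M, (0 < M)%N &
  forall N (q : nat -> E -> R) j, (forall m, Harm m (q m)) -> exists2 h, hpoly h &
    bint nu (fun x => (x ord0 j * (\sum_(m < N | (M <= m)%N) q m x) - h x) *
                      (x ord0 j * (\sum_(m < N | (M <= m)%N) q m x) - h x)) <=
    e * bint nu (fun x => (\sum_(m < N | (M <= m)%N) q m x) * (\sum_(m < N | (M <= m)%N) q m x)).
Proof.
move=> e0; have [M0 hM] := form_depth_le e0; exists M0.+1 => // N q j hq.
(* Both families are set to zero below the threshold so that every sum runs over all of [N]. *)
pose p m := fun x : E => if (M0 < m)%N then (n%:R + 2 * m.-1%:R)^-1 * partial j (q m) x else 0.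
pose b m := fun x : E => if (M0 < m)%N then q m x else 0.
have hp m : Harm m.-1 (p m).
  rewrite /p; case: (ltnP M0 m) => _; last exact: Harm0.
  by apply: HarmZ; exact: Harm_partial.
have hb m : Harm m (b m).
  by rewrite /b; case: (ltnP M0 m) => _; [exact: hq|exact: Harm0].
have bE x : \sum_(m < N | (M0.+1 <= m)%N) q m x = \sum_(m < N) b m x.
  by rewrite big_mkcond.
have hh m : hpoly (fun x => x ord0 j * b m x + (-1) * (nsq x * p m x)).
  rewrite /b /p; case: (ltnP M0 m) => mM; last first.
    rewrite (_ : (fun x => _) = fun=> 0); first exact: hpoly0.
    by apply/funext => x; rewrite !mulr0 addr0.
  case: m mM => // m mM; exact: Harm_hpoly (Harm_coord_mul j (hq m.+1)).
have hpol : hpoly (fun x => \sum_(m < N) (1 * (x ord0 j * b m x + (-1) * (nsq x * p m x)) + 1 * p m x)).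
  elim: N {bE} => [|N IH]; first by under eq_fun do rewrite big_ord0; exact: hpoly0.
  under eq_fun do rewrite big_ord_recr; apply: hpolyD => //=.
  by apply: hpoly_lin => //; exact: Harm_hpoly (hp N).
eexists; first exact: hpol.
have bp m : bmeas (p m) := hom_bmeas (hp m).1.
have bb m : bmeas (b m) := hom_bmeas (hb m).1.
(* Equal degrees are tolerated when the product vanishes: [predn] identifies 0 and 1, but [p 0] is
   zero. *)
have ortho w (F : nat -> E -> R) (d : nat -> nat) : weight w -> (forall m, Harm (d m) (F m)) ->
    (forall (m k : 'I_N) x, m != k -> d m = d k -> F m x * F k x = 0) ->
    wint nu w (fun x => (\sum_(m < N) F m x) * (\sum_(m < N) F m x)) =
    \sum_(m < N) wint nu w (fun x => F m x * F m x).
  move=> ww hF dF; have bw := ww.1; have bF m : bmeas (F m) := hom_bmeas (hF m).1.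
  have -> : (fun x : E => (\sum_(m < N) F m x) * (\sum_(m < N) F m x)) =
    (fun x => \sum_(i < N) \sum_(k < N) F i x * F k x).
    by apply/funext => x; rewrite mulr_suml; apply: eq_bigr => i _; rewrite mulr_sumr.
  rewrite (wint_sum nu _ bw); last by move=> i; apply: bmeas_sum => k; exact: bmeasM.
  apply: eq_bigr => i _.
  rewrite (wint_sum nu _ bw); last by move=> k; exact: bmeasM.
  rewrite (bigD1 i)//= big1 ?addr0// => k ki.
  have [dk|dk] := eqVneq (d i) (d k).
    rewrite /wint (_ : (fun x => _) = fun=> 0); first exact: bint_cst.
    by apply/funext => x; rewrite (dF i k) ?mulr0// eq_sym.
  exact: (wint_Harm_orthogonal n_ge2 nu_ball nu_invariant (elimN eqP dk) ww (hF i) (hF k)).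
under eq_bint => x _ do rewrite bE.
under [X in _ <= _ * X]eq_bint => x _ do rewrite bE.
have -> : bint nu (fun x => (\sum_(m < N) b m x) * (\sum_(m < N) b m x)) =
   \sum_(m < N) wint nu (fun=> 1) (fun x => b m x * b m x).
  rewrite -(ortho _ b id)//; last by move=> m k x mk h; case/eqP: mk; exact: val_inj.
    by rewrite /wint; congr bint; apply/funext => x; rewrite mul1r.
  exact: weight_cst.
have -> : bint nu (fun x => (x ord0 j * (\sum_(m < N) b m x) -
      \sum_(m < N) (1 * (x ord0 j * b m x + (-1) * (nsq x * p m x)) + 1 * p m x)) *
      (x ord0 j * (\sum_(m < N) b m x) -
      \sum_(m < N) (1 * (x ord0 j * b m x + (-1) * (nsq x * p m x)) + 1 * p m x))) =
   \sum_(m < N) wint nu depth (fun x => p m x * p m x).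
  rewrite -(ortho _ p predn)//; last 2 first.
  - exact: weight_depth.
  - move=> i k x ik; rewrite /p; case: (ltnP M0 i) => [iM|_ _]; last by rewrite mul0r.
    case: (ltnP M0 k) => [kM h|_ _]; last by rewrite mulr0.
    case/eqP: ik; apply: val_inj => /=.
    by rewrite -(prednK (leq_ltn_trans (leq0n M0) iM)) h prednK// (leq_ltn_trans (leq0n M0) kM).
  rewrite /wint; congr bint; apply/funext => x; rewrite /depth.
  have -> : x ord0 j * (\sum_(m < N) b m x) -
      \sum_(m < N) (1 * (x ord0 j * b m x + (-1) * (nsq x * p m x)) + 1 * p m x) =
      (nsq x - 1) * \sum_(m < N) p m x.
    by rewrite !mulr_sumr -sumrB; apply: eq_bigr => m _; ring.
  ring.
rewrite mulr_sumr; apply: ler_sum => m _; rewrite /b /p.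
case: (ltnP M0 m) => mM; last first.
  have -> : wint nu depth (fun=> 0 * 0) = 0.
    by rewrite /wint (_ : (fun x => _) = fun=> 0) ?(bint_cst nu_ball)//; apply/funext => x; rewrite mul0r mulr0.
  have -> : wint nu (fun=> 1) (fun=> 0 * 0) = 0.
    by rewrite /wint (_ : (fun x => _) = fun=> 0) ?(bint_cst nu_ball)//; apply/funext => x; rewrite mul0r mulr0.
  by rewrite mulr0.
case: (nat_of_ord m) mM => // k; rewrite ltnS => kM /=.
have n2 : (2 : R) <= n%:R by rewrite ler_nat.
have k0 : (0 : R) <= k%:R by [].
have p0 : 0 < n%:R + 2 * k%:R :> R by lra.
have bd : bmeas (partial j (q k.+1)) := hom_bmeas (Harm_partial j (hq k.+1)).1.
rewrite (_ : (fun x : E => _) = (fun x => ((n%:R + 2 * k%:R)^-1 ^+ 2) * (partial j (q k.+1) x * partial j (q k.+1) x))).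
  rewrite (wintZ nu _ weight_depth.1); last exact: bmeasM.
  rewrite exprVn mulrC ler_pdivrMr ?exprn_gt0// mulrAC.
  exact: hM (hq k.+1).
by apply/funext => x; ring.
Qed.

End CoordinateDefect.

(** * Density of the harmonic polynomials *)

Section Density.
Context {R : realType} {V : lmodType R[i]} (dot : V -> V -> R[i]) (H : hilbert dot).
Local Notation norm := (hnorm dot).

(** The residual of the projection onto the closure of [W] is orthogonal to [W], hence zero. *)
Lemma total_dense (W : set V) : lsubspace W ->
  (forall u, (forall w, W w -> dot u w = 0) -> u = 0) ->
  forall (u : V) (e : R), 0 < e -> exists2 w, W w & norm (u - w) < e.
Proof.
move=> [W0 WD] total.
pose X : set V := [set u | forall e : R, 0 < e -> exists2 w, W w & norm (u - w) < e].
have WX w : W w -> X w by move=> Ww e e0; exists w => //; rewrite subrr (hnorm0 H).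
have sX : lsubspace X.
  split=> [|c u v hu hv e e0]; first exact: WX.
  have e2 : 0 < e / 2 by rewrite divr_gt0.
  pose K := Num.sqrt (complex.Re c ^+ 2 + complex.Im c ^+ 2) + 1.
  have K0 : 0 < K by rewrite ltr_wpDl ?sqrtr_ge0.
  have [u' Wu hu'] := hu _ (divr_gt0 e2 K0); have [v' Wv hv'] := hv _ e2.
  exists (c *: u' + v'); first exact: WD.
  have -> : c *: u + v - (c *: u' + v') = c *: (u - u') + (v - v').
    by rewrite scalerBr opprD addrACA.
  rewrite (le_lt_trans (ler_hnormD H _ _))// [ltRHS]splitr ltr_leD// ?(ltW hv')//.
  move: hu'; rewrite ltr_pdivlMr// mulrC; apply: le_lt_trans.
  apply: (hnorm_le_sqr); first by rewrite mulr_ge0 ?hnorm_ge0// ltW.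
  rewrite (hnormZ H) exprMn ler_wpM2r ?sqr_ge0//.
  have s0 := sqrtr_ge0 (complex.Re c ^+ 2 + complex.Im c ^+ 2).
  have h0 : 0 <= complex.Re c ^+ 2 + complex.Im c ^+ 2 by rewrite addr_ge0// sqr_ge0.
  rewrite -[X in X <= _](sqr_sqrtr h0) ler_sqr ?nnegrE ?(ltW K0)//.
  by rewrite /K lerDl.
have cX : norm_closed dot X.
  move=> v hv e e0; have e2 : 0 < e / 2 by rewrite divr_gt0.
  have [w Xw vw] := hv _ e2; have [w' Ww' ww'] := Xw _ e2.
  exists w' => //; rewrite (le_lt_trans (ler_hdist H v w w'))// [ltRHS]splitr.
  exact: ltrD.
move=> u; have [p Xp up] := projection_exists H u sX cX.
have : u - p = 0 by apply: total => w /WX; exact: up.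
by move=> /eqP; rewrite subr_eq0 => /eqP ->.
Qed.

End Density.

Section HarmonicDensity.
Context {R : realType} {n : nat} (nu : probability (borel_rV R n) R).
Hypothesis n_ge2 : (2 <= n)%N.
Hypothesis nu_ball : nu uball = 1%E.
Hypothesis nu_invariant : rotation_invariant nu.
Hypothesis nu_boundary : charges_boundary nu.
Local Notation E := 'rV[R]_n.
Local Notation CF := ('rV[R]_n -> R[i]^o).
Local Notation B := (b2 nu).
Local Notation dot := (@b2_inner R n nu).
Local Notation norm := (hnorm dot).
Implicit Types (u v h : B) (p q : E -> R).

Let hilb : hilbert dot := b2_hilbert n_ge2 nu_ball nu_invariant nu_boundary.

Definition parts_are p q u : Prop := forall x, uball x -> reF u x = p x /\ imF u x = q x.

Definition hpoly_b2 : set B := [set u | exists p q, [/\ hpoly p, hpoly q & parts_are p q u]].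

Lemma hpoly_b2_exists p q : hpoly p -> hpoly q -> exists u, parts_are p q u.
Proof.
move=> hp hq; pose F : CF := fun x => Complex (p x) (q x).
have [|||u uF] := @b2_exists R n nu n_ge2 nu_ball nu_invariant nu_boundary F.
- exact: hpoly_harmonic hp.
- exact: hpoly_harmonic hq.
- by apply/L2P; split; apply: bmeas_sqint; exact: hpoly_bmeas.
by exists u => x Bx; rewrite /reF /imF uF.
Qed.

Lemma lsubspace_hpoly_b2 : lsubspace hpoly_b2.
Proof.
split=> [|c u v [p [q [hp hq uE]]] [p' [q' [hp' hq' vE]]]].
  by exists (fun=> 0), (fun=> 0); split=> //; exact: hpoly0.
exists (fun x => 1 * (complex.Re c * p x + (- complex.Im c) * q x) + 1 * p' x).
exists (fun x => 1 * (complex.Re c * q x + complex.Im c * p x) + 1 * q' x).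
split; [by do 2![apply: hpoly_lin => //]|by do 2![apply: hpoly_lin => //]|].
move=> x Bx; have [u1 u2] := uE x Bx; have [v1 v2] := vE x Bx.
rewrite /reF /imF -[b2_fun (c *: u + v) x]/(c * u x + v x) ReD ImD ReM ImM.
rewrite -[complex.Re (u x)]/(reF u x) -[complex.Im (u x)]/(imF u x).
rewrite -[complex.Re (v x)]/(reF v x) -[complex.Im (v x)]/(imF v x) u1 u2 v1 v2.
by split; ring.
Qed.

Lemma dot_real u v q : bmeas q -> parts_are q (fun=> 0) v ->
  complex.Re (dot u v) = bint nu (fun x => reF u x * q x) /\
  complex.Im (dot u v) = bint nu (fun x => imF u x * q x).
Proof.
move=> bq vE; rewrite [complex.Re _](re_inner (b2_L2 u) (b2_L2 v)).
rewrite [complex.Im _](im_inner (b2_L2 u) (b2_L2 v)).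
have z (f : E -> R) : pairing nu f (imF v) = 0.
  rewrite /pairing (@eq_bint R n nu _ (fun=> 0)); first exact: bint_cst.
  by move=> x Bx; rewrite (vE x Bx).2 mulr0.
rewrite !z addr0 subr0; split; apply: eq_bint => x Bx; rewrite (vE x Bx).1//.
Qed.

Lemma hpoly_b2_total u : (forall w, hpoly_b2 w -> dot u w = 0) -> u = 0.
Proof.
move=> h; have [hR hI lu _] := b2P u; have [sR sI] := (L2P nu u).1 lu.
have z m q : Harm m q -> bint nu (fun x => reF u x * q x) = 0 /\ bint nu (fun x => imF u x * q x) = 0.
  move=> hq; have [w wE] := hpoly_b2_exists (Harm_hpoly hq) hpoly0.
  have [<- <-] := dot_real u (hom_bmeas hq.1) wE.
  rewrite h//; exists q, (fun=> 0); split=> //; [exact: Harm_hpoly hq|exact: hpoly0].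
apply: b2_ext => x Bx; apply: complex_ext.
  exact: (harmonic_orthogonal_eq0 n_ge2 nu_ball nu_invariant nu_boundary hR sR (fun m q hq => (z m q hq).1)).
exact: (harmonic_orthogonal_eq0 n_ge2 nu_ball nu_invariant nu_boundary hI sI (fun m q hq => (z m q hq).2)).
Qed.

Theorem hpoly_b2_dense u (e : R) : 0 < e -> exists2 w, hpoly_b2 w & nrm2 nu (u - w) < e.
Proof.
move=> e0; have [|w hw uw] := total_dense hilb lsubspace_hpoly_b2 hpoly_b2_total u (e := Num.sqrt e).
  by rewrite sqrtr_gt0.
exists w => //; rewrite -[X in nrm2 _ X]/(b2_fun (u - w)) -hnorm_nrm2 -[ltRHS](sqr_sqrtr (ltW e0)).
by rewrite ltr_sqr ?nnegrE ?sqrtr_ge0.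
Qed.

End HarmonicDensity.

(** * Multiplication by coordinates away from low degrees *)

Section LowDegree.
Context {R : realType} {n : nat} (nu : probability (borel_rV R n) R).
Hypothesis n_ge2 : (2 <= n)%N.
Hypothesis nu_ball : nu uball = 1%E.
Hypothesis nu_invariant : rotation_invariant nu.
Hypothesis nu_boundary : charges_boundary nu.
Local Notation E := 'rV[R]_n.
Implicit Types (a f g h p q : E -> R).

Let sq f : R := bint nu (fun x => f x * f x).

Lemma sqintD f g : sqint nu f -> sqint nu g -> sqint nu (fun x => f x + g x).
Proof.
by move=> hf hg; have := sqint_lin 1 1 hf hg; congr sqint; apply/funext => x; rewrite !mul1r.
Qed.

Lemma sqintB f g : sqint nu f -> sqint nu g -> sqint nu (fun x => f x - g x).
Proof.
by move=> hf hg; have := sqint_lin 1 (-1) hf hg; congr sqint; apply/funext => x; rewrite mul1r mulN1r.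
Qed.

Lemma sq_add3 f g h : sqint nu f -> sqint nu g -> sqint nu h ->
  sq (fun x => f x + g x + h x) <= 3 * (sq f + sq g + sq h).
Proof.
move=> hf hg hh; rewrite /sq.
rewrite -ibintD; [|exact: hf.2|exact: hg.2].
rewrite -ibintD; [|exact: integD hf.2 hg.2|exact: hh.2].
rewrite -ibintZ; last exact: integD (integD hf.2 hg.2) hh.2.
apply: le_ibint => [||x _].
- exact: (sqintD (sqintD hf hg) hh).2.
- exact: integZ (integD (integD hf.2 hg.2) hh.2).
have := sqr_ge0 (f x - g x); have := sqr_ge0 (g x - h x); have := sqr_ge0 (f x - h x).
rewrite !expr2; nra.
Qed.

Lemma sqint_coord j f : sqint nu f -> sqint nu (fun x => x ord0 j * f x).
Proof. by apply: sqint_bmeasM; exact: hom_bmeas (homX j). Qed.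

Lemma sq_coord j f : sqint nu f -> sq (fun x => x ord0 j * f x) <= sq f.
Proof.
move=> hf; apply: le_ibint => [||x /uball_nsq /ltW x1]; [exact: (sqint_coord j hf).2|exact: hf.2|].
have -> : x ord0 j * f x * (x ord0 j * f x) = x ord0 j ^+ 2 * (f x * f x) by ring.
rewrite ler_piMl// -?expr2 ?sqr_ge0// -real_normK ?num_real// expr_le1//.
exact: coord_le.
Qed.

Lemma sq_ge0 f : 0 <= sq f.
Proof. by apply: bint_ge0 => x _; rewrite -expr2 sqr_ge0. Qed.

Lemma ibint_sum (I : Type) (r : seq I) (P : pred I) (F : I -> E -> R) :
  (forall i, integ nu (F i)) ->
  integ nu (fun x => \sum_(i <- r | P i) F i x) /\
  bint nu (fun x => \sum_(i <- r | P i) F i x) = \sum_(i <- r | P i) bint nu (F i).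
Proof.
move=> hF; elim: r => [|i r [IH1 IH2]].
  rewrite big_nil (_ : (fun x => _) = fun=> 0); last by apply/funext => x; rewrite big_nil.
  by split; [exact/bmeas_integ/bmeas_cst|exact: bint_cst].
rewrite big_cons; case: ifPn => Pi.
  have -> : (fun x => \sum_(k <- i :: r | P k) F k x) = (fun x => F i x + \sum_(k <- r | P k) F k x).
    by apply/funext => x; rewrite big_cons Pi.
  by split; [exact: integD|rewrite ibintD// IH2].
have -> : (fun x => \sum_(k <- i :: r | P k) F k x) = (fun x => \sum_(k <- r | P k) F k x).
  by apply/funext => x; rewrite big_cons (negbTE Pi).
by [].
Qed.

(** The approximant of [a] splits as [low + high]. As [low] is orthogonal to both [a] and [high],
    its square integral is at most that of the approximation error [a - low - high]. Thus
    multiplying by a coordinate leaves two terms of the size of the error plus the defect of [high],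
    where the degree is large. *)
Lemma low_degree_defect (e : R) : 0 < e -> e <= 1 -> exists M,
  forall a N (P : nat -> E -> R) j, sqint nu a ->
    (forall m q, (m < M)%N -> Harm m q -> bint nu (fun x => a x * q x) = 0) ->
    (forall m, Harm m (P m)) -> exists2 h, hpoly h &
      sq (fun x => x ord0 j * a x - h x) <=
      24 * sq (fun x => a x - \sum_(m < N) P m x) + 9 * e * sq a.
Proof.
move=> e0 e1; have [M M0 hM] := coordinate_defect n_ge2 nu_ball nu_invariant nu_boundary e0.
exists M => a N P j sa aM hP; have [h hh hle] := hM N P j hP; exists h => //.
pose high := fun x => \sum_(m < N | (M <= m)%N) P m x.
pose low := fun x => \sum_(m < N | ~~ (M <= m)%N) P m x.
pose p := fun x => \sum_(m < N) P m x.
have pE x : p x = high x + low x by rewrite /p (bigID (fun m : 'I_N => (M <= m)%N)).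
have bP m : bmeas (P m) := hom_bmeas (hP m).1.
have bsum (Z : pred 'I_N) : bmeas (fun x => \sum_(m < N | Z m) P m x).
  under eq_fun do rewrite big_mkcond; apply: bmeas_sum => m.
  by case: (Z m) => //; exact: bmeas_cst.
have sP m : sqint nu (P m) by exact: bmeas_sqint.
have shi : sqint nu high by apply: bmeas_sqint; exact: bsum.
have slo : sqint nu low by apply: bmeas_sqint; exact: bsum.
have sp : sqint nu p by apply: bmeas_sqint; exact: bsum.
have sd : sqint nu (fun x => a x - p x) by exact: sqintB.
have sh : sqint nu h by apply: bmeas_sqint; exact: hpoly_bmeas.
have lohi : bint nu (fun x => low x * high x) = 0.
  have -> : (fun x => low x * high x) = (fun x => \sum_(m < N | ~~ (M <= m)%N) P m x * high x).
    by apply/funext => x; rewrite mulr_suml.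
  apply: (etrans (ibint_sum _ _ (fun m : 'I_N => sqint_integM (sP m) shi)).2); apply: big1 => m mM.
  have -> : (fun x => P m x * high x) = (fun x => \sum_(k < N | (M <= k)%N) P m x * P k x).
    by apply/funext => x; rewrite mulr_sumr.
  apply: (etrans (ibint_sum _ _ (fun k : 'I_N => sqint_integM (sP m) (sP k))).2); apply: big1 => k kM.
  have mk : (m : nat) <> k by move=> mk; rewrite mk kM in mM.
  have := wint_Harm_orthogonal n_ge2 nu_ball nu_invariant mk (weight_cst 1) (hP m) (hP k).
  by rewrite /wint; under eq_bint => x _ do rewrite mul1r.
have alo : bint nu (fun x => low x * a x) = 0.
  have -> : (fun x => low x * a x) = (fun x => \sum_(m < N | ~~ (M <= m)%N) P m x * a x).
    by apply/funext => x; rewrite mulr_suml.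
  apply: (etrans (ibint_sum _ _ (fun m : 'I_N => sqint_integM (sP m) sa)).2); apply: big1 => m mM.
  under eq_bint => x _ do rewrite mulrC.
  by apply: (aM m); rewrite // ltnNge.
have dE : bint nu (fun x => low x * (a x - p x)) = - sq low.
  have -> : bint nu (fun x => low x * (a x - p x)) =
      bint nu (fun x => 1 * (low x * a x) + (-1) * (1 * (low x * high x) + 1 * (low x * low x))).
    by apply: eq_bint => x _; rewrite pE; ring.
  have i1 := sqint_integM slo sa; have i2 := sqint_integM slo shi; have i3 := slo.2.
  by rewrite (ibint_lin _ _ i1 (integ_lin _ _ i2 i3)) (ibint_lin _ _ i2 i3) alo lohi /sq; ring.
have Dlo : sq low <= sq (fun x => a x - p x).
  have i1 := sd.2; have i2 := sqint_integM slo sd; have i3 := slo.2.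
  have : 0 <= bint nu (fun x => 1 * (1 * ((a x - p x) * (a x - p x)) + 2 * (low x * (a x - p x))) +
      1 * (low x * low x)).
    apply: bint_ge0 => x _; have := sqr_ge0 (a x - p x + low x); rewrite expr2.
    by congr (_ <= _); ring.
  rewrite (ibint_lin _ _ (integ_lin _ _ i1 i2) i3) (ibint_lin _ _ i1 i2) dE /sq.
  set A := bint _ _; set B := bint _ _; lra.
have shi2 : sq high <= 3 * (sq a + sq (fun x => a x - p x) + sq low).
  have s1 : sqint nu (fun x => -1 * (a x - p x)) by apply: sqint_bmeasM sd; exact: bmeas_cst.
  have s2 : sqint nu (fun x => -1 * low x) by apply: sqint_bmeasM slo; exact: bmeas_cst.
  have := sq_add3 sa s1 s2; congr (_ <= _).
    by apply: eq_bint => x _; rewrite pE; ring.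
  by congr (3 * (_ + _ + _)); apply: eq_bint => x _; ring.
have sx : sqint nu (fun x => x ord0 j * high x - h x) by apply: sqintB => //; exact: sqint_coord.
have := sq_add3 (sqint_coord j sd) (sqint_coord j slo) sx.
have -> : sq (fun x => x ord0 j * (a x - p x) + x ord0 j * low x + (x ord0 j * high x - h x)) =
   sq (fun x => x ord0 j * a x - h x).
  by apply: eq_bint => x _; rewrite pE; ring.
have := sq_coord j sd; have := sq_coord j slo.
move: hle Dlo shi2; rewrite -/high -/(sq _) -/(sq high) -/p.
have := sq_ge0 (fun x => a x - p x); have := sq_ge0 a.
set D := sq (fun x => a x - p x); set A := sq a; set H := sq high; set L := sq low.
set T := sq (fun x => x ord0 j * high x - h x).
set T1 := sq _; set T2 := sq _; set T3 := sq _.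
move=> A0 D0 h1 h2 h3 h4 h5 h6.
(* With [e <= 1] this gives [e H <= 3 e A + 6 D], and the total [3 (D + D + e H)] becomes
   [24 D + 9 e A]. *)
have h7 : e * H <= e * (3 * (A + D + D)) by rewrite ler_pM2l//; lra.
have h8 : e * D <= D by rewrite ler_piMl.
lra.
Qed.

End LowDegree.

Lemma forall_mem_cat (T : eqType) (P : T -> Prop) (s1 s2 : seq T) :
  (forall x, x \in s1 ++ s2 -> P x) ->
  (forall x, x \in s1 -> P x) /\ (forall x, x \in s2 -> P x).
Proof. by move=> h; split=> x hx; apply: h; rewrite mem_cat hx ?orbT. Qed.

(** * Symbols with compact distance to the harmonic space *)

Section CompactDefect.
Context {R : realType} {n : nat} (nu : probability (borel_rV R n) R).
Hypothesis n_ge2 : (2 <= n)%N.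
Hypothesis nu_ball : nu uball = 1%E.
Hypothesis nu_invariant : rotation_invariant nu.
Hypothesis nu_boundary : charges_boundary nu.
Local Notation E := 'rV[R]_n.
Local Notation CF := ('rV[R]_n -> R[i]^o).
Local Notation B := (b2 nu).
Local Notation dot := (@b2_inner R n nu).
Local Notation norm := (hnorm dot).
Implicit Types (F G f g : CF) (u v h : B).

Let hilb : hilbert dot := b2_hilbert n_ge2 nu_ball nu_invariant nu_boundary.

Definition defect f u : R := nrm2 nu (fun x => f x * u x - toeplitz f u x).

(** Expresses that the Hankel operator [u |-> f u - Q (f u)] is compact. Its values are not
    harmonic, so it is not an operator on [b2] and the condition is stated through squared norms. *)
Definition compact_defect f : Prop := cbmeas f /\ forall e : R, 0 < e ->
  exists ws : seq B, forall u, (forall w, w \in ws -> dot u w = 0) ->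
    defect f u <= e * nrm2 nu u.

Lemma defect_le f u h : cbmeas f -> defect f u <= nrm2 nu (fun x => f x * u x - h x).
Proof. by move=> bf; exact: Q_dist (L2M bf (b2_L2 u)). Qed.

Lemma L2_defect f u : cbmeas f -> L2 nu (fun x => f x * u x - toeplitz f u x).
Proof. by move=> bf; apply: L2B; [exact: L2M bf (b2_L2 u)|exact: b2_L2]. Qed.

Lemma cbmeas_cst (c : R[i]) : cbmeas (fun _ : E => c : R[i]^o).
Proof. by split; exact: bmeas_cst. Qed.

Lemma cbmeasD f g : cbmeas f -> cbmeas g -> cbmeas (fun x => f x + g x).
Proof.
move=> [fR fI] [gR gI]; split.
  by have := bmeasD fR gR; congr bmeas; apply/funext => x; rewrite /reF ReD.
by have := bmeasD fI gI; congr bmeas; apply/funext => x; rewrite /imF ImD.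
Qed.

Lemma cbmeasM f g : cbmeas f -> cbmeas g -> cbmeas (fun x => f x * g x).
Proof.
move=> [fR fI] [gR gI]; split.
  by have := bmeasB (bmeasM fR gR) (bmeasM fI gI); congr bmeas; apply/funext => x; rewrite /reF ReM.
by have := bmeasD (bmeasM fR gI) (bmeasM fI gR); congr bmeas; apply/funext => x; rewrite /imF ImM.
Qed.

Lemma compact_defect_cst (c : R[i]) : compact_defect (fun=> c : R[i]^o).
Proof.
split; first exact: cbmeas_cst.
move=> e e0; exists [::] => u _; have := defect_le u (c *: u) (cbmeas_cst c).
have -> : nrm2 nu (fun x => (c : R[i]^o) * u x - b2_fun (c *: u) x) = 0.
  rewrite /nrm2 (@eq_bint R n nu _ (fun=> 0)); first exact: bint_cst.
  move=> x _; rewrite /reF /imF -[b2_fun (c *: u) x]/(c * u x) subrr /=.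
  by rewrite !mulr0 addr0.
by move=> h; apply: le_trans h _; rewrite mulr_ge0 ?nrm2_ge0// ltW.
Qed.

Lemma compact_defectD f g : compact_defect f -> compact_defect g ->
  compact_defect (fun x => f x + g x).
Proof.
move=> [bf cf] [bg cg]; have bfg := cbmeasD bf bg; split=> [|e e0]; first exact: bfg.
have e4 : 0 < e / 4 by rewrite divr_gt0.
have [ws1 h1] := cf _ e4; have [ws2 h2] := cg _ e4.
exists (ws1 ++ ws2) => u /forall_mem_cat[/h1 {}h1 /h2 {}h2].
apply: le_trans (defect_le u (toeplitz f u + toeplitz g u) bfg) _.
apply: (@le_trans _ _ (2 * defect f u + 2 * defect g u)); last first.
  by move: h1 h2; move: (defect f u) (defect g u) (nrm2 nu u) => a b c; lra.
apply: le_trans (nrm2D (L2_defect u bf) (L2_defect u bg)).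
rewrite le_eqVlt; apply/orP; left; apply/eqP; congr nrm2; apply/funext => x.
rewrite -[b2_fun (_ + _) x]/(toeplitz f u x + toeplitz g u x); ring.
Qed.

(** Splits [f g u - T_f (T_g u)] as [f (g u - T_g u)] plus the defect of [f] at [T_g u]; the tests
    for the latter are pulled back by the adjoint of [T_g], whose symbol is the conjugate of [g]. *)
Lemma compact_defectM f g : compact_defect f -> compact_defect g ->
  compact_defect (fun x => f x * g x).
Proof.
move=> [bf cf] [bg cg]; have bfg := cbmeasM bf bg; split=> [|e e0]; first exact: bfg.
have [Mf Mf0 hMf] := cbmeas_bound bf; have [Mg Mg0 hMg] := cbmeas_bound bg.
have e1 : 0 < e / (4 * Mg) by rewrite divr_gt0// mulr_gt0.
have e2 : 0 < e / (4 * Mf) by rewrite divr_gt0// mulr_gt0.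
have [ws1 h1] := cf _ e1; have [ws2 h2] := cg _ e2.
exists (map (toeplitz (cconj g)) ws1 ++ ws2) => u /forall_mem_cat[hu /h2 {}h2].
have {}h1 : defect f (toeplitz g u) <= e / (4 * Mg) * nrm2 nu (toeplitz g u).
  apply: h1 => w ww; rewrite (toeplitz_adjoint n_ge2 nu_ball nu_invariant nu_boundary bg).
  exact: hu (map_f _ ww).
apply: le_trans (defect_le u (toeplitz f (toeplitz g u)) bfg) _.
have lg := L2_defect u bg; have lfg := L2M bf lg.
apply: (@le_trans _ _ (2 * nrm2 nu (fun x => f x * (g x * u x - toeplitz g u x)) +
    2 * defect f (toeplitz g u))).
  apply: le_trans (nrm2D lfg (L2_defect _ bf)).
  rewrite le_eqVlt; apply/orP; left; apply/eqP; congr nrm2; apply/funext => x.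
  ring.
have h3 := nrm2M bf lg hMf; rewrite -/(defect g u) in h3.
have h4 := nrm2_toeplitz n_ge2 nu_ball nu_invariant nu_boundary u bg hMg.
have h5 : Mf * defect g u <= e / 4 * nrm2 nu u.
  have -> : e / 4 * nrm2 nu u = Mf * (e / (4 * Mf) * nrm2 nu u) by field; rewrite gt_eqF.
  by rewrite ler_pM2l.
have h6 : e / (4 * Mg) * nrm2 nu (toeplitz g u) <= e / 4 * nrm2 nu u.
  have -> : e / 4 * nrm2 nu u = e / (4 * Mg) * (Mg * nrm2 nu u) by field; rewrite gt_eqF.
  by rewrite ler_pM2l.
move: h1 h3 h5 h6; move: (nrm2 nu _) (nrm2 nu _) (defect f _) (Mf * _) (nrm2 nu u).
by move=> a k b c d; lra.
Qed.

Lemma compact_defect_lim f : cbmeas f -> (forall e : R, 0 < e -> exists2 g, compact_defect g &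
    forall x, uball x -> (reF f x - reF g x) ^+ 2 + (imF f x - imF g x) ^+ 2 <= e) ->
  compact_defect f.
Proof.
move=> bf h; split=> [|e e0]; first exact: bf.
have e4 : 0 < e / 4 by rewrite divr_gt0.
have [g [bg cg] fg] := h _ e4; have [ws hws] := cg _ e4.
exists ws => u /hws hu; apply: le_trans (defect_le u (toeplitz g u) bf) _.
pose d : CF := fun x => f x + (-1) * g x.
have bd : cbmeas d by apply: cbmeasD => //; apply: cbmeasM => //; exact: cbmeas_cst.
have hd x : uball x -> reF d x * reF d x + imF d x * imF d x <= e / 4.
  move=> Bx; apply: le_trans (fg x Bx); rewrite le_eqVlt; apply/orP; left; apply/eqP.
  by rewrite /reF /imF -[d x]/(f x + -1 * g x) mulN1r ReD ReN ImD ImN !expr2.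
have := nrm2D (L2M bd (b2_L2 u)) (L2_defect u bg).
have -> : nrm2 nu (fun x => d x * u x + (g x * u x - toeplitz g u x)) =
    nrm2 nu (fun x => f x * u x - toeplitz g u x).
  by congr nrm2; apply/funext => x; rewrite -[d x]/(f x + -1 * g x); ring.
have := nrm2M bd (b2_L2 u) hd; rewrite -/(defect g u).
move: hu; move: (defect g u) (nrm2 nu (fun x => d x * u x)) (nrm2 nu (fun x => f x * u x - _)) (nrm2 nu u).
by move=> a b c k; lra.
Qed.

(** Harmonic forms of each degree have a finite basis. Its real elements, placed in [b2], test the
    real and imaginary parts of [u] at once. *)
Lemma low_degree_tests M : exists ws : seq B, forall u, (forall w, w \in ws -> dot u w = 0) ->
  forall m q, (m < M)%N -> Harm m q ->
    bint nu (fun x => reF u x * q x) = 0 /\ bint nu (fun x => imF u x * q x) = 0.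
Proof.
elim: M => [|M [ws hws]]; first by exists [::].
have w1 := weight_cst (R := R) (n := n) 1.
have pos : 0 < wint nu (fun=> 1) (fun x : E => nsq x ^+ M).
  have [s [s0 s1 M0]] := moment_pos nu_boundary M; apply: lt_le_trans M0 _.
  apply: le_bint.
  - by apply: bmeasM; [exact: annulus_weight_bmeas|exact: bmeas_nsqX].
  - by apply: bmeasM; [exact: bmeas_cst|exact: bmeas_nsqX].
  move=> x _; rewrite annulus0E ler_wpM2r ?exprn_ge0 ?nsq_ge0//.
  by case: (nsq x <= s).
have [k [b [hb _] bE]] := orthonormal_Harm_basis n_ge2 nu_ball nu_invariant w1 pos.
have /choice[w wP] : forall i, exists w : B, parts_are (b i) (fun=> 0) w.
  by move=> i; exact: (hpoly_b2_exists n_ge2 nu_ball nu_invariant nu_boundary (Harm_hpoly (hb i)) hpoly0).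
exists ([seq w i | i <- enum 'I_k] ++ ws) => u /forall_mem_cat[hu /hws {}hws] m q.
rewrite ltnS leq_eqVlt => /orP[/eqP->|mM] hq; last exact: hws mM hq.
have hi i : bint nu (fun x => reF u x * b i x) = 0 /\ bint nu (fun x => imF u x * b i x) = 0.
  have [<- <-] := dot_real nu_ball u (hom_bmeas (hb i).1) (wP i).
  by rewrite (hu (w i) (map_f w (mem_enum _ i))).
have sb i : sqint nu (b i) by exact: bmeas_sqint (hom_bmeas (hb i).1).
have /L2P[sR sI] := b2_L2 u.
have z (a : E -> R) : sqint nu a -> (forall i, bint nu (fun x => a x * b i x) = 0) ->
    bint nu (fun x => a x * q x) = 0.
  move=> sa ha; pose cf i := wint nu (fun=> 1) (fun x => q x * b i x).
  have qE x : q x = \sum_(i < k) cf i * b i x.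
    exact: (congr1 (fun g : E -> R => g x) (bE q hq)).
  have -> : (fun x => a x * q x) = (fun x => \sum_(i < k) cf i * (a x * b i x)).
    by apply/funext => x; rewrite qE mulr_sumr; apply: eq_bigr => i _; rewrite mulrCA.
  apply: (etrans (ibint_sum nu_ball _ _ (fun i => integZ (cf i) (sqint_integM sa (sb i)))).2).
  apply: big1 => i _; rewrite ibintZ ?ha ?mulr0//; exact: sqint_integM.
by split; apply: z => // i; have [] := hi i.
Qed.

Lemma compact_defect_coord j : compact_defect (fun x => (x ord0 j)%:C%C).
Proof.
have bj : cbmeas (fun x : E => (x ord0 j)%:C%C : R[i]^o).
  by split; [exact: hom_bmeas (homX j)|exact: bmeas_cst].
split=> [|e e0]; first exact: bj.
(* The constants 24 and 9 of [low_degree_defect] are met by an approximation within [e / 48] and by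
   [t <= e / 18], each contributing [e / 2]. *)
pose t := Num.min 1 (e / 18).
have t0 : 0 < t by rewrite lt_min ltr01 divr_gt0.
have t1 : t <= 1 by rewrite ge_min lexx.
have te : t <= e / 18 by rewrite ge_min lexx orbT.
have [M hM] := low_degree_defect n_ge2 nu_ball nu_invariant nu_boundary t0 t1.
have [ws hws] := low_degree_tests M.
exists ws => u /hws hu.
(* Treated apart because density is used with an error proportional to the squared norm of [u],
   which has to be positive. *)
have [u0|u0] := eqVneq (nrm2 nu u) 0.
  apply: (@le_trans _ _ (1 * nrm2 nu u)); last by rewrite u0 !mulr0.
  apply: le_trans (defect_le u 0 bj) _.
  have -> : (fun x : E => (x ord0 j)%:C%C * u x - b2_fun (0 : B) x) = (fun x : E => (x ord0 j)%:C%C * u x).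
    by apply/funext => x; exact: subr0.
  apply: (nrm2M bj (b2_L2 u)) => x /uball_nsq/ltW x1.
  rewrite /reF /imF /= mulr0 addr0 -expr2 -real_normK ?num_real// expr_le1//.
  exact: coord_le.
have upos : 0 < nrm2 nu u by rewrite lt_def u0 nrm2_ge0.
have d0 : 0 < e / 48 * nrm2 nu u by rewrite mulr_gt0// divr_gt0.
have [v [p [q [hp hq vE]]] uv] := hpoly_b2_dense n_ge2 nu_ball nu_invariant nu_boundary u d0.
have /L2P[sR sI] := b2_L2 u.
have [N [P [hP pE]]] := hp; have [N' [P' [hP' qE]]] := hq.
have [h1 hh1 le1] := hM _ N P j sR (fun m s mM hs => (hu m s mM hs).1) hP.
have [h2 hh2 le2] := hM _ N' P' j sI (fun m s mM hs => (hu m s mM hs).2) hP'.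
have [h hE] := hpoly_b2_exists n_ge2 nu_ball nu_invariant nu_boundary hh1 hh2.
apply: le_trans (defect_le u h bj) _.
have sx (a g : E -> R) : sqint nu a -> hpoly g -> integ nu (fun x => (x ord0 j * a x - g x) * (x ord0 j * a x - g x)).
  move=> sa hg; apply: (sqintB _ _).2; first exact: sqint_coord.
  by apply: bmeas_sqint; exact: hpoly_bmeas.
have -> : nrm2 nu (fun x => (x ord0 j)%:C%C * u x - h x) =
    bint nu (fun x => (x ord0 j * reF u x - h1 x) * (x ord0 j * reF u x - h1 x)) +
    bint nu (fun x => (x ord0 j * imF u x - h2 x) * (x ord0 j * imF u x - h2 x)).
  rewrite -ibintD; [|exact: sx..].
  apply: eq_bint => x Bx; have [<- <-] := hE x Bx.
  rewrite /reF /imF ReD ImD ReN ImN ReM ImM /=; ring.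
have su (a : E -> R) : sqint nu a -> forall N (P : nat -> E -> R), (forall m, Harm m (P m)) ->
    integ nu (fun x => (a x - \sum_(m < N) P m x) * (a x - \sum_(m < N) P m x)).
  move=> sa N0 P0 hP0; apply: (sqintB _ _).2 => //.
  by apply: bmeas_sqint; apply: bmeas_sum => m; exact: hom_bmeas (hP0 m).1.
have e1 : nrm2 nu (u - v) = bint nu (fun x => (reF u x - \sum_(m < N) P m x) * (reF u x - \sum_(m < N) P m x)) +
    bint nu (fun x => (imF u x - \sum_(m < N') P' m x) * (imF u x - \sum_(m < N') P' m x)).
  rewrite -ibintD; [|exact: su..].
  apply: eq_bint => x Bx; have [] := vE x Bx; rewrite pE qE => <- <-.
  by rewrite /reF /imF -[b2_fun (u - v) x]/(u x - v x) ReD ImD ReN ImN.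
have e2 : nrm2 nu u = bint nu (fun x => reF u x * reF u x) + bint nu (fun x => imF u x * imF u x).
  by rewrite /nrm2 ibintD//; [exact: sR.2|exact: sI.2].
move: uv; rewrite e1 => uv.
apply: le_trans (lerD le1 le2) _.
have te' : t * nrm2 nu u <= e / 18 * nrm2 nu u by rewrite ler_pM2r.
move: uv te'; rewrite e2 => uv te'; set D1 := bint nu _ in uv *; set D2 := bint nu _ in uv *.
set A1 := bint nu _ in uv te' *; set A2 := bint nu _ in uv te' *.
have -> : 24 * D1 + 9 * t * A1 + (24 * D2 + 9 * t * A2) = 24 * (D1 + D2) + 9 * (t * (A1 + A2)) by ring.
lra.
Qed.

End CompactDefect.

(** * Continuous symbols on the closed ball *)

Section ContinuousSymbols.
Context {R : realType} {n : nat} (nu : probability (borel_rV R n) R).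
Hypothesis n_ge2 : (2 <= n)%N.
Hypothesis nu_ball : nu uball = 1%E.
Hypothesis nu_invariant : rotation_invariant nu.
Hypothesis nu_boundary : charges_boundary nu.
Local Notation E := 'rV[R]_n.
Local Notation CF := ('rV[R]_n -> R[i]^o).
Implicit Types (f g : CF) (p q : E -> R).

Definition continuous_symbol f : Prop := {within cuball, continuous f}.

Lemma cuball_nsq (x : E) : cuball x <-> nsq x <= 1.
Proof. by rewrite /cuball/= /enorm -/(nsq x) -{1}[1]sqrtr1 ler_sqrt. Qed.

Lemma norm_re_im (z : R[i]) : `|complex.Re z|%:C%C <= `|z| /\ `|complex.Im z|%:C%C <= `|z|.
Proof.
rewrite normc_def !lecR; split; rewrite -sqrtr_sqr ler_wsqrtr//.
  by rewrite lerDl sqr_ge0.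
by rewrite lerDr sqr_ge0.
Qed.

Lemma continuous_symbol_parts f : continuous_symbol f ->
  cball_continuous 1 (reF f) /\ cball_continuous 1 (imF f).
Proof.
move=> /subspace_continuousP cf.
have h y : cball 1 y -> forall e : R, 0 < e -> exists2 d : R, 0 < d &
    forall x, cball 1 x -> nsq (x - y) < d -> `|f y - f x| < e%:C%C.
  move=> y1 e e0.
  have e0' : 0 < e%:C%C by rewrite ltcR.
  have N := (cvgrPdist_lt _ _).1 (cf y ((cuball_nsq y).2 y1)) _ e0'.
  have [d d0 dP] := nsq_sub_nbhs (N _ : nbhs y (fun x : E => cuball x -> `|f y - f x| < e%:C%C)).
  exists d => // x x1 xd.
  by apply: (dP x xd); exact/cuball_nsq.
split=> y y1 e e0; have [d d0 dP] := h y y1 e e0; exists d => // x x1 xd;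
  have := dP x x1 xd; rewrite distrC; have [] := norm_re_im (f x - f y) => h1 h2 h3.
- by have := le_lt_trans h1 h3; rewrite ltcR /reF -ReN -ReD.
- by have := le_lt_trans h2 h3; rewrite ltcR /imF -ImN -ImD.
Qed.

Lemma cball_continuous_bmeas p : cball_continuous 1 p -> bmeas p.
Proof.
move=> cp; split; last first.
  have [C _ hC] := cball_continuous_bounded (lexx 1) cp.
  by exists C => x /uball_nsq/ltW; exact: hC.
apply: continuous_measurable => x Bx.
have x1 := (uball_nsq x).1 Bx.
apply/(@cvgrPdist_lt _ _ _ (nbhs x) (nbhs_filter x)) => e e0.
have [d d0 dP] := cp x (ltW x1) e e0.
have N1 : nbhs x [set y : E | nsq (y - x) < d].
  apply: open_nbhs_nbhs; split; first exact: open_nsq_sub.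
  by rewrite /= subrr /nsq big1// => i _; rewrite mxE expr0n.
have N2 := uball_nbhs x1.
apply: (@filterS _ (nbhs x) (nbhs_filter x) _ _ _ (@filterI _ (nbhs x) (nbhs_filter x) _ _ N1 N2)).
by move=> y [yd y1]; rewrite distrC; apply: dP => //; exact: ltW.
Qed.

Let cst := compact_defect_cst n_ge2 nu_ball nu_invariant nu_boundary.
Let add := @compact_defectD R n nu n_ge2 nu_ball nu_invariant nu_boundary.
Let mul := @compact_defectM R n nu n_ge2 nu_ball nu_invariant nu_boundary.

Lemma compact_defect_sum (I : Type) (r : seq I) (F : I -> CF) :
  (forall i, compact_defect nu (F i)) -> compact_defect nu (fun x => \sum_(i <- r) F i x).
Proof.
move=> hF; elim: r => [|i r IH].
  rewrite (_ : (fun x => _) = fun=> 0); first exact: (cst 0).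
  by apply/funext => x; rewrite big_nil.
rewrite (_ : (fun x => _) = (fun x => F i x + \sum_(k <- r) F k x)); first exact: add (hF i) IH.
by apply/funext => x; rewrite big_cons.
Qed.

Lemma compact_defect_homp m p : homp m p -> compact_defect nu (fun x => (p x)%:C%C).
Proof.
elim: m p => [|m IH] p; first by move=> [c ->]; exact: (cst c%:C%C).
move=> /homSP[g hg ->].
have -> : (fun x : E => (\sum_i x ord0 i * g i x)%:C%C : R[i]^o) =
    (fun x => \sum_i ((x ord0 i)%:C%C : R[i]^o) * (g i x)%:C%C).
  by apply/funext => x; rewrite rmorph_sum; apply: eq_bigr => i _; rewrite rmorphM.
apply: compact_defect_sum => i.
exact: mul (compact_defect_coord n_ge2 nu_ball nu_invariant nu_boundary i) (IH _ (hg i)).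
Qed.

Lemma compact_defect_polyf p : polyf p -> compact_defect nu (fun x => (p x)%:C%C).
Proof.
move=> [N [q [hq ->]]].
have -> : (fun x : E => (\sum_(m < N) q m x)%:C%C : R[i]^o) =
    (fun x => \sum_(m < N) ((q m x)%:C%C : R[i]^o)).
  by apply/funext => x; rewrite rmorph_sum.
apply: compact_defect_sum => m; exact: compact_defect_homp (hq m).
Qed.

Lemma cball_continuous_compact_defect f : cball_continuous 1 (reF f) ->
  cball_continuous 1 (imF f) -> compact_defect nu f.
Proof.
move=> cR cI.
have bf : cbmeas f by split; exact: cball_continuous_bmeas.
apply: (compact_defect_lim n_ge2 nu_ball nu_invariant nu_boundary bf) => e e0.
have s0 : 0 < Num.sqrt (e / 2) by rewrite sqrtr_gt0 divr_gt0.
have [p hp fp] := stone_weierstrass_cball (lexx 1) cR s0.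
have [q hq fq] := stone_weierstrass_cball (lexx 1) cI s0.
exists (fun x => (p x)%:C%C + ('i%C : R[i]^o) * (q x)%:C%C).
  exact: add (compact_defect_polyf hp) (mul (cst 'i%C) (compact_defect_polyf hq)).
move=> x /uball_nsq/ltW x1; rewrite /reF /imF ReD ReM ImD ImM /= !mul0r !mul1r subr0 !addr0 !add0r.
have le (a b : R) : `|a - b| <= Num.sqrt (e / 2) -> (a - b) ^+ 2 <= e / 2.
  move=> h; rewrite -real_normK ?num_real// -[X in _ <= X]sqr_sqrtr ?divr_ge0// ?(ltW e0)//.
  by rewrite ler_sqr ?nnegrE ?sqrtr_ge0.
by rewrite ?add0r [X in _ <= X](splitr e) lerD//; [exact/le/fp|exact/le/fq].
Qed.

Theorem continuous_symbol_compact_defect f : continuous_symbol f ->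
  compact_defect nu f /\ compact_defect nu (cconj f).
Proof.
move=> /continuous_symbol_parts[cR cI]; split; first exact: cball_continuous_compact_defect.
apply: cball_continuous_compact_defect; rewrite ?reF_cconj// imF_cconj => y y1 e e0.
have [d d0 dP] := cI y y1 e e0; exists d => // x x1 xd.
by rewrite -mulrBr mulN1r normrN dP.
Qed.

End ContinuousSymbols.

(** * The Toeplitz algebra modulo compact operators *)

Section ToeplitzAlgebra.
Context {R : realType} {n : nat} (nu : probability (borel_rV R n) R).
Hypothesis n_ge2 : (2 <= n)%N.
Hypothesis nu_ball : nu uball = 1%E.
Hypothesis nu_invariant : rotation_invariant nu.
Hypothesis nu_boundary : charges_boundary nu.
Local Notation E := 'rV[R]_n.
Local Notation CF := ('rV[R]_n -> R[i]^o).
Local Notation B := (b2 nu).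
Local Notation dot := (@b2_inner R n nu).
Local Notation norm := (hnorm dot).
Local Notation T f := (@toeplitz R n nu f).
Implicit Types (f g : CF) (u v w : B) (A K : B -> B).

Let hilb : hilbert dot := b2_hilbert n_ge2 nu_ball nu_invariant nu_boundary.
Let conjB : B -> B := conj_op n_ge2 nu_ball nu_invariant nu_boundary.

(** Requiring the conjugate as well keeps the class closed under conjugation, which corresponds to
    taking adjoints of Toeplitz operators. *)
Definition symbol f : Prop := compact_defect nu f /\ compact_defect nu (cconj f).

Lemma symbolD f g : symbol f -> symbol g -> symbol (fun x => f x + g x).
Proof.
move=> [cf cf'] [cg cg']; split; first exact: (compact_defectD n_ge2 nu_ball nu_invariant nu_boundary).
rewrite (_ : cconj _ = (fun x => cconj f x + cconj g x)).
  exact: (compact_defectD n_ge2 nu_ball nu_invariant nu_boundary).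
by apply/funext => x; rewrite /cconj rmorphD.
Qed.

Lemma symbolM f g : symbol f -> symbol g -> symbol (fun x => f x * g x).
Proof.
move=> [cf cf'] [cg cg']; split; first exact: (compact_defectM n_ge2 nu_ball nu_invariant nu_boundary).
rewrite (_ : cconj _ = (fun x => cconj f x * cconj g x)).
  exact: (compact_defectM n_ge2 nu_ball nu_invariant nu_boundary).
by apply/funext => x; apply: complex_ext; rewrite !complexpE; ring.
Qed.

Lemma symbol_cst (c : R[i]) : symbol (fun=> c).
Proof. by split; exact: (compact_defect_cst n_ge2 nu_ball nu_invariant nu_boundary). Qed.

Lemma symbol_conj f : symbol f -> symbol (cconj f).
Proof. by move=> [cf cf']; split; [exact: cf'|rewrite cconjK; exact: cf]. Qed.

Lemma Q_lin_fun (c : R[i]) (F G H : CF) : L2 nu F -> L2 nu G ->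
  (forall x, H x = c * F x + G x) -> Q nu H = c *: Q nu F + Q nu G.
Proof.
move=> hF hG hH; rewrite -(Q_lin n_ge2 nu_ball nu_invariant nu_boundary c hF hG).
by congr Q; apply/funext => x; rewrite hH.
Qed.

Lemma toeplitzD f g u : cbmeas f -> cbmeas g ->
  toeplitz (fun x => f x + g x) u = T f u + T g u.
Proof.
move=> bf bg; rewrite -[T f u]scale1r.
apply: (Q_lin_fun (L2M bf (b2_L2 u)) (L2M bg (b2_L2 u))) => x.
by rewrite mul1r mulrDl.
Qed.

Lemma toeplitzZ (c : R[i]) f u : cbmeas f -> toeplitz (fun x => (c : R[i]^o) * f x) u = c *: T f u.
Proof.
move=> bf; rewrite -[RHS]addr0 -[X in _ + X](Q_b2 n_ge2 nu_ball nu_invariant nu_boundary 0).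
apply: (Q_lin_fun (L2M bf (b2_L2 u)) (b2_L2 0)) => x.
by rewrite -[b2_fun 0 x]/(0 : R[i]) addr0 mulrA.
Qed.

(** The semicommutator is [u |-> - Q (f (g u - T_g u))], so the defect of [g] controls it. The
    threshold [e^2 / M] accounts for squared norms and for the bound [M] of [|f|^2]. *)
Lemma compact_semicommutator f g : symbol f -> symbol g ->
  compact_op dot ((T f \o T g) - T (fun x => f x * g x)).
Proof.
move=> [[bf _] _] [[bg cg] _] e e0; have [M M0 hM] := cbmeas_bound bf.
have [|ws hws] := cg (e ^+ 2 / M); first by rewrite divr_gt0// exprn_gt0.
exists ws => u /hws hu.
have lu := L2M bf (L2_defect u bg).
have -> : ((T f \o T g) - T (fun x => f x * g x)) u = - Q nu (fun x => f x * (g x * u x - T g u x)).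
  rewrite -[LHS]/(T f (T g u) - T (fun x => f x * g x) u).
  have l1 := L2M bf (b2_L2 (T g u)); have l2 := L2M (cbmeasM bf bg) (b2_L2 u).
  have h : Q nu (fun x => f x * (g x * u x - T g u x)) = -1 *: T f (T g u) + T (fun x => f x * g x) u.
    by apply: (Q_lin_fun l1 l2) => x; ring.
  by rewrite h scaleN1r opprD opprK.
rewrite (hnormN hilb) -ler_sqr ?nnegrE ?mulr_ge0 ?sqrtr_ge0 ?(ltW e0)// exprMn !hnorm_nrm2.
apply: le_trans (nrm2_Q n_ge2 nu_ball nu_invariant nu_boundary lu) _.
apply: le_trans (nrm2M bf (L2_defect u bg) hM) _.
have -> : e ^+ 2 * nrm2 nu u = M * (e ^+ 2 / M * nrm2 nu u) by field; rewrite gt_eqF.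
by rewrite ler_pM2l.
Qed.

Lemma dot_conj_op u v : dot (conjB u) v = (dot u (conjB v))^*%C.
Proof.
have conjE w : b2_fun (conjB w) = cconj w by apply/funext => x; exact: conj_opE.
rewrite -[in LHS](conj_opK n_ge2 nu_ball nu_invariant nu_boundary v) -/(conjB v).
rewrite -(inner_conj (b2_L2 u) (b2_L2 (conjB v))) -!conjE.
by [].
Qed.

Lemma compact_op_conj K : compact_op dot K -> compact_op dot (conjB \o K \o conjB).
Proof.
move=> cK e e0; have [ws hws] := cK e e0; exists (map conjB ws) => u hu.
rewrite -[(conjB \o K \o conjB) u]/(conjB (K (conjB u))) hnorm_conj_op.
rewrite -[X in _ <= e * X](hnorm_conj_op n_ge2 nu_ball nu_invariant nu_boundary).
apply: hws => w /(map_f conjB)/hu; rewrite -/(conjB u) dot_conj_op => ->.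
exact: conjc0.
Qed.

(** The norm closure of the operators [T f + K]. Approximation instead of an exact decomposition
    makes closedness immediate and is enough, since compactness passes to norm limits. *)
Definition toeplitz_plus_compact A : Prop := bounded_op dot A /\
  forall e : R, 0 < e -> exists f K, [/\ symbol f, bounded_op dot K, compact_op dot K &
    forall v, norm (A v - (T f v + K v)) <= e * norm v].

Let bT f : symbol f -> bounded_op dot (T f).
Proof. by move=> [[bf _] _]; exact: toeplitz_bounded. Qed.

Lemma toeplitz_plus_compactD A A' : toeplitz_plus_compact A -> toeplitz_plus_compact A' ->
  toeplitz_plus_compact (A + A').
Proof.
move=> [bA hA] [bA' hA']; split; first exact (bounded_add hilb bA bA').
move=> e e0; have e2 : 0 < e / 2 by rewrite divr_gt0.
have [f [K [sf bK cK AK]]] := hA _ e2; have [g [L [sg bL cL AL]]] := hA' _ e2.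
exists (fun x => f x + g x), (K + L); split.
- exact: symbolD.
- exact (bounded_add hilb bK bL).
- exact (compact_add hilb cK cL).
move=> v; rewrite -[(A + A') v]/(A v + A' v) -[(K + L) v]/(K v + L v).
rewrite (toeplitzD v sf.1.1 sg.1.1).
have -> : A v + A' v - (T f v + T g v + (K v + L v)) = (A v - (T f v + K v)) + (A' v - (T g v + L v)).
  by rewrite addrACA opprD addrACA.
apply: le_trans (ler_hnormD hilb _ _) _.
by rewrite [e]splitr mulrDl lerD.
Qed.

Lemma hnormZ_le (c : R[i]) v : norm (c *: v) = Num.sqrt (complex.Re c ^+ 2 + complex.Im c ^+ 2) * norm v.
Proof.
have c0 : 0 <= complex.Re c ^+ 2 + complex.Im c ^+ 2 by rewrite addr_ge0// sqr_ge0.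
apply/eqP; rewrite -(@eqrXn2 _ 2) ?mulr_ge0 ?sqrtr_ge0//.
by rewrite (hnormZ hilb) exprMn (sqr_sqrtr c0).
Qed.

Lemma compact_scale (c : R[i]) K : compact_op dot K -> compact_op dot (c *: K).
Proof.
move=> cK e e0; pose s := Num.sqrt (complex.Re c ^+ 2 + complex.Im c ^+ 2).
have s0 : 0 <= s := sqrtr_ge0 _.
have s1 : 0 < s + 1 by rewrite ltr_wpDl.
have [ws hws] := cK _ (divr_gt0 e0 s1); exists ws => u /hws hu.
rewrite -[(c *: K) u]/(c *: K u) hnormZ_le -/s.
have h1 := ler_wpM2l s0 hu; apply: le_trans h1 _.
have -> : s * (e / (s + 1) * norm u) = (s / (s + 1)) * (e * norm u) by field; rewrite gt_eqF.
rewrite ler_piMl ?mulr_ge0 ?sqrtr_ge0 ?(ltW e0)// ler_pdivrMr// mul1r lerDl//.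
Qed.

Lemma toeplitz_plus_compactZ (c : R[i]) A : toeplitz_plus_compact A ->
  toeplitz_plus_compact (c *: A).
Proof.
move=> [bA hA]; split; first exact (bounded_scale hilb c bA).
move=> e e0; pose s := Num.sqrt (complex.Re c ^+ 2 + complex.Im c ^+ 2).
have s0 : 0 <= s := sqrtr_ge0 _.
have s1 : 0 < s + 1 by rewrite ltr_wpDl.
have [f [K [sf bK cK AK]]] := hA _ (divr_gt0 e0 s1).
exists (fun x => (c : R[i]^o) * f x), (c *: K); split.
- exact: symbolM (symbol_cst c) sf.
- exact (bounded_scale hilb c bK).
- exact: compact_scale.
move=> v; rewrite -[(c *: A) v]/(c *: A v) -[(c *: K) v]/(c *: K v).
rewrite (toeplitzZ c v sf.1.1) -scalerDr -scalerBr hnormZ_le -/s.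
have h1 := ler_wpM2l s0 (AK v); apply: le_trans h1 _.
have -> : s * (e / (s + 1) * norm v) = (s / (s + 1)) * (e * norm v) by field; rewrite gt_eqF.
by rewrite ler_piMl ?mulr_ge0 ?sqrtr_ge0 ?(ltW e0)// ler_pdivrMr// mul1r lerDl.
Qed.

(** With [G = T f + K] approximating [A], the error is [(A - G) A' + G (A' - T g - L)]. The operator
    [A'] has to be approximated after [G] is chosen, because the accuracy depends on the norm of
    [G]. *)
Lemma toeplitz_plus_compactM A A' : toeplitz_plus_compact A -> toeplitz_plus_compact A' ->
  toeplitz_plus_compact (A \o A').
Proof.
move=> [bA hA] [bA' hA']; split; first exact (bounded_comp bA bA').
move=> e e0; have [lA' [M' M'0 hM']] := bounded_opP bA'.
have [|f [K [sf bK cK AK]]] := hA (e / (2 * M')); first by rewrite divr_gt0// mulr_gt0.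
have bG := bounded_add hilb (bT sf) bK; have [lG [M M0 hM]] := bounded_opP bG.
have [|g [L [sg bL cL AL]]] := hA' (e / (2 * M)); first by rewrite divr_gt0// mulr_gt0.
pose S := (T f \o T g) - T (fun x => f x * g x).
have bS : bounded_op dot S.
  exact (bounded_sub hilb (bounded_comp (bT sf) (bT sg)) (bT (symbolM sf sg))).
exists (fun x => f x * g x), (S + ((T f + K) \o L) + (K \o T g)); split.
- exact: symbolM.
- exact (bounded_add hilb (bounded_add hilb bS (bounded_comp bG bL)) (bounded_comp bK (bT sg))).
- exact (compact_add hilb (compact_add hilb (compact_semicommutator sf sg)
    (compact_compl bG cL)) (compact_compr hilb (bT sg) cK)).
move=> v.
have lT : T f (T g v + L v) = T f (T g v) + T f (L v).
  exact (linearD' _ _ (bT sf).1).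
have lK : K (T g v + L v) = K (T g v) + K (L v).
  exact (linearD' _ _ bK.1).
have lG' : (T f + K) (A' v - (T g v + L v)) = (T f + K) (A' v) - (T f (T g v + L v) + K (T g v + L v)).
  exact (linearB' _ _ lG).
have -> : (A \o A') v - (T (fun x => f x * g x) v + (S + ((T f + K) \o L) + (K \o T g)) v) =
    (A (A' v) - (T f (A' v) + K (A' v))) + (T f + K) (A' v - (T g v + L v)).
  rewrite lG' lT lK -[(T f + K) (A' v)]/(T f (A' v) + K (A' v)).
  rewrite -[(_ + (K \o T g)) v]/(T f (T g v) - T (fun x => f x * g x) v + (T f (L v) + K (L v)) + K (T g v)).
  rewrite -[(A \o A') v]/(A (A' v)) [RHS]addrA subrK; congr (_ - _).
  by rewrite -!addrA addrCA addNKr [K (T g v) + _]addrC.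
apply: le_trans (ler_hnormD hilb _ _) _.
have h1 := AK (A' v); have h2 := hM (A' v - (T g v + L v)).
have h3 := hM' v; have h4 := AL v.
have h5 : e / (2 * M') * norm (A' v) <= e / 2 * norm v.
  have -> : e / 2 * norm v = e / (2 * M') * (M' * norm v) by field; rewrite gt_eqF.
  by rewrite ler_pM2l// divr_gt0// mulr_gt0.
have h6 : M * norm (A' v - (T g v + L v)) <= e / 2 * norm v.
  have -> : e / 2 * norm v = M * (e / (2 * M) * norm v) by field; rewrite gt_eqF.
  by rewrite ler_pM2l.
rewrite [e]splitr mulrDl; apply: lerD; first exact: le_trans h1 h5.
exact: le_trans h2 h6.
Qed.

End ToeplitzAlgebra.

Lemma adjoint_bound (R : realType) (V : lmodType R[i]) (dot : V -> V -> R[i]) (H : hilbert dot)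
    (D D' : V -> V) (e : R) : is_adjoint dot D D' ->
  (forall v, hnorm dot (D v) <= e * hnorm dot v) -> forall v, hnorm dot (D' v) <= e * hnorm dot v.
Proof.
move=> DD hD v; have [v0|/(hnorm_gt0 H) D0] := pselect (D' v = 0).
  apply: le_trans (hD v); rewrite v0 (hnorm0 H); exact: sqrtr_ge0.
rewrite -(ler_pM2l D0) -expr2 (hnormE H) -(DD (D' v) v).
apply: le_trans (rdot_le H _ _) _.
by rewrite mulrA ler_wpM2r ?sqrtr_ge0// mulrC.
Qed.

(** * Conjugation versus adjoint, and the index *)

Section ToeplitzIndex.
Context {R : realType} {n : nat} (nu : probability (borel_rV R n) R).
Hypothesis n_ge2 : (2 <= n)%N.
Hypothesis nu_ball : nu uball = 1%E.
Hypothesis nu_invariant : rotation_invariant nu.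
Hypothesis nu_boundary : charges_boundary nu.
Local Notation CF := ('rV[R]_n -> R[i]^o).
Local Notation B := (b2 nu).
Local Notation dot := (@b2_inner R n nu).
Local Notation norm := (hnorm dot).
Local Notation T f := (@toeplitz R n nu f).
Implicit Types (f g : CF) (u v w : B) (A K : B -> B).

Let hilb : hilbert dot := b2_hilbert n_ge2 nu_ball nu_invariant nu_boundary.
Let conjB : B -> B := conj_op n_ge2 nu_ball nu_invariant nu_boundary.
Let plus_compact := @toeplitz_plus_compact R n nu.

Let sub_adjoint f K L A A' : cbmeas f -> is_adjoint dot A A' -> is_adjoint dot K L ->
  is_adjoint dot (fun v => A v - (T f v + K v)) (fun v => A' v - (T (cconj f) v + L v)).
Proof.
move=> bf AA KL u v; rewrite (dotBl hilb) (dotDl hilb) (dotBr hilb) (dotDr hilb).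
by rewrite AA KL (toeplitz_adjoint n_ge2 nu_ball nu_invariant nu_boundary bf).
Qed.

Lemma toeplitz_plus_compact_adjoint A A' : plus_compact A -> bounded_op dot A' ->
  is_adjoint dot A A' -> plus_compact A'.
Proof.
move=> [bA hA] bA' AA; split; first exact bA'.
move=> e e0; have [f [K [sf bK cK AK]]] := hA e e0.
have [L bL KL] := adjoint_exists hilb bK.
exists (cconj f), L; split.
- exact: symbol_conj sf.
- exact bL.
- exact (compact_adjoint hilb cK KL).
exact (adjoint_bound hilb (sub_adjoint sf.1.1 AA KL) AK).
Qed.

Lemma toeplitz_plus_compact_lim A : bounded_op dot A ->
  (forall e : R, 0 < e -> exists2 A', plus_compact A' & forall v, norm (A v - A' v) <= e * norm v) ->
  plus_compact A.
Proof.
move=> bA hA; split; first exact bA.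
move=> e e0; have e2 : 0 < e / 2 by rewrite divr_gt0.
have [A' [bA' hA'] AA] := hA _ e2; have [f [K [sf bK cK AK]]] := hA' _ e2.
exists f, K; split; [exact sf|exact bK|exact cK|move=> v].
apply: le_trans (ler_hdist hilb _ (A' v) _) _.
rewrite [e]splitr mulrDl; apply: lerD; [exact: AA|exact: AK].
Qed.

Lemma cstar_subalgebra_plus_compact : cstar_subalgebra dot plus_compact.
Proof.
split.
- by move=> A [bA _].
- split; first by move=> A A'; exact (@toeplitz_plus_compactD R n nu n_ge2 nu_ball nu_invariant nu_boundary A A').
  by move=> c A; exact (@toeplitz_plus_compactZ R n nu n_ge2 nu_ball nu_invariant nu_boundary c A).
- by move=> A A'; exact (@toeplitz_plus_compactM R n nu n_ge2 nu_ball nu_invariant nu_boundary A A').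
- exact toeplitz_plus_compact_adjoint.
- exact toeplitz_plus_compact_lim.
Qed.

Lemma toeplitz_plus_compact_symbol f : continuous_symbol f -> plus_compact (T f).
Proof.
move=> cf; have sf := continuous_symbol_compact_defect n_ge2 nu_ball nu_invariant nu_boundary cf.
split; first exact (toeplitz_bounded n_ge2 nu_ball nu_invariant nu_boundary sf.1.1).
have n0 (v : B) (e : R) : 0 < e -> norm 0 <= e * norm v.
  by move=> e0; rewrite (hnorm0 hilb) mulr_ge0 ?sqrtr_ge0// ltW.
move=> e e0; exists f, (fun=> 0); split.
- exact sf.
- split; first by move=> c u v; rewrite scaler0 addr0.
  by exists 1 => v; exact: n0.
- by move=> d d0; exists [::] => u _; exact: n0.
- by move=> v; rewrite addr0 subrr; exact: n0.
Qed.

Lemma toeplitz_algebra_plus_compact A : toeplitz_algebra A -> plus_compact A.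
Proof.
move=> /(_ _ cstar_subalgebra_plus_compact); apply.
by move=> _ [f cf <-]; exact: toeplitz_plus_compact_symbol.
Qed.

(** For [T f] the conjugate and the adjoint coincide exactly, so for [T f + K] the difference
    involves only [K] and its adjoint and is compact; the approximation error enters twice, hence
    [e / 2]. *)
Lemma toeplitz_algebra_conj A A' : toeplitz_algebra A -> is_adjoint dot A A' ->
  compact_op dot (conjB \o A \o conjB - A').
Proof.
move=> /toeplitz_algebra_plus_compact[bA hA] AA; apply: (compact_lim hilb) => e e0.
have e2 : 0 < e / 2 by rewrite divr_gt0.
have [f [K [sf bK cK AK]]] := hA _ e2; have [L bL KL] := adjoint_exists hilb bK.
exists (conjB \o K \o conjB + (-1) *: L).
  apply (compact_add hilb); first exact (compact_op_conj n_ge2 nu_ball nu_invariant nu_boundary cK).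
  exact (compact_scale n_ge2 nu_ball nu_invariant nu_boundary (-1) (compact_adjoint hilb cK KL)).
move=> v.
have conjBD u w : conjB (u + w) = conjB u + conjB w.
  rewrite -[u]scale1r /conjB (conj_op_lin n_ge2 nu_ball nu_invariant nu_boundary) rmorph1.
  by rewrite !scale1r.
have conjBN u w : conjB (u - w) = conjB u - conjB w.
  rewrite -scaleN1r addrC /conjB (conj_op_lin n_ge2 nu_ball nu_invariant nu_boundary).
  by rewrite rmorphN rmorph1 scaleN1r addrC.
have -> : (conjB \o A \o conjB - A') v - (conjB \o K \o conjB + (-1) *: L) v =
    conjB (A (conjB v) - (T f (conjB v) + K (conjB v))) - (A' v - (T (cconj f) v + L v)).
  rewrite -[(_ - A') v]/(conjB (A (conjB v)) - A' v).
  rewrite -[(_ + (-1) *: L) v]/(conjB (K (conjB v)) + (-1) *: L v) scaleN1r conjBN conjBD.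
  have -> : conjB (T f (conjB v)) = T (cconj f) v by exact: conj_op_toeplitz sf.1.1.
  rewrite !opprD !opprK [RHS]addrACA; congr (_ + _).
  by rewrite addrACA addNr add0r.
apply: le_trans (ler_hnormB hilb _ _) _.
rewrite (hnorm_conj_op n_ge2 nu_ball nu_invariant nu_boundary) [e]splitr mulrDl; apply: lerD.
  by apply: le_trans (AK _) _; rewrite (hnorm_conj_op n_ge2 nu_ball nu_invariant nu_boundary).
exact (adjoint_bound hilb (sub_adjoint sf.1.1 AA KL) AK v).
Qed.

End ToeplitzIndex.

Theorem corollary4p4 (R : realType) (n : nat) (n_ge2 : (2 <= n)%N)
    (nu : probability (borel_rV R n) R)
    (nu_ball : nu uball = 1%E)
    (nu_regular : regular_on_ball nu)
    (nu_invariant : rotation_invariant nu)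
    (nu_boundary : charges_boundary nu)
    (A : b2 nu -> b2 nu)
    (A_fredholm : fredholm (@b2_inner R n nu) A)
    (A_toeplitz : toeplitz_algebra A) :
  fredholm_index A = 0.
Proof.
have hilb := b2_hilbert n_ge2 nu_ball nu_invariant nu_boundary.
have [bA _ _ _] := A_fredholm.
have [A' bA' AA] := adjoint_exists hilb bA.
exact (index_eq0 hilb (conj_op_lin n_ge2 nu_ball nu_invariant nu_boundary)
  (conj_opK n_ge2 nu_ball nu_invariant nu_boundary) A_fredholm bA' AA
  (toeplitz_algebra_conj n_ge2 nu_ball nu_invariant nu_boundary A_toeplitz AA)).
Qed.
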